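(* Let $U \subset \mathbb R^n$ be a bounded open set and $\varphi=(\varphi^1,\dots,\varphi^n) : \mathbb R^n \to \mathbb R^n$ be a map such that $\varphi^i \in \mathrm{Lip}^{\alpha_i}(\partial U)$, $i=1,\dots,n$, for exponents $\alpha_1,\dots,\alpha_n \in \,]0,1]$. If $\chi_U \in \mathrm{BV}^{d-(n-1)}(\mathbb R^n)$ for some $d \in [n-1,n[$ and $\tau_n := \alpha_1 + \dots + \alpha_n > d$, then \[(\varphi_{\#}[\![U]\!]) \llcorner (\mathbb R^n \setminus \varphi(\partial U)) = [\![\deg(\varphi,U,\cdot)]\!].\] If additionally $\mathscr L^{n}(\varphi(\partial U)) = 0$, then $\deg(\varphi,U,\cdot) \in L^1_c(\mathbb R^n)$ and \[\varphi_{\#}[\![U]\!] = [\![\deg(\varphi,U,\cdot)]\!].\] If $\dim_{\rm box}(\partial U) < \tau_n$, then $\mathscr L^{n}(\varphi(\partial U)) = 0$ and $\chi_U \in \mathrm{BV}_c^{\delta-(n-1)}(\mathbb R^n)$ for all $\delta \in \,]\dim_{\rm box}(\partial U),\tau_n[$.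
   Context: $n\ge1$. $\mathscr L^n$ is Lebesgue measure; $L^1_c(\mathbb R^n)$: integrable functions with (essentially) compact support. For $A\subset\mathbb R^n$ and $g:A\to\mathbb R$, $\mathrm{Lip}^\alpha(g)=\sup_{x\ne y}|g(x)-g(y)|/|x-y|^\alpha$; $\mathrm{Lip}^\alpha(A)$ is the set of real functions on $A$ for which this is finite, and $\varphi^i\in\mathrm{Lip}^{\alpha_i}(\partial U)$ means that the restriction of $\varphi^i$ to $\partial U$ is in this set; $\mathrm{Lip}=\mathrm{Lip}^1$. For $u\in L^1(\mathbb R^n)$ and $\alpha\in[0,1]$, $\mathbf V^\alpha(u)=\sup\bigl|\int u\det D(f,g^1,\dots,g^{n-1})\,dx\bigr|$ over all compactly supported $f\in\mathrm{Lip}(\mathbb R^n)$ and all $g^i\in\mathrm{Lip}(\mathbb R^n)$ with $\mathrm{Lip}^\alpha(f)\le1$, $\mathrm{Lip}(g^i)\le1$; $\mathrm{BV}^\alpha(\mathbb R^n)=\{u\in L^1(\mathbb R^n):\mathbf V^\alpha(u)<\infty\}$ and $\mathrm{BV}^\alpha_c(\mathbb R^n)=\mathrm{BV}^\alpha(\mathbb R^n)\cap L^1_c(\mathbb R^n)$. For a bounded set $A\subset\mathbb R^n$ let $N_A(\epsilon)$ be the minimal number of balls of radius $\epsilon$ needed to cover $A$; $\dim_{\rm box}(A)=\lim_{\epsilon\downarrow0}\log N_A(\epsilon)/\log(1/\epsilon)$, in case the limit exists. For an integrable $u$, $[\![u]\!]$ is the current $(f,g^1,\dots,g^n)\mapsto\int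 u f\det D(g^1,\dots,g^n)\,dx$ on $\mathrm{Lip}(\mathbb R^n)^{n+1}$, $[\![U]\!]=[\![\chi_U]\!]$, and for a Borel set $B$, $[\![v]\!]\llcorner B=[\![v\chi_B]\!]$. Brouwer degree. $\deg(\varphi,U,y)\in\mathbb Z$ is defined for $y\in\mathbb R^n\setminus\varphi(\partial U)$ (and is taken to be $0$ on $\varphi(\partial U)$ when $[\![\deg(\varphi,U,\cdot)]\!]$ is formed). It depends only on $\varphi|_{\partial U}$: it is the degree at $y$ of any continuous extension of $\varphi|_{\partial U}$ to the closure of $U$. Push forward. For Lipschitz $\psi:\mathbb R^n\to\mathbb R^n$, $\psi_\#[\![u]\!](f,g^1,\dots,g^n)=[\![u]\!](f\circ\psi,g^1\circ\psi,\dots,g^n\circ\psi)$, which equals $[\![v]\!]$ with $v(y)=\sum_{x\in\psi^{-1}(y)}u(x)\operatorname{sign}(\det D\psi_x)$ a.e. If $u\in\mathrm{BV}^{d-(n-1)}_c(\mathbb R^n)$ and $\psi:\mathbb R^n\to\mathbb R^n$ has components $\psi^i\in\mathrm{Lip}^{\alpha_i}(\mathbb R^n)$ with $\alpha_1+\dots+\alpha_n>d$, then $\psi_\#[\![u]\!]$ is defined by approximation: for Lipschitz maps $\psi_k\to\psi$ uniformly with $\sup_{i,k}\mathrm{Lip}^{\alpha_i}(\psi_k^i)<\infty$ the densities of $\psi_{k\#}[\![u]\!]$ converge in $L^1$ to a function $v_{u,\psi}\in L^1_c(\mathbb R^n)$ independent of the sequence, and $\psi_\#[\![u]\!]:=[\![v_{u,\psi}]\!]$.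 For $\varphi$ as in the claim, $\varphi_\#[\![U]\!]$ is understood as the push forward under any map with components in $\mathrm{Lip}^{\alpha_i}(\mathbb R^n)$ that agrees with $\varphi$ on $\partial U$ (such maps exist by McShane–Whitney extension). *)

(* Defs.v *)
(* [R^n] is the space of row vectors ['rV[R]_n] over an arbitrary [R : realType]. *)
From HB Require Import structures.
From mathcomp Require Import all_boot all_order all_algebra.
From mathcomp Require Import all_classical all_reals all_analysis.

Set Implicit Arguments.
Unset Strict Implicit.
Unset Printing Implicit Defensive.

Import Order.TTheory GRing.Theory Num.Theory.
Import numFieldNormedType.Exports.

Local Open Scope classical_set_scope.
Local Open Scope ring_scope.

(* The family (a, g_0, ..., g_(n-1)). *)
Definition fcons (T : Type) (n : nat) (a : T) (g : 'I_n -> T) : 'I_n.+1 -> T :=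
  fun i => if unlift ord0 i is Some j then g j else a.

(* The sigma-algebra on ['rV[T]_n] is the product one, i.e. the Borel
   sigma-algebra when [T] is the real line. *)
Definition measure_rV_display : measure_display -> measure_display.
Proof. exact. Qed.

Section measurable_rV.
Context {d} {T : sigmaRingType d}.
Variable n : nat.

Let coors : 'I_n -> 'rV[T]_n -> T := fun i x => x ord0 i.

Let rV_set0 : g_sigma_preimage coors set0.
Proof. exact: sigma_algebra0. Qed.

Let rV_setC A : g_sigma_preimage coors A -> g_sigma_preimage coors (~` A).
Proof. exact: sigma_algebraC. Qed.

Let rV_bigcup (F : _^nat) : (forall i, g_sigma_preimage coors (F i)) ->
  g_sigma_preimage coors (\bigcup_i (F i)).
Proof. exact: sigma_algebra_bigcup. Qed.

HB.instance Definition _ := @isMeasurable.Build (measure_rV_display d)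
  'rV[T]_n (g_sigma_preimage coors) rV_set0 rV_setC rV_bigcup.

End measurable_rV.

Section measurable_rV_lemmas.
Context d (T : measurableType d).

Lemma measurable_coor n (i : 'I_n) :
  measurable_fun [set: 'rV[T]_n] (fun x : 'rV[T]_n => x ord0 i).
Proof.
move=> _ Y mY; rewrite setTI; apply: sub_sigma_algebra => /=.
rewrite -bigcup_seq/=; exists i => /=; first by rewrite mem_index_enum.
by exists Y => //; rewrite setTI.
Qed.

Lemma measurable_fun_rV d1 (T1 : measurableType d1) n (f : T1 -> 'rV[T]_n) :
  (forall i, measurable_fun [set: T1] (fun x => f x ord0 i)) ->
  measurable_fun [set: T1] f.
Proof.
move=> mf.
suff H : preimage_set_system setT f measurable `<=` measurable.
  by move=> _ A mA; apply: H; exists A.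
move=> _ [A mA <-]; rewrite setTI.
pose S := [set B : set 'rV[T]_n | measurable (f @^-1` B)].
suff : S A by [].
move: A mA; apply: smallest_sub.
  split; rewrite /S/=.
  - by rewrite preimage_set0; exact: measurable0.
  - by move=> B mB; rewrite setTD preimage_setC; exact: measurableC.
  - by move=> F mF; rewrite preimage_bigcup; exact: bigcup_measurable.
rewrite -bigcup_seq => B [i _ [C mC <-]]; rewrite /S/= setTI -comp_preimage.
by rewrite -[X in measurable X]setTI; exact: mf.
Qed.

Definition cons_rV n (p : T * 'rV[T]_n) : 'rV[T]_n.+1 :=
  \row_i fcons p.1 (p.2 ord0) i.

Definition uncons_rV n (v : 'rV[T]_n.+1) : T * 'rV[T]_n :=
  (v ord0 ord0, \row_i v ord0 (lift ord0 i)).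

Lemma cons_rVK n : cancel (@cons_rV n) (@uncons_rV n).
Proof.
move=> [a v]; rewrite /cons_rV /uncons_rV /=; congr pair.
  by rewrite mxE /fcons unlift_none.
by apply/rowP => i; rewrite !mxE /fcons liftK.
Qed.

Lemma measurable_cons_rV n : measurable_fun setT (@cons_rV n).
Proof.
apply: measurable_fun_rV => i.
case: (unliftP ord0 i) => [j|] ->.
  rewrite [X in measurable_fun _ X](_ : _ = (fun v : 'rV[T]_n => v ord0 j) \o snd).
    by apply: measurableT_comp; [exact: measurable_coor|exact: measurable_snd].
  by apply/funext => p; rewrite mxE /fcons liftK.
rewrite [X in measurable_fun _ X](_ : _ = fst); first exact: measurable_fst.
by apply/funext => p; rewrite mxE /fcons unlift_none.
Qed.

Lemma measurable_uncons_rV n : measurable_fun setT (@uncons_rV n).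
Proof.
apply: measurable_fun_pair; first exact: measurable_coor.
apply: measurable_fun_rV => i.
rewrite [X in measurable_fun _ X](_ : _ = fun x : 'rV[T]_n.+1 => x ord0 (lift ord0 i)).
  exact: measurable_coor.
by apply/funext => v; rewrite mxE.
Qed.

End measurable_rV_lemmas.

(* Lebesgue measure on [R^(n+1)] is the product of Lebesgue measures on [R] and
   on [R^n], transported along [cons_rV]. *)
Section lebesgue_rV_step.
Context (R : realType) (n : nat).
Variable mu : {sigma_finite_measure set 'rV[measurableTypeR R]_n -> \bar R}.
Local Open Scope ereal_scope.

Definition leb_step (A : set 'rV[measurableTypeR R]_n.+1) : \bar R :=
  pushforward (lebesgue_measure \x mu) (@cons_rV _ (measurableTypeR R) n) A.

Let leb_step0 : leb_step set0 = 0.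
Proof. by rewrite /leb_step /pushforward preimage_set0 measure0. Qed.

Let leb_step_ge0 A : 0 <= leb_step A.
Proof. by rewrite /leb_step /pushforward; exact: measure_ge0. Qed.

Let leb_step_sigma_additive : semi_sigma_additive leb_step.
Proof.
move=> F mF tF mUF; rewrite /leb_step /pushforward preimage_bigcup.
apply: measure_semi_sigma_additive.
- by move=> k; rewrite -[X in measurable X]setTI; exact: measurable_cons_rV.
- apply/trivIsetP => /= i j _ _ ij; rewrite -preimage_setI.
  by move/trivIsetP : tF => /(_ _ _ _ _ ij) ->//; rewrite preimage_set0.
- rewrite -preimage_bigcup -[X in measurable X]setTI.
  exact: measurable_cons_rV.
Qed.

HB.instance Definition _ := isMeasure.Build _ _ _
  leb_step leb_step0 leb_step_ge0 leb_step_sigma_additive.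

Let leb_step_sigma_finite : sigma_finite setT leb_step.
Proof.
have /sigma_finiteP[F [TF ndF Foo]] :=
  sigma_finiteT (lebesgue_measure : set (measurableTypeR R) -> \bar R).
have /sigma_finiteP[G [TG ndG Goo]] := sigma_finiteT mu.
exists (fun k => @uncons_rV _ (measurableTypeR R) n @^-1` (F k `*` G k)).
  apply/esym; rewrite -subTset => v _.
  have : (\bigcup_k F k) (uncons_rV v).1 by rewrite -TF.
  have : (\bigcup_k G k) (uncons_rV v).2 by rewrite -TG.
  move=> [l _ Gl] [k _ Fk]; exists (maxn k l) => //; split.
  - by move: Fk; exact/subsetPset/ndF/leq_maxl.
  - by move: Gl; exact/subsetPset/ndG/leq_maxr.
move=> k; have [mF Fk] := Foo k; have [mG Gk] := Goo k; split.
  rewrite -[X in measurable X]setTI; apply: measurable_uncons_rV => //.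
  exact: measurableX.
rewrite /leb_step /pushforward -comp_preimage.
rewrite (_ : _ \o _ = id) ?preimage_id; last first.
  by apply/funext => p /=; rewrite cons_rVK.
by rewrite product_measure1E// lte_mul_pinfty// ge0_fin_numE.
Qed.

HB.instance Definition _ := Measure_isSigmaFinite.Build _ _ _
  leb_step leb_step_sigma_finite.

End lebesgue_rV_step.

Fixpoint lebesgue_rV (R : realType) (n : nat) :
    {sigma_finite_measure set 'rV[measurableTypeR R]_n -> \bar R} :=
  match n with
  | 0 => \d_(0 : 'rV[measurableTypeR R]_0)
  | m.+1 => leb_step (lebesgue_rV R m)
  end.

Lemma lebesgue_rV_box (R : realType) (n : nat)
    (A : 'I_n -> set (measurableTypeR R)) :
  (forall i, measurable (A i)) ->
  lebesgue_rV R n [set v | forall i, A i (v ord0 i)] =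
  (\prod_(i < n) lebesgue_measure (A i))%E.
Proof.
elim: n A => [|n IH] A mA.
  by rewrite big_ord0 /= diracE mem_set// => -[].
pose B := [set v : 'rV[measurableTypeR R]_n |
  forall i, A (lift ord0 i) (v ord0 i)].
have mB : measurable B.
  have -> : B = \big[setI/setT]_(i < n)
      ((fun v : 'rV[measurableTypeR R]_n => v ord0 i) @^-1` A (lift ord0 i)).
    rewrite -bigcap_seq; apply/seteqP; split => v /= H i.
      by move=> _; exact: H.
    by apply: H; rewrite /= mem_index_enum.
  apply: bigsetI_measurable => i _.
  by rewrite -[X in measurable X]setTI; exact: measurable_coor.
rewrite big_ord_recl -IH// -product_measure1E//= /leb_step /pushforward.
congr (_ _); apply/seteqP; split=> -[a v] /=.
  move=> H; split=> [|i]; first by have := H ord0; rewrite mxE /fcons unlift_none.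
  by have := H (lift ord0 i); rewrite mxE /fcons liftK.
move=> [Aa Av] i; rewrite mxE /fcons.
by case: (unliftP ord0 i) => [j|] ->.
Qed.

Section euclidean.
Context {R : realType} {n : nat}.
Local Notation V := 'rV[R]_n.

(* The library norm on matrices is the sup norm. *)
Definition enorm (v : V) : R := Num.sqrt (\sum_i v ord0 i ^+ 2).

Definition dist_set (y : V) (A : set V) : R := inf [set enorm (y - z) | z in A].

Definition covered_by (A : set V) (e : R) (k : nat) : Prop :=
  exists c : 'I_k -> V, A `<=` [set x | exists i, enorm (x - c i) <= e].

Definition covering_number (A : set V) (e : R) : R :=
  inf [set k%:R | k in covered_by A e].

(* "The limit defining dim_box A exists and equals D". As [ln 0 = 0], the empty
   set is given the dimension 0. *)
Definition has_box_dim (A : set V) (D : R) : Prop :=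
  ln (covering_number A e) / ln (e^-1) @[e --> 0^'+] --> D.

(* The Hoelder seminorm [Lip^a (g)] of [g] restricted to [A]. *)
Definition Lipc (a : R) (A : set V) (g : V -> R) : \bar R :=
  ereal_sup [set r | exists x y, [/\ A x, A y, x != y &
    r = (`|g x - g y| / (enorm (x - y) `^ a))%:E]].

Definition Lipa (a : R) (A : set V) (g : V -> R) : Prop := (Lipc a A g < +oo)%E.

Definition Lip (g : V -> R) : Prop := Lipa 1 setT g.

Definition comp_fun (psi : V -> V) (i : 'I_n) : V -> R := fun x => psi x ord0 i.

End euclidean.

Section theory.
Context {R : realType} {n : nat}.
Local Notation V := 'rV[R]_n.+1.
Local Notation mu := (lebesgue_rV R n.+1).

Definition boundary (U : set V) : set V := closure U `\` interior U.

(* [D(h^1, ..., h^n)]: partial derivatives, which exist almost everywhere when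
   the [h^i] are Lipschitz; on the remaining null set ['D_] has a junk value. *)
Definition Dmx (h : 'I_n.+1 -> V -> R) (x : V) : 'M[R]_n.+1 :=
  \matrix_(i, j) 'D_(delta_mx ord0 j) (h i) x.

Definition L1 (u : V -> R) : Prop := mu.-integrable setT (EFin \o u).

Definition L1c (u : V -> R) : Prop :=
  L1 u /\ exists2 K : set V, compact K & {ae mu, forall x, ~ K x -> u x = 0}.

(* [V^a (u)], in dimension n.+1, so that there are n functions [g^i]; the range
   [0 <= a <= 1] is not imposed here. *)
Definition frac_var (a : R) (u : V -> R) : \bar R :=
  ereal_sup [set r | exists (f : V -> R) (g : 'I_n -> V -> R),
    [/\ compact (closure [set x | f x != 0]), Lip f, (Lipc a setT f <= 1)%E,
        (forall i, (Lipc 1 setT (g i) <= 1)%E) &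
        r = (`| \int[mu]_x (u x * \det (Dmx (fcons f g) x)) |)%:E]].

Definition BV (a : R) (u : V -> R) : Prop := L1 u /\ (frac_var a u < +oo)%E.

Definition BVc (a : R) (u : V -> R) : Prop := BV a u /\ L1c u.

(* Meant for [L1c u], since [f] need not be bounded. *)
Definition current (u : V -> R) (f : V -> R) (g : 'I_n.+1 -> V -> R) : R :=
  \int[mu]_x (u x * f x * \det (Dmx g x)).

Definition current_push (psi : V -> V)
    (T : (V -> R) -> ('I_n.+1 -> V -> R) -> R) f g : R :=
  T (f \o psi) (fun i => g i \o psi).

(* Equality of functionals on [Lip(R^n)^(n+1)]. *)
Definition current_eq (S T : (V -> R) -> ('I_n.+1 -> V -> R) -> R) : Prop :=
  forall f g, Lip f -> (forall i, Lip (g i)) -> S f g = T f g.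

Definition is_lip_push_density (u : V -> R) (psi : V -> V) (w : V -> R) : Prop :=
  L1c w /\ current_eq (current_push psi (current u)) (current w).

(* [v] is the L^1-limit of the densities of the push forwards of [[u]] along
   every admissible sequence of Lipschitz approximations of [psi]. *)
Definition is_push_density (alpha : 'I_n.+1 -> R) (u : V -> R) (psi : V -> V)
    (v : V -> R) : Prop :=
  L1c v /\
  forall (psi_ : nat -> V -> V) (w_ : nat -> V -> R),
    (forall k i, Lip (comp_fun (psi_ k) i)) ->
    (forall e : R, 0 < e ->
       \forall k \near \oo, forall x, enorm (psi_ k x - psi x) < e) ->
    (exists M : R, forall k i,
       (Lipc (alpha i) setT (comp_fun (psi_ k) i) <= M%:E)%E) ->
    (forall k, is_lip_push_density u (psi_ k) (w_ k)) ->
    (\int[mu]_x (`| w_ k x - v x |)%:E)%E @[k --> \oo] --> 0%E.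

(* The function [v_(u, psi)], determined almost everywhere. *)
Definition push_density (alpha : 'I_n.+1 -> R) (u : V -> R) (psi : V -> V) :
    V -> R :=
  xget (fun=> 0) [set v | is_push_density alpha u psi v].

(* Brouwer degree: first for a C^1 map at a regular value, then for a continuous
   map on the closure of [U] through a C^1 map which is closer to it than
   the distance from [y] to the image of the boundary. *)
Definition C1 (psi : V -> V) : Prop :=
  (forall x, differentiable psi x) /\
  (forall i j, continuous (fun x => Dmx (comp_fun psi) x i j)).

Definition regular_value (psi : V -> V) (U : set V) (y : V) : Prop :=
  forall x, U x -> psi x = y -> \det (Dmx (comp_fun psi) x) != 0.

Definition degree_C1 (psi : V -> V) (U : set V) (y : V) : int :=
  \sum_(x \in U `&` psi @^-1` [set y]) sgz (\det (Dmx (comp_fun psi) x)).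

Definition is_degree_cont (Phi : V -> V) (U : set V) (y : V) (k : int) : Prop :=
  exists psi : V -> V,
    [/\ C1 psi,
        (forall x, closure U x ->
           enorm (psi x - Phi x) < dist_set y (Phi @` boundary U)),
        regular_value psi U y &
        k = degree_C1 psi U y].

Definition is_degree (phi : V -> V) (U : set V) (y : V) (k : int) : Prop :=
  exists Phi : V -> V,
    [/\ {within closure U, continuous Phi},
        (forall x, boundary U x -> Phi x = phi x) &
        is_degree_cont Phi U y k].

Definition degree (phi : V -> V) (U : set V) (y : V) : int :=
  xget 0 [set k | is_degree phi U y k].

(* The degree as a real function, extended by 0 to the image of the boundary. *)
Definition degree_fun (phi : V -> V) (U : set V) : V -> R :=
  (fun y => (degree phi U y)%:~R) \_ (~` (phi @` boundary U)).

End theory.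

(* Main.v *)
(* Let [u] be the indicator of [U] and [V^a(u) < oo]. Its mollification [w_e] at
   scale [e] satisfies [|D w_e|_1 <= C e^-a] and [|u - w_e|_1 <= C e^(1-a)]. If
   the Lipschitz maps [p], [q] satisfy [Lip(p^i), Lip(q^i) <= M e^(alpha_i - 1)]
   and [|p^i - q^i| <= M e^alpha_i], then Stokes' theorem for the affine homotopy
   between them, weighted by [w_e], bounds the difference of the push forwards of
   [u] on a test function [f] by [C |f|_oo e^(tau - d)]. Joining Lipschitz maps
   through their inf-convolutions at dyadic scales, one sums a geometric series:
   the densities of the push forwards by Lipschitz approximations of [psi]
   converge in [L^1], with an error depending on [f] through [|f|_oo] only.

   Away from [phi(bd U)], test the limit [v] against a mollifier centred near [y].
   A homotopy leads to a smooth map with regular value [y], and then to its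
   linearisations at the preimages of [y], each of which contributes the sign of
   its determinant. So the mollifications of [v] near [y] equal the degree.

   If [bd U] has box dimension [D < s < tau], it is covered by [e^-s] balls of
   radius [e], and its image by as many boxes of volume [C e^tau]. Moreover, with
   [eta_e = min(1, dist(., U^c) / e)], replacing [f] by its inf-convolution at
   scale [e] shows that [int (eta_(e/2) - eta_e) det D(f, g)] is at most
   [C e^(delta - s)], which is summable over dyadic [e]. *)
Require Import Defs.
From HB Require Import structures.
From mathcomp Require Import all_boot all_order all_algebra fingroup perm.
From mathcomp Require Import all_classical all_reals all_analysis.
From mathcomp Require Import measurable_realfun ring lra.

Set Implicit Arguments.
Unset Strict Implicit.
Unset Printing Implicit Defensive.

Import Order.TTheory GRing.Theory Num.Theory.
Import numFieldNormedType.Exports.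

Local Open Scope classical_set_scope.
Local Open Scope ring_scope.

(** * Real-valued integrals *)

(** The ambient dimension is [n.+1], so the fractional exponent is [a = d - n] and the power gained
    in the push forward is [tau - (n + a) = tau - d]: the product of the Lipschitz constants
    contributes [tau - (n + 1)], while the homotopy of relative length [e] against [|D w_e|_1], like
    the error [|u - w_e|_1], contributes [1 - a]. Errors may depend on the test function through its
    sup norm alone, because [L^1] norms are recovered by duality with bounded Lipschitz functions.
    This excludes estimates by the modulus of continuity of [f], and is why even a translation of a
    map is treated as a homotopy. Lipschitz maps have partial derivatives only almost everywhere.
    Identities between Jacobians are therefore established for mollified [C^{1,1}] functions and
    passed to the limit by weak continuity of determinants. [degree] selects some admissible
    integer. Existence rests on a Sard-type covering argument; that all choices agree is a
    by-product of testing the push forward, which accepts any admissible [C^1] map. *)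

Section Rint.
Context d (T : measurableType d) (R : realType).
Variable m : {measure set T -> \bar R}.
Implicit Types f g h : T -> R.

Definition mble d' (T' : measurableType d') (f : T' -> R) := measurable_fun [set: T'] f.
Definition itg f := m.-integrable setT (EFin \o f).

Lemma itg_mble f : itg f -> mble f.
Proof. by move=> /integrableP[/measurable_EFinP]. Qed.

Lemma itg_le f g : mble f -> (forall x, `|f x| <= `|g x|) -> itg g -> itg f.
Proof.
move=> mf fg ig; apply: le_integrable ig => //; first exact/measurable_EFinP.
by move=> x _ /=; rewrite lee_fin.
Qed.

Lemma itgD f g : itg f -> itg g -> itg (fun x => f x + g x).
Proof. by move=> fi gi; have := integrableD measurableT fi gi; apply: eq_integrable. Qed.

Lemma itgN f : itg f -> itg (fun x => - f x).
Proof. by move=> fi; have := integrableN fi; apply: eq_integrable. Qed.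

Lemma itgB f g : itg f -> itg g -> itg (fun x => f x - g x).
Proof. by move=> fi gi; apply: itgD => //; apply: itgN. Qed.

Lemma itgZ c f : itg f -> itg (fun x => c * f x).
Proof. by move=> fi; have := integrableZl measurableT c fi; apply: eq_integrable. Qed.

Lemma itg0 : itg (fun=> 0).
Proof. exact: integrable0. Qed.

Lemma itg_norm f : itg f -> itg (fun x => `|f x|).
Proof. by move=> fi; apply: (itg_le _ _ fi) => [|x]; [exact/measurableT_comp/itg_mble|rewrite normr_id]. Qed.

Lemma itgMb f g C : itg f -> mble g -> (forall x, `|g x| <= C) -> itg (fun x => f x * g x).
Proof.
move=> fi mg gC; apply: (@itg_le _ (fun x => C * f x)); last exact: itgZ.
  by apply: measurable_funM => //; exact: itg_mble.
move=> x; rewrite !normrM mulrC ler_wpM2r// (le_trans (gC x))//.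
exact: ler_norm.
Qed.

Lemma itg_sum I (s : seq I) (P : pred I) (F : I -> T -> R) :
  (forall i, P i -> itg (F i)) -> itg (fun x => \sum_(i <- s | P i) F i x).
Proof.
move=> Fi; elim: s => [|a s IH].
  by under [X in itg X]eq_fun do rewrite big_nil; exact: itg0.
under [X in itg X]eq_fun do rewrite big_cons.
by case Pa: (P a) => //; apply: itgD => //; exact: Fi.
Qed.

Lemma intD f g : itg f -> itg g -> \int[m]_x (f x + g x) = \int[m]_x f x + \int[m]_x g x.
Proof. by move=> fi gi; rewrite RintegralD. Qed.

Lemma intB f g : itg f -> itg g -> \int[m]_x (f x - g x) = \int[m]_x f x - \int[m]_x g x.
Proof. by move=> fi gi; rewrite RintegralB. Qed.

Lemma intZ c f : itg f -> \int[m]_x (c * f x) = c * \int[m]_x f x.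
Proof. by move=> fi; rewrite RintegralZl. Qed.

Lemma intN f : itg f -> \int[m]_x (- f x) = - \int[m]_x f x.
Proof.
move=> fi; rewrite -mulN1r -intZ//.
by apply: eq_Rintegral => x _; rewrite mulN1r.
Qed.

Lemma int0 : \int[m]_x (0 : R) = 0.
Proof. by rewrite /Rintegral integral0. Qed.

Lemma int_sum I (s : seq I) (P : pred I) (F : I -> T -> R) :
  (forall i, P i -> itg (F i)) ->
  \int[m]_x (\sum_(i <- s | P i) F i x) = \sum_(i <- s | P i) \int[m]_x F i x.
Proof.
move=> Fi; elim: s => [|a s IH].
  by under eq_Rintegral do rewrite big_nil; rewrite int0 big_nil.
under eq_Rintegral do rewrite big_cons.
rewrite big_cons; case: ifP => // Pa.
by rewrite intD ?IH//; [exact: Fi|exact: itg_sum].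
Qed.

Lemma int_le f g : itg f -> itg g -> (forall x, f x <= g x) ->
  \int[m]_x f x <= \int[m]_x g x.
Proof. by move=> fi gi fg; apply: le_Rintegral. Qed.

Lemma int_norm f : itg f -> `|\int[m]_x f x| <= \int[m]_x `|f x|.
Proof. by move=> fi; apply: le_normr_Rintegral. Qed.

Lemma int_norm_le f g : itg f -> itg g -> (forall x, `|f x| <= g x) ->
  `|\int[m]_x f x| <= \int[m]_x g x.
Proof.
move=> fi gi fg; rewrite (le_trans (int_norm fi))//; apply: int_le => //.
exact: itg_norm.
Qed.

Lemma int_add_lt f g a b : itg f -> itg g -> \int[m]_x f x < a -> \int[m]_x g x < b ->
  \int[m]_x (f x + g x) < a + b.
Proof. by move=> fi gi fa gb; rewrite (intD fi gi) ltrD. Qed.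

Lemma int_ge0 f : (forall x, 0 <= f x) -> 0 <= \int[m]_x f x.
Proof. by move=> f0; apply: Rintegral_ge0. Qed.

Lemma int_EFin f : itg f -> (\int[m]_x (f x)%:E)%E = (\int[m]_x f x)%:E.
Proof. by move=> fi; rewrite /Rintegral fineK//; exact: integrable_fin_num. Qed.

Lemma int_aeE f g : mble f -> mble g -> {ae m, forall x, f x = g x} ->
  \int[m]_x f x = \int[m]_x g x.
Proof.
move=> mf mg fg; congr fine; apply: ae_eq_integral => //.
- exact/measurable_EFinP.
- exact/measurable_EFinP.
- by apply: filterS fg => x /= ->.
Qed.

Lemma itg_aeE f g : itg f -> mble g -> {ae m, forall x, f x = g x} -> itg g.
Proof.
move=> fi mg fg; apply/integrableP; split; first exact/measurable_EFinP.
move/integrableP: fi => [mf]; congr (_ < _)%E.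
apply: ae_eq_integral => //.
- exact: measurableT_comp.
- by apply: measurableT_comp => //; exact/measurable_EFinP.
- by apply: filterS fg => x /= ->.
Qed.

Lemma int_norm0_ae f : itg f -> \int[m]_x `|f x| = 0 -> {ae m, forall x, f x = 0}.
Proof.
move=> fi f0.
have h : (\int[m]_(x in setT) `|(EFin \o f) x|)%E = 0%E.
  by rewrite (int_EFin (itg_norm fi)) f0.
have := (ae_eq_integral_abs m measurableT (measurable_int m fi)).1 h.
by apply: filterS => x /= /(_ I) [].
Qed.

Lemma dct (F : nat -> T -> R) f g : (forall k, mble (F k)) -> mble f -> itg g ->
  {ae m, forall x, F k x @[k --> \oo] --> f x} ->
  (forall k x, `|F k x| <= g x) ->
  itg f /\ (\int[m]_x F k x @[k --> \oo] --> \int[m]_x f x).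
Proof.
move=> mF mf gi Ff Fg.
have FfE : {ae m, forall x, setT x -> (fun k => (F k x)%:E) @ \oo --> (f x)%:E}.
  by apply: filterS Ff => x Fx _; apply/fine_cvgP; split => /=; [exact: nearW|exact: Fx].
have [] := @dominated_convergence _ _ _ m setT measurableT
   (fun k x => (F k x)%:E) (fun x => (f x)%:E) (EFin \o g) _ _ FfE gi _.
- by move=> k; apply/measurable_EFinP; exact: mF.
- apply/measurable_EFinP; exact: mf.
- by apply: aeW => x k _ /=; rewrite lee_fin.
move=> fi _ cv; split=> //.
have Fi k : itg (F k).
  by apply: (itg_le _ _ gi) => // x; rewrite (le_trans (Fg k x))// ler_norm.
apply: fine_cvg.
by rewrite fineK//; exact: integrable_fin_num.
Qed.

End Rint.

Section fubini_real.
Context d1 d2 (T1 : measurableType d1) (T2 : measurableType d2) (R : realType).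
Variable m1 : {sigma_finite_measure set T1 -> \bar R}.
Variable m2 : {sigma_finite_measure set T2 -> \bar R}.
Variables (h : T1 * T2 -> R) (G : T1 -> R) (H : T2 -> R).
Hypothesis mh : mble h.
Hypothesis hGH : forall x y, `|h (x, y)| <= G x * H y.
Hypothesis Gi : itg m1 G.
Hypothesis Hi : itg m2 H.

(** The product bound [G x * H y] makes every slice integrable, not just almost every one, so that
    the iterated integrals below carry no exceptional sets. *)
Lemma dom_itg1 x : itg m2 (fun y => h (x, y)).
Proof.
apply: (itg_le _ _ (itgZ (G x) Hi)).
  by apply: (measurableT_comp mh); exact: pair1_measurable.
by move=> y; rewrite (le_trans (hGH x y))// ler_norm.
Qed.

Lemma dom_itg2 y : itg m1 (fun x => h (x, y)).
Proof.
apply: (itg_le _ _ (itgZ (H y) Gi)).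
  by apply: (measurableT_comp mh); exact: pair2_measurable.
by move=> x; rewrite mulrC (le_trans (hGH x y))// ler_norm.
Qed.

Lemma dom_itg : itg (m1 \x m2)%E h.
Proof.
apply/integrable12ltyP; first exact/measurable_EFinP.
apply: (@le_lt_trans _ _ (\int[m1]_x (`|G x| * \int[m2]_y `|H y|)%:E)%E).
  apply: ge0_le_integral => //.
  - by move=> x _; exact: integral_ge0.
  - have mabs : measurable_fun [set: T1 * T2] (fun z => `|(h z)%:E|%E).
      by apply: measurableT_comp => //; exact/measurable_EFinP.
    exact: (measurable_fun_fubini_tonelli_F _ mabs).
  - by apply/measurable_EFinP; apply: measurable_funM => //; exact: (itg_mble (itg_norm Gi)).
  move=> x _; rewrite -intZ ?itg_norm// -int_EFin; last exact/itgZ/itg_norm.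
  apply: ge0_le_integral => //.
  - apply: measurableT_comp => //; apply/measurable_EFinP.
    exact: (itg_mble (dom_itg1 x)).
  - by apply/measurable_EFinP; apply: measurable_funM => //; exact: (itg_mble (itg_norm Hi)).
  by move=> y _; rewrite lee_fin (le_trans (hGH x y))// -normrM ler_norm.
under eq_integral do rewrite mulrC.
rewrite int_EFin; last exact/itgZ/itg_norm.
exact: ltry.
Qed.

Lemma dom_mble1 : mble (fun x => \int[m2]_y h (x, y)).
Proof.
apply/measurable_EFinP; have := measurable_fubini_F dom_itg.
by apply: eq_measurable_fun => x _; rewrite /fubini_F /= int_EFin//; exact: dom_itg1.
Qed.

Lemma dom_fubini1 : \int[m1]_x \int[m2]_y h (x, y) = \int[(m1 \x m2)%E]_z h z.
Proof.
transitivity (fine (\int[(m1 \x m2)%E]_z (h z)%:E)%E) => //.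
rewrite -(integral12_prod_meas1 dom_itg).
by congr fine; apply: eq_integral => x _; rewrite /fubini_F/= int_EFin//; exact: dom_itg1.
Qed.

Lemma dom_fubini2 : \int[m2]_y \int[m1]_x h (x, y) = \int[(m1 \x m2)%E]_z h z.
Proof.
transitivity (fine (\int[(m1 \x m2)%E]_z (h z)%:E)%E) => //.
rewrite -(integral21_prod_meas1 dom_itg).
by congr fine; apply: eq_integral => x _; rewrite /fubini_G/= int_EFin//; exact: dom_itg2.
Qed.

Lemma dom_fubini :
  \int[m1]_x \int[m2]_y h (x, y) = \int[m2]_y \int[m1]_x h (x, y).
Proof. by rewrite dom_fubini1 dom_fubini2. Qed.

Lemma dom_itg_fubini1 : itg m1 (fun x => \int[m2]_y h (x, y)).
Proof.
apply: (itg_le dom_mble1 _ (itgZ (\int[m2]_y `|H y|) Gi)) => x.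
rewrite (le_trans (int_norm (dom_itg1 x)))// normrM [`|\int[m2]_y _|]ger0_norm ?int_ge0//.
rewrite mulrC -intZ ?itg_norm//; apply: int_le.
- exact/itg_norm/dom_itg1.
- exact/itgZ/itg_norm.
by move=> y; rewrite (le_trans (hGH x y))// -normrM ler_norm.
Qed.

End fubini_real.

(** * Euclidean norm, Lipschitz functions and Lebesgue measure *)

Section enorm.
Context (R : realType) (n : nat).
Implicit Types (v w : 'rV[R]_n).

Lemma enorm_ge0 v : 0 <= enorm v.
Proof. exact: sqrtr_ge0. Qed.

Lemma enorm_sqr v : enorm v ^+ 2 = \sum_i v ord0 i ^+ 2.
Proof. by rewrite sqr_sqrtr// sumr_ge0// => i _; exact: sqr_ge0. Qed.

Lemma enorm0 : enorm (0 : 'rV[R]_n) = 0.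
Proof. by rewrite /enorm big1 ?sqrtr0// => i _; rewrite mxE expr0n. Qed.

Lemma enormN v : enorm (- v) = enorm v.
Proof. by rewrite /enorm; under eq_bigr do rewrite mxE sqrrN. Qed.

Lemma enormB v w : enorm (v - w) = enorm (w - v).
Proof. by rewrite -enormN opprB. Qed.

Lemma enormZ c v : enorm (c *: v) = `|c| * enorm v.
Proof.
rewrite /enorm; under eq_bigr do rewrite mxE exprMn.
by rewrite -mulr_sumr sqrtrM ?sqr_ge0// sqrtr_sqr.
Qed.

Lemma coor_le v i : `|v ord0 i| <= enorm v.
Proof.
rewrite -sqrtr_sqr; apply: ler_wsqrtr.
by rewrite (bigD1 i)//= lerDl sumr_ge0// => j _; exact: sqr_ge0.
Qed.

Lemma enorm_eq0 v : enorm v = 0 -> v = 0.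
Proof.
move=> v0; apply/rowP => i; rewrite mxE; apply/eqP.
by rewrite -normr_le0 -v0 coor_le.
Qed.

Lemma enorm_gt0 v : v != 0 -> 0 < enorm v.
Proof.
move=> v0; rewrite lt_neqAle enorm_ge0 andbT.
by apply: contra v0 => /eqP/esym/enorm_eq0 ->.
Qed.

Lemma cauchy_schwarz_sum v w :
  (\sum_i v ord0 i * w ord0 i) ^+ 2 <= enorm v ^+ 2 * enorm w ^+ 2.
Proof.
set S := \sum_i _; have [v0|v0] := eqVneq (enorm v) 0.
  rewrite /S (enorm_eq0 v0) big1 ?expr0n/=; last by move=> i _; rewrite mxE mul0r.
  by rewrite mulr_ge0 ?sqr_ge0.
have A0 : 0 < enorm v ^+ 2 by rewrite exprn_gt0// lt_neqAle eq_sym v0 enorm_ge0.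
have H t : 0 <= t ^+ 2 * enorm v ^+ 2 + 2 * t * S + enorm w ^+ 2.
  have : 0 <= \sum_i (t * v ord0 i + w ord0 i) ^+ 2.
    by apply: sumr_ge0 => i _; exact: sqr_ge0.
  congr (_ <= _); rewrite !enorm_sqr /S !mulr_sumr -!big_split/=.
  by apply: eq_bigr => i _; ring.
(* The minimiser of the nonnegative quadratic in [t]; multiplying by [A] then clears the
   denominator. *)
have := H (- S / enorm v ^+ 2).
move: A0; set A := enorm v ^+ 2; set B := enorm w ^+ 2 => A0 HH.
have {}HH : 0 <= A * ((- S / A) ^+ 2 * A + 2 * (- S / A) * S + B).
  by rewrite mulr_ge0 // ltW.
have A0' : A != 0 by rewrite gt_eqF.
rewrite -subr_ge0; have -> // : A * B - S ^+ 2 = A * ((- S / A) ^+ 2 * A + 2 * (- S / A) * S + B).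
by field.
Qed.

Lemma enormD v w : enorm (v + w) <= enorm v + enorm w.
Proof.
have := cauchy_schwarz_sum v w; rewrite -exprMn -ler_sqrt ?sqr_ge0//.
rewrite !sqrtr_sqr [X in _ <= X]ger0_norm ?mulr_ge0 ?enorm_ge0// => H.
rewrite -(@ler_pXn2r _ 2) ?nnegrE ?addr_ge0 ?enorm_ge0//.
rewrite sqrrD !enorm_sqr.
have -> : \sum_i (v + w) ord0 i ^+ 2 = \sum_i v ord0 i ^+ 2 +
   (\sum_i v ord0 i * w ord0 i) *+ 2 + \sum_i w ord0 i ^+ 2.
  by rewrite -sumrMnl -!big_split/=; apply: eq_bigr => i _; rewrite mxE sqrrD.
rewrite lerD2r lerD2l lerMn2r/=.
by rewrite (le_trans (ler_norm _)).
Qed.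

Lemma enorm_sum I (s : seq I) (F : I -> 'rV[R]_n) :
  enorm (\sum_(i <- s) F i) <= \sum_(i <- s) enorm (F i).
Proof.
elim: s => [|a s IH]; first by rewrite !big_nil enorm0.
by rewrite !big_cons (le_trans (enormD _ _))// lerD2l.
Qed.

Lemma enorm_dist_triangle u v w : enorm (u - w) <= enorm (u - v) + enorm (v - w).
Proof. by rewrite (le_trans _ (enormD _ _))// addrA subrK. Qed.

Lemma enorm_lip v w : `|enorm v - enorm w| <= enorm (v - w).
Proof.
rewrite ler_norml; apply/andP; split.
  rewrite lerNl opprB lerBlDr enormB.
  by rewrite (le_trans _ (enormD _ _))// subrK.
by rewrite lerBlDr (le_trans _ (enormD _ _))// subrK.
Qed.

Lemma enorm_delta (i : 'I_n) : enorm (delta_mx ord0 i : 'rV[R]_n) = 1.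
Proof.
rewrite /enorm (bigD1 i)//= big1 ?addr0.
  by rewrite mxE !eqxx expr1n sqrtr1.
by move=> j ji; rewrite mxE eqxx/= (negbTE ji) expr0n.
Qed.

Lemma enorm_sumE v : enorm v <= \sum_i `|v ord0 i|.
Proof.
rewrite {1}(row_sum_delta v) (le_trans (enorm_sum _ _))//.
by apply: ler_sum => i _; rewrite enormZ enorm_delta mulr1.
Qed.

End enorm.

Section enorm_top.
Context (R : realType) (n : nat).
Implicit Types (v w : 'rV[R]_n.+1).

Lemma mxnorm_enorm v : `|v| <= enorm v.
Proof.
rewrite /Num.norm/= mx_normrE; apply: (big_ind (fun x => x <= enorm v)).
- exact: enorm_ge0.
- by move=> x y xv yv; rewrite ge_max xv.
- by move=> [i j] _ /=; rewrite (ord1 i) coor_le.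
Qed.

Lemma coor_mxnorm v i : `|v ord0 i| <= `|v|.
Proof.
rewrite /Num.norm/= mx_normrE.
by have := @le_bigmax _ _ _ 0 (fun ij => `|v ij.1 ij.2|) (ord0, i).
Qed.

Lemma enorm_mxnorm v : enorm v <= n.+1%:R * `|v|.
Proof.
rewrite (le_trans (enorm_sumE v))// mulr_natl -[X in _ *+ X](card_ord n.+1) -sumr_const.
by apply: ler_sum => i _; exact: coor_mxnorm.
Qed.

(** The topology of row vectors comes from the sup norm. As the two norms are comparable,
    neighbourhoods can be tested on Euclidean balls, which is how every topological argument below
    is run. *)
Lemma nbhs_eballP (x : 'rV[R]_n.+1) (A : set 'rV[R]_n.+1) :
  nbhs x A <-> exists2 e, 0 < e & forall y, enorm (x - y) < e -> A y.
Proof.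
split=> [/nbhs_ballP[e /= e0 H]|[e e0 H]].
  exists e => // y xy; apply: H; rewrite -ball_normE/=.
  exact: le_lt_trans (mxnorm_enorm _) xy.
apply/nbhs_ballP; exists (e / n.+1%:R); first by rewrite /= divr_gt0.
move=> y; rewrite -ball_normE/= => xy; apply: H.
by rewrite (le_lt_trans (enorm_mxnorm _))// mulrC -ltr_pdivlMr.
Qed.

End enorm_top.

Section lip.
Context (R : realType) (n : nat).
Local Notation V := 'rV[R]_n.
Implicit Types (f g : V -> R).

(** A named real constant takes the place of the extended seminorm [Lipc]. The sign of [L] is not
    prescribed; in dimension [n.+1] its nonnegativity follows from [pd_bound]. *)
Definition lip (L : R) f := forall x y, `|f x - f y| <= L * enorm (x - y).

Lemma lipW L L' f : L <= L' -> lip L f -> lip L' f.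
Proof. by move=> LL fl x y; rewrite (le_trans (fl x y))// ler_wpM2r ?enorm_ge0. Qed.

Lemma lip_cst c : lip 0 (fun=> c).
Proof. by move=> x y; rewrite subrr normr0 mul0r. Qed.

Lemma lipD L L' f g : lip L f -> lip L' g -> lip (L + L') (fun x => f x + g x).
Proof.
move=> fl gl x y; rewrite opprD addrACA mulrDl.
by rewrite (le_trans (ler_normD _ _))// lerD.
Qed.

Lemma lipN L f : lip L f -> lip L (fun x => - f x).
Proof. by move=> fl x y; rewrite -opprD normrN. Qed.

Lemma lipB L L' f g : lip L f -> lip L' g -> lip (L + L') (fun x => f x - g x).
Proof. by move=> fl gl; apply: lipD => //; exact: lipN. Qed.

Lemma lipZ c L f : lip L f -> lip (`|c| * L) (fun x => c * f x).
Proof. by move=> fl x y; rewrite -mulrBr normrM -mulrA ler_wpM2l. Qed.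

Lemma lipM L L' (C C' : R) f g : lip L f -> lip L' g -> (forall x, `|f x| <= C) ->
  (forall x, `|g x| <= C') -> lip (C * L' + L * C') (fun x => f x * g x).
Proof.
move=> fl gl fC gC x y.
have -> : f x * g x - f y * g y = f x * (g x - g y) + (f x - f y) * g y by ring.
rewrite (le_trans (ler_normD _ _))// !normrM mulrDl -[C * L' * _]mulrA [L * C' * _]mulrAC.
by apply: lerD; apply: ler_pM.
Qed.

Lemma lip_coor i : lip 1 (fun x => x ord0 i).
Proof. by move=> x y; rewrite mul1r; have := coor_le (x - y) i; rewrite !mxE. Qed.

Lemma lip_enorm z : lip 1 (fun x => enorm (x - z)).
Proof. by move=> x y; rewrite mul1r (le_trans (enorm_lip _ _))// opprB addrA subrK. Qed.

Lemma lip_max c L f : lip L f -> lip L (fun x => Num.max c (f x)).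
Proof.
move=> fl x y; apply: le_trans (fl x y).
by rewrite !maxEle; case: ifPn; case: ifPn; rewrite -?ltNge => A B; apply/ler_normlP; split; have /ler_normlP[] := lexx `|f x - f y|; lra.
Qed.

Lemma lip_min c L f : lip L f -> lip L (fun x => Num.min c (f x)).
Proof.
move=> fl; have := lip_max (- c) (lipN fl) => /lipN.
by congr lip; apply/funext => x; rewrite oppr_max !opprK.
Qed.

Lemma lip_ge0 L f (x y : V) : x != y -> lip L f -> 0 <= L.
Proof.
move=> xy /(_ x y) H; have e0 : 0 < enorm (x - y) by rewrite enorm_gt0// subr_eq0.
by rewrite -(pmulr_lge0 _ e0) (le_trans _ H).
Qed.

Definition lipm m (L : R) (psi : V -> 'rV[R]_m) := forall x y,
  enorm (psi x - psi y) <= L * enorm (x - y).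

Lemma lipm_coor m (psi : V -> 'rV[R]_m) L : (forall i, lip L (fun x => psi x ord0 i)) ->
  lipm (m%:R * L) psi.
Proof.
move=> h x y; rewrite (le_trans (enorm_sumE _))// -[X in X%:R](card_ord m) -mulrA mulr_natl -sumr_const.
by apply: ler_sum => i _; rewrite !mxE; exact: h.
Qed.

End lip.

Lemma lip_comp (R : realType) n m L L' (f : 'rV[R]_m -> R) (psi : 'rV[R]_n -> 'rV[R]_m) :
  0 <= L -> lip L f -> lipm L' psi -> lip (L * L') (f \o psi).
Proof.
by move=> L0 fl pl x y; rewrite (le_trans (fl _ _))// -mulrA ler_wpM2l.
Qed.

Section lip_top.
Context (R : realType) (n : nat).
Local Notation V := 'rV[R]_n.+1.
Implicit Types (f g : V -> R).

Lemma lip_continuous L f : lip L f -> continuous f.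
Proof.
move=> fl x; apply/(@cvgrPdist_lt _ _ _ _ (nbhs_filter x)) => e e0.
apply/nbhs_eballP; exists (e / (`|L| + 1)); first by rewrite divr_gt0// ltr_wpDl.
move=> y; rewrite ltr_pdivlMr ?ltr_wpDl// => xy.
apply: le_lt_trans xy; rewrite (le_trans (fl _ _))// mulrC ler_wpM2l ?enorm_ge0//.
by rewrite (le_trans (ler_norm _))// lerDl.
Qed.

Lemma enorm_continuous : continuous (@enorm R n.+1).
Proof.
have := @lip_enorm R n.+1 0 => /lip_continuous.
by rewrite (_ : (fun x => enorm (x - 0)) = @enorm R n.+1)//; apply/funext => x; rewrite subr0.
Qed.

Lemma lipm_continuous m L (psi : V -> 'rV[R]_m.+1) : lipm L psi -> continuous psi.
Proof.
move=> fl x; apply/(@cvgrPdist_lt _ _ _ _ (nbhs_filter x)) => e e0.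
apply/nbhs_eballP; exists (e / (`|L| + 1)); first by rewrite divr_gt0// ltr_wpDl.
move=> y; rewrite ltr_pdivlMr ?ltr_wpDl// => xy.
apply: le_lt_trans xy; rewrite (le_trans (mxnorm_enorm _))//.
rewrite (le_trans (fl _ _))// mulrC ler_wpM2l ?enorm_ge0//.
by rewrite (le_trans (ler_norm _))// lerDl.
Qed.

Lemma LipP f : Lip f <-> exists2 L, 0 <= L & lip L f.
Proof.
rewrite /Lip /Lipa /Lipc; split=> [H|[L L0 fl]].
  set S := [set r | _] in H; exists (`|fine (ereal_sup S)|) => // x y.
  have [->|xy] := eqVneq x y; first by rewrite subrr normr0 mulr_ge0 ?enorm_ge0.
  have exy : 0 < enorm (x - y) by rewrite enorm_gt0// subr_eq0.
  have : ((`|f x - f y| / (enorm (x - y) `^ 1))%:E <= ereal_sup S)%E.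
    by apply: ereal_sup_ubound; exists x, y.
  rewrite powRr1 ?enorm_ge0// => H1.
  have fS : ereal_sup S \is a fin_num.
    by rewrite fin_numE -ltey H andbT gt_eqF// (lt_le_trans _ H1)// ltNyr.
  move: H1; rewrite -[ereal_sup S]fineK// lee_fin ler_pdivrMr// => /le_trans; apply.
  by rewrite ler_wpM2r ?enorm_ge0// ler_norm.
apply: (@le_lt_trans _ _ L%:E); last exact: ltry.
apply: ub_ereal_sup => _ [x [y [_ _ xy ->]]].
by rewrite lee_fin powRr1 ?enorm_ge0// ler_pdivrMr ?enorm_gt0 ?subr_eq0.
Qed.

Definition hol (a M : R) f := forall x y, `|f x - f y| <= M * enorm (x - y) `^ a.

Lemma Lipc_le a M f : 0 <= M -> (Lipc a setT f <= M%:E)%E <-> hol a M f.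
Proof.
move=> M0; split=> [H x y|H].
  have [->|xy] := eqVneq x y; first by rewrite subrr normr0 mulr_ge0 ?powR_ge0.
  rewrite -ler_pdivrMr ?powR_gt0 ?enorm_gt0 ?subr_eq0// -lee_fin.
  by apply: le_trans H; apply: ereal_sup_ubound; exists x, y.
apply: ub_ereal_sup => _ [x [y [_ _ xy ->]]].
by rewrite lee_fin ler_pdivrMr ?powR_gt0 ?enorm_gt0 ?subr_eq0.
Qed.

Lemma LipaP a (A : set V) f : Lipa a A f ->
  exists2 M, 0 <= M & forall x y, A x -> A y -> `|f x - f y| <= M * enorm (x - y) `^ a.
Proof.
rewrite /Lipa /Lipc => H; set S := [set r | _] in H.
exists (`|fine (ereal_sup S)|) => // x y Ax Ay.
have [->|xy] := eqVneq x y; first by rewrite subrr normr0 mulr_ge0 ?powR_ge0.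
have exy : 0 < enorm (x - y) `^ a by rewrite powR_gt0 ?enorm_gt0// subr_eq0.
have H1 : ((`|f x - f y| / (enorm (x - y) `^ a))%:E <= ereal_sup S)%E.
  by apply: ereal_sup_ubound; exists x, y.
have fS : ereal_sup S \is a fin_num.
  by rewrite fin_numE -ltey H andbT gt_eqF// (lt_le_trans _ H1)// ltNyr.
move: H1; rewrite -[ereal_sup S]fineK// lee_fin ler_pdivrMr// => /le_trans; apply.
by rewrite ler_wpM2r ?powR_ge0// ler_norm.
Qed.

End lip_top.

Section borel.
Context (R : realType) (n : nat).
Local Notation T := 'rV[measurableTypeR R]_n.
Local Notation mu := (lebesgue_rV R n).

Definition rV_box (A : 'I_n -> set R) : set T := [set v | forall i, A i (v ord0 i)].

Lemma measurable_rV_box (A : 'I_n -> set (measurableTypeR R)) :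
  (forall i, measurable (A i)) -> measurable (rV_box A).
Proof.
move=> mA; have -> : rV_box A = \big[setI/setT]_(i < n) ((fun v : T => v ord0 i) @^-1` A i).
  rewrite -bigcap_seq; apply/seteqP; split => v /= H i; first by move=> _; exact: H.
  by apply: H; rewrite /= mem_index_enum.
apply: bigsetI_measurable => i _.
by rewrite -[X in measurable X]setTI; exact: measurable_coor.
Qed.

Lemma mu_rV_box (A : 'I_n -> set (measurableTypeR R)) : (forall i, measurable (A i)) ->
  mu (rV_box A) = (\prod_(i < n) lebesgue_measure (A i))%E.
Proof. by move=> mA; exact: (@lebesgue_rV_box R n A mA). Qed.

(** Boxes are stable under intersection and generate the product sigma-algebra, and the cubes
    [[-k, k]^n] give the exhaustion by sets of finite measure on which uniqueness of measures
    relies. *)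
Lemma rV_measure_unique (m : {measure set T -> \bar R}) :
  (forall A : 'I_n -> set (measurableTypeR R), (forall i, measurable (A i)) ->
     m (rV_box A) = (\prod_(i < n) lebesgue_measure (A i))%E) ->
  forall A, measurable A -> mu A = m A.
Proof.
move=> mE.
pose G := [set B : set T | exists2 A : 'I_n -> set (measurableTypeR R),
  (forall i, measurable (A i)) & B = rV_box A].
pose g (k : nat) : set T := rV_box (fun=> `[- k%:R, k%:R]%classic).
apply: (measure_unique G g).
- apply/seteqP; split.
    apply: smallest_sub; first exact: smallest_sigma_algebra.
    rewrite -bigcup_seq => B [i _ [C mC <-]]; rewrite setTI.
    apply: sub_sigma_algebra; exists (fun j => if j == i then C else setT).
      by move=> j; case: ifP.
    apply/seteqP; split=> v /=; first by move=> Cv j; case: ifP => // /eqP ->.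
    by move=> /(_ i); rewrite eqxx.
  apply: smallest_sub; first exact: sigma_algebra_measurable.
  by move=> _ [A mA ->]; exact: measurable_rV_box.
- move=> _ _ [A mA ->] [B mB ->]; exists (fun i => A i `&` B i).
    by move=> i; exact: measurableI.
  apply/seteqP; split=> v /=; first by move=> [Av Bv] i; split; [exact: Av|exact: Bv].
  by move=> ABv; split=> i; have [] := ABv i.
- by move=> k; exists (fun=> `[- k%:R, k%:R]%classic) => // i; exact: measurable_itv.
- rewrite -subTset => v _; exists (Num.Def.trunc (\sum_i `|v ord0 i|)).+1 => // i.
  rewrite /= in_itv/= -ler_norml ltW//.
  apply: le_lt_trans (truncnS_gt _).
  by rewrite (bigD1 i)//= lerDl sumr_ge0.
- by move=> _ [A mA ->]; rewrite (mE _ mA); exact: mu_rV_box.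
move=> k; suff H : mu (g k) = (\prod_(i < n) (k%:R *+ 2)%:E)%E.
  by apply: (@le_lt_trans _ _ (\prod_(i < n) (k%:R *+ 2)%:E)%E); [rewrite -H|rewrite prodEFin ltry].
transitivity (\prod_(i < n) lebesgue_measure ([set` `[- (k%:R : R), k%:R]%R] : set (measurableTypeR R)))%E.
  by apply: mu_rV_box => i; exact: measurable_itv.
apply: eq_bigr => i _; rewrite lebesgue_measure_itv/= lte_fin.
case: ifPn => [_|]; first by rewrite -EFinB opprK mulr2n.
rewrite -leNgt => k0; congr EFin; have k1 : 0 <= k%:R :> R by [].
by move: k0 k1; rewrite mulr2n; set c : R := k%:R => k0 k1; lra.
Qed.

End borel.

Section borel1.
Context (R : realType) (n : nat).
Local Notation V := 'rV[R]_n.+1.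
Local Notation T := 'rV[measurableTypeR R]_n.+1.
Local Notation mu := (lebesgue_rV R n.+1).

(** The sigma-algebra is the product one. An open set is the union of the boxes with rational centre
    and radius [k.+1%:R^-1] that it contains, and there are countably many of these. *)
Lemma open_measurable_rV (A : set V) : open A -> measurable (A : set T).
Proof.
move=> oA.
pose B (q : 'rV[rat]_n.+1) (k : nat) : set T := rV_box (fun i => [set t | `|ratr (q ord0 i) - t| < k.+1%:R^-1]).
have mB q k : measurable (B q k).
  apply: measurable_rV_box => i.
  rewrite (_ : [set t | _] = `](ratr (q ord0 i)) - k.+1%:R^-1, (ratr (q ord0 i)) + k.+1%:R^-1[%classic).
    exact: measurable_itv.
  by apply/seteqP; split=> t /=; rewrite in_itv/= ltr_distlC.
have -> : A = \bigcup_q \bigcup_k (if `[< B q k `<=` A >] then B q k else set0).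
  apply/seteqP; split=> [x Ax|x [q _ [k _]]]; last first.
    by case: ifPn => // /asboolP H; exact: H.
  have : nbhs x A by exact: open_nbhs_nbhs.
  move=> /nbhs_eballP[e e0 He].
  (* One factor converts the sup norm into the Euclidean one; the half leaves room for moving the
     centre of the box from [x] to a rational point. *)
  have n0 : 0 < e / n.+1%:R / 2 by rewrite !divr_gt0.
  have [k _ /(_ k (leqnn k)) Hk] := near_infty_natSinv_lt (PosNum n0).
  rewrite /= in Hk.
  have k0 : 0 < k.+1%:R^-1 :> R by rewrite invr_gt0.
  have /choice[q Hq] : forall i : 'I_n.+1, exists r : rat, `|ratr r - x ord0 i| < k.+1%:R^-1.
    move=> i; have : x ord0 i - k.+1%:R^-1 < x ord0 i + k.+1%:R^-1 by apply: (@lt_trans _ _ (x ord0 i)); rewrite ?ltrDl// ltrBlDr ltrDl.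
    move=> /rat_in_itvoo[r]; rewrite in_itv/= => Hr; exists r.
    by rewrite distrC ltr_distlC.
  exists (\row_i q i) => //; exists k => //.
  have -> : `[< B (\row_i q i) k `<=` A >] = true.
    apply/asboolP => y By; apply: He; rewrite (le_lt_trans (enorm_mxnorm _))//.
    rewrite mulrC -ltr_pdivlMr//.
    rewrite /Num.norm/= mx_normrE; apply: (big_ind (fun x => x < e / n.+1%:R)).
    + by rewrite divr_gt0.
    + by move=> a b ea eb; rewrite gt_max ea.
    move=> [i j] _ /=; rewrite (ord1 i) !mxE.
    have := By j; rewrite mxE => h1; have h2 := Hq j.
    have := ler_distD (ratr (q j)) (x ord0 j) (y ord0 j).
    move=> h3; rewrite (le_lt_trans (ler_distD (ratr (q j)) _ _))//.
    rewrite distrC (splitr (e / n.+1%:R)) ltrD//; apply: lt_trans Hk => //.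
  move=> i; rewrite /= mxE; exact: Hq.
apply: countable_bigcupT_measurable; first exact: countableP.
move=> q; apply: bigcupT_measurable => k.
by case: ifP.
Qed.

Lemma closed_measurable_rV (A : set V) : closed A -> measurable (A : set T).
Proof.
by move=> cA; rewrite -[A]setCK; apply: measurableC; apply: open_measurable_rV; exact: closed_openC.
Qed.

Lemma continuous_mble (f : V -> R) : continuous f -> mble (f : T -> R).
Proof.
move=> cf; apply: (measurability _ (RGenOInfty.measurableE R)).
move=> /= _ [_ [a ->] <-]; rewrite setTI; apply: open_measurable_rV.
by move/continuousP: cf; apply; exact: rray_open.
Qed.

Lemma lip_mble L (f : V -> R) : lip L f -> mble (f : T -> R).
Proof. by move=> /lip_continuous/continuous_mble. Qed.

Definition cube (r : R) : set T := rV_box (fun=> `[- r, r]%classic).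

Lemma cubeE r (v : V) : cube r v <-> forall i, `|v ord0 i| <= r.
Proof. by split=> H i; have := H i; rewrite /= in_itv/= ler_norml. Qed.

Lemma mu_cube (r : R) : 0 <= r -> mu (cube r) = ((2 * r) ^+ n.+1)%:E.
Proof.
move=> r0; rewrite /cube.
rewrite mu_rV_box => [|i]; last exact: measurable_itv.
under eq_bigr do rewrite lebesgue_measure_itv/= lte_fin.
have [->|r1] := eqVneq r 0.
  rewrite oppr0 ltxx mulr0 expr0n/= (bigD1 ord0)//= mul0e//.
have -> : - r < r by lra.
rewrite (eq_bigr (fun=> (2 * r)%:E)); last by move=> i _; rewrite -EFinD; congr EFin; ring.
by rewrite prodEFin prodr_const card_ord.
Qed.

Lemma measurable_cube (r : R) : measurable (cube r).
Proof.
by apply: measurable_rV_box => i; exact: measurable_itv.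
Qed.

End borel1.

Section translation.
Context (R : realType).

Definition shift1 (z : R) (x : measurableTypeR R) : measurableTypeR R := x + z.

Lemma measurable_shift1 z : measurable_fun setT (shift1 z).
Proof. exact: (@measurable_funD _ (measurableTypeR R) R setT idfun (cst z) (@measurable_id _ _ _) (measurable_cst z)). Qed.

HB.instance Definition _ z := isMeasurableFun.Build _ _ _ _ (shift1 z) (measurable_shift1 z).

Lemma lebesgue_shift1 z (A : set (measurableTypeR R)) : measurable A ->
  lebesgue_measure (shift1 z @^-1` A) = lebesgue_measure A.
Proof.
move=> mA; apply/esym.
apply: (@lebesgue_measure_unique R (pushforward lebesgue_measure (shift1 z))) => //= _ [[a b]] _ <-.
rewrite /pushforward.
have -> : shift1 z @^-1` [set` `]a, b]] = [set` `](a - z), (b - z)]].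
  by apply/seteqP; split=> x /=; rewrite !in_itv/= ltrBlDr lerBrDr.
by rewrite !lebesgue_measure_itv/= !lte_fin ltrD2r -!EFinB; case: ifP => // _; congr EFin; ring.
Qed.

Definition rVshift n (z : 'rV[R]_n) (x : 'rV[measurableTypeR R]_n) : 'rV[measurableTypeR R]_n := (x : 'rV[R]_n) + z.

Lemma measurable_rVshift n (z : 'rV[R]_n) : measurable_fun setT (rVshift z).
Proof.
apply: measurable_fun_rV => i.
rewrite [X in measurable_fun _ X](_ : _ = shift1 (z ord0 i) \o (fun v : 'rV[measurableTypeR R]_n => v ord0 i)).
  by apply: measurableT_comp; [exact: measurable_shift1|exact: measurable_coor].
by apply/funext => x; rewrite /rVshift mxE.
Qed.

HB.instance Definition _ n (z : 'rV[R]_n) := isMeasurableFun.Build _ _ _ _ (rVshift z) (measurable_rVshift z).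

Lemma lebesgue_rVshift n (z : 'rV[R]_n) (A : set 'rV[measurableTypeR R]_n) : measurable A ->
  lebesgue_rV R n (rVshift z @^-1` A) = lebesgue_rV R n A.
Proof.
move=> mA; apply/esym.
apply: (rV_measure_unique (m := pushforward (lebesgue_rV R n) (rVshift z))) => //= B mB.
rewrite /pushforward.
have -> : rVshift z @^-1` rV_box B = rV_box (fun i => shift1 (z ord0 i) @^-1` (B i)).
  by apply/seteqP; split=> x /= H i; have := H i; rewrite /rVshift mxE.
rewrite mu_rV_box; last first.
  by move=> i; rewrite -[X in measurable X]setTI; apply: measurable_shift1.
by apply: eq_bigr => i _; rewrite lebesgue_shift1.
Qed.

Lemma int_rVshift n (z : 'rV[R]_n) (f : 'rV[measurableTypeR R]_n -> R) :
  itg (lebesgue_rV R n) f ->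
  itg (lebesgue_rV R n) (f \o rVshift z) /\
  \int[lebesgue_rV R n]_x f (rVshift z x) = \int[lebesgue_rV R n]_x f x.
Proof.
move=> fi; have mf := itg_mble fi.
have mE A : measurable A -> (pushforward (lebesgue_rV R n) (rVshift z)) A = lebesgue_rV R n A.
  exact: lebesgue_rVshift.
have fi' : itg (lebesgue_rV R n) (f \o rVshift z).
  apply/integrableP; split; first by apply/measurable_EFinP; apply: measurableT_comp.
  move/integrableP : fi => [_]; congr (_ < _)%E.
  have := @ge0_integral_pushforward _ _ _ _ R (rVshift z) (measurable_rVshift z) (lebesgue_rV R n) setT
    (fun x => `|(f x)%:E|)%E measurableT.
  rewrite preimage_setT => <- //; last by apply: measurableT_comp => //; exact/measurable_EFinP.
  by apply: eq_measure_integral => A mA _; first [exact: mE | exact/esym/mE].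
split=> //; congr fine.
have /measurable_EFinP mfE := mf.
have := @integral_pushforward _ _ _ _ R (rVshift z) (measurable_rVshift z) (lebesgue_rV R n) setT
    (EFin \o f) mfE; rewrite preimage_setT => /(_ fi' measurableT) <-.
by apply: eq_measure_integral => A mA _; first [exact: mE | exact/esym/mE].
Qed.

Lemma ge0_int_rVshift n (z : 'rV[R]_n) (f : 'rV[measurableTypeR R]_n -> \bar R) :
  measurable_fun setT f -> (forall x, 0 <= f x)%E ->
  (\int[lebesgue_rV R n]_x f (rVshift z x) = \int[lebesgue_rV R n]_x f x)%E.
Proof.
move=> mf f0.
have := @ge0_integral_pushforward _ _ _ _ R (rVshift z) (measurable_rVshift z) (lebesgue_rV R n) setT
    f measurableT mf; rewrite preimage_setT => <- //.
by apply: eq_measure_integral => A mA _; exact: lebesgue_rVshift.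
Qed.

End translation.

Opaque lebesgue_rV.

(** * Differentiability of Lipschitz functions *)

Section stieltjes.
Context (R : realType) (G : cumulative R R).
Local Notation nu := (lebesgue_stieltjes_measure G).

Lemma stieltjes_oc (a b : R) : a <= b -> nu `]a, b]%classic = (G b - G a)%:E.
Proof.
move=> ab; rewrite /lebesgue_stieltjes_measure /measure_extension/= measurable_mu_extE/=; last exact: is_ocitv.
by rewrite wlength_itv_bnd.
Qed.

End stieltjes.

Section rademacher1.
Context (R : realType) (F : R -> R) (L : R).
Hypothesis FL : forall x y, `|F x - F y| <= L * `|x - y|.

Let G x := L * x + F x.
Let H x := L * x - F x.

Let F_cont : continuous F.
Proof.
move=> x; apply/cvgrPdist_lt => e e0; near=> y.
rewrite (le_lt_trans (FL _ _))//.
have L0 : 0 < `|L| + 1 by rewrite ltr_wpDl.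
apply: (@le_lt_trans _ _ ((`|L| + 1) * `|x - y|)).
  by rewrite ler_wpM2r// (le_trans (ler_norm _))// lerDl.
rewrite mulrC -ltr_pdivlMr//; near: y.
by apply: cvgr_dist_lt => //; rewrite divr_gt0.
Unshelve. all: by end_near. Qed.

Let G_nd : nondecreasing G.
Proof.
move=> x y xy; rewrite /G; have := FL x y => /ler_normlP[].
by rewrite -normrN opprB ger0_norm ?subr_ge0//; lra.
Qed.

Let H_nd : nondecreasing H.
Proof.
move=> x y xy; rewrite /H; have := FL x y => /ler_normlP[].
by rewrite -normrN opprB ger0_norm ?subr_ge0//; lra.
Qed.

Let K x := 2 * L * x.

Let L_ge0 : 0 <= L.
Proof. by have := FL 1 0; rewrite subr0 normr1 mulr1 => /(le_trans (normr_ge0 _)). Qed.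

Let K_nd : nondecreasing K.
Proof. by move=> x y xy; rewrite /K ler_wpM2l// mulr_ge0. Qed.

Let K_rc : right_continuous K.
Proof. by apply: right_continuousW; exact: mulrl_continuous. Qed.

Let lin_cont : continuous (fun x : R => L * x).
Proof. exact: mulrl_continuous. Qed.

Let G_rc : right_continuous G.
Proof. by apply: right_continuousW => x; apply: continuousD; [exact: lin_cont|exact: F_cont]. Qed.

Let H_rc : right_continuous H.
Proof. by apply: right_continuousW => x; apply: continuousB; [exact: lin_cont|exact: F_cont]. Qed.

HB.instance Definition _ := isCumulative.Build R _ R G G_nd G_rc.
HB.instance Definition _ := isCumulative.Build R _ R H H_nd H_rc.
HB.instance Definition _ := isCumulative.Build R _ R K K_nd K_rc.

Let nuG := lebesgue_stieltjes_measure G.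
Let nuH := lebesgue_stieltjes_measure H.

(* The Stieltjes measures of [L x + F] and [L x - F] add up to [2 L] times
   Lebesgue measure, so the first one has a density and the FTC applies. *)
Let nuG_le (A : set (measurableTypeR R)) : measurable A -> (nuG A <= (2 * L)%:E * lebesgue_measure A)%E.
Proof.
move=> mA; have c0 : 0 <= 2 * L by rewrite mulr_ge0.
pose c : {nonneg R} := NngNum c0.
have E1 : lebesgue_stieltjes_measure K A = measure_add nuG nuH A.
  apply: lebesgue_stieltjes_measure_unique => // _ [[a b] _ <-].
  apply: (etrans _ (esym (measure_addE nuG nuH _))).
  rewrite /=.
  have [ab|ab] := leP a b; last first.
    by rewrite set_itv_ge ?bnd_simp -?leNgt ?ltW// !measure0 adde0.
  by rewrite /nuG /nuH !stieltjes_oc// -EFinD; congr EFin; rewrite /= /K /G /H; ring.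
have E2 : lebesgue_stieltjes_measure K A = mscale c (@lebesgue_measure R) A.
  apply: lebesgue_stieltjes_measure_unique => // _ [[a b] _ <-] /=; rewrite /mscale/=.
  have [ab|ab] := leP a b; last first.
    by rewrite set_itv_ge ?bnd_simp -?leNgt ?ltW// !measure0 mule0.
  rewrite /lebesgue_measure !stieltjes_oc// -EFinM; congr EFin; rewrite /= /K; ring.
have -> : ((2 * L)%:E * lebesgue_measure A)%E = mscale c (@lebesgue_measure R) A by [].
by rewrite -E2 E1 measure_addE leeDl.
Qed.

Let derivable_in (m : R) : 0 < m ->
  {ae lebesgue_measure, forall x, -m < x < m -> derivable F x 1}.
Proof.
(* Restriction to a bounded interval makes the Stieltjes measure finite, as the density theorem
   asks; on this interval [G] is then an indefinite integral. *)
move=> m0; pose D : set (measurableTypeR R) := `](- m), m]%classic.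
have mD : measurable D by exact: measurable_itv.
have Dfin : (nuG D < +oo)%E.
  by rewrite /nuG stieltjes_oc ?ltry// (@le_trans _ _ 0)// ?oppr_le0 ltW.
pose nu := mfrestr mD Dfin.
have nula : (nu : set (measurableTypeR R) -> \bar R) `<< lebesgue_measure.
  move=> A nA B mB BA; have B0 : lebesgue_measure B = 0%E := nA B mB BA.
  rewrite /nu /mfrestr /mrestr/=; apply/eqP; rewrite eq_le measure_ge0 andbT.
  apply: (le_trans (nuG_le (measurableI _ _ mB mD))).
  rewrite -[leRHS](mule0 (2 * L)%:E) lee_wpmul2l ?lee_fin ?mulr_ge0//.
  by rewrite -B0 le_measure ?inE//; exact: measurableI.
pose f := Radon_Nikodym_SigmaFinite.f nu (@lebesgue_measure R).
have f_int := Radon_Nikodym_SigmaFinite.f_integrable nula.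
have f_fin := Radon_Nikodym_SigmaFinite.f_fin_num nula.
have fE := Radon_Nikodym_SigmaFinite.f_integral nula.
pose g x := fine (f x).
have gf : EFin \o g = f by apply/funext => x; rewrite /g/= fineK.
have g_int : lebesgue_measure.-integrable setT (EFin \o g) by rewrite gf.
have GE x : -m <= x <= m -> G x = G (- m) + \int[lebesgue_measure]_(t in [set` Interval (BRight (- m)) (BRight x)]) g t.
  move=> /andP[mx xm]; rewrite /Rintegral.
  have -> : (\int[lebesgue_measure]_(t in [set` Interval (BRight (- m)%R) (BRight x)]) (g t)%:E)%E = (G x - G (- m))%:E.
    rewrite -(stieltjes_oc G mx) -[X in integral _ _ X]/(EFin \o g) gf -fE//.
    rewrite /nu /mfrestr /mrestr; congr (nuG _).
    rewrite setIidl// => t; rewrite /D /= !in_itv/= => /andP[mt tx]; rewrite mt/=.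
    exact: le_trans xm.
  by rewrite /= addrC subrK.
have locg : locally_integrable setT g by apply: open_integrable_locally => //; exact: openT.
have gi y : lebesgue_measure.-integrable [set` Interval (BRight (- m)) (BRight y)] (EFin \o g).
  by apply: (integrableS measurableT) => //; exact: measurable_itv.
have := FTC1 gi locg.
move=> /=; apply: (@filterS _ _ (ae_filter_ringOfSetsType (@lebesgue_measure R))) => x H1 /andP[mx xm].
have /H1[dF _] : ((- m)%:E < x%:E)%E by rewrite lte_fin.
have dG : derivable G x 1.
  apply: (near_eq_derivable (f := (cst (G (- m)) \+ (fun y => \int[lebesgue_measure]_(t in [set` Interval (BRight (- m)) (BRight y)]) g t)))).
    near=> y; rewrite /= -GE//; apply/andP; split; apply/ltW; near: y.
      exact: lt_nbhsr.
    exact: lt_nbhsl.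
  by apply: derivableD.
have -> : F = G \- (fun y => L * y) by apply/funext => y /=; rewrite /G; ring.
by apply: derivableB => //; exact: (@derivableM _ _ (cst L) id).
Unshelve. all: by end_near. Qed.

Lemma lip1_ae_derivable : {ae lebesgue_measure, forall x, derivable F x 1}.
Proof.
have : {ae lebesgue_measure, forall x : measurableTypeR R, forall k : nat, -(k.+1%:R) < x < k.+1%:R -> derivable F x 1}.
  by apply: ae_foralln => k; exact: derivable_in.
apply: (@filterS _ _ (ae_filter_ringOfSetsType (@lebesgue_measure R))) => x H1; apply: (H1 (Num.Def.trunc `|x|)).
by rewrite -ltr_norml truncnS_gt.
Qed.

End rademacher1.

Lemma near_dist (R : realType) (h d : R) : 0 < d -> \forall k \near h, `|h - k| < d.
Proof. by move=> d0; apply/nbhs_ballP; exists d => // y; rewrite -ball_normE. Qed.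

Section pd.
Context (R : realType) (n : nat).
Local Notation V := 'rV[R]_n.+1.
Local Notation T := 'rV[measurableTypeR R]_n.+1.
Local Notation mu := (lebesgue_rV R n.+1).
Local Notation e_ j := (delta_mx ord0 j : V).

Definition pd (j : 'I_n.+1) (f : V -> R) (x : V) : R := 'D_(e_ j) f x.

Definition dq (f : V -> R) (j : 'I_n.+1) (x : V) (h : R) := h^-1 * (f (x + h *: e_ j) - f x).

Lemma derivable_dq f j x : derivable f x (e_ j) <-> cvg (dq f j x h @[h --> 0^']).
Proof.
rewrite /derivable; have -> // : (fun h : R => h^-1 *: ((f \o shift x) (h *: e_ j) - f x)) = dq f j x.
by apply/funext => h; rewrite /dq/= [h *: _ + x]addrC.
Qed.

Lemma pd_dq f j x : pd j f x = lim (dq f j x h @[h --> 0^']).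
Proof.
rewrite /pd /derive; have -> // : (fun h : R => h^-1 *: ((f \o shift x) (h *: e_ j) - f x)) = dq f j x.
by apply/funext => h; rewrite /dq/= [h *: _ + x]addrC.
Qed.

(** The limit of a divergent filter is the default point, here [0]. Thanks to this value, bounds on
    [pd] hold at every point, without an exceptional set. *)
Lemma pd_ndvg f j x : ~ derivable f x (e_ j) -> pd j f x = 0.
Proof.
move=> nd; rewrite pd_dq; apply: dvgP => H; apply: nd; exact/derivable_dq.
Qed.

Section lipf.
Variables (L : R) (f : V -> R).
Hypotheses (fL : lip L f).

Let L0 : 0 <= L.
Proof.
have := fL (e_ ord0) 0; rewrite subr0 enorm_delta mulr1.
by apply: le_trans.
Qed.

Lemma dq_bound j x h : `|dq f j x h| <= L.
Proof.
rewrite /dq; have [->|h0] := eqVneq h 0; first by rewrite invr0 mul0r normr0.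
rewrite normrM normfV ler_pdivrMl ?normr_gt0// (le_trans (fL _ _))//.
by rewrite addrAC subrr add0r enormZ enorm_delta mulr1 mulrC.
Qed.

Lemma dq_continuous j x h : h != 0 -> {for h, continuous (dq f j x)}.
Proof.
move=> h0; apply: cvgM; first exact: cvgV.
apply: cvgB; last exact: cvg_cst.
apply/cvgrPdist_lt => e e0.
have L1 : 0 < L + 1 by rewrite ltr_wpDl.
apply: filterS (near_dist h (divr_gt0 e0 L1)) => k hk.
rewrite (le_lt_trans (fL _ _))// opprD addrACA subrr add0r -scalerBl enormZ enorm_delta mulr1.
apply: (@le_lt_trans _ _ ((L + 1) * `|h - k|)); first by rewrite ler_wpM2r// lerDl.
by rewrite mulrC -ltr_pdivlMr.
Qed.

Let small (k : nat) (h : R) := (h != 0) && (`|h| < k.+1%:R^-1).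

Let near_small k : \forall h \near (0 : R)^', small k h.
Proof.
near=> h; apply/andP; split; near: h; first exact: nbhs_dnbhs_neq.
by apply: dnbhs0_lt; rewrite invr_gt0.
Unshelve. all: by end_near. Qed.

Let E j m k (h h' : rat) : set V :=
  if small k (ratr h) && small k (ratr h')
  then [set x | `|dq f j x (ratr h) - dq f j x (ratr h')| <= m.+1%:R^-1] else setT.

(** Cauchy criterion for the difference quotients. They are continuous in the increment away from
    [0], so rational increments represent all of them and only countable operations occur. *)
Let derivableE j : [set x | derivable f x (e_ j)] =
  \bigcap_m \bigcup_k \bigcap_h \bigcap_h' E j m k h h'.
Proof.
apply/seteqP; split=> x /=.
  move=> /derivable_dq cv m _.
  have m0 : 0 < m.+1%:R^-1 / 2 :> R by rewrite divr_gt0// invr_gt0.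
  move/cvgrPdist_lt : (cv : _ --> lim _) => /(_ _ m0).
  rewrite /dnbhs /within /= => /nbhs_ballP[d /= d0 H].
  have [k _ /(_ k (leqnn k)) Hk] := near_infty_natSinv_lt (PosNum d0).
  exists k => // h _ h' _; rewrite /E; case: ifP => // /andP[/andP[h0 hk] /andP[h0' hk']] /=.
  have H1 : `|lim (dq f j x h @[h --> 0^']) - dq f j x (ratr h)| < m.+1%:R^-1 / 2.
    by apply: H => //; rewrite -ball_normE/= sub0r normrN (lt_trans hk).
  have H2 : `|lim (dq f j x h @[h --> 0^']) - dq f j x (ratr h')| < m.+1%:R^-1 / 2.
    by apply: H => //; rewrite -ball_normE/= sub0r normrN (lt_trans hk').
  rewrite ltW// (le_lt_trans (ler_distD (lim (dq f j x h @[h --> 0^'])) _ _))//.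
  by rewrite [X in _ < X]splitr ltrD// distrC.
move=> H; apply/derivable_dq/cauchy_cvgP/cauchy_exP => e e0.
have [m _ /(_ m (leqnn m)) Hm] := near_infty_natSinv_lt (PosNum e0).
rewrite /= in Hm.
have [k _ Hk] := H m I.
have k0 : 0 < k.+1%:R^-1 :> R by rewrite invr_gt0.
have [h0] := rat_in_itvoo k0; rewrite in_itv/= => /andP[h00 h0k].
have sh0 : small k (ratr h0) by rewrite /small gt_eqF//= gtr0_norm.
exists (dq f j x (ratr h0)); rewrite /nbhs/=; apply: filterS (near_small k) => h /andP[hn0 hk].
rewrite -ball_normE/=.
have e1 : 0 < e - m.+1%:R^-1 by rewrite subr_gt0.
have /cvgrPdist_lt/(_ _ e1) := dq_continuous (j := j) (x := x) hn0.
have nk : \forall t \near h, small k t.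
  near=> t; apply/andP; split; near: t.
    have hp : 0 < `|h| by rewrite normr_gt0.
    apply: filterS (near_dist h hp) => t.
    by apply: contraTneq => ->; rewrite subr0 ltxx.
  have hp : 0 < k.+1%:R^-1 - `|h| by rewrite subr_gt0.
  apply: filterS (near_dist h hp) => t ht.
  rewrite -[t](subrK h) (le_lt_trans (ler_normD _ _))// -ltrBrDr.
  by rewrite distrC.
move=> /(filterI nk)/nbhs_ballP[d /= d0 Hd].
have hd : h - d < h + d by rewrite ltrD2l (lt_trans _ d0)// oppr_lt0.
have [r] := rat_in_itvoo hd; rewrite in_itv/= => Hr.
have [] := Hd (ratr r); first by rewrite -ball_normE/= ltr_distlC.
move=> sr Hd1; have := Hk h0 I r I; rewrite /E sh0 sr/= => Hd2.
rewrite (le_lt_trans (ler_distD (dq f j x (ratr r)) _ _))//.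
by rewrite -(subrK m.+1%:R^-1 e) addrC ltr_leD// distrC.
Unshelve. all: by end_near. Qed.

Lemma lip_shift z : lip L (fun x => f (x + z)).
Proof. by move=> x y; have := fL (x + z) (y + z); rewrite opprD addrACA subrr addr0. Qed.

Lemma dq_mble j h : mble (fun x : T => dq f j x h).
Proof.
apply: measurable_funM => //; apply: measurable_funB; last exact: (lip_mble fL).
exact: (lip_mble (lip_shift (h *: e_ j))).
Qed.

Lemma measurable_derivable j : measurable ([set x | derivable f x (e_ j)] : set T).
Proof.
rewrite derivableE; apply: bigcapT_measurable => m; apply: bigcupT_measurable => k.
have mE h h' : measurable (E j m k h h' : set T).
  rewrite /E; case: ifP => // _.
  have mD : mble (fun x : T => `|dq f j x (ratr h) - dq f j x (ratr h')|).
    by apply: measurableT_comp => //; apply: measurable_funB; exact: dq_mble.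
  have := mD measurableT _ (@measurable_itv R `]-oo, (m.+1%:R^-1)]); rewrite setTI.
  by congr measurable; apply/seteqP; split=> x /=; rewrite in_itv.
rewrite -[X in measurable X]setCK; apply: measurableC.
rewrite setC_bigcap; apply: bigcupT_measurable_rat => h.
rewrite setC_bigcap; apply: bigcupT_measurable_rat => h'.
by apply: measurableC; exact: mE.
Qed.

Definition hseq (k : nat) : R := k.+1%:R^-1.

Lemma hseq_cvg : hseq k @[k --> \oo] --> (0:R)^'.
Proof.
move=> A [e /= e0 H].
have [k _ Hk] := near_infty_natSinv_lt (PosNum e0).
exists k => // i /= ki; apply: H.
  by rewrite /= sub0r normrN ger0_norm ?invr_ge0//; exact: Hk.
by rewrite /hseq gt_eqF// invr_gt0.
Qed.

Lemma pd_cvg j x : derivable f x (e_ j) -> dq f j x (hseq k) @[k --> \oo] --> pd j f x.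
Proof.
move=> /derivable_dq d; rewrite pd_dq.
exact: (cvg_comp _ _ hseq_cvg d).
Qed.

Lemma pd_bound j x : `|pd j f x| <= L.
Proof.
have [d|nd] := pselect (derivable f x (e_ j)); last by rewrite pd_ndvg// normr0.
have /cvg_norm dn := pd_cvg d.
have c : cvg (`|dq f j x (hseq k)| @[k --> \oo]) by apply/cvg_ex; eexists; exact: dn.
rewrite -(cvg_lim _ dn)//; apply: limr_le => //.
by apply: nearW => k; exact: dq_bound.
Qed.

(** Difference quotients along [hseq], multiplied by the indicator of the set of derivability,
    converge everywhere: off that set both they and [pd] are [0]. *)
Lemma pd_mble j : mble (pd j f : T -> R).
Proof.
have H (x : T) : (dq f j x (hseq k) * \1_[set x | derivable f x (e_ j)] x) @[k --> \oo] --> pd j f x.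
  rewrite indicE; have [d|nd] := pselect (derivable f x (e_ j)).
    by rewrite mem_set//; under eq_fun do rewrite mulr1; exact: pd_cvg.
  by rewrite memNset// pd_ndvg//; under eq_fun do rewrite mulr0; exact: cvg_cst.
apply/measurable_EFinP.
apply: (emeasurable_fun_cvg (fun k x => (dq f j x (hseq k) * \1_[set x | derivable f x (e_ j)] x)%:E)) => //.
  move=> k; apply/measurable_EFinP; apply: measurable_funM; first exact: dq_mble.
  by apply: measurable_indic; exact: measurable_derivable.
by move=> x _; apply/fine_cvgP; split => /=; [exact: nearW|exact: H].
Qed.

Lemma line_derivable j (x : V) (t : R) :
  derivable (fun s : R => f (x + s *: e_ j) : R) t (1 : R) <-> derivable f (x + t *: e_ j) (e_ j).
Proof.
rewrite derivable_dq /derivable.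
have -> // : (fun h : R => h^-1 *: (((fun s => f (x + s *: e_ j)) \o shift t) h%:A - f (x + t *: e_ j))) = dq f j (x + t *: e_ j).
apply/funext => h; rewrite /dq/=; congr (_ * (f _ - _)).
by rewrite [h%:A]mulr1 scalerDl [h *: _ + _]addrC addrA.
Qed.

End lipf.

Lemma measurable_line j : measurable_fun setT (fun p : measurableTypeR R * T => ((p.2 : V) + p.1 *: e_ j : T)).
Proof.
apply: measurable_fun_rV => i.
rewrite (_ : (fun x => _) = (fun p : measurableTypeR R * T => p.2 ord0 i + p.1 * (e_ j) ord0 i)); last first.
  by apply/funext => p; rewrite !mxE.
apply: (@measurable_funD _ _ R).
  exact: (measurableT_comp (lip_mble (@lip_coor R n.+1 i)) measurable_snd).
have m1 : measurable_fun setT (fst : measurableTypeR R * T -> R) := @measurable_fst _ _ (measurableTypeR R) T.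
exact: (@measurable_funM _ _ R _ _ (cst _) m1 (measurable_cst _)).
Qed.

(* By translation invariance and Fubini, [mu N] is the average over [t] in
   [[0, 1]] of the measures of the translates [N - t e_j]. *)
Lemma null_lines j (N : set T) : measurable N ->
  (forall x : V, lebesgue_measure [set t : measurableTypeR R | N (x + t *: e_ j)] = 0%E) -> mu N = 0%E.
Proof.
move=> mN N0.
pose h (p : measurableTypeR R * T) := (\1_(`[0, 1]%classic : set R) p.1 * \1_N ((p.2 : V) + p.1 *: e_ j) : R)%:E.
have mh : measurable_fun setT h.
  apply/measurable_EFinP; apply: measurable_funM.
    by apply: measurableT_comp; [exact: measurable_indic|exact: measurable_fst].
  by apply: measurableT_comp; [exact: measurable_indic|exact: measurable_line].
have h0 p : (0 <= h p)%E by rewrite lee_fin mulr_ge0.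
have F1 := fubini_tonelli1 (m1 := lebesgue_measure) (m2 := mu) h mh h0.
have F2 := fubini_tonelli2 (m1 := lebesgue_measure) (m2 := mu) h mh h0.
have : (\int[lebesgue_measure]_t fubini_F mu h t)%E = 0%E.
  rewrite -F1 F2; apply: integral0_eq => x _; rewrite /fubini_G.
  apply/eqP; rewrite eq_le integral_ge0// andbT.
  apply: (@le_trans _ _ (\int[lebesgue_measure]_t (\1_[set t : measurableTypeR R | N (x + t *: e_ j)] t)%:E)%E).
    apply: ge0_le_integral => //.
    - exact: (measurableT_comp mh (pair2_measurable x)).
    - by apply/measurable_EFinP; apply: measurable_indic; rewrite -[X in measurable X]setTI;
       apply: (measurableT_comp (measurable_line j) (pair2_measurable x)).
    move=> t _; rewrite /h lee_fin /= !indicE.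
    by case: (_ \in _); rewrite ?mul1r ?mul0r//; case: (_ \in _).
  rewrite integral_indic//.
    by rewrite setIT le_eqVlt; apply/orP; left; apply/eqP; exact: N0.
  by rewrite -[X in measurable X]setTI; apply: (measurableT_comp (measurable_line j) (pair2_measurable x)).
have -> : (\int[lebesgue_measure]_t fubini_F mu h t = \int[lebesgue_measure]_(t in `[0%R, 1%R]) mu N)%E.
  rewrite [RHS]integral_mkcond; apply: eq_integral => t _; rewrite /fubini_F /h /= patchE.
  rewrite indicE; case: (t \in _); last first.
    by under eq_integral do rewrite mul0r; rewrite integral0.
  under eq_integral do rewrite mul1r.
  have H1 := @ge0_int_rVshift R n.+1 (t *: e_ j) (fun x => (\1_N x)%:E).
  have H2 : (\int[mu]_x (\1_N x)%:E = mu N)%E by rewrite integral_indic// setIT.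
  rewrite -H2; apply: H1 => //; exact/measurable_EFinP/measurable_indic.
rewrite integral_cst//= lebesgue_measure_itv/= lte_fin ltr01 oppr0 adde0 mule1.
by [].
Qed.

(** The one-dimensional theorem holds on each line parallel to [e_ j], and [null_lines] assembles
    the exceptional sets of these lines. *)
Lemma lip_ae_derivable L f j : lip L f -> {ae mu, forall x : T, derivable f x (e_ j)}.
Proof.
move=> fL; exists (~` [set x | derivable f x (e_ j)]); split => //.
  by apply: measurableC; exact: (measurable_derivable fL).
apply: (null_lines (j := j)); first by apply: measurableC; exact: (measurable_derivable fL).
move=> x; have := @lip1_ae_derivable R (fun s => f (x + s *: e_ j)) L _.
case.
  move=> s t; rewrite (le_trans (fL _ _))// opprD addrACA subrr add0r -scalerBl.
  by rewrite enormZ enorm_delta mulr1.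
move=> A [mA A0 HA]; apply/eqP; rewrite eq_le measure_ge0 andbT -A0.
apply: le_measure; [apply/mem_set|exact/mem_set|].
  rewrite -[X in measurable X]setTI; apply: (measurableT_comp (measurable_line j) (pair2_measurable x)) => //.
  by apply: measurableC; exact: (measurable_derivable fL).
by move=> t /= Ht; apply: HA => /= /line_derivable.
Qed.

Lemma lip_ae_derivable_all L f : lip L f -> {ae mu, forall x : T, forall j, derivable f x (e_ j)}.
Proof.
by move=> fL; apply: filter_forall => j; exact: (lip_ae_derivable j fL).
Qed.

End pd.

Section pd_rules.
Context (R : realType) (n : nat).
Local Notation V := 'rV[R]_n.+1.
Local Notation T := 'rV[measurableTypeR R]_n.+1.
Local Notation mu := (lebesgue_rV R n.+1).
Local Notation e_ j := (delta_mx ord0 j : V).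
Implicit Types f g h : V -> R.

Lemma pdB j f g x : derivable f x (e_ j) -> derivable g x (e_ j) ->
  pd j (fun x => f x - g x) x = pd j f x - pd j g x.
Proof. by move=> df dg; rewrite /pd; exact: deriveB. Qed.

Lemma pdM j f g x : derivable f x (e_ j) -> derivable g x (e_ j) ->
  pd j (fun x => f x * g x) x = f x * pd j g x + g x * pd j f x.
Proof. by move=> df dg; rewrite /pd; exact: deriveM. Qed.

Lemma pd_cst j c (x : V) : pd j (fun=> c) x = 0.
Proof. by rewrite /pd; exact: derive_cst. Qed.

Lemma pd_near j f g x : (\forall y \near x, f y = g y) -> pd j f x = pd j g x.
Proof. by move=> fg; rewrite /pd; exact: near_eq_derive. Qed.

Lemma pd0_near j f x : (\forall y \near x, f y = 0) -> pd j f x = 0.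
Proof. by move=> /(pd_near j) ->; rewrite (pd_cst j 0). Qed.

(** A negative [r] is allowed and forces [f = 0]; this is why [|r|] appears in several bounds. The
    strict inequality makes the region of vanishing open, so derivatives vanish there too. *)
Definition csup (r : R) f := forall x, r < enorm x -> f x = 0.

Lemma csupW r r' f : r <= r' -> csup r f -> csup r' f.
Proof. by move=> rr fr x r'x; apply: fr; exact: le_lt_trans rr r'x. Qed.

Lemma csup_pd r f j : csup r f -> csup r (pd j f).
Proof.
move=> fr x rx; apply: pd0_near.
have := @enorm_continuous R n x => /(@cvgrPdist_lt _ _ _ _ (nbhs_filter x))/(_ (enorm x - r)); rewrite subr_gt0 => /(_ rx).
apply: filterS => y; rewrite ltr_norml => /andP[_ H]; apply: fr.
by move: H; rewrite ltrBlDr addrC -ltrBlDr opprB addrC subrK.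
Qed.

Lemma cube_ball r (x : V) : enorm x <= r -> cube r x.
Proof. by move=> xr; apply/cubeE => i; rewrite (le_trans (coor_le _ _)). Qed.

Lemma itg_cube r : itg mu (\1_(cube r : set T) : T -> R).
Proof.
have mc : measurable (cube r : set T) by exact: measurable_cube.
apply/integrableP; split; first exact/measurable_EFinP/measurable_indic.
rewrite (eq_integral (fun x => (\1_(cube r : set T) x)%:E)); last by move=> x _ /=; rewrite ger0_norm.
rewrite integral_indic// setIT.
have [r0|r0] := leP 0 r; first by apply: (@le_lt_trans _ _ (((2 * r) ^+ n.+1)%:E)); [have /eqP := @mu_cube R n r r0; rewrite eq_le => /andP[]|exact: ltry].
rewrite (_ : cube r = set0) ?measure0//.
apply/seteqP; split=> // x /cubeE/(_ ord0) h.
by have := le_lt_trans h r0; rewrite normr_lt0.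
Qed.

Lemma itg_csup r C f : mble (f : T -> R) -> (forall x, `|f x| <= C) -> csup r f -> itg mu (f : T -> R).
Proof.
move=> mf fC fr; apply: (itg_le mf _ (itgZ C (itg_cube r))) => x.
have C0 : 0 <= C by rewrite (le_trans _ (fC 0)).
have [xr|rx] := leP (enorm x) r; last by rewrite fr// normr0.
by rewrite indicE mem_set ?mulr1 ?(ger0_norm C0)//; exact: cube_ball.
Qed.

Lemma lip_csup_bounded L r f : lip L f -> csup r f -> exists2 C, 0 <= C & forall x, `|f x| <= C.
Proof.
move=> fL fr; pose z : V := (`|r| + 1) *: e_ ord0.
have zr : enorm z = `|r| + 1 by rewrite /z enormZ enorm_delta mulr1 ger0_norm// addr_ge0.
have fz : f z = 0 by apply: fr; rewrite zr (le_lt_trans (ler_norm r))// ltrDl.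
exists (`|L| * (2 * (`|r| + 1))); first by rewrite mulr_ge0// mulr_ge0// addr_ge0.
move=> x; have [xr|rx] := leP (enorm x) r; last first.
  by rewrite fr// normr0 mulr_ge0// mulr_ge0// addr_ge0.
rewrite -[f x]subr0 -fz (le_trans (fL _ _))//.
apply: (@le_trans _ _ (`|L| * enorm (x - z))); first by rewrite ler_wpM2r ?enorm_ge0// ler_norm.
rewrite ler_wpM2l// (le_trans (enormD _ _))// enormN zr.
have := ler_norm r; lra.
Qed.

Lemma itg_lip_csup L r f : lip L f -> csup r f -> itg mu (f : T -> R).
Proof.
move=> fL fr; have [C _ fC] := lip_csup_bounded fL fr.
by apply: itg_csup fC fr; exact: lip_mble fL.
Qed.

Lemma lip_bounded_ball L f r : lip L f -> forall x, enorm x <= r -> `|f x| <= `|f 0| + `|L| * `|r|.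
Proof.
move=> fL x xr; rewrite -[f x](subrK (f 0)) (le_trans (ler_normD _ _))// addrC lerD2l.
rewrite (le_trans (fL _ _))// subr0 (le_trans _ (ler_wpM2l (normr_ge0 L) (le_trans xr (ler_norm r))))//.
by rewrite ler_wpM2r ?enorm_ge0// ler_norm.
Qed.

Definition clamp (C : R) f x := Num.max (- C) (Num.min C (f x)).

Lemma clamp_lip C L f : lip L f -> lip L (clamp C f).
Proof. by move=> fL; apply: lip_max; exact: lip_min. Qed.

Lemma clamp_bound C f x : 0 <= C -> `|clamp C f x| <= C.
Proof.
by move=> C0; rewrite ler_norml /clamp le_max lexx/= ge_max ge_min lexx/= andbT; lra.
Qed.

Lemma clamp_id C f x : `|f x| <= C -> clamp C f x = f x.
Proof.
by rewrite ler_norml /clamp => /andP[a b]; rewrite (min_idPr _)//; apply/max_idPr.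
Qed.

(** The factor [f] may be unbounded. On the support of [g] it agrees with its truncation at [C], and
    the product of two bounded Lipschitz functions is Lipschitz. *)
Lemma lip_mul_csup L L' r f g : lip L f -> lip L' g -> csup r g ->
  exists2 M, 0 <= M & lip M (fun x => f x * g x).
Proof.
move=> fL gL gr; have [C' C'0 gC] := lip_csup_bounded gL gr.
pose C := `|f 0| + `|L| * `|r|.
have C0 : 0 <= C by rewrite addr_ge0// mulr_ge0.
have -> : (fun x => f x * g x) = fun x => clamp C f x * g x.
  apply/funext => x; have [xr|rx] := leP (enorm x) r; last by rewrite gr// !mulr0.
  by rewrite clamp_id//; exact: lip_bounded_ball.
exists `|C * L' + L * C'|; first by [].
apply: lipW (ler_norm _) _; apply: lipM => //; first exact: clamp_lip.
by move=> x; exact: clamp_bound.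
Qed.

Lemma csupMr r f g : csup r g -> csup r (fun x => f x * g x).
Proof. by move=> gr x rx; rewrite gr// mulr0. Qed.

Lemma csupMl r f g : csup r f -> csup r (fun x => f x * g x).
Proof. by move=> gr x rx; rewrite gr// mul0r. Qed.

(** Difference quotients have integral zero by translation invariance. As [hseq] takes values at
    most 1, all of them live in one cube of half-side [|r| + 1], and dominated convergence
    applies. *)
Lemma int_pd0 L r f j : lip L f -> csup r f -> \int[mu]_x pd j f x = 0.
Proof.
move=> fL fr; have L0 : 0 <= L by apply: (@lip_ge0 _ _ L f (e_ ord0) 0) => //; apply/eqP => /(congr1 (@enorm _ _)); rewrite enorm_delta enorm0 => /eqP; rewrite oner_eq0.
have r1 : r <= `|r| + 1 by rewrite (le_trans (ler_norm _))// lerDl.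
have [|||_ cv] := @dct _ _ _ mu (fun k x => dq f j x (hseq R k)) (pd j f : T -> R)
   (fun x : T => L * \1_(cube (`|r| + 1)) x) (fun k => dq_mble fL j _) (pd_mble fL j) _ _ _.
- exact/itgZ/itg_cube.
- by apply: filterS (lip_ae_derivable j fL) => x dx; exact: pd_cvg.
- move=> k x; rewrite indicE; case: (boolP (x \in _)) => [_|]; first by rewrite mulr1; exact: dq_bound.
  rewrite notin_setE => nx; have xr : `|r| + 1 < enorm x by rewrite ltNge; apply/negP => /cube_ball.
  have h1 : `|hseq R k| <= 1 by rewrite ger0_norm ?invr_ge0// invf_le1// ler1n.
  have hr : r < enorm (x + hseq R k *: e_ j).
    rewrite (le_lt_trans (ler_norm _))//.
    have := enormD (x + hseq R k *: e_ j) (- (hseq R k *: e_ j)).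
    by rewrite addrK enormN enormZ enorm_delta mulr1; lra.
  by rewrite /dq fr// fr ?subr0 ?mulr0 ?normr0//; have := ler_norm r; lra.
have z k : \int[mu]_x dq f j x (hseq R k) = 0.
  have fi := itg_lip_csup fL fr.
  have [si sE] := int_rVshift (hseq R k *: e_ j) fi.
  have -> : \int[mu]_x dq f j x (hseq R k) = \int[mu]_x ((hseq R k)^-1 * (f (rVshift (hseq R k *: e_ j) x) - f x)) by [].
  by rewrite intZ ?intB// ?sE ?subrr ?mulr0//; exact: itgB.
have : (\int[mu]_x dq f j x (hseq R k)) @[k --> \oo] --> (0 : R).
  by under eq_fun do rewrite z; exact: cvg_cst.
by move=> c0; apply: (cvg_unique _ cv c0).
Qed.

Lemma itg_pd_mul L L' r f g j : lip L f -> lip L' g -> csup r g ->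
  itg mu (fun x : T => pd j f x * g x).
Proof.
move=> fL gL gr; have gi := itg_lip_csup gL gr.
under [X in itg _ X]eq_fun do rewrite mulrC.
by apply: (itgMb gi (pd_mble fL j)) => x; exact: pd_bound.
Qed.

Lemma itg_mul_pd L L' r f g j : lip L f -> lip L' g -> csup r g ->
  itg mu (fun x : T => f x * pd j g x).
Proof.
move=> fL gL gr; pose C := `|f 0| + `|L| * `|r|.
have C0 : 0 <= C by rewrite addr_ge0// mulr_ge0.
apply: (@itg_csup r (C * L')).
- by apply: measurable_funM; [exact: lip_mble fL|exact: pd_mble gL j].
- move=> x; rewrite normrM; have [xr|rx] := leP (enorm x) r.
    by apply: ler_pM => //; [exact: lip_bounded_ball|exact: pd_bound].
  rewrite (csup_pd j gr rx) normr0 mulr0 mulr_ge0//.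
  by rewrite (le_trans _ (pd_bound gL j x)).
- by apply: csupMr; exact: csup_pd.
Qed.

Lemma ibp1 L L' r f g j : lip L f -> lip L' g -> csup r g ->
  \int[mu]_x (pd j f x * g x) = - \int[mu]_x (f x * pd j g x).
Proof.
move=> fL gL gr; have [M M0 fgM] := lip_mul_csup fL gL gr.
apply/eqP; rewrite -addr_eq0 -intD; last 2 first.
- exact: itg_pd_mul fL gL gr.
- exact: itg_mul_pd fL gL gr.
rewrite -(int_pd0 j fgM (csupMr f gr)); apply/eqP; apply: int_aeE.
- apply: measurable_funD; apply: measurable_funM.
  + exact: pd_mble fL j.
  + exact: lip_mble gL.
  + exact: lip_mble fL.
  + exact: pd_mble gL j.
- exact: pd_mble fgM j.
apply: filterS2 (lip_ae_derivable j fL) (lip_ae_derivable j gL) => x df dg.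
by rewrite pdM// addrC [g x * _]mulrC.
Qed.

End pd_rules.

(** The expression [f + max 0 (g - f)] is the maximum of [f] and [g], written through a maximum with
    a constant, which is the form that [lip_max] handles. *)
Lemma indic_max_dist (R : realFieldType) (a b : bool) (f g : R) : 0 <= f <= 1 -> 0 <= g <= 1 ->
  `|(a || b)%:R - (f + Num.max 0 (g - f))| <= `|a%:R - f| + `|b%:R - g|.
Proof.
move=> /andP[f0 f1] /andP[g0 g1].
have hA1 := ler_norm (a%:R - f); have hA2 := ler_norm (f - a%:R).
have hB1 := ler_norm (b%:R - g); have hB2 := ler_norm (g - b%:R).
move: hA1 hA2 hB1 hB2; rewrite (distrC f) (distrC g).
move: `|a%:R - f| `|b%:R - g| => NA NB; rewrite ler_norml maxEle.
have [h|h] := leP 0 (g - f); move: NA NB; case: a; case: b => /= NA NB h1 h2 h3 h4; apply/andP; split; lra.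
Qed.

(** * Density and duality in L^1 *)

Section density.
Context (R : realType) (n : nat).
Local Notation V := 'rV[R]_n.+1.
Local Notation T := 'rV[measurableTypeR R]_n.+1.
Local Notation mu := (lebesgue_rV R n.+1).
Variable w : T -> R.
Hypotheses (w0 : forall x, 0 <= w x) (wi : itg mu w).

(* The sets satisfying [apx] form a sigma-algebra containing the half-spaces. *)
Let apx (B : set T) := measurable B /\ forall e, 0 < e -> exists L (f : V -> R),
  [/\ lip L f, (forall x, 0 <= f x <= 1) & \int[mu]_x (`|\1_B x - f x| * w x) < e].

Let itg_b (f : T -> R) C : mble f -> (forall x, `|f x| <= C) -> itg mu (fun x => f x * w x).
Proof.
move=> mf fC; under [X in itg _ X]eq_fun do rewrite mulrC.
exact: itgMb wi mf fC.
Qed.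

Let ind01 (B : set T) x : 0 <= (\1_B x : R) <= 1.
Proof. by rewrite indicE; case: (_ \in _); rewrite ?lexx ?ler01. Qed.

Let itg_d (B : set T) L (f : V -> R) : measurable B -> lip L f -> (forall x, 0 <= f x <= 1) ->
  itg mu (fun x : T => `|\1_B x - f x| * w x).
Proof.
move=> mB fL f01; apply: (@itg_b _ 1).
  apply: measurableT_comp => //; apply: measurable_funB; first exact: measurable_indic.
  exact: lip_mble fL.
move=> x; rewrite normr_id ler_norml; have /andP[a b] := f01 x; have /andP[c d] := ind01 B x.
by apply/andP; split; lra.
Qed.

Let apxC B : apx B -> apx (~` B).
Proof.
move=> [mB HB]; split; first exact: measurableC.
move=> e e0; have [L [f [fL f01 fe]]] := HB e e0.
exists L, (fun x => 1 - f x); split.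
- by have := lipB (lip_cst (1 : R)) fL; rewrite add0r.
- by move=> x; have /andP[a b] := f01 x; apply/andP; split; lra.
apply: le_lt_trans fe; rewrite le_eqVlt; apply/orP; left; apply/eqP; apply: eq_Rintegral => x _.
congr (_ * _); rewrite !indicE in_setC; case: (x \in B) => /=.
  by rewrite sub0r normrN.
by rewrite sub0r normrN opprB addrC subrK.
Qed.

Let apxU A B : apx A -> apx B -> apx (A `|` B).
Proof.
move=> [mA HA] [mB HB]; split; first exact: measurableU.
move=> e e0; have e2 : 0 < e / 2 by rewrite divr_gt0.
have [L [f [fL f01 fe]]] := HA _ e2; have [M [g [gM g01 ge]]] := HB _ e2.
exists (L + (M + L)), (fun x => f x + Num.max 0 (g x - f x)); split.
- by apply: lipD => //; apply: lip_max; exact: lipB.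
- move=> x; have /andP[a b] := f01 x; have /andP[c d] := g01 x.
  by rewrite maxEle; case: ifPn; rewrite -?ltNge => h; apply/andP; split; lra.
apply: (@le_lt_trans _ _ (\int[mu]_x (`|\1_A x - f x| * w x + `|\1_B x - g x| * w x))).
  apply: int_le => [||x].
  - apply: (@itg_d _ (L + (M + L)) (fun x => f x + Num.max 0 (g x - f x))).
    + exact: measurableU.
    + by apply: lipD => //; apply: lip_max; exact: lipB.
    move=> x; have /andP[a b] := f01 x; have /andP[c d] := g01 x.
    by rewrite maxEle; case: ifPn; rewrite -?ltNge => h; apply/andP; split; lra.
  - by apply: itgD; [exact: itg_d mA fL f01|exact: itg_d mB gM g01].
  rewrite -mulrDl ler_wpM2r//.
  have /andP[a b] := f01 x; have /andP[c d] := g01 x.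
  by rewrite !indicE in_setU; apply: indic_max_dist.
have ia := itg_d mA fL f01; have ib := itg_d mB gM g01.
by rewrite (intD ia ib) (splitr e); apply: ltrD.
Qed.

Let apx0 : apx set0.
Proof.
split=> // e e0; exists 0, (fun=> 0); split; first exact: lip_cst.
  by move=> x; rewrite lexx ler01.
under eq_Rintegral do rewrite indicE in_set0/= subrr normr0 mul0r.
by rewrite int0.
Qed.

Let apx_bigU (F : nat -> set T) : (forall i, apx (F i)) -> apx (\bigcup_i F i).
Proof.
move=> HF; have mF i : measurable (F i) := (HF i).1.
split; first exact: bigcupT_measurable.
move=> e e0; have e2 : 0 < e / 2 by rewrite divr_gt0.
pose G k := \big[setU/set0]_(i < k) F i.
have aG k : apx (G k)
  by elim: k => [|k IH]; rewrite /G ?big_ord0 ?big_ord_recr/=; [exact: apx0|exact: apxU].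
pose D k x := `|(\1_(\bigcup_i F i) x : R) - \1_(G k) x| * w x.
have D1 x k : `|(\1_(\bigcup_i F i) x : R) - \1_(G k) x| <= 1.
  have /andP[a b] := ind01 (\bigcup_i F i) x; have /andP[c d] := ind01 (G k) x.
  by rewrite ler_norml; apply/andP; split; lra.
have mD k : mble (fun x => `|(\1_(\bigcup_i F i) x : R) - \1_(G k) x|).
  by apply: measurableT_comp => //; apply: measurable_funB; apply: measurable_indic;
    [exact: bigcupT_measurable|exact: (aG k).1].
have iD k : itg mu (D k) by apply: (@itg_b _ 1) => // x; rewrite normr_id.
have [||||_ /= cv] := @dct _ _ _ mu D (fun=> 0) w (fun k => itg_mble (iD k)) _ _ _ _.
- exact: measurable_cst.
- exact: wi.
- apply: aeW => x.
  have : \forall k \near \oo, D k x = 0.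
    have [[i _ Fi]|nF] := pselect ((\bigcup_i F i) x).
      near=> k; rewrite /D !indicE !mem_set ?subrr ?normr0 ?mul0r//; last by exists i.
      rewrite /G -bigcup_mkord; exists i => //=; near: k; exact: nbhs_infty_gt.
    near=> k; rewrite /D !indicE !memNset ?subrr ?normr0 ?mul0r//.
    by rewrite /G -bigcup_mkord => -[i _ Fi]; apply: nF; exists i.
  by move=> h0; apply: cvg_near_cst.
- move=> k x; rewrite /D normrM normr_id (ger0_norm (w0 x)).
  by rewrite -[leRHS]mul1r ler_wpM2r.
move: cv; rewrite int0 => /cvgrPdist_lt/(_ _ e2)[k _ /(_ k (leqnn k))]; rewrite /= sub0r normrN => Hk.
have [_ /(_ _ e2)[L [f [fL f01 fe]]]] := aG k.
exists L, f; split => //.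
apply: (@le_lt_trans _ _ (\int[mu]_x (D k x + `|\1_(G k) x - f x| * w x))).
  apply: int_le => [||x].
  - by apply: itg_d fL f01; exact: bigcupT_measurable.
  - by apply: itgD => //; exact: itg_d (aG k).1 fL f01.
  by rewrite /D -mulrDl ler_wpM2r// ler_distD.
have ib := itg_d (aG k).1 fL f01.
rewrite (intD (iD k) ib) (splitr e); apply: ltrD => //.
exact: le_lt_trans (ler_norm _) Hk.
Unshelve. all: by end_near. Qed.

(** Ramps of slope [k] in the coordinate [i], cut off at 0 and 1, tend pointwise to the indicator of
    the open half-space. *)
Let apx_halfspace i (a : R) : apx [set v : T | a < v ord0 i].
Proof.
pose F k (v : V) := Num.min 1 (Num.max 0 (k%:R * (v ord0 i - a))).
have FL k : lip k%:R (F k).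
  apply/lip_min/lip_max; have := lipZ k%:R (lipB (@lip_coor R n.+1 i) (lip_cst a)).
  by rewrite addr0 mulr1 normr_nat.
have F01 k x : 0 <= F k x <= 1.
  by rewrite /F le_min ler01/= le_max lexx/= ge_min lexx.
have mA : measurable [set v : T | a < v ord0 i].
  have := lip_mble (@lip_coor R n.+1 i) measurableT (@measurable_itv R `]a, +oo[).
  by rewrite setTI; congr measurable; apply/seteqP; split=> v /=; rewrite in_itv/= andbT.
split=> // e e0.
pose D k x := `|\1_[set v : T | a < v ord0 i] x - F k x| * w x.
have iD k : itg mu (D k) by exact: itg_d mA (FL k) (F01 k).
have [||||_ /= cv] := @dct _ _ _ mu D (fun=> 0) w (fun k => itg_mble (iD k)) _ _ _ _.
- exact: measurable_cst.
- exact: wi.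
- apply: aeW => x.
  have : \forall k \near \oo, D k x = 0.
    have [ax|xa] := ltP a (x ord0 i).
      near=> k; rewrite /D indicE mem_set//=.
      have : 1 <= k%:R * (x ord0 i - a).
        rewrite -ler_pdivrMr ?subr_gt0// div1r; near: k; exact: nbhs_infty_ger.
      rewrite /F => h1; rewrite (max_idPr _) ?(le_trans ler01)//.
      by rewrite (min_idPl _)// subrr normr0 mul0r.
    near=> k; rewrite /D indicE memNset/=; last by apply/negP; rewrite -leNgt.
    rewrite /F (max_idPl _); last by rewrite mulr_ge0_le0// subr_le0.
    by rewrite (min_idPr _)// subrr normr0 mul0r.
  by move=> h0; apply: cvg_near_cst.
- move=> k x; rewrite /D normrM normr_id (ger0_norm (w0 x)) -[leRHS]mul1r ler_wpM2r//.
  have /andP[p q] := ind01 [set v : T | a < v ord0 i] x; have /andP[c d] := F01 k x.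
  by rewrite ler_norml; apply/andP; split; lra.
move: cv; rewrite int0 => /cvgrPdist_lt/(_ _ e0)[k _ /(_ k (leqnn k))]; rewrite /= sub0r normrN => Hk.
exists k%:R, (F k); split => //.
exact: le_lt_trans (ler_norm _) Hk.
Unshelve. all: by end_near. Qed.

Let apx_coor i (C : set (measurableTypeR R)) : measurable C -> apx ((fun v : T => v ord0 i) @^-1` C).
Proof.
have sa : sigma_algebra setT [set C : set R | apx ((fun v : T => v ord0 i) @^-1` C)].
  split.
  - by rewrite /= preimage_set0; exact: apx0.
  - by move=> A /= HA; rewrite setTD preimage_setC; exact: apxC.
  - by move=> F /= HF; rewrite preimage_bigcup; exact: apx_bigU.
move=> mC; have : (@RGenOInfty.G R).-sigma.-measurable C by rewrite -RGenOInfty.measurableE.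
suff H : (@RGenOInfty.G R).-sigma.-measurable `<=` [set C : set R | apx ((fun v : T => v ord0 i) @^-1` C)] by move=> /H.
apply: smallest_sub; first exact: sa.
move=> _ [a ->] /=.
rewrite (_ : _ @^-1` _ = [set v : T | a < v ord0 i]); first exact: apx_halfspace.
by apply/seteqP; split=> v /=; rewrite in_itv/= andbT.
Qed.

(** The weight [w] turns Lebesgue measure into a finite measure. Complements then preserve
    approximability, and the approximants need no decay at infinity. *)
Lemma lip_dense_indic (B : set T) e : measurable B -> 0 < e -> exists L (f : V -> R),
  [/\ lip L f, (forall x, 0 <= f x <= 1) & \int[mu]_x (`|\1_B x - f x| * w x) < e].
Proof.
move=> mB e0; suff [_ /(_ e e0)] : apx B by [].
move: B mB; apply: smallest_sub.
  split; [exact: apx0|by move=> A HA; rewrite setTD; exact: apxC|exact: apx_bigU].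
rewrite -bigcup_seq => B [i _ [C mC <-]]; rewrite setTI; exact: apx_coor.
Qed.

End density.

Import HBSimple.

Section duality.
Context (R : realType) (n : nat).
Local Notation V := 'rV[R]_n.+1.
Local Notation T := 'rV[measurableTypeR R]_n.+1.
Local Notation mu := (lebesgue_rV R n.+1).
Implicit Types f g h : V -> R.

Lemma enorm_le_cube (k : R) (x : V) : (forall i, `|x ord0 i| <= k) -> enorm x <= n.+1%:R * k.
Proof.
move=> h; rewrite (le_trans (enorm_sumE x))// (le_trans (ler_sum _ (fun i _ => h i)))//.
by rewrite sumr_const card_ord mulr_natl.
Qed.

Definition cutoff (r : R) (x : V) : R := Num.min 1 (Num.max 0 (r + 1 - enorm x)).

Lemma cutoff_lip r : lip 1 (cutoff r).
Proof.
apply/lip_min/lip_max; have := lipB (lip_cst (r + 1)) (@lip_enorm R n.+1 0); rewrite add0r.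
by congr lip; apply/funext => x; rewrite subr0.
Qed.

Lemma cutoff01 r x : 0 <= cutoff r x <= 1.
Proof. by rewrite /cutoff le_min ler01/= le_max lexx/= ge_min lexx. Qed.

Lemma cutoff_norm r x : `|cutoff r x| <= 1.
Proof. by have /andP[a b] := cutoff01 r x; rewrite ger0_norm. Qed.

Lemma cutoff1 r x : enorm x <= r -> cutoff r x = 1.
Proof.
move=> xr; rewrite /cutoff; apply/min_idPl.
by rewrite le_max; apply/orP; right; lra.
Qed.

Lemma cutoff_csup r : csup (r + 1) (cutoff r).
Proof.
move=> x xr; rewrite /cutoff (max_idPl _) ?(min_idPr _)//; lra.
Qed.

Lemma cutoff_cvg x : \forall k \near \oo, cutoff k%:R x = 1.
Proof. by near=> k; apply: cutoff1; near: k; exact: nbhs_infty_ger. Unshelve. all: by end_near. Qed.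

(** All [L^1] bounds of the development pass through this duality: it is enough to bound the pairing
    with compactly supported Lipschitz functions of sup norm at most 1, uniformly in their Lipschitz
    constant. *)
Lemma L1_dual (w : T -> R) C : itg mu w ->
  (forall L r f, lip L f -> csup r f -> (forall x, `|f x| <= 1) -> `|\int[mu]_x (w x * f x)| <= C) ->
  \int[mu]_x `|w x| <= C.
Proof.
move=> wi H; apply/ler_addgt0Pr => e e0; have e2 : 0 < e / 2 by rewrite divr_gt0.
pose P := [set x : T | 0 <= w x].
have mP : measurable P.
  have := itg_mble wi measurableT (@measurable_itv R `[0, +oo[).
  by rewrite setTI; congr measurable; apply/seteqP; split=> v /=; rewrite in_itv/= andbT.
have [L [f [fL f01 fe]]] := lip_dense_indic (fun x => normr_ge0 (w x)) (itg_norm wi) mP e2.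
(* With [f] close to the indicator of [w >= 0], this approximates the sign of [w]; the error is
   [2 |1_P - f|] in the weight [|w|]. Cutoffs then give [g] compact support. *)
pose g x := 2 * f x - 1.
have gL : lip (2 * L + 0) g by apply: lipB; [have := lipZ 2 fL; rewrite ger0_norm|exact: lip_cst].
have g1 x : `|g x| <= 1 by have /andP[a b] := f01 x; rewrite /g ler_norml; apply/andP; split; lra.
have mg : mble (g : T -> R) := lip_mble gL.
have wg : itg mu (fun x => w x * g x) by exact: itgMb wi mg g1.
have Hg : \int[mu]_x (w x * g x) <= C.
  have wgk k : itg mu (fun x => w x * g x * cutoff k%:R x).
    exact: (itgMb wg (lip_mble (@cutoff_lip k%:R)) (cutoff_norm k%:R)).
  have [||||_ /= cv] := @dct _ _ _ mu (fun k x => w x * g x * cutoff k%:R x) (fun x => w x * g x)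
    (fun x => `|w x * g x|) (fun k => itg_mble (wgk k)) _ _ _ _.
  - exact: (itg_mble wg).
  - exact: (itg_norm wg).
  - apply: aeW => x; apply: cvg_near_cst.
    by apply: filterS (cutoff_cvg x) => k ->; rewrite mulr1.
  - by move=> k x; rewrite normrM -[leRHS]mulr1 ler_wpM2l// cutoff_norm.
  have <- := cvg_lim (@Rhausdorff R) cv.
  apply: limr_le; first by apply/cvg_ex; eexists; exact: cv.
  apply: nearW => k; rewrite (le_trans (ler_norm _))//.
  have [M M0 gcL] := lip_mul_csup gL (@cutoff_lip k%:R) (@cutoff_csup k%:R).
  have := H M (k%:R + 1) (fun x => g x * cutoff k%:R x) gcL (csupMr g (@cutoff_csup k%:R)) _.
  under eq_Rintegral do rewrite mulrA; apply.
  by move=> x; rewrite normrM -[leRHS]mulr1 ler_pM// cutoff_norm.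
have ii := itg_norm wi.
have id : itg mu (fun x => `|\1_P x - f x| * `|w x|).
  under [X in itg _ X]eq_fun do rewrite mulrC.
  apply: (@itgMb _ _ _ _ _ _ 1) => //.
    by apply: measurableT_comp => //; apply: measurable_funB; [exact: measurable_indic|exact: lip_mble fL].
  move=> x; rewrite normr_id ler_norml; have /andP[a b] := f01 x.
  by rewrite indicE; case: (_ \in _) => /=; apply/andP; split; lra.
have : \int[mu]_x `|w x| <= \int[mu]_x (w x * g x + 2 * (`|\1_P x - f x| * `|w x|)).
  apply: int_le => //; first by apply: itgD => //; exact: itgZ.
  move=> x; have /andP[a b] := f01 x; rewrite indicE.
  have [w0|w0] := leP 0 (w x).
    rewrite mem_set// /g (ger0_norm w0) ger0_norm ?subr_ge0//=; nra.
  rewrite memNset ?sub0r ?normrN ?(ger0_norm a) ?(ltr0_norm w0)/g/=; first by nra.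
  by rewrite /P/=; apply/negP; rewrite -ltNge.
rewrite intD// ?intZ//; last exact: itgZ.
by move=> H3; apply: (le_trans H3); apply: lerD => //; rewrite mulrC -ler_pdivlMr// ltW.
Qed.

Definition L1lip (f : T -> R) := itg mu f /\ forall e, 0 < e -> exists L r g,
  [/\ lip L g, csup r g & \int[mu]_x `|f x - g x| < e].

Lemma L1lip_limit (f : T -> R) : itg mu f ->
  (forall e, 0 < e -> exists2 g, L1lip g & \int[mu]_x `|f x - g x| < e) -> L1lip f.
Proof.
move=> fi H; split=> // e e0; have e2 : 0 < e / 2 by rewrite divr_gt0.
have [g [gi /(_ _ e2)[L [r [h [hL hr gh]]]]] fg] := H _ e2.
exists L, r, h; split => //; have hi := itg_lip_csup hL hr.
apply: (@le_lt_trans _ _ (\int[mu]_x (`|f x - g x| + `|g x - h x|))).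
  apply: int_le.
  - exact/itg_norm/itgB.
  - by apply: itgD; exact/itg_norm/itgB.
  - by move=> x; exact: ler_distD.
by rewrite (splitr e); apply: (int_add_lt (itg_norm (itgB fi gi)) (itg_norm (itgB gi hi))).
Qed.

Lemma L1lip0 : L1lip (fun=> 0).
Proof.
split; first exact: itg0.
move=> e e0; exists 0, 0, (fun=> 0); split=> //; first exact: lip_cst.
by under eq_Rintegral do rewrite subrr normr0; rewrite int0.
Qed.

Lemma L1lipD f g : L1lip f -> L1lip g -> L1lip (fun x => f x + g x).
Proof.
move=> [fi Hf] [gi Hg]; split; first exact: itgD.
move=> e e0; have e2 : 0 < e / 2 by rewrite divr_gt0.
have [L [r [f' [fL fr fe]]]] := Hf _ e2; have [M [s [g' [gL gs ge]]]] := Hg _ e2.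
have fi' := itg_lip_csup fL fr; have gi' := itg_lip_csup gL gs.
exists (L + M), (Num.max r s), (fun x => f' x + g' x); split.
- exact: lipD.
- by move=> x; rewrite gt_max => /andP[rx sx]; rewrite fr// gs// addr0.
apply: (@le_lt_trans _ _ (\int[mu]_x (`|f x - f' x| + `|g x - g' x|))).
  apply: int_le.
  - by apply: itg_norm; apply: itgB; exact: itgD.
  - by apply: itgD; exact/itg_norm/itgB.
  - by move=> x; rewrite opprD addrACA ler_normD.
by rewrite (splitr e); apply: (int_add_lt (itg_norm (itgB fi fi')) (itg_norm (itgB gi gi'))).
Qed.

Lemma L1lipZ c f : L1lip f -> L1lip (fun x => c * f x).
Proof.
move=> [fi Hf]; split; first exact: itgZ.
move=> e e0; have c1 : 0 < `|c| + 1 by rewrite ltr_wpDl.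
have [L [r [f' [fL fr fe]]]] := Hf _ (divr_gt0 e0 c1).
have fi' := itg_lip_csup fL fr.
exists (`|c| * L), r, (fun x => c * f' x); split.
- exact: lipZ.
- exact: csupMr.
under eq_Rintegral do rewrite -mulrBr normrM.
rewrite intZ; last exact/itg_norm/itgB.
apply: (@le_lt_trans _ _ ((`|c| + 1) * \int[mu]_x `|f x - f' x|)).
  by rewrite ler_wpM2r ?lerDl// int_ge0.
by rewrite mulrC -ltr_pdivlMr.
Qed.

Lemma L1lip_sum I (s : seq I) (F : I -> T -> R) : (forall i, L1lip (F i)) ->
  L1lip (fun x => \sum_(i <- s) F i x).
Proof.
move=> HF; elim: s => [|y ys IH].
  by under [X in L1lip X]eq_fun do rewrite big_nil; exact: L1lip0.
by under [X in L1lip X]eq_fun do rewrite big_cons; exact: L1lipD.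
Qed.

Lemma L1lip_indic (B : set T) (k : nat) : measurable B -> B `<=` cube k%:R -> L1lip (\1_B).
Proof.
move=> mB Bk.
have iB : itg mu (\1_B : T -> R).
  have mI : mble (\1_B : T -> R) by exact: measurable_indic.
  apply: (itg_le mI _ (itg_cube n k%:R)) => x; rewrite !indicE; have [xB|xB] := boolP (x \in B); last by rewrite normr0.
  by rewrite mem_set//; apply: Bk; move: xB; rewrite inE.
(* The cube of half-side [k] lies in the Euclidean ball of this radius, where the cutoff equals
   1. *)
split=> // e e0; pose r : R := n.+1%:R * k%:R.
have w0 x : 0 <= (\1_(cube (r + 1) : set T) x : R) by rewrite indicE.
have [L [f [fL f01 fe]]] := lip_dense_indic w0 (itg_cube n (r + 1)) mB e0.
have [M M0 gL] := lip_mul_csup fL (@cutoff_lip r) (@cutoff_csup r).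
exists M, (r + 1), (fun x => f x * cutoff r x); split => //.
  exact/csupMr/cutoff_csup.
have gi := itg_lip_csup gL (csupMr f (@cutoff_csup r)).
apply: le_lt_trans fe; apply: int_le => [||x].
- exact/itg_norm/itgB.
- under [X in itg _ X]eq_fun do rewrite mulrC.
  apply: (@itgMb _ _ _ _ _ _ 1); first exact: itg_cube.
    by apply: measurableT_comp => //; apply: measurable_funB; [exact: measurable_indic|exact: lip_mble fL].
  move=> x; rewrite normr_id ler_norml; have /andP[a b] := f01 x.
  by rewrite indicE; case: (_ \in _) => /=; apply/andP; split; lra.
have /andP[a b] := f01 x; have /andP[c d] := cutoff01 r x.
have [xr|rx] := leP (enorm x) (r + 1); last first.
  rewrite cutoff_csup// mulr0 subr0 !indicE memNset ?normr0 ?mulr_ge0// => xB.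
  have := Bk x xB => /cubeE /enorm_le_cube h.
  by move: rx; rewrite ltNge (le_trans h)// lerDl.
have -> : (\1_(cube (r + 1) : set T) x : R) = 1 by rewrite indicE mem_set//; exact: cube_ball.
rewrite mulr1.
have [xB|xB] := pselect (B x).
  by rewrite cutoff1 ?mulr1//; have := Bk x xB => /cubeE /enorm_le_cube.
rewrite indicE memNset// !sub0r !normrN !ger0_norm ?mulr_ge0//.
by rewrite -[leRHS]mulr1 ler_wpM2l.
Qed.

Lemma L1lip_all (f : T -> R) : itg mu f -> L1lip f.
Proof.
move=> fi; apply: L1lip_limit => // e e0; have e2 : 0 < e / 2 by rewrite divr_gt0.
have [s_ [si _ sc]] := approximation_sfun_integrable measurableT fi.
have [k Hk] : exists k, \int[mu]_x `|f x - s_ k x| < e / 2.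
  have : \forall k \near \oo, (\int[mu]_x `|(EFin \o f) x - (s_ k x)%:E| < (e / 2)%:E)%E.
    have h0 : nbhs (0 : \bar R)%E [set y | (y < (e / 2)%:E)%E] by apply: open_ereal_lt'; rewrite lte_fin.
    exact: sc h0.
  move=> [k _ /(_ k (leqnn k)) Hk]; exists k.
  rewrite -lte_fin -int_EFin//; apply/itg_norm/itgB => //; exact: si.
pose s := s_ k.
have ski := si k.
have sck j : itg mu (fun x => s x * \1_(cube j%:R : set T) x).
  apply: (itgMb (C := 1) ski); first by apply: measurable_indic; exact: measurable_cube.
  by move=> x; rewrite indicE; case: (_ \in _) => /=; rewrite ?normr1 ?normr0.
have [||||_ /= cv] := @dct _ _ _ mu (fun j x => `|s x - s x * \1_(cube j%:R : set T) x|) (fun x => 0)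
    (fun x => `|s x|) (fun j => itg_mble (itg_norm (itgB ski (sck j)))) _ _ _ _.
- exact: measurable_cst.
- exact: itg_norm.
- apply: aeW => x; apply: cvg_near_cst; near=> j.
  rewrite indicE mem_set ?mulr1 ?subrr ?normr0//; apply: cube_ball; near: j; exact: nbhs_infty_ger.
- move=> j x; rewrite normr_id indicE; case: (_ \in _) => /=; rewrite ?mulr1 ?subrr ?normr0//.
  by rewrite mulr0 subr0.
move: cv; rewrite int0 => /cvgrPdist_lt/(_ _ e2)[j _ /(_ j (leqnn j))]; rewrite /= sub0r normrN => Hj.
exists (fun x => s x * \1_(cube j%:R : set T) x).
  rewrite (_ : (fun x => _) = fun x => \sum_(y <- finmap.enum_fset (fset_set (range s)))
     y * (\1_(s @^-1` [set y] `&` cube j%:R) x)); last first.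
    apply/funext => x; rewrite {1}(fimfunE s x) fsbig_finite// mulr_suml.
    by apply: eq_bigr => y _; rewrite -mulrA indicI.
  apply: L1lip_sum => i; apply: L1lipZ; apply: (@L1lip_indic _ j) => //.
  by apply: measurableI; [exact: measurable_funPTI|exact: measurable_cube].
apply: (@le_lt_trans _ _ (\int[mu]_x (`|f x - s x| + `|s x - s x * \1_(cube j%:R : set T) x|))).
  apply: int_le.
  - exact/itg_norm/itgB.
  - by apply: itgD; exact/itg_norm/itgB.
  - by move=> x; exact: ler_distD.
rewrite (splitr e); apply: (int_add_lt (itg_norm (itgB fi ski)) (itg_norm (itgB ski (sck j)))) => //.
exact: le_lt_trans (ler_norm _) Hj.
Unshelve. all: by end_near. Qed.

Lemma lip_dense (f : T -> R) e : itg mu f -> 0 < e -> exists L r g,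
  [/\ lip L g, csup r g & \int[mu]_x `|f x - g x| < e].
Proof. by move=> /L1lip_all[_]; exact. Qed.

(** Derivatives of uniformly Lipschitz functions are bounded, so [Psi] may be replaced by a
    compactly supported Lipschitz [g]. An integration by parts moves the derivative onto [g], where
    pointwise convergence of [h_] suffices. *)
Lemma pd_weak (h_ : nat -> V -> R) h L j (Psi : T -> R) :
  (forall m, lip L (h_ m)) -> lip L h -> (forall x, h_ m x @[m --> \oo] --> h x) ->
  itg mu Psi ->
  \int[mu]_x (Psi x * pd j (h_ m) x) @[m --> \oo] --> \int[mu]_x (Psi x * pd j h x).
Proof.
move=> hmL hL hmh Pi; apply/cvgrPdist_lt => e e0.
have L0 : 0 <= L by rewrite (le_trans _ (pd_bound hL j 0)).
pose C := 2 * L + 1; have C0 : 0 < C by rewrite ltr_wpDl// mulr_ge0.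
have e2 : 0 < e / 2 by rewrite divr_gt0.
have [M [r [g [gM gr Pg]]]] := lip_dense Pi (divr_gt0 e2 C0).
have gi := itg_lip_csup gM gr.
have ipd f (F : T -> R) : lip L f -> itg mu F -> itg mu (fun x => F x * pd j f x).
  by move=> fL Fi; apply: (itgMb Fi (pd_mble fL j)) => x; exact: pd_bound.
pose D m x := h x - h_ m x.
have DL m : lip (L + L) (D m) by exact: lipB.
have c1 : \int[mu]_x (D m x * pd j g x) @[m --> \oo] --> 0.
  have [B HB] : exists B : R, forall m, `|h_ m 0| <= B.
    have cn : cvgn (h_ ^~ 0) by apply/cvg_ex; exists (h 0); exact: hmh.
    have := cvg_seq_bounded cn.
    by move=> [B [_ /(_ (B + 1))]]; rewrite ltrDl ltr01 => /(_ isT) HB; exists (B + 1) => m; exact: HB.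
  have B0 : 0 <= B by rewrite (le_trans _ (HB 0%N)).
  pose B' := `|h 0| + B + `|L + L| * `|r|.
  have [|||||_] := @dct _ _ _ mu (fun m x => D m x * pd j g x) (fun=> 0)
     (fun x : T => (B' * M) * \1_(cube r) x) _ _ _ _ _.
  - by move=> m; apply: measurable_funM; [exact: lip_mble (DL m)|exact: pd_mble gM j].
  - exact: measurable_cst.
  - exact/itgZ/itg_cube.
  - apply: aeW => x; rewrite -[X in _ --> X](mul0r (pd j g x)); apply: cvgM; last exact: cvg_cst.
    by rewrite -(subrr (h x)); apply: cvgB => //; exact: cvg_cst.
  - move=> m x; rewrite normrM; have [xr|rx] := leP (enorm x) r; last first.
      rewrite (csup_pd j gr rx) normr0 mulr0 mulr_ge0// mulr_ge0//.
        by rewrite addr_ge0 ?addr_ge0// mulr_ge0.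
      by rewrite (le_trans _ (pd_bound gM j 0)).
    rewrite indicE mem_set ?mulr1; last exact: cube_ball.
    apply: ler_pM => //; last exact: pd_bound.
    rewrite (le_trans (lip_bounded_ball (DL m) xr))// lerD2r /D.
    by rewrite (le_trans (ler_normB _ _))// lerD2l.
  by rewrite int0.
move/cvgrPdist_lt : c1 => /(_ _ e2); apply: filterS => m; rewrite sub0r normrN => Hm.
have dL := lipB hL (hmL m).
have I1 := ipd _ _ hL Pi; have I2 := ipd _ _ (hmL m) Pi.
rewrite -intB//.
pose F x := pd j h x - pd j (h_ m) x.
have mF : mble (F : T -> R) by apply: measurable_funB; [exact: pd_mble hL j|exact: pd_mble (hmL m) j].
have FC x : `|F x| <= C.
  rewrite (le_trans (ler_normB _ _))// /C.
  by have := pd_bound hL j x; have := pd_bound (hmL m) j x; lra.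
have igF : itg mu (fun x => g x * F x) by exact: itgMb gi mF FC.
have iPgF : itg mu (fun x => (Psi x - g x) * F x) by apply: (itgMb _ mF FC); exact: itgB.
have -> : \int[mu]_x (Psi x * pd j h x - Psi x * pd j (h_ m) x) =
  \int[mu]_x ((Psi x - g x) * F x) + \int[mu]_x (g x * F x).
  by rewrite -intD//; apply: eq_Rintegral => x _; rewrite /F; ring.
have -> : \int[mu]_x (g x * F x) = - \int[mu]_x (D m x * pd j g x).
  rewrite -(ibp1 j dL gM gr); apply: int_aeE.
  - exact: itg_mble igF.
  - by apply: measurable_funM; [exact: pd_mble dL j|exact: lip_mble gM].
  - by apply: filterS2 (lip_ae_derivable j hL) (lip_ae_derivable j (hmL m)) => x d1 d2; rewrite pdB// mulrC.
rewrite (le_lt_trans (ler_normD _ _))// normrN (splitr e) ltrD//.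
apply: (@le_lt_trans _ _ (C * \int[mu]_x `|Psi x - g x|)).
  rewrite -intZ; last exact/itg_norm/itgB.
  apply: int_norm_le => //; first exact/itgZ/itg_norm/itgB.
  by move=> x; rewrite normrM mulrC ler_wpM2r.
by rewrite mulrC -ltr_pdivlMr.
Qed.

End duality.

(** * Mollification *)

Section taylor.
Context (R : realType) (n : nat).
Local Notation V := 'rV[R]_n.+1.
Local Notation e_ j := (delta_mx ord0 j : V).
Implicit Types (f g h : V -> R) (G : 'I_n.+1 -> V -> R).

(** Here [G] plays the gradient of [h]. The quadratic remainder, uniform in [x], survives
    convolution and composition with Lipschitz maps, and takes the place of differentiability
    wherever smooth functions are used. *)
Definition taylor C h G := forall x v : V,
  `|h (x + v) - h x - \sum_j v ord0 j * G j x| <= C * enorm v ^+ 2.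

Lemma taylor_delta C h G j x s : taylor C h G ->
  `|h (x + s *: e_ j) - h x - s * G j x| <= C * s ^+ 2.
Proof.
move=> /(_ x (s *: e_ j)); rewrite enormZ enorm_delta mulr1 real_normK ?num_real//.
rewrite (bigD1 j)//= !mxE !eqxx/= mulr1 big1 ?addr0// => i ij.
by rewrite !mxE eqxx (negbTE ij) mulr0 mul0r.
Qed.

Lemma taylor_dq C h G j x s : taylor C h G -> s != 0 -> `|dq h j x s - G j x| <= C * `|s|.
Proof.
move=> H s0; rewrite -(ler_pM2l (_ : 0 < `|s|)) ?normr_gt0// -normrM mulrBr /dq mulVKf//.
by rewrite (le_trans (taylor_delta j x s H))// [leRHS]mulrCA -expr2 real_normK ?num_real.
Qed.

Lemma taylor_cvg C h G j x : taylor C h G -> dq h j x s @[s --> 0^'] --> G j x.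
Proof.
move=> H; apply/cvgrPdist_lt => e e0.
have C1 : 0 < `|C| + 1 by rewrite ltr_wpDl.
near=> s; have s0 : s != 0 by near: s; exact: nbhs_dnbhs_neq.
rewrite distrC (le_lt_trans (taylor_dq j x H s0))//.
apply: (@le_lt_trans _ _ ((`|C| + 1) * `|s|)).
  by rewrite ler_wpM2r// (le_trans (ler_norm _))// lerDl.
rewrite mulrC -ltr_pdivlMr//; near: s; apply: dnbhs0_lt; exact: divr_gt0.
Unshelve. all: by end_near. Qed.

Lemma taylor_dble C h G : taylor C h G -> forall j x, derivable h x (e_ j).
Proof. by move=> H j x; apply/derivable_dq; apply/cvg_ex; exists (G j x); exact: taylor_cvg H. Qed.

Lemma taylor_pd C h G j : taylor C h G -> pd j h = G j.
Proof. by move=> H; apply/funext => x; rewrite pd_dq; exact: (cvg_lim (@Rhausdorff R) (taylor_cvg H)). Qed.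

Lemma taylor_shift C h G (a : V) : taylor C h G -> taylor C (fun y => h (y + a)) (fun j y => G j (y + a)).
Proof. by move=> H x v; have := H (x + a) v; rewrite (addrAC x a v). Qed.

End taylor.

Section kernel.
Context (R : realType) (n : nat).
Local Notation V := 'rV[R]_n.+1.
Local Notation T := 'rV[measurableTypeR R]_n.+1.
Local Notation mu := (lebesgue_rV R n.+1).
Local Notation e_ j := (delta_mx ord0 j : V).

Definition pos (t : R) : R := Num.max 0 t.

Lemma pos_ge0 t : 0 <= pos t. Proof. by rewrite /pos le_max lexx. Qed.

Lemma pos_sqr_taylor t s : `|pos (t + s) ^+ 2 - pos t ^+ 2 - 2 * pos t * s| <= s ^+ 2.
Proof.
rewrite /pos; case: (leP 0 (t + s)) => h1; case: (leP 0 t) => h2; rewrite ler_norml; apply/andP; split; nra.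
Qed.

Definition dotv (v w : V) : R := \sum_j v ord0 j * w ord0 j.

Lemma enorm_sqrD (x v : V) : enorm (x + v) ^+ 2 = enorm x ^+ 2 + 2 * dotv v x + enorm v ^+ 2.
Proof.
rewrite !enorm_sqr /dotv mulr_sumr -!big_split/=; apply: eq_bigr => i _; rewrite mxE; ring.
Qed.

Lemma dotv_le (v w : V) : `|dotv v w| <= enorm v * enorm w.
Proof.
rewrite -[leRHS]ger0_norm ?mulr_ge0 ?enorm_ge0// -ler_sqr ?nnegrE//.
by rewrite !real_normK ?num_real// exprMn; exact: cauchy_schwarz_sum.
Qed.

Variable e : R.
Hypothesis e0 : 0 < e.
Let e00 : 0 <= e := ltW e0.

(** The square of the positive part is of class [C^{1,1}], which is all that a mollifier has to
    provide here, and keeps its constants explicit. *)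
Definition bump (x : V) : R := pos (e ^+ 2 - enorm x ^+ 2) ^+ 2.

Definition dbump (j : 'I_n.+1) (x : V) : R := - (4 * pos (e ^+ 2 - enorm x ^+ 2)) * x ord0 j.

Lemma pos_csup : csup e (fun x : V => pos (e ^+ 2 - enorm x ^+ 2)).
Proof. by move=> x xe; apply/max_idPl; rewrite subr_le0 ler_sqr ?nnegrE ?enorm_ge0 ?ltW. Qed.

Lemma pos_le (x : V) : pos (e ^+ 2 - enorm x ^+ 2) <= e ^+ 2.
Proof. by rewrite /pos ge_max sqr_ge0 lerBlDr lerDl sqr_ge0. Qed.

Lemma bump_csup : csup e bump.
Proof. by move=> x xe; rewrite /bump pos_csup// expr0n. Qed.

Lemma dbump_csup j : csup e (dbump j).
Proof. by move=> x xe; rewrite /dbump pos_csup// mulr0 oppr0 mul0r. Qed.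

(** For [|v| > e] crude bounds suffice. For [|v| <= e] and [|x| > 2 e] all terms vanish. In the
    remaining case [pos_sqr_taylor] gives [25 e^2 |v|^2], the square [enorm v ^+ 2] inside the
    argument costs 2 more, and 30 leaves slack. *)
Lemma bump_taylor : taylor (30 * e ^+ 2) bump dbump.
Proof.
move=> x v.
have -> : \sum_j v ord0 j * dbump j x = - 4 * pos (e ^+ 2 - enorm x ^+ 2) * dotv v x.
  by rewrite /dotv mulr_sumr; apply: eq_bigr => j _; rewrite /dbump; ring.
have dv := dotv_le v x; have x0 := enorm_ge0 x; have v0 := enorm_ge0 v.
have p0 := pos_ge0 (e ^+ 2 - enorm x ^+ 2); have p1 := pos_le x.
have [vs|vl] := leP (enorm v) e; last first.
  have b1 z : 0 <= bump z <= e ^+ 4.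
    by rewrite /bump sqr_ge0/= (_ : e ^+ 4 = (e ^+ 2) ^+ 2); [rewrite ler_sqr ?nnegrE ?sqr_ge0 ?pos_ge0 ?pos_le|rewrite -exprM].
  have bb : `|bump (x + v) - bump x| <= e ^+ 4.
    by have /andP[? ?] := b1 x; have /andP[? ?] := b1 (x + v); rewrite ler_norml; apply/andP; split; lra.
  have e4 : e ^+ 4 <= e ^+ 2 * enorm v ^+ 2.
    by rewrite (_ : e ^+ 4 = e ^+ 2 * e ^+ 2); [rewrite ler_wpM2l ?sqr_ge0// ler_sqr ?nnegrE// ltW|rewrite -exprD].
  have pd : `|- 4 * pos (e ^+ 2 - enorm x ^+ 2) * dotv v x| <= 4 * (e ^+ 2 * enorm v ^+ 2).
    have n4 : `|4 : R| = 4 by rewrite ger0_norm.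
    rewrite normrM normrM normrN (ger0_norm p0) n4.
    have [xe|xe] := leP (enorm x) e; last by rewrite pos_csup// mulr0 mul0r !mulr_ge0 ?sqr_ge0.
    rewrite -mulrA ler_wpM2l//; apply: ler_pM => //; apply: (le_trans dv).
    by rewrite expr2 ler_wpM2l// (le_trans xe)// ltW.
  rewrite (le_trans (ler_normB _ _))//; have : 0 <= e ^+ 2 * enorm v ^+ 2 by rewrite mulr_ge0 ?sqr_ge0.
  have -> : 30 * e ^+ 2 * enorm v ^+ 2 = 30 * (e ^+ 2 * enorm v ^+ 2) by ring.
  move: (`|bump _ - _|) (`| _ * dotv v x|) bb pd => a b; move: (e ^+ 4) (e ^+ 2 * _) e4 => c d; lra.
have [xs|xl] := leP (enorm x) (2 * e); last first.
  have xv : e < enorm (x + v).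
    have := enormD (x + v) (- v); rewrite enormN addrK; lra.
  rewrite (bump_csup xv) (bump_csup (_ : e < enorm x)); last by lra.
  by rewrite pos_csup ?mulr0 ?mul0r ?subrr ?normr0 ?mulr_ge0 ?sqr_ge0//; lra.
have := pos_sqr_taylor (e ^+ 2 - enorm x ^+ 2) (- (2 * dotv v x + enorm v ^+ 2)).
rewrite /bump enorm_sqrD.
have -> : e ^+ 2 - (enorm x ^+ 2 + 2 * dotv v x + enorm v ^+ 2) =
   e ^+ 2 - enorm x ^+ 2 + - (2 * dotv v x + enorm v ^+ 2) by ring.
set P := pos (_ + _); set p := pos (_ - _) in p0 p1 *.
have -> : P ^+ 2 - p ^+ 2 - 2 * p * - (2 * dotv v x + enorm v ^+ 2) =
  (P ^+ 2 - p ^+ 2 - -4 * p * dotv v x) + 2 * p * enorm v ^+ 2 by ring.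
set Q := _ - _ - _ => H.
have s2 : (- (2 * dotv v x + enorm v ^+ 2)) ^+ 2 <= 25 * (e ^+ 2 * enorm v ^+ 2).
  have -> : 25 * (e ^+ 2 * enorm v ^+ 2) = (5 * e * enorm v) ^+ 2 by ring.
  rewrite sqrrN -[leLHS]real_normK ?num_real// ler_sqr ?nnegrE ?mulr_ge0//.
  have d4 : `|dotv v x| <= enorm v * (2 * e) by rewrite (le_trans dv)// ler_wpM2l.
  have v2 : enorm v ^+ 2 <= enorm v * e by rewrite expr2 ler_wpM2l.
  rewrite (le_trans (ler_normD _ _))// normrM (ger0_norm (sqr_ge0 (enorm v))) ger0_norm//.
  by nra.
have pv : 0 <= 2 * p * enorm v ^+ 2 <= 2 * (e ^+ 2 * enorm v ^+ 2).
  by rewrite !mulr_ge0 ?sqr_ge0//= -mulrA ler_wpM2l// ler_wpM2r// sqr_ge0.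
have -> : 30 * e ^+ 2 * enorm v ^+ 2 = 30 * (e ^+ 2 * enorm v ^+ 2) by ring.
move: (2 * p * _) (e ^+ 2 * _) pv s2 H => a b /andP[a0 a1] s2; rewrite !ler_norml => /andP[h1 h2].
by apply/andP; split; lra.
Qed.

Lemma pos_lip : exists2 L, 0 <= L & lip L (fun x : V => pos (e ^+ 2 - enorm x ^+ 2)).
Proof.
have le : lip 1 (@enorm R n.+1).
  by move=> x y; rewrite mul1r; have := @enorm_lip R n.+1 x y.
have pl : lip 1 (fun x : V => pos (e - enorm x)).
  by apply: lip_max; have := lipB (lip_cst e) le; rewrite add0r.
have pc : csup e (fun x : V => pos (e - enorm x)).
  by move=> x xe; apply/max_idPl; rewrite subr_le0 ltW.
have [L L0 HL] := lip_mul_csup (lipD (lip_cst e) le) pl pc.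
exists L => //; move: HL; congr lip; apply/funext => x.
have -> : e ^+ 2 - enorm x ^+ 2 = (e + enorm x) * (e - enorm x) by ring.
have ex : 0 < e + enorm x by rewrite ltr_wpDr ?enorm_ge0.
by rewrite /pos !maxEle pmulr_rge0//; case: ifP => // _; rewrite mulr0.
Qed.

Lemma bump_lip : exists2 L, 0 <= L & lip L bump.
Proof. by have [L L0 H] := pos_lip; have := lip_mul_csup H H pos_csup. Qed.

Lemma dbump_lip j : exists2 L, 0 <= L & lip L (dbump j).
Proof.
have [L L0 H] := pos_lip; have [M M0 HM] := lip_mul_csup (@lip_coor R n.+1 j) H pos_csup.
exists (`|-4| * M); first by rewrite mulr_ge0.
have := lipZ (-4) HM; congr lip; apply/funext => x; rewrite /dbump; ring.
Qed.

Definition bumpc : R := \int[mu]_x bump x.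

Lemma bump_itg : itg mu (bump : T -> R).
Proof. by have [L L0 H] := bump_lip; exact: itg_lip_csup H bump_csup. Qed.

Lemma int_cube r : 0 <= r -> \int[mu]_x (\1_(cube r : set T) x : R) = (2 * r) ^+ n.+1.
Proof.
move=> r0; rewrite /Rintegral integral_indic ?setIT//; last exact: measurable_cube.
transitivity (fine (((2 * r) ^+ n.+1)%:E : \bar R)) => //; congr fine; exact: mu_cube.
Qed.

(** A cube of side [e / (n + 1)] lies in the ball of radius [e / 2], on which the bump is at least
    [(3/4 e^2)^2]. *)
Lemma bumpc_ge : 9 / 16 * e ^+ 4 * (e / n.+1%:R) ^+ n.+1 <= bumpc.
Proof.
pose r := e / (2 * n.+1%:R); have r0 : 0 <= r by rewrite divr_ge0// ltW.
have N0 : n.+1%:R != 0 :> R by rewrite pnatr_eq0.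
have -> : e / n.+1%:R = 2 * r by rewrite /r; move: N0; generalize (n.+1%:R : R) => N N0; field.
rewrite -int_cube// -intZ; last exact: itg_cube.
apply: int_le => [||x]; [exact/itgZ/itg_cube|exact: bump_itg|].
rewrite indicE; have [xr|xr] := boolP (x \in _); last by rewrite mulr0 sqr_ge0.
have /cubeE/enorm_le_cube : cube r x by move: xr; rewrite inE.
have -> : n.+1%:R * r = e / 2 by rewrite /r invfM mulrC -!mulrA mulVf// mulr1.
move=> xe; rewrite mulr1 /bump.
have -> : 9 / 16 * e ^+ 4 = (3 / 4 * e ^+ 2) ^+ 2 by field.
rewrite ler_sqr ?nnegrE ?pos_ge0 ?mulr_ge0 ?sqr_ge0//.
rewrite /pos le_max; apply/orP; right.
have : enorm x ^+ 2 <= (e / 2) ^+ 2 by rewrite ler_sqr ?nnegrE ?enorm_ge0// divr_ge0.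
by rewrite expr_div_n; lra.
Qed.

Lemma bumpc_gt0 : 0 < bumpc.
Proof. by apply: lt_le_trans bumpc_ge; rewrite !mulr_gt0 ?exprn_gt0 ?divr_gt0. Qed.

Lemma dbump_itg j : itg mu (dbump j : T -> R).
Proof. by have [L L0 H] := dbump_lip j; exact: itg_lip_csup H (@dbump_csup j). Qed.

Lemma int_dbump j : \int[mu]_x `|dbump j x| <= 4 * e ^+ 3 * (2 * e) ^+ n.+1.
Proof.
rewrite -(int_cube (ltW e0)) -intZ; last exact: itg_cube.
apply: int_le => [||x]; [exact/itg_norm/dbump_itg|exact/itgZ/itg_cube|].
have [xe|xe] := leP (enorm x) e; last first.
  rewrite dbump_csup// normr0; apply: mulr_ge0; last by rewrite indicE ler0n.
  by rewrite mulr_ge0// exprn_ge0// ltW.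
rewrite indicE mem_set ?mulr1; last exact: cube_ball.
have n4 : `|4 : R| = 4 by rewrite ger0_norm.
rewrite /dbump normrM normrN normrM n4 (ger0_norm (pos_ge0 _)) -!mulrA ler_wpM2l// [e ^+ 3]exprSr.
by apply: ler_pM => //; [exact: pos_ge0|exact: pos_le|exact: le_trans (coor_le _ _) xe].
Qed.

Definition mol (x : V) : R := bumpc^-1 * bump x.

Definition dmol (j : 'I_n.+1) (x : V) : R := bumpc^-1 * dbump j x.

(** Dividing the bound of [int_dbump] by that of [bumpc_ge] gives [64/9] in front, rounded up to
    8. *)
Definition molK : R := 8 * (2 * n.+1%:R) ^+ n.+1.

Lemma int_dmol j : \int[mu]_x `|dmol j x| <= molK / e.
Proof.
have -> : \int[mu]_x `|dmol j x| = bumpc^-1 * \int[mu]_x `|dbump j x|.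
  rewrite -intZ; last exact/itg_norm/dbump_itg.
  by apply: eq_Rintegral => x _; rewrite /dmol normrM ger0_norm// invr_ge0 ltW// bumpc_gt0.
rewrite ler_pdivrMl ?bumpc_gt0// (le_trans (int_dbump j))//.
apply: (le_trans _ (ler_wpM2r _ bumpc_ge)); last by rewrite /molK divr_ge0 ?mulr_ge0 ?exprn_ge0 ?ltW// mulr_ge0.
have -> : 9 / 16 * e ^+ 4 * (e / n.+1%:R) ^+ n.+1 * (molK / e) = 9 / 2 * e ^+ 3 * (2 * e) ^+ n.+1.
  rewrite /molK !exprMn exprVn; field.
  by rewrite (gt_eqF e0) expf_neq0// pnatr_eq0.
by rewrite !ler_wpM2r ?exprn_ge0 ?mulr_ge0 ?ltW//; lra.
Qed.

Lemma mol_ge0 x : 0 <= mol x.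
Proof. by have c0 := ltW bumpc_gt0; rewrite mulr_ge0 ?sqr_ge0 ?invr_ge0. Qed.

Lemma molN x : mol (- x) = mol x.
Proof. by rewrite /mol /bump enormN. Qed.

Lemma mol_csup : csup e mol. Proof. exact: csupMr bump_csup. Qed.
Lemma dmol_csup j : csup e (dmol j). Proof. exact/csupMr/dbump_csup. Qed.

Lemma mol_itg : itg mu (mol : T -> R). Proof. exact/itgZ/bump_itg. Qed.
Lemma dmol_itg j : itg mu (dmol j : T -> R). Proof. exact/itgZ/dbump_itg. Qed.

Lemma int_mol : \int[mu]_x mol x = 1.
Proof. rewrite intZ; last exact: bump_itg.
by rewrite mulVf// gt_eqF// bumpc_gt0. Qed.

Lemma mol_lip : exists2 L, 0 <= L & lip L mol.
Proof.
have [L L0 H] := bump_lip; exists (`|bumpc^-1| * L); first by rewrite mulr_ge0.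
exact: lipZ.
Qed.

Lemma dmol_lip : exists2 L, 0 <= L & forall j, lip L (dmol j).
Proof.
have H j := cid2 (dbump_lip j).
exists (\sum_j (`|bumpc^-1| * s2val (H j))).
  by apply: sumr_ge0 => j _; rewrite mulr_ge0// (s2valP (H j)).
move=> j; apply: lipW (lipZ _ (s2valP' (H j))).
by rewrite (bigD1 j)//= lerDl sumr_ge0// => i _; rewrite mulr_ge0// (s2valP (H i)).
Qed.

Lemma mol_taylor : exists2 C, 0 <= C & taylor C mol dmol.
Proof.
exists (`|bumpc^-1| * (30 * e ^+ 2)); first by apply: mulr_ge0 => //; apply: mulr_ge0; [exact: ler0n|exact: sqr_ge0].
move=> x v; have := bump_taylor x v => /(ler_wpM2l (normr_ge0 bumpc^-1)).
rewrite -normrM mulrA; apply: le_trans; rewrite le_eqVlt; apply/orP; left; apply/eqP; congr `|_|.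
rewrite /mol !mulrBr; congr (_ - _); rewrite mulr_sumr; apply: eq_bigr => j _.
by rewrite /dmol mulrCA.
Qed.

End kernel.

Section conv.
Context (R : realType) (n : nat).
Local Notation V := 'rV[R]_n.+1.
Local Notation T := 'rV[measurableTypeR R]_n.+1.
Local Notation mu := (lebesgue_rV R n.+1).
Local Notation e_ j := (delta_mx ord0 j : V).
Implicit Types (f g h : V -> R).

(* [convk K g x] is the convolution of [g] with the reflection of [K]. *)
Definition convk (K g : V -> R) (x : V) : R := \int[mu]_y (K ((y : V) - x) * g y).

Lemma shift_mble K (x : V) : mble (K : T -> R) -> mble (fun y : T => K ((y : V) - x)).
Proof. by move=> mK; exact: (measurableT_comp mK (measurable_rVshift (- x))). Qed.

Lemma convk_itg K g (x : V) C : mble (K : T -> R) -> (forall y, `|K y| <= C) -> itg mu (g : T -> R) ->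
  itg mu (fun y : T => K ((y : V) - x) * g y).
Proof.
move=> mK KC gi; under [X in itg _ X]eq_fun do rewrite mulrC.
by apply: (itgMb gi (shift_mble x mK)) => y; exact: KC.
Qed.

Lemma convk_shift K g (x : V) C : mble (K : T -> R) -> (forall y, `|K y| <= C) -> itg mu (g : T -> R) ->
  itg mu (fun z : T => K z * g (x + (z : V))) /\ convk K g x = \int[mu]_z (K z * g (x + (z : V))).
Proof.
move=> mK KC gi; have := int_rVshift x (convk_itg x mK KC gi).
have -> : ((fun y : T => K ((y : V) - x) * g y) \o rVshift x) = (fun z : T => K z * g (x + (z : V))).
  by apply/funext => z; rewrite /= /rVshift addrK [z + x]addrC.
move=> [i1 i2]; split=> //; rewrite /convk -i2; apply: eq_Rintegral => z _.
by rewrite /rVshift addrK [_ + x]addrC.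
Qed.

Lemma convk_sup K g C D : itg mu (K : T -> R) -> (forall y, `|K y| <= C) -> itg mu (g : T -> R) ->
  (forall x, `|g x| <= D) -> forall x, `|convk K g x| <= D * \int[mu]_y `|K y|.
Proof.
move=> Ki KC gi gD x; have [i1 ->] := convk_shift x (itg_mble Ki) KC gi.
rewrite -intZ; last exact: itg_norm.
apply: int_norm_le => //; first exact/itgZ/itg_norm.
by move=> z; rewrite normrM mulrC ler_wpM2r.
Qed.

Lemma convk_csup K g r e : csup e K -> csup r g -> csup (r + e) (convk K g).
Proof.
move=> Ke gr x xr; rewrite /convk -[RHS](@int0 _ _ _ mu); apply: eq_Rintegral => y _.
have [ye|ye] := leP (enorm ((y : V) - x)) e; last by rewrite Ke ?mul0r.
rewrite [g y]gr ?mulr0//; have := enormD ((x : V) - y) y; rewrite subrK enormB; lra.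
Qed.

(** The kernel is evaluated at [y - x], which explains the sign in front of [dK]. The quadratic
    remainder is integrated against [|g|], whence the new constant. *)
Lemma convk_taylor C K dK g : itg mu (g : T -> R) -> taylor C K dK ->
  mble (K : T -> R) -> (forall j, mble (dK j : T -> R)) ->
  (forall x, `|K x| <= C) -> (forall j x, `|dK j x| <= C) ->
  taylor (C * \int[mu]_y `|g y|) (convk K g) (fun j => convk (fun z => - dK j z) g).
Proof.
move=> gi Kt mK mdK KC dKC x v.
have i1 := convk_itg (x + v) mK KC gi; have i2 := convk_itg x mK KC gi.
have mN j : mble (fun y : T => - dK j y : R) by exact: (measurableT_comp (@oppr_measurable R setT) (mdK j)).
have NC j y : `|- dK j y| <= C by rewrite normrN.
have i3 j := convk_itg x (mN j) (NC j) gi.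
have i4 : itg mu (fun y : T => \sum_j v ord0 j * (- dK j ((y : V) - x) * g y)).
  by apply: itg_sum => j _; exact: itgZ.
have -> : \sum_j v ord0 j * convk (fun z => - dK j z) g x =
   \int[mu]_y (\sum_j v ord0 j * (- dK j ((y : V) - x) * g y)).
  by rewrite int_sum => [|j _]; [apply: eq_bigr => j _; rewrite intZ|exact: itgZ].
rewrite /convk -(intB i1 i2) -(intB (itgB i1 i2) i4).
have -> : C * \int[mu]_y `|g y| * enorm v ^+ 2 = \int[mu]_y (C * enorm v ^+ 2 * `|g y|).
  by rewrite intZ 1?mulrAC//; exact: itg_norm.
apply: int_norm_le => [||y].
- by apply: itgB => //; exact: itgB.
- exact/itgZ/itg_norm.
have -> : K ((y : V) - (x + v)) * g y - K ((y : V) - x) * g y -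
    \sum_j v ord0 j * (- dK j ((y : V) - x) * g y) =
    (K (((y : V) - x) + - v) - K ((y : V) - x) - \sum_j (- v) ord0 j * dK j ((y : V) - x)) * g y.
  rewrite !mulrBl opprD addrA; congr (_ - _); rewrite mulr_suml; apply: eq_bigr => j _.
  by rewrite mxE; ring.
by rewrite normrM ler_wpM2r// -(enormN v).
Qed.

Lemma convk_lip L K g : itg mu (g : T -> R) -> lip L K -> mble (K : T -> R) -> (exists C, forall x, `|K x| <= C) ->
  lip (L * \int[mu]_y `|g y|) (convk K g).
Proof.
move=> gi KL mK [C KC] x x'.
have i1 := convk_itg x mK KC gi; have i2 := convk_itg x' mK KC gi.
rewrite /convk -intB// mulrAC -intZ; last exact: itg_norm.
apply: int_norm_le => [||y]; [exact: itgB|exact/itgZ/itg_norm|].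
rewrite -mulrBl normrM ler_wpM2r// (le_trans (KL _ _))//.
by rewrite opprB addrC addrA subrK -enormB.
Qed.

Lemma convk_selfadj K f g C : mble (K : T -> R) -> (forall x, `|K x| <= C) -> (forall x, K (- x) = K x) ->
  itg mu (f : T -> R) -> itg mu (g : T -> R) ->
  itg mu (fun x : T => convk K g x * f x) /\
  \int[mu]_x (convk K g x * f x) = \int[mu]_x (g x * convk K f x).
Proof.
move=> mK KC Ks fi gi.
pose h (p : T * T) := K ((p.2 : V) - p.1) * g p.2 * f p.1.
have md : measurable_fun setT (fun p : T * T => ((p.2 : V) - p.1 : T)).
  apply: measurable_fun_rV => i.
  rewrite (_ : (fun x => _) = (fun p : T * T => p.2 ord0 i - p.1 ord0 i)); last first.
    by apply/funext => p; rewrite !mxE.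
  by apply: measurable_funB; apply: (measurableT_comp (measurable_coor _)); [exact: measurable_snd|exact: measurable_fst].
have mh : mble h.
  apply: measurable_funM; first apply: measurable_funM.
  - exact: (measurableT_comp mK md).
  - exact: (measurableT_comp (itg_mble gi) measurable_snd).
  - exact: (measurableT_comp (itg_mble fi) measurable_fst).
have hd x y : `|h (x, y)| <= (C * `|f x|) * `|g y|.
  by rewrite /h/= !normrM mulrAC ler_wpM2r// ler_wpM2r.
have fi' := itgZ C (itg_norm fi); have gi' := itg_norm gi.
have e1 x : \int[mu]_y h (x, y) = convk K g x * f x.
  rewrite /h/= mulrC -intZ; last exact: convk_itg KC gi.
  by apply: eq_Rintegral => y _; rewrite mulrC.
have e2 y : \int[mu]_x h (x, y) = g y * convk K f y.
  rewrite /h/= -intZ; last exact: convk_itg KC fi.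
  by apply: eq_Rintegral => x _; rewrite -(Ks (x - y)) opprB mulrCA mulrA.
split.
  have := dom_itg_fubini1 mh hd fi' gi'; congr (itg _ _).
  by apply/funext => x; exact: e1.
transitivity (\int[mu]_x \int[mu]_y h (x, y)); first by apply: eq_Rintegral => x _; rewrite e1.
by rewrite (dom_fubini mh hd fi' gi'); apply: eq_Rintegral => y _; rewrite e2.
Qed.

End conv.

Section mollify.
Context (R : realType) (n : nat).
Local Notation V := 'rV[R]_n.+1.
Local Notation T := 'rV[measurableTypeR R]_n.+1.
Local Notation mu := (lebesgue_rV R n.+1).
Implicit Types (f g h : V -> R).

Definition cv (e : R) (g : V -> R) : V -> R := convk (mol e) g.
Definition dcv (e : R) (g : V -> R) (j : 'I_n.+1) : V -> R := convk (fun z => - dmol e j z) g.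

Variable e : R.
Hypothesis e0 : 0 < e.

Lemma mol_bounded : exists2 C, 0 <= C & (forall x : V, `|mol e x| <= C) /\ (forall j (x : V), `|dmol e j x| <= C).
Proof.
have [L L0 HL] := @mol_lip R n e e0; have [M M0 HM] := @dmol_lip R n e e0.
have [C C0 HC] := lip_csup_bounded HL (@mol_csup R n e e0).
have H j := cid2 (lip_csup_bounded (HM j) (@dmol_csup R n e e0 j)).
exists (C + \sum_j s2val (H j)); first by apply: addr_ge0 => //; apply: sumr_ge0 => j _; exact: (s2valP (H j)).
split=> [x|j x]; first by rewrite (le_trans (HC x))// lerDl; apply: sumr_ge0 => j _; exact: (s2valP (H j)).
rewrite (le_trans (s2valP' (H j) x))// (bigD1 j)//= ler_wpDl// lerDl.
by apply: sumr_ge0 => i _; exact: (s2valP (H i)).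
Qed.

Lemma mol_mble : mble (mol e : T -> R).
Proof. exact: (itg_mble (@mol_itg R n e e0)). Qed.

Lemma dmol_mble j : mble (dmol e j : T -> R).
Proof. exact: (itg_mble (@dmol_itg R n e e0 j)). Qed.

Lemma cv_taylor g : itg mu (g : T -> R) -> exists2 C, 0 <= C & taylor C (cv e g) (dcv e g).
Proof.
move=> gi; have [C C0 [KC dKC]] := mol_bounded; have [D D0 KD] := @mol_taylor R n e e0.
exists (Num.max C D * \int[mu]_y `|g y|); first by rewrite mulr_ge0 ?int_ge0// le_max C0.
apply: convk_taylor => //.
- by move=> x v; rewrite (le_trans (KD x v))// ler_wpM2r ?sqr_ge0// le_max lexx orbT.
- exact: mol_mble.
- exact: dmol_mble.
- by move=> x; rewrite (le_trans (KC x))// le_max lexx.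
- by move=> j x; rewrite (le_trans (dKC j x))// le_max lexx.
Qed.

Lemma cv_pd g j : itg mu (g : T -> R) -> pd j (cv e g) = dcv e g j.
Proof. by move=> gi; have [C _ H] := cv_taylor gi; exact: taylor_pd H. Qed.

Lemma dcv_lip g : itg mu (g : T -> R) -> exists2 L, 0 <= L & forall j, lip L (dcv e g j).
Proof.
move=> gi; have [C C0 [_ KC]] := mol_bounded; have [L L0 KL] := @dmol_lip R n e e0.
exists (L * \int[mu]_y `|g y|); first by rewrite mulr_ge0 ?int_ge0.
move=> j; apply: convk_lip => //.
- exact/lipN.
- exact: (measurableT_comp (@oppr_measurable R setT) (dmol_mble j)).
- by exists C => x; rewrite normrN.
Qed.

Lemma cv_lip g : itg mu (g : T -> R) -> exists2 L, 0 <= L & lip L (cv e g).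
Proof.
move=> gi; have [C C0 [KC _]] := mol_bounded; have [L L0 KL] := @mol_lip R n e e0.
exists (L * \int[mu]_y `|g y|); first by rewrite mulr_ge0 ?int_ge0.
by apply: convk_lip => //; [exact: mol_mble|exists C].
Qed.

Lemma cv_csup r g : csup r g -> csup (r + e) (cv e g).
Proof. exact/convk_csup/mol_csup. Qed.

Lemma cv_shift g x : itg mu (g : T -> R) ->
  itg mu (fun z : T => mol e z * g (x + (z : V))) /\ cv e g x = \int[mu]_z (mol e z * g (x + (z : V))).
Proof.
by move=> gi; have [C C0 [KC _]] := mol_bounded; exact: (convk_shift x mol_mble KC gi).
Qed.

Lemma mol_avg (F G : V -> R) w : itg mu (fun z : T => mol e z * F z) -> itg mu (fun z : T => mol e z * G z) ->
  (forall z, enorm z <= e -> `|F z - G z| <= w) ->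
  `|\int[mu]_z (mol e z * F z) - \int[mu]_z (mol e z * G z)| <= w.
Proof.
move=> iF iG FG; rewrite -(intB iF iG).
have mi := @mol_itg R n e e0.
rewrite -[w]mulr1 -(int_mol n e0) -intZ//.
apply: int_norm_le => [||z]; [exact: itgB|exact: itgZ|].
rewrite -mulrBr normrM mulrC (ger0_norm (mol_ge0 e0 z)).
have [ze|ze] := leP (enorm (z : V)) e; last by rewrite mol_csup// !mulr0.
by rewrite ler_wpM2r ?mol_ge0// FG.
Qed.

Lemma cv_close g x w : itg mu (g : T -> R) ->
  (forall z, enorm z <= e -> `|g (x + z) - g x| <= w) -> `|cv e g x - g x| <= w.
Proof.
move=> gi H; have [i1 ->] := cv_shift x gi.
have ic : itg mu (fun z : T => mol e z * g x).
  by under [X in itg _ X]eq_fun do rewrite mulrC; exact/itgZ/mol_itg.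
have -> : g x = \int[mu]_z (mol e z * g x).
  under eq_Rintegral do rewrite mulrC.
  by rewrite intZ ?int_mol ?mulr1//; exact: mol_itg.
exact: mol_avg.
Qed.

Lemma cv_diff g x y w : itg mu (g : T -> R) ->
  (forall z, `|g (x + z) - g (y + z)| <= w) -> `|cv e g x - cv e g y| <= w.
Proof.
move=> gi H; have [i1 ->] := cv_shift x gi; have [i2 ->] := cv_shift y gi.
exact: mol_avg.
Qed.

Lemma cv_lipL L g : itg mu (g : T -> R) -> lip L g -> lip L (cv e g).
Proof.
move=> gi gL x y; apply: cv_diff => // z.
by rewrite (le_trans (gL _ _))// opprD addrACA subrr addr0.
Qed.

Lemma cv_sup g D : itg mu (g : T -> R) -> (forall x, `|g x| <= D) -> forall x, `|cv e g x| <= D.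
Proof.
move=> gi gD x; have [C C0 [KC _]] := mol_bounded.
rewrite (le_trans (convk_sup (@mol_itg R n e e0) KC gi gD x))//.
rewrite (_ : \int[mu]_y _ = 1) ?mulr1// -(int_mol n e0).
by apply: eq_Rintegral => y _; rewrite ger0_norm// mol_ge0.
Qed.

Lemma dcv_sup g D j : itg mu (g : T -> R) -> (forall x, `|g x| <= D) -> forall x, `|dcv e g j x| <= D * (molK R n / e).
Proof.
move=> gi gD x; have [C C0 [_ KC]] := mol_bounded.
have D0 : 0 <= D by rewrite (le_trans _ (gD 0)).
have KC' y : `|- dmol e j y| <= C by rewrite normrN.
rewrite (le_trans (convk_sup (itgN (@dmol_itg R n e e0 j)) KC' gi gD x))//.
rewrite ler_wpM2l// (le_trans _ (@int_dmol R n e e0 j))//.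
by under eq_Rintegral do rewrite normrN.
Qed.

Lemma cv_selfadj f g : itg mu (f : T -> R) -> itg mu (g : T -> R) ->
  itg mu (fun x : T => cv e g x * f x) /\
  \int[mu]_x (cv e g x * f x) = \int[mu]_x (g x * cv e f x).
Proof.
move=> fi gi; have [C C0 [KC _]] := mol_bounded.
by apply: convk_selfadj fi gi; [exact: mol_mble|exact: KC|exact: molN].
Qed.

Lemma cv_pd_lip L r f j : lip L f -> csup r f -> pd j (cv e f) = cv e (pd j f).
Proof.
move=> fL fr; have fi := itg_lip_csup fL fr; rewrite cv_pd//; apply/funext => x.
have [M M0 mL] := @mol_lip R n e e0.
pose K y := mol e (y - x).
have KL : lip M K by exact: lip_shift.
have [C C0 mt] := @mol_taylor R n e e0.
have dK y : pd j K y = dmol e j (y - x).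
  have Kt : taylor C K (fun j y => dmol e j (y - x)) by exact: (taylor_shift (- x) mt).
  by rewrite (taylor_pd j Kt).
rewrite /dcv /cv /convk -[RHS]opprK -(ibp1 j KL fL fr) -intN.
  by apply: eq_Rintegral => y _; rewrite dK mulNr.
exact: itg_pd_mul KL fL fr.
Qed.

Lemma itg_cv r g : itg mu (g : T -> R) -> csup r g -> itg mu (cv e g : T -> R).
Proof.
by move=> gi gr; have [L _ gL] := cv_lip gi; exact: itg_lip_csup gL (cv_csup gr).
Qed.

(** The kernel is even, so duality moves the mollification onto the test function, whose sup norm
    does not increase. *)
Lemma cv_L1 r g : itg mu (g : T -> R) -> csup r g -> \int[mu]_x `|cv e g x| <= \int[mu]_x `|g x|.
Proof.
move=> gi gr; apply: L1_dual; first exact: itg_cv gr.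
move=> L r' f fL fr' f1; have fi := itg_lip_csup fL fr'.
have [_ ->] := cv_selfadj fi gi.
have c1 := cv_sup fi f1.
have ig := itgMb gi (itg_mble (itg_cv fi fr')) c1.
apply: int_norm_le => //; first exact: itg_norm.
by move=> x; rewrite normrM -[leRHS]mulr1 ler_wpM2l.
Qed.

Lemma cvB f g : itg mu (f : T -> R) -> itg mu (g : T -> R) ->
  cv e (fun x => f x - g x) = fun x => cv e f x - cv e g x.
Proof.
move=> fi gi; apply/funext => x; have [C C0 [KC _]] := mol_bounded.
rewrite /cv /convk -(intB (convk_itg x mol_mble KC fi) (convk_itg x mol_mble KC gi)).
by apply: eq_Rintegral => y _; rewrite mulrBr.
Qed.

End mollify.

Section mollify_lim.
Context (R : realType) (n : nat).
Local Notation V := 'rV[R]_n.+1.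
Local Notation T := 'rV[measurableTypeR R]_n.+1.
Local Notation mu := (lebesgue_rV R n.+1).
Implicit Types (f g h : V -> R).

Lemma cv_L1_cvg r g eta : itg mu (g : T -> R) -> csup r g -> 0 < eta ->
  exists2 d, 0 < d & forall e, 0 < e -> e < d -> \int[mu]_x `|cv e g x - g x| < eta.
Proof.
move=> gi gr eta0; have eta3 : 0 < eta / 3 by rewrite divr_gt0.
have [L [s [g' [gL gs ge]]]] := lip_dense gi eta3.
have gi' := itg_lip_csup gL gs.
pose B := (2 * (`|s| + 1)) ^+ n.+1.
have B0 : 0 <= B by rewrite exprn_ge0// mulr_ge0// addr_ge0.
(* The Lipschitz approximant moves by at most [|L| e] under mollification, inside a cube of volume
   [B] as long as [e <= 1]. *)
pose d := Num.min 1 (eta / 3 / (`|L| * B + 1)).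
have q0 : 0 < `|L| * B + 1 by rewrite ltr_wpDl// mulr_ge0.
exists d; first by rewrite lt_min ltr01/= divr_gt0.
move=> e e0; rewrite lt_min => /andP[e1 e2].
have s1 : s + e <= `|s| + 1 by rewrite lerD ?ler_norm// ltW.
have ci := itg_cv e0 gi gr; have ci' := itg_cv e0 gi' gs.
have cw : csup (`|s| + 1) (fun x => cv e g' x - g' x).
  move=> x xs; rewrite (cv_csup e0 gs) ?(le_lt_trans s1)// gs ?subrr//.
  by apply: le_lt_trans xs; rewrite (le_trans (ler_norm s))// lerDl.
have b1 x : `|cv e g' x - g' x| <= `|L| * e.
  apply: cv_close => // z ze; rewrite (le_trans (gL _ _))// [x + z]addrC addrK.
  by rewrite (le_trans (ler_wpM2r (enorm_ge0 _) (ler_norm L)))// ler_wpM2l.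
have h1 : \int[mu]_x `|cv e g' x - g' x| < eta / 3.
  apply: (@le_lt_trans _ _ (\int[mu]_x (`|L| * e * \1_(cube (`|s| + 1) : set T) x))).
    apply: int_le => [||x]; [exact/itg_norm/itgB|exact/itgZ/itg_cube|].
    have [xs|xs] := leP (enorm (x : V)) (`|s| + 1).
      by rewrite indicE mem_set ?mulr1//; exact: cube_ball.
    rewrite cw// normr0; apply: mulr_ge0; last by rewrite indicE ler0n.
    by rewrite mulr_ge0// ltW.
  rewrite intZ; last exact: itg_cube.
  rewrite int_cube ?addr_ge0// -/B mulrAC.
  move: e2; rewrite ltr_pdivlMr// mulrC; apply: le_lt_trans.
  by rewrite (ler_wpM2r (ltW e0))// lerDl.
have h2 : \int[mu]_x `|cv e g x - cv e g' x| < eta / 3.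
  apply: le_lt_trans ge.
  have -> : (fun x => `|cv e g x - cv e g' x|) = fun x => `|cv e (fun y => g y - g' y) x|.
    by rewrite cvB.
  apply: (cv_L1 e0 (r := Num.max r s)); first exact: itgB.
  by move=> x; rewrite gt_max => /andP[xr xs]; rewrite gr// gs// subrr.
have h3 : \int[mu]_x `|g' x - g x| < eta / 3.
  by under eq_Rintegral do rewrite distrC.
have i2 := itg_norm (itgB ci ci'); have i1 := itg_norm (itgB ci' gi'); have i3 := itg_norm (itgB gi' gi).
apply: (@le_lt_trans _ _ (\int[mu]_x (`|cv e g x - cv e g' x| + `|cv e g' x - g' x| + `|g' x - g x|))).
  apply: int_le => [||x].
  - exact/itg_norm/itgB.
  - by apply: itgD => //; exact: itgD.
  - have -> : cv e g x - g x = (cv e g x - cv e g' x) + (cv e g' x - g' x) + (g' x - g x) by ring.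
    by rewrite (le_trans (ler_normD _ _))// lerD2r ler_normD.
have -> : eta = eta / 3 + eta / 3 + eta / 3 by field.
exact: int_add_lt (itgD i2 i1) i3 (int_add_lt i2 i1 h2 h1) h3.
Qed.

Lemma cv_comm e e' r g D : 0 < e -> 0 < e' -> itg mu (g : T -> R) -> csup r g -> (forall x, `|g x| <= D) ->
  cv e (cv e' g) = cv e' (cv e g).
Proof.
move=> e0 e'0 gi gr gD; apply/funext => x.
have [_ ->] := cv_shift e0 x (itg_cv e'0 gi gr).
have [_ ->] := cv_shift e'0 x (itg_cv e0 gi gr).
pose h (p : T * T) := mol e p.1 * (mol e' p.2 * g (x + (p.1 : V) + p.2)).
have ms : measurable_fun setT (fun p : T * T => (x + (p.1 : V) + p.2 : T)).
  apply: measurable_fun_rV => i.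
  rewrite (_ : (fun x => _) = (fun p : T * T => x ord0 i + p.1 ord0 i + p.2 ord0 i)); last first.
    by apply/funext => p; rewrite !mxE.
  apply: measurable_funD; last exact: (measurableT_comp (measurable_coor _) measurable_snd).
  by apply: measurable_funD => //; exact: (measurableT_comp (measurable_coor _) measurable_fst).
have mh : mble h.
  apply: measurable_funM; first exact: (measurableT_comp (itg_mble (@mol_itg R n e e0)) measurable_fst).
  apply: measurable_funM; first exact: (measurableT_comp (itg_mble (@mol_itg R n e' e'0)) measurable_snd).
  exact: (measurableT_comp (itg_mble gi) ms).
have hd (y z : T) : `|h (y, z)| <= D * mol e y * mol e' z.
  rewrite /h/= (normrM (mol e y)) (normrM (mol e' z)) (ger0_norm (mol_ge0 e0 _)) (ger0_norm (mol_ge0 e'0 _)).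
  have -> : D * mol e y * mol e' z = mol e y * (mol e' z * D) by ring.
  by apply: ler_wpM2l; [exact: mol_ge0|apply: ler_wpM2l; [exact: mol_ge0|]].
have i1 := itgZ D (@mol_itg R n e e0); have i2 := @mol_itg R n e' e'0.
transitivity (\int[mu]_y \int[mu]_z h (y, z)).
  apply: eq_Rintegral => y _; have [i3 ->] := cv_shift e'0 (x + (y : V)) gi.
  by rewrite /h/= intZ.
rewrite (dom_fubini mh hd i1 i2); apply: eq_Rintegral => z _.
have [i3 ->] := cv_shift e0 (x + (z : V)) gi.
rewrite -intZ//; apply: eq_Rintegral => y _; rewrite /h/= (addrAC x (y : V) z); exact: mulrCA.
Qed.

End mollify_lim.

(** * Jacobian determinants of Lipschitz maps *)

Section det_tools.
Context (R : realType).

Lemma cvg_seq_eq (u v : nat -> R) (l : R) : (forall k, u k = v k) -> u k @[k --> \oo] --> l -> v k @[k --> \oo] --> l.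
Proof. by move=> /funext ->. Qed.

Lemma cvg_seq_unique (u : nat -> R) (a b : R) : u k @[k --> \oo] --> a -> u k @[k --> \oo] --> b -> a = b.
Proof. by move=> ca cb; exact: (cvg_unique (@Rhausdorff R) ca cb). Qed.

Lemma cvg_seqN_unique (u v : nat -> R) (a b : R) : (forall k, v k = - u k) ->
  u k @[k --> \oo] --> a -> v k @[k --> \oo] --> b -> b = - a.
Proof. by move=> vu ca cb; apply: (cvg_seq_unique cb); apply: (cvg_seq_eq _ (cvgN ca)) => k; rewrite vu. Qed.

Lemma cvg_seqD0 (u v w : nat -> R) (l : R) : (forall k, u k + v k = w k) ->
  u k @[k --> \oo] --> (0 : R) -> v k @[k --> \oo] --> l -> w k @[k --> \oo] --> l.
Proof. by move=> uvw cu cv; rewrite -(add0r l); apply: (@cvg_seq_eq (fun k => u k + v k)) => //; exact: cvgD. Qed.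

Lemma norm_add_lt (a b e : R) : `|a| < e / 2 -> `|b| < e / 2 -> `|a + b| < e.
Proof. by move=> ae be; rewrite (le_lt_trans (ler_normD _ _))// (splitr e) ltrD. Qed.

Lemma cvg_seq0P (u : nat -> R) : u k @[k --> \oo] --> (0 : R) <->
  forall e, 0 < e -> \forall k \near \oo, `|u k| < e.
Proof.
split=> [/cvgrPdist_lt H e e0|H]; first by have := H _ e0; apply: filterS => k; rewrite sub0r normrN.
by apply/cvgrPdist_lt => e e0; have := H _ e0; apply: filterS => k; rewrite sub0r normrN.
Qed.

Lemma cvg_big_sum T (F : set_system T) {FF : Filter F} I (s : seq I) (u : I -> T -> R) (l : I -> R) :
  (forall i, u i k @[k --> F] --> l i) ->
  \sum_(i <- s) u i k @[k --> F] --> \sum_(i <- s) l i.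
Proof.
move=> H; elim: s => [|a s IH].
  by rewrite big_nil (_ : (fun k => _) = fun=> 0); [exact: cvg_cst|apply/funext => k; rewrite big_nil].
rewrite big_cons (_ : (fun k => _) = fun k => u a k + \sum_(i <- s) u i k).
  exact: cvgD (H a) IH.
by apply/funext => k; rewrite big_cons.
Qed.

Lemma det_bound m (A : 'M[R]_m) (L : 'I_m -> R) : (forall i j, `|A i j| <= L i) ->
  `|\det A| <= m`!%:R * \prod_i L i.
Proof.
move=> AL; rewrite /determinant (le_trans (ler_norm_sum _ _ _))//.
apply: (@le_trans _ _ (\sum_(s : 'S_m) \prod_i L i)); last first.
  by rewrite sumr_const card_Sn mulr_natl.
apply: ler_sum => s _; rewrite normrM normrX normrN1 expr1n mul1r normr_prod.
by apply: ler_prod => i _; rewrite normr_ge0 AL.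
Qed.

Lemma det_row0 m (A : 'M[R]_m) i : (forall j, A i j = 0) -> \det A = 0.
Proof. by move=> A0; rewrite (expand_det_row A i) big1// => j _; rewrite A0 mul0r. Qed.

Lemma cofactor_row0 m (A : 'M[R]_m) i p j : p != i -> (forall j, A p j = 0) -> cofactor A i j = 0.
Proof.
move=> pi A0; rewrite /cofactor; case: (unliftP i p) => [k pk|pk]; last by rewrite pk eqxx in pi.
by rewrite (@det_row0 _ _ k) ?mulr0// => l; rewrite !mxE -pk A0.
Qed.

Lemma cofactor_bound m (A : 'M[R]_m.+1) L i j : 0 <= L -> (forall i j, `|A i j| <= L) ->
  `|cofactor A i j| <= m`!%:R * L ^+ m.
Proof.
move=> L0 AL; rewrite /cofactor normrM normrX normrN1 expr1n mul1r.
have := @det_bound m (row' i (col' j A)) (fun=> L); rewrite prodr_const card_ord; apply.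
by move=> k l; rewrite !mxE.
Qed.

Lemma mble_det d (T : measurableType d) m (A : T -> 'M[R]_m) :
  (forall i j, mble (fun x => A x i j)) -> mble (fun x => \det (A x)).
Proof.
move=> mA; apply: measurable_sum => s; apply: measurable_funM; first exact: measurable_cst.
by apply: measurable_prod => i _; exact: mA.
Qed.

Lemma mble_cofactor d (T : measurableType d) m (A : T -> 'M[R]_m) i j :
  (forall i j, mble (fun x => A x i j)) -> mble (fun x => cofactor (A x) i j).
Proof.
move=> mA; apply: measurable_funM; first exact: measurable_cst.
by apply: mble_det => k l; under [X in mble X]eq_fun do rewrite !mxE; exact: mA.
Qed.

End det_tools.

Section ibp.
Context (R : realType) (n : nat).
Local Notation V := 'rV[R]_n.+1.
Local Notation T := 'rV[measurableTypeR R]_n.+1.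
Local Notation mu := (lebesgue_rV R n.+1).
Local Notation e_ j := (delta_mx ord0 j : V).
Implicit Types (f g : V -> R) (h : 'I_n.+1 -> V -> R) (p : 'I_n.+1).

Definition upd h p f : 'I_n.+1 -> V -> R := fun i => if i == p then f else h i.

Lemma DmxE h x i j : Dmx h x i j = pd j (h i) x. Proof. by rewrite mxE. Qed.

(** Cofactors along row [p] do not see that row: the Jacobian is linear in [f], with coefficients
    that stay fixed while [f] varies. *)
Lemma det_upd h p f x : \det (Dmx (upd h p f) x) = \sum_j pd j f x * cofactor (Dmx h x) p j.
Proof.
rewrite (expand_det_row _ p); apply: eq_bigr => j _; rewrite DmxE /upd eqxx; congr (_ * _).
rewrite /cofactor; congr (_ * \det _); apply/matrixP => k l; rewrite !mxE.
by rewrite eq_sym (negbTE (neq_lift _ _)).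
Qed.

Lemma upd_id h p : upd h p (h p) = h.
Proof. by apply/funext => i; rewrite /upd; case: eqP => // ->. Qed.

Lemma mble_Dmx h i j : (exists L, lip L (h i)) -> mble (fun x : T => Dmx h x i j).
Proof. by move=> [L hL]; under [X in mble X]eq_fun do rewrite DmxE; exact: pd_mble hL j. Qed.

Lemma mble_detD h : (forall i, exists L, lip L (h i)) -> mble (fun x : T => \det (Dmx h x)).
Proof. by move=> hL; apply: mble_det => i j; exact: mble_Dmx. Qed.

Lemma mble_cofD h p j : (forall i, exists L, lip L (h i)) -> mble (fun x : T => cofactor (Dmx h x) p j).
Proof. by move=> hL; apply: mble_cofactor => k l; exact: mble_Dmx. Qed.

Lemma detD_bound h (L : 'I_n.+1 -> R) : (forall i, lip (L i) (h i)) ->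
  forall x, `|\det (Dmx h x)| <= n.+1`!%:R * \prod_i L i.
Proof. by move=> hL x; apply: det_bound => i j; rewrite DmxE; exact: pd_bound (hL i) j x. Qed.

Lemma cofD_bound h L p j : 0 <= L -> (forall i, lip L (h i)) ->
  forall x, `|cofactor (Dmx h x) p j| <= n`!%:R * L ^+ n.
Proof. by move=> L0 hL x; apply: cofactor_bound => // i k; rewrite DmxE; exact: pd_bound. Qed.

(** Class [C^{1,1}] with global constants. Second derivatives then exist almost everywhere, which
    makes integration by parts in a Jacobian meaningful. *)
Definition nice f := exists C L, [/\ taylor C f (fun j => pd j f), forall j, lip L (pd j f) & lip L f].

Lemma cv_nice e f : 0 < e -> itg mu (f : T -> R) -> nice (cv e f).
Proof.
move=> e0 fi; have [C C0 H] := cv_taylor e0 fi; have [L L0 HL] := cv_lip e0 fi.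
have [M M0 HM] := dcv_lip e0 fi.
exists C, (Num.max L M); split=> [|j|].
- by under [X in taylor _ _ X]eq_fun do rewrite cv_pd//.
- by rewrite cv_pd//; apply: lipW (HM j); rewrite le_max lexx orbT.
- by apply: lipW HL; rewrite le_max lexx.
Qed.

Lemma dq_taylor C f j s : taylor C f (fun j => pd j f) ->
  exists C', taylor C' (fun x => dq f j x s) (fun k x => dq (pd k f) j x s).
Proof.
move=> fC; exists (`|s^-1| * (C + C)) => x v; rewrite /dq.
have -> : s^-1 * (f (x + v + s *: e_ j) - f (x + v)) - s^-1 * (f (x + s *: e_ j) - f x) -
   \sum_k v ord0 k * (s^-1 * (pd k f (x + s *: e_ j) - pd k f x)) =
   s^-1 * ((f (x + s *: e_ j + v) - f (x + s *: e_ j) - \sum_k v ord0 k * pd k f (x + s *: e_ j)) -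
     (f (x + v) - f x - \sum_k v ord0 k * pd k f x)).
  rewrite (addrAC x v) -[X in _ - X = _](_ : s^-1 * (\sum_k v ord0 k * pd k f (x + s *: e_ j) -
     \sum_k v ord0 k * pd k f x) = _); first by ring.
  by rewrite -sumrB mulr_sumr; apply: eq_bigr => k _; rewrite -mulrBr mulrCA.
rewrite normrM -mulrA ler_wpM2l// mulrDl (le_trans (ler_normB _ _))// lerD//; exact: fC.
Qed.

(** Second derivatives exist only almost everywhere, so symmetry is obtained after testing: both
    sides equal minus the integral of [pd k f * pd j g], the right one through difference quotients
    in direction [k]. *)
Lemma sym_weak f g L r j k : nice f -> lip L g -> csup r g ->
  \int[mu]_x (pd j (pd k f) x * g x) = \int[mu]_x (pd k (pd j f) x * g x).
Proof.
move=> [C [M [ft fM fL]]] gL gr; have gi := itg_lip_csup gL gr.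
have [B B0 gB] := lip_csup_bounded gL gr.
have dgi := itg_csup (pd_mble gL j) (pd_bound gL j) (csup_pd j gr).
have c1 : \int[mu]_x (dq f k x (hseq R m) * pd j g x) @[m --> \oo] --> \int[mu]_x (pd k f x * pd j g x).
  have [|||||_ //] := @dct _ _ _ mu (fun m x => dq f k x (hseq R m) * pd j g x)
    (fun x => pd k f x * pd j g x) (fun x => M * `|pd j g x|) _ _ _ _ _.
  - by move=> m; apply: measurable_funM; [exact: dq_mble fL k (hseq R m)|exact: pd_mble gL j].
  - by apply: measurable_funM; [exact: pd_mble fL k|exact: pd_mble gL j].
  - exact/itgZ/itg_norm.
  - apply: aeW => x; apply: cvgM; last exact: cvg_cst.
    have dx : derivable f x (e_ k)  by apply: (taylor_dble ft).
    exact: pd_cvg dx.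
  - by move=> m x; rewrite normrM ler_wpM2r//; exact: dq_bound fL k x (hseq R m).
have c2 : \int[mu]_x (dq (pd j f) k x (hseq R m) * g x) @[m --> \oo] --> \int[mu]_x (pd k (pd j f) x * g x).
  have [|||||_ //] := @dct _ _ _ mu (fun m x => dq (pd j f) k x (hseq R m) * g x)
    (fun x => pd k (pd j f) x * g x) (fun x => M * `|g x|) _ _ _ _ _.
  - by move=> m; apply: measurable_funM; [exact: dq_mble (fM j) k (hseq R m)|exact: lip_mble gL].
  - by apply: measurable_funM; [exact: pd_mble (fM j) k|exact: lip_mble gL].
  - exact/itgZ/itg_norm.
  - apply: filterS (lip_ae_derivable k (fM j)) => x dx; apply: cvgM; last exact: cvg_cst.
    exact: pd_cvg dx.
  - by move=> m x; rewrite normrM ler_wpM2r//; exact: dq_bound (fM j) k x (hseq R m).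
have E m : \int[mu]_x (dq (pd j f) k x (hseq R m) * g x) = - \int[mu]_x (dq f k x (hseq R m) * pd j g x).
  have [C' tC] := dq_taylor k (hseq R m) ft.
  transitivity (\int[mu]_x (pd j (fun y => dq f k y (hseq R m)) x * g x)); first by rewrite (taylor_pd j tC).
  apply: (ibp1 j _ gL gr (L := `|(hseq R m)^-1| * (M + M))).
  by apply: lipZ; apply: lipB => //; exact: lip_shift.
have H := cvg_seqN_unique E c1 c2; apply: (etrans _ (esym H)).
exact: ibp1 j (fM k) gL gr.
Qed.

Definition lipb f := exists L C, lip L f /\ forall x, `|f x| <= C.

Lemma lipb_prod I (s : seq I) (P : pred I) (F : I -> V -> R) : (forall i, P i -> lipb (F i)) ->
  lipb (fun x => \prod_(i <- s | P i) F i x).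
Proof.
move=> HF; elim: s => [|a s [L [C [HL HC]]]].
  exists 0, 1; split=> [|x]; last by rewrite big_nil normr1.
  by under [X in lip _ X]eq_fun do rewrite big_nil; exact: lip_cst.
have [Pa|nPa] := boolP (P a); last first.
  by exists L, C; split=> [|x]; [under [X in lip _ X]eq_fun do rewrite big_cons (negbTE nPa)|rewrite big_cons (negbTE nPa)].
have [L' [C' [HL' HC']]] := HF a Pa.
exists (C' * L + L' * C), (C' * C); split=> [|x].
  under [X in lip _ X]eq_fun do rewrite big_cons Pa.
  exact: lipM.
by rewrite big_cons Pa normrM ler_pM.
Qed.

Lemma derivable_prod I (s : seq I) (P : pred I) (F : I -> V -> R) j x :
  (forall i, P i -> derivable (F i) x (e_ j)) -> derivable (fun x => \prod_(i <- s | P i) F i x) x (e_ j).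
Proof.
move=> HF; elim: s => [|a s IH].
  by rewrite (_ : (fun _ => _) = fun=> 1); [exact: derivable_cst|apply/funext => y; rewrite big_nil].
have [Pa|nPa] := boolP (P a); last first.
  by rewrite (_ : (fun _ => _) = fun x => \prod_(i <- s | P i) F i x)//; apply/funext => y; rewrite big_cons (negbTE nPa).
rewrite (_ : (fun _ => _) = fun x => F a x * \prod_(i <- s | P i) F i x); last first.
  by apply/funext => y; rewrite big_cons Pa.
exact: derivableM (HF a Pa) IH.
Qed.

Lemma pd_prod (I : eqType) (s : seq I) (P : pred I) (F : I -> V -> R) j x : uniq s ->
  (forall i, P i -> derivable (F i) x (e_ j)) ->
  pd j (fun x => \prod_(i <- s | P i) F i x) x =
  \sum_(k <- s | P k) pd j (F k) x * \prod_(i <- s | P i && (i != k)) F i x.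
Proof.
elim: s => [_ _|a s IH /= /andP[as_ us] HF].
  rewrite big_nil (_ : (fun _ => _) = fun=> 1); first exact: pd_cst.
  by apply/funext => y; rewrite big_nil.
have [Pa|nPa] := boolP (P a); last first.
  rewrite (_ : (fun _ => _) = fun x => \prod_(i <- s | P i) F i x); last first.
    by apply/funext => y; rewrite big_cons (negbTE nPa).
  rewrite big_cons (negbTE nPa) IH//; apply: eq_bigr => k Pk.
  by rewrite big_cons (negbTE nPa).
rewrite (_ : (fun _ => _) = fun x => F a x * \prod_(i <- s | P i) F i x); last first.
  by apply/funext => y; rewrite big_cons Pa.
rewrite pdM; [|exact: HF|exact: derivable_prod].
rewrite IH// big_cons Pa addrC; congr (_ + _).
  rewrite mulrC; congr (_ * _); rewrite big_cons eqxx/= andbF.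
  rewrite [LHS]big_seq_cond [RHS]big_seq_cond; apply: eq_bigl => i.
  by case: (boolP (i \in s)) => //= is_; rewrite (_ : i != a) ?andbT//; apply: contra as_ => /eqP <-.
rewrite mulr_sumr [LHS]big_seq_cond [RHS]big_seq_cond; apply: eq_bigr => k /andP[ks Pk].
have ak : a != k by apply: contra as_ => /eqP ->.
rewrite big_cons Pa ak /=; set A := pd j (F k) x; set B := \big[_/_]_(i <- s | _) _.
exact: mulrCA.
Qed.

(** In the Leibniz expansion the derivative of [h p] is integrated by parts. What remains are second
    derivatives of the other components, and these cancel in pairs: the rows of the cofactor matrix
    are divergence free. *)
Lemma ibp_nice h p L r : lip L (h p) -> csup r (h p) -> (forall i, i != p -> nice (h i)) ->
  \int[mu]_x \det (Dmx h x) = 0.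
Proof.
move=> hL hr hn.
have hl i : i != p -> exists L, lip L (h i) by move=> ip; have [C [M [? ? ?]]] := hn i ip; exists M.
have pl i j : i != p -> lipb (pd j (h i)).
  by move=> ip; have [C [M [? HM hM]]] := hn i ip; exists M, M; split; [exact: HM|exact: pd_bound hM j].
pose P (s : 'S_n.+1) (x : V) := \prod_(i | i != p) pd (s i) (h i) x.
pose Q (s : 'S_n.+1) k (x : V) := (\prod_(i | (i != p) && (i != k)) pd (s i) (h i) x) * h p x.
have Pl s : lipb (P s) by apply: lipb_prod => i ip; exact: pl.
have Ql s k : exists L, lip L (Q s k).
  have [M [C [HM _]]] : lipb (fun x => \prod_(i | (i != p) && (i != k)) pd (s i) (h i) x).
    by apply: lipb_prod => i /andP[ip _]; exact: pl.
  by have [M' _ H] := lip_mul_csup HM hL hr; exists M'.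
have Qr s k : csup r (Q s k) by exact: csupMr.
pose E (s : 'S_n.+1) k := \int[mu]_x (pd (s p) (pd (s k) (h k)) x * Q s k x).
have Ei (s : 'S_n.+1) k : k != p -> itg mu (fun x : T => pd (s p) (pd (s k) (h k)) x * Q s k x).
  move=> kp; have [M [C [HM _]]] := pl k (s k) kp; have [M' HM'] := Ql s k.
  exact: itg_pd_mul HM HM' (Qr s k).
have Di (s : 'S_n.+1) : itg mu (fun x : T => pd (s p) (h p) x * P s x).
  have [M [C [HM HC]]] := Pl s.
  apply: (itgMb (C := C)) => //; last exact: lip_mble HM.
  exact: itg_csup (pd_mble hL (s p)) (pd_bound hL (s p)) (csup_pd (s p) hr).
have ES (s : 'S_n.+1) : \int[mu]_x (pd (s p) (h p) x * P s x) = - \sum_(k | k != p) E s k.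
  have [M [C [HM HC]]] := Pl s.
  have -> : \int[mu]_x (pd (s p) (h p) x * P s x) = \int[mu]_x (P s x * pd (s p) (h p) x).
    by apply: eq_Rintegral => x _; rewrite mulrC.
  have := ibp1 (s p) HM hL hr => /(congr1 -%R); rewrite opprK => <-; congr (- _).
  rewrite /E -int_sum; last by move=> k; exact: Ei.
  apply: int_aeE.
  - by apply: measurable_funM; [exact: pd_mble HM (s p)|exact: lip_mble hL].
  - by apply: itg_mble; apply: itg_sum => k; exact: Ei.
  - have : {ae mu, forall x : T, forall i, i != p -> derivable (pd (s i) (h i)) x (e_ (s p))}.
      apply: filter_forall => i; have [->|ip] := eqVneq i p; first by apply: aeW.
      have [M1 [C1 [HM1 _]]] := pl i (s i) ip.
      by apply: filterS (lip_ae_derivable (s p) HM1) => x.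
    apply: filterS => x Hx; rewrite /P pd_prod//; last by rewrite index_enum_uniq.
    by rewrite mulr_suml; apply: eq_bigr => k kp; rewrite /Q mulrA.
have -> : \int[mu]_x \det (Dmx h x) = \sum_(s : 'S_n.+1) (-1) ^+ s * \int[mu]_x (pd (s p) (h p) x * P s x).
  transitivity (\int[mu]_x (\sum_(s : 'S_n.+1) (-1) ^+ s * (pd (s p) (h p) x * P s x))).
    apply: eq_Rintegral => x _; apply: eq_bigr => s _; congr (_ * _).
    by rewrite (bigD1 p)//= DmxE; congr (_ * _); apply: eq_bigr => i _; rewrite DmxE.
  rewrite int_sum; first by apply: eq_bigr => s _; rewrite intZ.
  by move=> s _; exact: itgZ.
under eq_bigr do rewrite ES mulrN mulr_sumr.
rewrite sumrN exchange_big/= big1 ?oppr0// => k kp.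
(* Composing with the transposition of [p] and [k] exchanges the two directions in which [h k] is
   differentiated and reverses the sign of the permutation. *)
set S := (X in X = _); suff : S = - S by move=> H; lra.
rewrite {1}/S (reindex_inj (mulgI (tperm p k)))/= /S -sumrN.
apply: eq_bigr => s _; suff -> : E (tperm p k * s)%g k = E s k.
  by rewrite odd_mul_tperm eq_sym kp addTb signrN mulNr.
rewrite /E !permM tpermL tpermR.
have [M' HM'] := Ql s k.
have -> : Q (tperm p k * s)%g k = Q s k.
  apply/funext => x; rewrite /Q; congr (_ * _); apply: eq_bigr => i /andP[ip ik].
  by rewrite permM tpermD// eq_sym.
exact: (sym_weak _ _ (hn k kp) HM' (Qr s k)).
Qed.

(** The components are mollified one at a time, [s] listing those still to be treated. With the
    others fixed, the cofactors are a fixed integrable weight, and [pd_weak] passes to the limit. *)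
Lemma ibp_csup h p r : (forall i, exists L, lip L (h i)) -> (forall i, csup r (h i)) ->
  \int[mu]_x \det (Dmx h x) = 0.
Proof.
move=> hL hr; suff H (s : seq 'I_n.+1) h' r' : (forall i, exists L, lip L (h' i)) -> (forall i, csup r' (h' i)) ->
    (forall i, i != p -> i \notin s -> nice (h' i)) -> \int[mu]_x \det (Dmx h' x) = 0.
  by apply: (H (enum 'I_n.+1) h r) => // i _; rewrite mem_enum.
elim: s h' r' => [|a s IH] g r' gL gr gn.
  by have [L gpL] := gL p; apply: (ibp_nice gpL (gr p)) => i ip; exact: gn.
(* The component [p] keeps its mere Lipschitz regularity: [ibp_nice] asks smoothness of the others
   only. *)
have [ap|ap] := eqVneq a p.
  apply: IH gL gr _ => i ip is_; apply: gn => //; rewrite inE ap negb_or ip; exact: is_.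
have [L gaL] := gL a; have gai := itg_lip_csup gaL (gr a).
pose G m := cv (hseq R m) (g a).
have h0 m : 0 < hseq R m :> R by rewrite invr_gt0.
have h1 m : hseq R m <= 1 :> R by rewrite invf_le1 ?ler1n.
have L0 : 0 <= L by rewrite (le_trans _ (pd_bound gaL a 0)).
have GL m : lip L (G m) by exact: cv_lipL.
have E0 m : \int[mu]_x \det (Dmx (upd g a (G m)) x) = 0.
  apply: (IH _ (r' + 1)) => i.
  - by rewrite /upd; case: eqP => // _; exists L.
  - rewrite /upd; case: eqP => [_|_]; last by apply: csupW (gr i); rewrite lerDl.
    by apply: csupW (cv_csup (h0 m) (gr a)); rewrite lerD2l.
  - move=> ip is_; rewrite /upd; case: eqP => [_|/eqP ia]; first exact: cv_nice.
    by apply: gn => //; rewrite inE negb_or ia.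
(* As [a] differs from [p], row [p] is still present in these minors; its compact support makes the
   cofactors integrable. *)
have c0 x j : r' < enorm x -> cofactor (Dmx g x) a j = 0.
  by move=> xr; apply: (cofactor_row0 _ (p := p)); [rewrite eq_sym|move=> k; rewrite DmxE; exact: (csup_pd k (gr p))].
have [M M0 gM] : exists2 M, 0 <= M & forall i, lip M (g i).
  have H i := cid (gL i).
  exists (\sum_i `|sval (H i)|); first exact: sumr_ge0.
  move=> i; apply: lipW (svalP (H i)); rewrite (bigD1 i)//= (le_trans (ler_norm _))// lerDl.
  exact: sumr_ge0.
have ci j : itg mu (fun x : T => cofactor (Dmx g x) a j).
  apply: (itg_csup (C := n`!%:R * M ^+ n) (r := r')); [exact: mble_cofD|exact: cofD_bound|].
  by move=> x; exact: c0.
have ii f j : lip L f -> itg mu (fun x : T => cofactor (Dmx g x) a j * pd j f x).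
  by move=> fL; apply: (itgMb (ci j) (pd_mble fL j)) => x; exact: pd_bound.
have Ef f : lip L f -> \int[mu]_x \det (Dmx (upd g a f) x) = \sum_j \int[mu]_x (cofactor (Dmx g x) a j * pd j f x).
  move=> fL; rewrite -int_sum; last by move=> j _; exact: ii.
  by apply: eq_Rintegral => x _; rewrite det_upd; apply: eq_bigr => j _; rewrite mulrC.
rewrite -{1}(upd_id g a) Ef//.
have c : \sum_j \int[mu]_x (cofactor (Dmx g x) a j * pd j (G m) x) @[m --> \oo] -->
   \sum_j \int[mu]_x (cofactor (Dmx g x) a j * pd j (g a) x).
  apply: cvg_big_sum => j; apply: pd_weak => // x.
  apply/cvgrPdist_le => e e0; have q : 0 < L + 1 by rewrite ltr_wpDl.
  have [k _ Hk] := near_infty_natSinv_lt (PosNum (divr_gt0 e0 q)).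
  exists k => // m /= km; rewrite distrC; apply: cv_close => // z zm.
  rewrite (le_trans (gaL _ _))// [x + z]addrC addrK.
  apply: (@le_trans _ _ ((L + 1) * hseq R m)).
    by apply: ler_pM => //; [exact: enorm_ge0|rewrite lerDl].
  by rewrite mulrC -ler_pdivlMr// ltW//; exact: Hk.
by apply: (cvg_seq_unique c); apply: (@cvg_seq_eq _ (fun=> 0)) => [m|]; [rewrite -Ef// E0|exact: cvg_cst].
Qed.

(** Compact support of one row is enough: the other components are cut off away from the ball of
    radius [r], which changes nothing near the support of the determinant. *)
Lemma int_det0 h p r : (forall i, exists L, lip L (h i)) -> csup r (h p) ->
  \int[mu]_x \det (Dmx h x) = 0.
Proof.
move=> hL hr; pose q := `|r| + 1.
have rq : r < q by rewrite (le_lt_trans (ler_norm r))// ltrDl.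
pose h' i := if i == p then h p else (fun x => h i x * cutoff q x).
rewrite -(@ibp_csup h' p (q + 1)).
- apply: eq_Rintegral => x _; have [xr|xr] := leP (enorm (x : V)) r; last first.
    rewrite (det_row0 (i := p)) 1?[RHS](det_row0 (i := p))// => j; rewrite DmxE.
      by rewrite /h' eqxx (csup_pd j hr).
    by rewrite (csup_pd j hr).
  congr (\det _); apply/matrixP => i j; rewrite !DmxE /h'; case: eqP => [->//|_].
  apply: pd_near; apply/nbhs_eballP; exists (q - r); rewrite ?subr_gt0// => y xy.
  rewrite cutoff1 ?mulr1//; have := enormD (y - (x : V)) x; rewrite subrK enormB; lra.
- move=> i; rewrite /h'; case: eqP => // _; have [L hi] := hL i.
  by have [M _ H] := lip_mul_csup hi (@cutoff_lip R n q) (@cutoff_csup R n q); exists M.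
- move=> i; rewrite /h'; case: eqP => _; last exact/csupMr/cutoff_csup.
  by apply: csupW hr; rewrite (le_trans (ltW rq))// lerDl.
Qed.

Lemma upd_lip h p f : (forall i, exists L, lip L (h i)) -> (exists L, lip L f) ->
  forall i, exists L, lip L (upd h p f i).
Proof. by move=> hL fL i; rewrite /upd; case: eqP. Qed.

Lemma upd_lipM h p f M : (forall i, lip M (h i)) -> lip M f -> forall i, lip M (upd h p f i).
Proof. by move=> hL fL i; rewrite /upd; case: eqP. Qed.

(** By the product rule, the sum of the two integrands is the Jacobian with [f * g] in row [p],
    whose integral vanishes by [int_det0]. *)
Lemma int_det_parts h p L M r f g : (forall i, lip M (h i)) -> lip L f -> lip L g -> csup r g ->
  \int[mu]_x (g x * \det (Dmx (upd h p f) x)) = - \int[mu]_x (f x * \det (Dmx (upd h p g) x)).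
Proof.
move=> hM fL gL gr; have [N N0 fgN] := lip_mul_csup fL gL gr.
have hM' i : exists L, lip L (h i) by exists M.
have gi := itg_lip_csup gL gr.
have M0 : 0 <= M by rewrite (le_trans _ (pd_bound (hM p) p 0)).
have L0 : 0 <= L by rewrite (le_trans _ (pd_bound fL p 0)).
have i1 : itg mu (fun x : T => g x * \det (Dmx (upd h p f) x)).
  apply: (itgMb gi); first by apply: mble_detD => i; apply: upd_lip => //; exists L.
  apply: (detD_bound (L := fun=> Num.max L M)) => i; apply: upd_lipM => [k|].
    by apply: lipW (hM k); rewrite le_max lexx orbT.
  by apply: lipW fL; rewrite le_max lexx.
have i2 : itg mu (fun x : T => f x * \det (Dmx (upd h p g) x)).
  pose C := `|f 0| + `|L| * `|r|.
  apply: (itg_csup (C := C * (n.+1`!%:R * \prod_(i < n.+1) Num.max L M)) (r := r)).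
  - apply: measurable_funM; first exact: lip_mble fL.
    by apply: mble_detD => i; apply: upd_lip => //; exists L.
  - move=> x; have [xr|xr] := leP (enorm x) r; last first.
      rewrite (det_row0 (i := p)) ?mulr0 ?normr0; last first.
        by move=> j; rewrite DmxE /upd eqxx (csup_pd j gr).
      rewrite mulr_ge0 ?addr_ge0 ?mulr_ge0//; apply: prodr_ge0 => i _.
      by rewrite le_max L0.
    rewrite normrM; apply: ler_pM => //; first exact: (lip_bounded_ball fL xr).
    apply: (detD_bound (L := fun=> Num.max L M)) => i; apply: upd_lipM => [k|].
      by apply: lipW (hM k); rewrite le_max lexx orbT.
    by apply: lipW gL; rewrite le_max lexx.
  - move=> x xr; rewrite (det_row0 (i := p)) ?mulr0// => j.
    by rewrite DmxE /upd eqxx (csup_pd j gr).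
apply/eqP; rewrite -addr_eq0 -(intD i1 i2); apply/eqP.
have <- : \int[mu]_x \det (Dmx (upd h p (fun x => f x * g x)) x) = 0.
  apply: (@int_det0 _ p r); first by apply: upd_lip => //; exists N.
  by rewrite /upd eqxx; exact: csupMr.
apply: int_aeE.
- exact: itg_mble (itgD i1 i2).
- by apply: mble_detD => i; apply: upd_lip => //; exists N.
- apply: filterS2 (lip_ae_derivable_all fL) (lip_ae_derivable_all gL) => x df dg.
  rewrite !det_upd !mulr_sumr -big_split/=; apply: eq_bigr => j _.
  by rewrite pdM//; ring.
Qed.

(** Once [Psi] is replaced by a compactly supported Lipschitz [g], parts put [g] into row [p] and
    leave [f m] undifferentiated, so that its pointwise convergence decides. The other rows may vary
    with [m] as long as they stay Lipschitz with one constant. *)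
Lemma weak_det0 (h : nat -> 'I_n.+1 -> V -> R) (f : nat -> V -> R) p M (Psi : T -> R) :
  (forall m i, lip M (h m i)) -> (forall m, lip M (f m)) -> (forall x, f m x @[m --> \oo] --> 0) ->
  itg mu Psi -> \int[mu]_x (Psi x * \det (Dmx (upd (h m) p (f m)) x)) @[m --> \oo] --> 0.
Proof.
move=> hM fM f0 Pi; have M0 : 0 <= M by rewrite (le_trans _ (pd_bound (fM 0%N) p 0)).
pose B : R := n.+1`!%:R * \prod_(i < n.+1) M.
have B0 : 0 <= B by rewrite mulr_ge0 ?prodr_ge0.
have dB m x : `|\det (Dmx (upd (h m) p (f m)) x)| <= B by apply: detD_bound => i; exact: upd_lipM.
have md m : mble (fun x : T => \det (Dmx (upd (h m) p (f m)) x)).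
  by apply: mble_detD => i; exists M; exact: upd_lipM.
apply/cvg_seq0P => e e0; have e2 : 0 < e / 2 by rewrite divr_gt0.
have B1 : 0 < B + 1 by rewrite ltr_wpDl.
have [L [r [g [gL gr Pg]]]] := lip_dense Pi (divr_gt0 e2 B1).
have gi := itg_lip_csup gL gr.
pose K := Num.max M L.
have gK : lip K g by apply: lipW gL; rewrite le_max lexx orbT.
have fK m : lip K (f m) by apply: lipW (fM m); rewrite le_max lexx.
have hK m i : lip K (h m i) by apply: lipW (hM m i); rewrite le_max lexx.
pose D : R := n.+1`!%:R * \prod_(i < n.+1) K.
have D0 : 0 <= D by rewrite mulr_ge0 ?prodr_ge0// => i _; rewrite le_max M0.
have [F HF] : exists F : R, forall m, `|f m 0| <= F.
  have cn : cvgn (f ^~ 0) by apply/cvg_ex; exists 0; exact: f0.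
  have := cvg_seq_bounded cn.
  by move=> [F [_ /(_ (F + 1))]]; rewrite ltrDl ltr01 => /(_ isT) HB; exists (F + 1) => m; exact: HB.
pose C := F + `|M| * `|r|.
have C0 : 0 <= C by rewrite addr_ge0 ?mulr_ge0// (le_trans _ (HF 0%N)).
have [|||||_] := @dct _ _ _ mu (fun m x => f m x * \det (Dmx (upd (h m) p g) x)) (fun=> 0)
    (fun x : T => (C * D) * \1_(cube r) x) _ _ _ _ _.
- move=> m; apply: measurable_funM; first exact: lip_mble (fM m).
  by apply: mble_detD => i; exists K; exact: upd_lipM.
- exact: measurable_cst.
- exact/itgZ/itg_cube.
- apply: aeW => x; have [xr|xr] := leP (enorm (x : V)) r; last first.
    apply: cvg_near_cst; apply: nearW => m; rewrite (det_row0 (i := p)) ?mulr0// => j.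
    by rewrite DmxE /upd eqxx (csup_pd j gr).
  apply/cvg_seq0P => d d0; have D1 : 0 < D + 1 by rewrite ltr_wpDl.
  have /cvg_seq0P/(_ _ (divr_gt0 d0 D1)) := f0 x; apply: filterS => m.
  rewrite normrM ltr_pdivlMr//; apply: le_lt_trans; apply: ler_wpM2l => //.
  rewrite (le_trans (detD_bound (L := fun=> K) _ x)) ?lerDl// => i; exact: upd_lipM.
- move=> m x; have [xr|xr] := leP (enorm (x : V)) r; last first.
    rewrite (det_row0 (i := p)) => [|j]; last by rewrite DmxE /upd eqxx (csup_pd j gr).
    by rewrite mulr0 normr0; apply: mulr_ge0; [exact: mulr_ge0|rewrite indicE ler0n].
  rewrite normrM indicE mem_set ?mulr1; last exact: cube_ball.
  apply: ler_pM => //; first by rewrite (le_trans (lip_bounded_ball (fM m) xr))// lerD2r.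
  by apply: detD_bound => i; exact: upd_lipM.
rewrite int0 => /cvg_seq0P/(_ _ e2); apply: filterS => m Hm.
have iP : itg mu (fun x => Psi x * \det (Dmx (upd (h m) p (f m)) x)) by exact: itgMb Pi (md m) (dB m).
have ig : itg mu (fun x => g x * \det (Dmx (upd (h m) p (f m)) x)) by exact: itgMb gi (md m) (dB m).
have iPg : itg mu (fun x => (Psi x - g x) * \det (Dmx (upd (h m) p (f m)) x)).
  by apply: (itgMb _ (md m) (dB m)); exact: itgB.
have -> : \int[mu]_x (Psi x * \det (Dmx (upd (h m) p (f m)) x)) =
   \int[mu]_x ((Psi x - g x) * \det (Dmx (upd (h m) p (f m)) x)) + \int[mu]_x (g x * \det (Dmx (upd (h m) p (f m)) x)).
  by rewrite -(intD iPg ig); apply: eq_Rintegral => x _; rewrite -mulrDl subrK.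
apply: norm_add_lt; last by rewrite (int_det_parts p (hK m) (fK m) gK gr) normrN.
apply: (@le_lt_trans _ _ ((B + 1) * \int[mu]_x `|Psi x - g x|)).
  rewrite -intZ; last exact/itg_norm/itgB.
  apply: int_norm_le => //; first exact/itgZ/itg_norm/itgB.
  move=> x; rewrite normrM mulrC ler_wpM2r// (le_trans (dB m x))// lerDl//.
by rewrite mulrC -ltr_pdivlMr.
Qed.

(** Weak continuity of Jacobian determinants. The components are exchanged one by one through [mix];
    each exchange changes a single row by a function tending to zero. *)
Lemma weak_det (h_ : nat -> 'I_n.+1 -> V -> R) h M (Psi : T -> R) :
  (forall m i, lip M (h_ m i)) -> (forall i, lip M (h i)) -> (forall i x, h_ m i x @[m --> \oo] --> h i x) ->
  itg mu Psi ->
  \int[mu]_x (Psi x * \det (Dmx (h_ m) x)) @[m --> \oo] --> \int[mu]_x (Psi x * \det (Dmx h x)).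
Proof.
move=> h_M hM hh Pi.
pose mix (s : seq 'I_n.+1) m : 'I_n.+1 -> V -> R := fun i => if i \in s then h_ m i else h i.
have mixM s m i : lip M (mix s m i) by rewrite /mix; case: ifP.
suff H s : \int[mu]_x (Psi x * \det (Dmx (mix s m) x)) @[m --> \oo] --> \int[mu]_x (Psi x * \det (Dmx h x)).
  apply: cvg_seq_eq (H (enum 'I_n.+1)) => m.
  by apply: eq_Rintegral => x _; congr (_ * \det (Dmx _ x)); apply/funext => i; rewrite /mix mem_enum.
elim: s => [|a s IH].
  apply: (@cvg_seq_eq _ (fun=> \int[mu]_x (Psi x * \det (Dmx h x)))) => [m //|]; exact: cvg_cst.
have [as_|as_] := boolP (a \in s).
  apply: cvg_seq_eq IH => m; apply: eq_Rintegral => x _.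
  by congr (_ * \det (Dmx _ x)); apply/funext => i; rewrite /mix inE; case: eqP => // ->; rewrite as_.
pose d m := fun x => h_ m a x - h a x.
have M0 : 0 <= M by rewrite (le_trans _ (pd_bound (hM a) a 0)).
have dM m : lip (M + M) (d m) by exact: lipB.
have mixM2 s' m i : lip (M + M) (mix s' m i) by apply: lipW (mixM s' m i); rewrite lerDl.
have := @weak_det0 (mix s) d a (M + M) Psi (mixM2 s) dM _ Pi.
have dc x : d m x @[m --> \oo] --> 0.
  by rewrite -(subrr (h a x)); apply: cvgB; [exact: hh|exact: cvg_cst].
move=> /(_ dc) c0; apply: (cvg_seqD0 _ c0 IH) => m.
have b h' : (forall i, lip (M + M) (h' i)) -> itg mu (fun x => Psi x * \det (Dmx h' x)).
  move=> h'M; apply: (itgMb Pi); first by apply: mble_detD => i; exists (M + M); exact: h'M.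
  by apply: detD_bound => i; exact: h'M.
have b1 := b _ (upd_lipM a (mixM2 s m) (dM m)); have b2 := b _ (mixM2 s m); have b3 := b _ (mixM2 (a :: s) m).
rewrite -(intD b1 b2); apply: int_aeE; [exact: itg_mble (itgD b1 b2)|exact: itg_mble b3|].
apply: filterS2 (lip_ae_derivable_all (h_M m a)) (lip_ae_derivable_all (hM a)) => x d1 d2.
have -> : mix (a :: s) m = upd (mix s m) a (h_ m a).
  by apply/funext => i; rewrite /mix /upd inE; case: eqP => // ->.
have -> : Dmx (mix s m) x = Dmx (upd (mix s m) a (h a)) x.
  by congr (Dmx _ x); apply/funext => i; rewrite /upd; case: eqP => // ->; rewrite /mix (negbTE as_).
rewrite -mulrDr; congr (_ * _); rewrite !det_upd -big_split/=; apply: eq_bigr => j _.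
by rewrite -mulrDl pdB// subrK.
Qed.

End ibp.

Section chain_rule.
Context (R : realType) (n m : nat).
Local Notation V := 'rV[R]_n.+1.
Local Notation W := 'rV[R]_m.+1.
Local Notation T := 'rV[measurableTypeR R]_n.+1.
Local Notation mu := (lebesgue_rV R n.+1).
Local Notation e_ j := (delta_mx ord0 j : V).

(** The quadratic remainder of the outer function is [O(s^2)] because [F] is Lipschitz. Partial
    derivatives of [F] at [x] are therefore enough on the inner side. *)
Lemma chain_rule (f : W -> R) G C L (F : V -> W) j x : taylor C f G -> 0 <= C ->
  lipm L F -> (forall i, derivable (fun y => F y ord0 i) x (e_ j)) ->
  derivable (f \o F) x (e_ j) /\
  pd j (f \o F) x = \sum_i G i (F x) * pd j (fun y => F y ord0 i) x.
Proof.
move=> ft C0 FL dF.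
have c : dq (f \o F) j x s @[s --> 0^'] --> \sum_i G i (F x) * pd j (fun y => F y ord0 i) x.
  have c1 : (\sum_i G i (F x) * dq (fun y => F y ord0 i) j x s) @[s --> 0^'] -->
     \sum_i G i (F x) * pd j (fun y => F y ord0 i) x.
    apply: cvg_big_sum => i; apply: cvgM; first exact: cvg_cst.
    by rewrite pd_dq; exact/derivable_dq.
  apply/cvgrPdist_lt => e e0; have e2 : 0 < e / 2 by rewrite divr_gt0.
  have CL : 0 < C * L ^+ 2 + 1 by rewrite ltr_wpDl// mulr_ge0 ?sqr_ge0.
  have {}c1 : \forall s \near 0^', `|\sum_i G i (F x) * pd j (fun y => F y ord0 i) x -
      \sum_i G i (F x) * dq (fun y => F y ord0 i) j x s| < e / 2.
    by move/cvgrPdist_lt: c1; exact.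
  near=> s; have s0 : s != 0 by near: s; exact: nbhs_dnbhs_neq.
  pose A := \sum_i G i (F x) * dq (fun y => F y ord0 i) j x s.
  rewrite -[X in X - _](subrK A) -addrA (le_lt_trans (ler_normD _ _))// (splitr e) ltrD//.
    by rewrite /A; near: s.
  pose v := F (x + s *: e_ j) - F x.
  have vL : enorm v <= `|L| * `|s|.
    rewrite (le_trans (FL _ _))// addrAC subrr add0r enormZ enorm_delta mulr1 ler_wpM2r//; exact: ler_norm.
  have Fv : F x + v = F (x + s *: e_ j) by rewrite /v addrC subrK.
  have H := ft (F x) v; rewrite Fv in H.
  have -> : A - dq (f \o F) j x s = - (s^-1 * (f (F (x + s *: e_ j)) - f (F x) - \sum_i v ord0 i * G i (F x))).
    have -> : A = s^-1 * \sum_i v ord0 i * G i (F x).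
      by rewrite mulr_sumr; apply: eq_bigr => i _; rewrite /dq /v !mxE; ring.
    by rewrite /dq /=; ring.
  rewrite normrN normrM normfV ltr_pdivrMl ?normr_gt0//.
  apply: (le_lt_trans H); apply: (@le_lt_trans _ _ (C * (`|L| * `|s|) ^+ 2)).
    by rewrite ler_wpM2l// ler_sqr ?nnegrE ?enorm_ge0// mulr_ge0.
  have -> : C * (`|L| * `|s|) ^+ 2 = `|s| * (C * L ^+ 2 * `|s|).
    by rewrite exprMn (real_normK (num_real L)); ring.
  rewrite ltr_pM2l ?normr_gt0//.
  apply: (@le_lt_trans _ _ ((C * L ^+ 2 + 1) * `|s|)); first by rewrite ler_wpM2r// lerDl.
  by rewrite mulrC -ltr_pdivlMr//; near: s; apply: dnbhs0_lt; exact: divr_gt0.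
split; first by apply/derivable_dq/cvg_ex; eexists; exact: c.
by rewrite pd_dq; exact: (cvg_lim (@Rhausdorff R) c).
Unshelve. all: by end_near. Qed.

End chain_rule.

Section degenerate.
Context (R : realType) (n : nat).
Local Notation V := 'rV[R]_n.+2.
Local Notation W := 'rV[R]_n.+1.
Local Notation T := 'rV[measurableTypeR R]_n.+2.
Local Notation mu := (lebesgue_rV R n.+2).

(** The first row is a function of the others. For mollified [f] the chain rule exhibits a linear
    relation between the rows; for Lipschitz [f], where no chain rule is available, [weak_det] takes
    the limit. *)
Lemma int_det_dependent L M r (f : W -> R) (Phi : 'I_n.+1 -> V -> R) (Psi : T -> R) :
  lip L f -> csup r f -> (forall i, lip M (Phi i)) -> itg mu Psi ->
  \int[mu]_x (Psi x * \det (Dmx (fcons (fun x => f (\row_i Phi i x)) Phi) x)) = 0.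
Proof.
move=> fL fr PM Pi; pose F x : W := \row_i Phi i x.
have FE i : (fun y => F y ord0 i) = Phi i by apply/funext => y; rewrite mxE.
have FM : lipm (n.+1%:R * M) F by apply: lipm_coor => i; rewrite FE; exact: PM.
have fi := itg_lip_csup fL fr.
have M0 : 0 <= M by rewrite (le_trans _ (pd_bound (PM ord0) ord0 0)).
have L0 : 0 <= L by rewrite (le_trans _ (pd_bound fL ord0 0)).
have h0 m : 0 < hseq R m :> R by rewrite invr_gt0.
pose f_ m := cv (hseq R m) f.
have f_L m : lip L (f_ m) by exact: cv_lipL.
pose K := L * (n.+1%:R * M) + M.
have K1 : L * (n.+1%:R * M) <= K by rewrite lerDl.
have K2 : M <= K by rewrite lerDr !mulr_ge0.
have consK g : lip L g -> forall i, lip K (fcons (g \o F) Phi i).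
  move=> gL i; rewrite /fcons; case: unliftP => [j _|_]; first exact: lipW (PM j).
  by apply: lipW K1 _; exact: lip_comp.
have E m : \int[mu]_x (Psi x * \det (Dmx (fcons (f_ m \o F) Phi) x)) = 0.
  have [C C0 ft] := cv_taylor (h0 m) fi.
  rewrite -(@int0 _ _ _ mu); apply: int_aeE; last first.
  - have : {ae mu, forall x : T, forall i j, derivable (Phi i) x (delta_mx ord0 j : V)}.
      by apply: filter_forall => i; exact: lip_ae_derivable_all (PM i).
    apply: filterS => x dx.
    suff -> : \det (Dmx (fcons (f_ m \o F) Phi) x) = 0 by rewrite mulr0.
    apply/eqP/det0P; exists (\row_i fcons 1 (fun i => - dcv (hseq R m) f i (F x)) i).
      by apply/eqP => /rowP /(_ ord0); rewrite !mxE /= /fcons unlift_none => /eqP; rewrite oner_eq0.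
    apply/rowP => j; rewrite !mxE big_ord_recl !mxE /= /fcons unlift_none mul1r.
    have dF i : derivable (fun y => F y ord0 i) x (delta_mx ord0 j : V) by rewrite FE.
    have [_ HH] := chain_rule ft C0 FM dF; have -> : 'D_(delta_mx ord0 j) (f_ m \o F) x = _ := HH; rewrite -big_split/= big1// => i _.
    by rewrite !mxE liftK FE mulNr subrr.
  - exact: measurable_cst.
  - apply: measurable_funM; first exact: (itg_mble Pi).
    by apply: mble_detD => i; exists K; exact: consK.
have c := @weak_det _ _ (fun m => fcons (f_ m \o F) Phi) (fcons (f \o F) Phi) K Psi
  (fun m => consK _ (f_L m)) (consK _ fL) _ Pi.
have fc x : f_ m x @[m --> \oo] --> f x.
  apply/cvgrPdist_le => e e0; have q : 0 < L + 1 by rewrite ltr_wpDl.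
  have [k _ Hk] := near_infty_natSinv_lt (PosNum (divr_gt0 e0 q)).
  exists k => // l /= km; rewrite distrC; apply: cv_close => // z zm.
  rewrite (le_trans (fL _ _))// [x + z]addrC addrK.
  apply: (@le_trans _ _ ((L + 1) * hseq R l)).
    by apply: ler_pM => //; [exact: enorm_ge0|rewrite lerDl].
  by rewrite mulrC -ler_pdivlMr// ltW//; exact: Hk.
have {}c := c _; have cc i x : fcons (f_ m \o F) Phi i x @[m --> \oo] --> fcons (f \o F) Phi i x.
  by rewrite /fcons; case: unliftP => [j _|_]; [exact: cvg_cst|exact: fc].
by apply: (cvg_seq_unique (c cc)); apply: (@cvg_seq_eq _ (fun=> 0)) => [m|]; [rewrite E|exact: cvg_cst].
Qed.

End degenerate.

Transparent lebesgue_rV.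

(** * The homotopy estimate *)

Section peel.
Context (R : realType) (n : nat).
Local Notation T := 'rV[measurableTypeR R]_n.
Local Notation T' := 'rV[measurableTypeR R]_n.+1.
Local Notation mu := (lebesgue_rV R n).
Local Notation mu' := (lebesgue_rV R n.+1).
Local Notation lam := (@lebesgue_measure R).
Local Notation cons := (@cons_rV _ (measurableTypeR R) n).

Lemma int_peel (a : measurableTypeR R -> R) (H : T -> R) : itg lam a -> itg mu H ->
  itg mu' (fun p : T' => a (uncons_rV p).1 * H (uncons_rV p).2) /\
  \int[mu']_p (a (uncons_rV p).1 * H (uncons_rV p).2) = (\int[lam]_t a t) * \int[mu]_x H x.
Proof.
move=> ai Hi; pose h (p : measurableTypeR R * T) := a p.1 * H p.2.
have mh : mble h.
  by apply: measurable_funM; [exact: (measurableT_comp (itg_mble ai) measurable_fst)|exact: (measurableT_comp (itg_mble Hi) measurable_snd)].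
have hd x y : `|h (x, y)| <= `|a x| * `|H y| by rewrite normrM.
have hi := dom_itg mh hd (itg_norm ai) (itg_norm Hi).
pose F (p : T') := a (uncons_rV p).1 * H (uncons_rV p).2.
have mF : mble F by exact: (measurableT_comp mh (@measurable_uncons_rV _ (measurableTypeR R) n)).
have FE : F \o cons = h by apply/funext => -[x y]; rewrite /= /F cons_rVK.
have mc := @measurable_cons_rV _ (measurableTypeR R) n.
have iF : itg mu' F.
  apply/integrableP; split; first exact/measurable_EFinP.
  move/integrableP : (hi) => [_]; congr (_ < _)%E.
  have := @ge0_integral_pushforward _ _ _ _ R cons mc (lam \x mu)%E setT
    (fun x => `|(F x)%:E|)%E measurableT.
  rewrite preimage_setT => E; transitivity (\int[pushforward (lam \x mu)%E cons]_x `|(F x)%:E|)%E; last first.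
    by apply: eq_measure_integral.
  rewrite E//; last by apply: measurableT_comp => //; exact/measurable_EFinP.
  by apply: eq_integral => z _; rewrite -FE.
split=> //.
transitivity (\int[(lam \x mu)%E]_z h z).
  congr fine; have /measurable_EFinP mfE := mF.
  have := @integral_pushforward _ _ _ _ R cons mc (lam \x mu)%E setT (EFin \o F) mfE.
  have hi' : (lam \x mu)%E.-integrable setT ((EFin \o F) \o cons).
    by move: hi; rewrite /itg -FE.
  rewrite preimage_setT => /(_ hi' measurableT) E.
  transitivity (\int[pushforward (lam \x mu)%E cons]_x (F x)%:E)%E; first by apply: eq_measure_integral.
  by rewrite E; apply: eq_integral => z _; rewrite -FE.
rewrite -(dom_fubini1 mh hd (itg_norm ai) (itg_norm Hi)) mulrC -intZ//.
by apply: eq_Rintegral => x _; rewrite /h/= intZ// mulrC.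
Qed.

End peel.

Opaque lebesgue_rV.

Section tail.
Context (R : realType) (n : nat).
Local Notation V := 'rV[R]_n.+1.
Local Notation X := 'rV[R]_n.+2.
Local Notation e_ j := (delta_mx ord0 j).

Definition tl (p : X) : V := \row_i p ord0 (lift ord0 i).

Lemma tl_lip : lipm 1 tl.
Proof.
move=> p q; rewrite mul1r -ler_sqr ?nnegrE ?enorm_ge0// !enorm_sqr [leRHS]big_ord_recl.
rewrite ler_wpDl ?sqr_ge0// ler_sum// => i _; by rewrite !mxE.
Qed.

Lemma tl_lift (p : X) h (j : 'I_n.+1) : tl (p + h *: e_ (lift ord0 j)) = tl p + h *: e_ j.
Proof. by apply/rowP => i; rewrite !mxE (inj_eq lift_inj). Qed.

Lemma tl_ord0 (p : X) h : tl (p + h *: e_ ord0) = tl p.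
Proof. apply/rowP => i; rewrite !mxE (_ : lift ord0 i == ord0 = false) ?andbF ?mulr0 ?addr0//. Qed.

Lemma dq_tl (f : V -> R) j p : dq (f \o tl) (lift ord0 j) p = dq f j (tl p).
Proof. by apply/funext => h; rewrite /dq /= tl_lift. Qed.

Lemma pd_tl (f : V -> R) j p : pd (lift ord0 j) (f \o tl) p = pd j f (tl p).
Proof. by rewrite !pd_dq dq_tl. Qed.

Lemma derivable_tl (f : V -> R) j p : derivable (f \o tl) p (e_ (lift ord0 j)) -> derivable f (tl p) (e_ j).
Proof. by move=> H; apply/derivable_dq; rewrite -dq_tl; exact/derivable_dq. Qed.

Lemma lip_tl L (f : V -> R) : 0 <= L -> lip L f -> lip L (f \o tl).
Proof. by move=> L0 fL; rewrite -[L]mulr1; exact: lip_comp L0 fL tl_lip. Qed.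

Lemma head_null (a : R) : {ae lebesgue_rV R n.+2, forall p : 'rV[measurableTypeR R]_n.+2, p ord0 ord0 != a}.
Proof.
pose N := [set p : 'rV[measurableTypeR R]_n.+2 | p ord0 ord0 = a].
have mN : measurable N.
  have := @measurable_coor _ (measurableTypeR R) n.+2 ord0 measurableT [set a] (measurable_set1 a).
  by rewrite setTI.
exists N; split => //; last by move=> p /= /negP; rewrite negbK => /eqP.
apply: (@null_lines R n.+1 ord0 N mN) => x.
have -> : [set t : measurableTypeR R | N (x + t *: e_ ord0)] = [set a - x ord0 ord0].
  apply/seteqP; split=> t; rewrite /N /= !mxE/= mulr1; first by move=> <-; ring.
  by move=> ->; ring.
exact: lebesgue_measure_set1.
Qed.

End tail.

Section homotopy.
Context (R : realType) (n : nat).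
Local Notation V := 'rV[R]_n.+1.
Local Notation X := 'rV[R]_n.+2.
Local Notation T := 'rV[measurableTypeR R]_n.+1.
Local Notation TX := 'rV[measurableTypeR R]_n.+2.
Local Notation mu := (lebesgue_rV R n.+1).
Local Notation e_ j := (delta_mx ord0 j).

(** Every permutation contributes the same product of row and column weights. The column weights
    serve to isolate the small derivative in the homotopy parameter. *)
Lemma det_bound2 m (A : 'M[R]_m) (L w : 'I_m -> R) : (forall i j, `|A i j| <= L i * w j) ->
  `|\det A| <= m`!%:R * (\prod_i L i * \prod_i w i).
Proof.
move=> AL; rewrite /determinant (le_trans (ler_norm_sum _ _ _))//.
apply: (@le_trans _ _ (\sum_(s : 'S_m) (\prod_i L i * \prod_i w i))); last first.
  by rewrite sumr_const card_Sn mulr_natl.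
apply: ler_sum => s _; rewrite normrM normrX normrN1 expr1n mul1r normr_prod.
rewrite [X in _ * X](reindex_inj (@perm_inj _ s))/= -big_split/=.
by apply: ler_prod => i _; rewrite normr_ge0 AL.
Qed.

Lemma pd_dir_bound k (f : 'rV[R]_k.+1 -> R) j p c : 0 <= c ->
  (forall h, `|f (p + h *: e_ j) - f p| <= c * `|h|) -> `|pd j f p| <= c.
Proof.
move=> c0 H; have [d|nd] := pselect (derivable f p (e_ j)); last by rewrite pd_ndvg// normr0.
have dn := pd_cvg d; rewrite -(cvg_lim (@Rhausdorff R) dn).
have b m : `|dq f j p (hseq R m)| <= c.
  have h0 : 0 < hseq R m :> R by rewrite invr_gt0.
  by rewrite /dq normrM normfV ler_pdivrMl ?normr_gt0 ?gt_eqF// mulrC.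
rewrite ler_norml; apply/andP; split.
  apply: limr_ge; first by apply/cvg_ex; eexists; exact: dn.
  by apply: nearW => m; have := b m; rewrite ler_norml => /andP[].
apply: limr_le; first by apply/cvg_ex; eexists; exact: dn.
by apply: nearW => m; have := b m; rewrite ler_norml => /andP[].
Qed.

Definition clamp01 (t : R) : R := Num.max 0 (Num.min 1 t).
Definition chi (t : R) : R := clamp01 (Num.min (t + 1) (2 - t)).

Lemma clamp01_le t : 0 <= clamp01 t <= 1.
Proof. by rewrite /clamp01 le_max lexx/= ge_max ler01 ge_min lexx. Qed.

Lemma clamp01_lip k (f : 'rV[R]_k -> R) L : lip L f -> lip L (fun x => clamp01 (f x)).
Proof. by move=> fL; apply/lip_max/lip_min. Qed.

Lemma chi_lip : lip 1 (fun p : X => chi (p ord0 ord0)).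
Proof.
apply: clamp01_lip => p q.
have : `|(p ord0 ord0 + 1) - (q ord0 ord0 + 1)| <= enorm (p - q).
  by have := coor_le (p - q) ord0; rewrite !mxE opprD addrACA subrr addr0.
have : `|(2 - p ord0 ord0) - (2 - q ord0 ord0)| <= enorm (p - q).
  by have := coor_le (q - p) ord0; rewrite !mxE enormB; congr (`|_| <= _); ring.
rewrite mul1r !minEle; move: (p _ _) (q _ _) (enorm _) => a b d.
by case: ifPn; case: ifPn; rewrite -?ltNge => h1 h2 /ler_normlP[h3 h4] /ler_normlP[h5 h6]; apply/ler_normlP; split; lra.
Qed.

Lemma chi_le t : 0 <= chi t <= 1. Proof. exact: clamp01_le. Qed.

Lemma chi_out t : 2 < `|t| -> chi t = 0.
Proof.
rewrite /chi /clamp01 => t2; apply/max_idPl; rewrite ge_min; apply/orP; right.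
by rewrite ge_min; move: t2; rewrite lter_normr => /orP[h|h]; apply/orP; [right|left]; lra.
Qed.

Lemma chi_up t : -1 <= t <= 0 -> chi t = t + 1.
Proof.
move=> /andP[a b]; rewrite /chi /clamp01 (min_idPl (_ : t + 1 <= 2 - t)); last by lra.
by rewrite (min_idPr _) ?(max_idPr _)//; lra.
Qed.

Lemma chi_down t : 1 <= t <= 2 -> chi t = 2 - t.
Proof.
move=> /andP[a b]; rewrite /chi /clamp01 (min_idPr (_ : 2 - t <= t + 1)); last by lra.
by rewrite (min_idPr _) ?(max_idPr _)//; lra.
Qed.

Lemma chi_one t : 0 <= t <= 1 -> chi t = 1.
Proof.
move=> /andP[a b]; rewrite /chi /clamp01 (min_idPl _) ?(max_idPr _)//.
by rewrite le_min; apply/andP; split; lra.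
Qed.

Lemma chi_zero t : t <= -1 \/ 2 <= t -> chi t = 0.
Proof.
by rewrite /chi /clamp01 => t2; apply/max_idPl; rewrite !ge_min; case: t2 => h; apply/orP; right; apply/orP; [left|right]; lra.
Qed.

Lemma clamp01_0 t : t <= 0 -> clamp01 t = 0.
Proof. by move=> t0; apply/max_idPl; rewrite ge_min t0 orbT. Qed.

Lemma clamp01_1 t : 1 <= t -> clamp01 t = 1.
Proof. by move=> t1; rewrite /clamp01 (min_idPl t1); apply/max_idPr. Qed.

Lemma near_head (p : X) (a b : R) : a < p ord0 ord0 < b -> \forall q \near p, a < (q : X) ord0 ord0 < b.
Proof.
move=> /andP[pa pb]; apply/nbhs_eballP; exists (Num.min (p ord0 ord0 - a) (b - p ord0 ord0)).
  by rewrite lt_min !subr_gt0 pa.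
move=> q; rewrite lt_min => /andP[h1 h2].
have := coor_le (p - q) ord0; rewrite !mxE => h3.
by move: (enorm _) h1 h2 h3 => d h1 h2 /ler_normlP[h3 h4]; apply/andP; split; lra.
Qed.

Lemma enorm_head_tl (p : X) : enorm p <= `|p ord0 ord0| + enorm (tl p).
Proof.
rewrite -ler_sqr ?nnegrE ?addr_ge0 ?enorm_ge0//.
have -> : enorm p ^+ 2 = `|p ord0 ord0| ^+ 2 + enorm (tl p) ^+ 2.
  rewrite real_normK ?num_real// !enorm_sqr big_ord_recl; congr (_ + _).
  by apply: eq_bigr => i _; rewrite mxE.
have := mulr_ge0 (normr_ge0 (p ord0 ord0)) (enorm_ge0 (tl p)); rewrite sqrrD.
move: (_ * _) (_ ^+ 2) (_ ^+ 2) => x y z; lra.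
Qed.

Lemma upd_fcons k (a b : 'rV[R]_k.+1 -> R) (P : 'I_k -> 'rV[R]_k.+1 -> R) :
  upd (fcons a P) ord0 b = fcons b P.
Proof.
by apply/funext => i; rewrite /upd /fcons; case: unliftP => [j ->|->]; rewrite ?eqxx// eq_sym (negbTE (neq_lift _ _)).
Qed.

Lemma int_norm_le_ae (F G : TX -> R) : itg (lebesgue_rV R n.+2) F -> itg (lebesgue_rV R n.+2) G ->
  {ae lebesgue_rV R n.+2, forall p, `|F p| <= G p} ->
  `|\int[lebesgue_rV R n.+2]_p F p| <= \int[lebesgue_rV R n.+2]_p G p.
Proof.
move=> iF iG FG.
have iM : itg (lebesgue_rV R n.+2) (fun p => Num.max (G p) `|F p|).
  apply: (itg_aeE iG).
    by apply: measurable_maxr; [exact: (itg_mble iG)|exact: (itg_mble (itg_norm iF))].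
  by apply: filterS FG => p h; rewrite (max_idPl h).
have -> : \int[lebesgue_rV R n.+2]_p G p = \int[lebesgue_rV R n.+2]_p Num.max (G p) `|F p|.
  apply: int_aeE; [exact: itg_mble iG|exact: itg_mble iM|].
  by apply: filterS FG => p h; rewrite (max_idPl h).
by apply: int_norm_le => // p; rewrite le_max lexx orbT.
Qed.

Lemma int_indic_fin (A : set R) (r : R) : measurable A -> lebesgue_measure A = r%:E ->
  itg (@lebesgue_measure R) (\1_A : R -> R) /\ \int[@lebesgue_measure R]_t (\1_A t : R) = r.
Proof.
move=> mA mE; split.
  apply/integrableP; split; first exact/measurable_EFinP/measurable_indic.
  under eq_integral do rewrite /= ger0_norm ?indicE ?ler0n// -indicE.
  by rewrite integral_indic ?setIT// [X in (X < _)%E](_ : _ = r%:E) ?ltry.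
by rewrite /Rintegral integral_indic ?setIT// [X in fine X](_ : _ = r%:E).
Qed.

(** The push forward of the current of [w] under [phi], evaluated at [f] and the coordinate
    functions. These values determine the density of the push forward. *)
Definition tint (w f : V -> R) (phi : 'I_n.+1 -> V -> R) : R :=
  \int[mu]_x (w x * f (\row_i phi i x) * \det (Dmx phi x)).

Section estimate.
Variables (phi0 phi1 : 'I_n.+1 -> V -> R) (L : 'I_n.+1 -> R) (eta b Lw rw Lf rf : R) (w f : V -> R).
Hypotheses (phi0L : forall i, lip (L i) (phi0 i)) (phi1L : forall i, lip (L i) (phi1 i)).
Hypotheses (eta0 : 0 <= eta) (b0 : 0 <= b) (phi01 : forall i x, `|phi1 i x - phi0 i x| <= eta * L i).
Hypotheses (wL : lip Lw w) (wr : csup rw w) (fL : lip Lf f) (fr : csup rf f).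
Hypothesis fb : forall x k, pd k w x != 0 -> forall s, 0 <= s <= 1 ->
  `|f (\row_i (phi0 i x + s * (phi1 i x - phi0 i x)))| <= b.

Let L0 i : 0 <= L i.
Proof. by rewrite (le_trans _ (pd_bound (phi0L i) ord0 0)). Qed.

(* Stokes' theorem on [R^(n+2)] for [chi(t) w(x) f(Phi(t, x))], where [Phi] is
   the affine homotopy with [t] clamped to [[0, 1]]: the slopes of [chi] on
   [[-1, 0]] and [[1, 2]], where [Phi] is constant in [t], produce the two end
   maps. *)
Let D i x := phi1 i x - phi0 i x.
Let Phi i (p : X) := phi0 i (tl p) + clamp01 (p ord0 ord0) * D i (tl p).
Let g (p : X) := chi (p ord0 ord0) * w (tl p).
Let F (p : X) := f (\row_i Phi i p).
Let Q (p : X) := Dmx (fcons (fun=> 0) Phi) p.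

Let Phi_lip : exists2 M, 0 <= M & forall i, lip M (Phi i).
Proof.
pose M i := L i + (1 * (L i + L i) + 1 * (eta * L i)).
have M0 i : 0 <= M i by rewrite !addr_ge0 ?mulr_ge0 ?addr_ge0.
exists (\sum_i M i); first exact: sumr_ge0.
move=> i; apply: (@lipW _ _ (M i)); first by rewrite (bigD1 i)//= lerDl sumr_ge0.
apply: lipD; first exact: lip_tl.
apply: lipM => [||p|p].
- exact: clamp01_lip (@lip_coor R n.+2 ord0).
- by apply: lip_tl; [exact: addr_ge0|exact: lipB].
- by have /andP[h1 h2] := clamp01_le (p ord0 ord0); rewrite ger0_norm.
- exact: phi01.
Qed.

Let g_lip : exists2 M, 0 <= M & lip M g.
Proof.
have [C C0 wC] := lip_csup_bounded wL wr.
have Lw0 : 0 <= Lw by rewrite (le_trans _ (pd_bound wL ord0 0)).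
exists (1 * Lw + 1 * C); first by rewrite !mul1r addr_ge0.
apply: lipM => [||p|p]; [exact: chi_lip|exact: lip_tl| |exact: wC].
by have /andP[h1 h2] := chi_le (p ord0 ord0); rewrite ger0_norm.
Qed.

Let g_csup : csup (2 + rw) g.
Proof.
move=> p pr; rewrite /g; have [p2|p2] := leP `|p ord0 ord0| 2; last by rewrite chi_out ?mul0r.
by rewrite wr ?mulr0//; have := enorm_head_tl p; lra.
Qed.

Let FE : {M | lip M F}.
Proof.
apply: cid; have [M M0 PM] := Phi_lip; exists (Lf * (n.+1%:R * M)).
have : lip (Lf * (n.+1%:R * M)) (f \o (fun p : X => \row_i Phi i p)); last exact.
apply: lip_comp => //.
  by rewrite (le_trans _ (pd_bound fL ord0 0)).
by apply: lipm_coor => i; under [X in lip _ X]eq_fun do rewrite mxE; exact: PM.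
Qed.

Let int_F : itg (lebesgue_rV R n.+2) (fun p : TX => F p * \det (Dmx (fcons g Phi) p)) /\
  \int[lebesgue_rV R n.+2]_p (F p * \det (Dmx (fcons g Phi) p)) = 0.
Proof.
have [M M0 PM] := Phi_lip; have [Mg Mg0 gM] := g_lip; have [MF FM] := FE.
have gi := itg_lip_csup gM g_csup.
have [C C0 fC] := lip_csup_bounded fL fr.
pose K := Num.max M Mg.
have consK i : lip K (fcons g Phi i).
  rewrite /fcons; case: unliftP => [j _|_]; first by apply: lipW (PM j); rewrite le_max lexx.
  by apply: lipW gM; rewrite le_max lexx orbT.
have zeroM i : lip M (fcons (fun=> 0) Phi i).
  rewrite /fcons; case: unliftP => [j _|_]; [exact: PM|exact: lipW M0 (lip_cst _)].
split.
  apply: (itg_csup (C := C * (n.+2`!%:R * \prod_(i < n.+2) K)) (r := 2 + rw)).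
  - apply: measurable_funM; first exact: lip_mble FM.
    by apply: mble_detD => i; exists K.
  - move=> p; rewrite normrM; apply: ler_pM => //; first exact: fC.
    exact: (detD_bound (L := fun=> K)).
  - move=> p pr; rewrite (det_row0 (i := ord0)) ?mulr0// => j.
    by rewrite DmxE /fcons unlift_none (csup_pd j g_csup).
have h1 := int_det_dependent fL fr PM gi.
have FK : lip (Num.max MF Mg) F by apply: lipW FM; rewrite le_max lexx.
have gK : lip (Num.max MF Mg) g by apply: lipW gM; rewrite le_max lexx orbT.
have h2 := int_det_parts ord0 zeroM FK gK g_csup.
move: h2; rewrite !upd_fcons h1 => /eqP; rewrite eq_sym oppr_eq0 => /eqP.
exact.
Qed.

Let Phi_out (p : X) : (p ord0 ord0 < 0 -> forall i, \forall q \near p, Phi i q = (phi0 i \o @tl R n) q) /\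
  (1 < p ord0 ord0 -> forall i, \forall q \near p, Phi i q = (phi1 i \o @tl R n) q).
Proof.
split=> h i.
  have : p ord0 ord0 - 1 < p ord0 ord0 < 0 by rewrite h andbT; lra.
  move=> /near_head; apply: filterS => q /andP[_ q0].
  by rewrite /Phi clamp01_0 ?ltW// mul0r addr0.
have : 1 < p ord0 ord0 < p ord0 ord0 + 1 by rewrite h/=; lra.
move=> /near_head; apply: filterS => q /andP[q0 _].
by rewrite /Phi clamp01_1 ?ltW// mul1r /D addrC subrK.
Qed.

Let pd_Phi_lift p i j : `|pd (lift ord0 j) (Phi i) p| <= L i.
Proof.
apply: pd_dir_bound => // h; rewrite /Phi tl_lift.
have -> : (p + h *: (e_ (lift ord0 j) : X)) ord0 ord0 = p ord0 ord0.
  by rewrite !mxE (negbTE (neq_lift _ _)) andbF mulr0 addr0.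
have /andP[] := clamp01_le (p ord0 ord0); move: (clamp01 _) => c c0 c1.
have := phi0L i (tl p + h *: (e_ j : V)) (tl p); have := phi1L i (tl p + h *: (e_ j : V)) (tl p).
rewrite addrAC subrr add0r enormZ enorm_delta mulr1 /D; move: (L i * _) => d.
move=> /ler_normlP[h1 h2] /ler_normlP[h3 h4]; apply/ler_normlP; split; nra.
Qed.

Let w0 (p : X) : R := if 0 <= p ord0 ord0 <= 1 then eta else 0.

Let pd_Phi_0 p i : `|pd ord0 (Phi i) p| <= L i * w0 p.
Proof.
have z (h : V -> R) : pd ord0 (h \o @tl R n) p = 0.
  apply/eqP; rewrite -normr_le0; apply: pd_dir_bound => // s.
  by rewrite /= tl_ord0 subrr normr0 mul0r.
rewrite /w0; have [P0 P1] := Phi_out p.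
have [t0|t0] := ltP (p ord0 ord0) 0; first by rewrite mulr0 (pd_near _ (P0 t0 i)) z normr0.
have [t1|t1] := leP (p ord0 ord0) 1; last by rewrite mulr0 (pd_near _ (P1 t1 i)) z normr0.
apply: pd_dir_bound => [|h]; first exact: mulr_ge0.
rewrite /Phi tl_ord0 opprD addrACA subrr add0r -mulrBl normrM mulrC.
apply: ler_pM => //; first by rewrite mulrC; exact: phi01.
have := clamp01_lip (@lip_coor R n.+2 ord0) (p + h *: (e_ ord0 : X)) p.
by rewrite addrAC subrr add0r enormZ enorm_delta mulr1 mul1r.
Qed.

Let cof_lift p k : `|cofactor (Q p) ord0 (lift ord0 k)| <= n.+1`!%:R * (\prod_i L i * w0 p).
Proof.
rewrite /cofactor normrM normrX normrN1 expr1n mul1r.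
have -> : w0 p = \prod_(j < n.+1) (if j == ord0 then w0 p else 1).
  by rewrite (bigD1 ord0)//= big1 ?mulr1// => j /negbTE ->.
apply: det_bound2 => i j; rewrite mxE mxE DmxE /fcons liftK.
(* Deleting a spatial column leaves the column of the homotopy parameter in position 0; it alone
   carries the factor [w0]. *)
case: eqP => [->|/eqP j0].
  rewrite (_ : lift (lift ord0 k) ord0 = ord0); first exact: pd_Phi_0.
  exact/val_inj.
rewrite mulr1; case: (unliftP ord0 (lift (lift ord0 k) j)) => [l ->|]; first exact: pd_Phi_lift.
move=> /(congr1 val) /= /eqP; rewrite /bump addn_eq0 => /andP[_ /eqP jz].
by case/eqP: j0; exact/val_inj.
Qed.

Let pd_g_lift p k : derivable (w \o @tl R n) p (e_ (lift ord0 k)) ->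
  `|pd (lift ord0 k) g p| <= `|pd k w (tl p)|.
Proof.
move=> /derivable_tl dw.
have E : dq g (lift ord0 k) p = fun h => chi (p ord0 ord0) * dq w k (tl p) h.
  apply/funext => h; rewrite /dq /g tl_lift.
  have -> : (p + h *: (e_ (lift ord0 k) : X)) ord0 ord0 = p ord0 ord0.
    by rewrite !mxE (negbTE (neq_lift _ _)) andbF mulr0 addr0.
  by ring.
rewrite pd_dq E.
have -> : lim (chi (p ord0 ord0) * dq w k (tl p) h @[h --> 0^']) = chi (p ord0 ord0) * pd k w (tl p).
  apply: (cvg_lim (@Rhausdorff R)); apply: cvgM; first exact: cvg_cst.
  by rewrite pd_dq; exact/derivable_dq.
rewrite normrM -[leRHS]mul1r ler_wpM2r//.
by have /andP[h1 h2] := chi_le (p ord0 ord0); rewrite ger0_norm.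
Qed.

Let pd_g_0 p al be : (\forall q \near p, chi ((q : X) ord0 ord0) = al + be * q ord0 ord0) ->
  pd ord0 g p = be * w (tl p).
Proof.
move=> H; rewrite (_ : pd ord0 g p = pd ord0 (fun q => (al + be * q ord0 ord0) * w (tl q)) p); last first.
  by apply: pd_near; apply: filterS H => q; rewrite /g => ->.
rewrite pd_dq; apply: (cvg_lim (@Rhausdorff R)); apply: cvg_near_cst; near=> h.
have h0 : h != 0 by near: h; exact: nbhs_dnbhs_neq.
rewrite /dq tl_ord0 !mxE !eqxx/= mulr1; field.
Unshelve. all: by end_near. Qed.

Let I0 : set R := `]-1, 0[%classic.
Let I1 : set R := `]1, 2[%classic.
Let g0 x := w x * f (\row_i phi0 i x) * \det (Dmx phi0 x).
Let g1 x := w x * f (\row_i phi1 i x) * \det (Dmx phi1 x).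

(** The excluded values are the corners of [chi]. Elsewhere [chi] is affine near [p]; where its
    slope is nonzero, [Phi] coincides near [p] with [phi0] or [phi1], and the cofactor is the
    Jacobian of that end map. *)
Let first_term (p : X) : p ord0 ord0 != -1 -> p ord0 ord0 != 0 -> p ord0 ord0 != 1 -> p ord0 ord0 != 2 ->
  F p * (pd ord0 g p * cofactor (Q p) ord0 ord0) = \1_I0 (p ord0 ord0) * g0 (tl p) - \1_I1 (p ord0 ord0) * g1 (tl p).
Proof.
move=> n1 n2 n3 n4; set t := p ord0 ord0.
have cofE (ph : 'I_n.+1 -> V -> R) : (forall i, \forall q \near p, Phi i q = (ph i \o @tl R n) q) ->
    cofactor (Q p) ord0 ord0 = \det (Dmx ph (tl p)).
  move=> H; rewrite /cofactor addn0 expr0 mul1r; congr (\det _); apply/matrixP => i j.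
  by rewrite mxE mxE !DmxE /fcons liftK (pd_near _ (H i)) pd_tl.
have FE' (ph : 'I_n.+1 -> V -> R) : (forall i, \forall q \near p, Phi i q = (ph i \o @tl R n) q) ->
    F p = f (\row_i ph i (tl p)).
  by move=> H; congr f; apply/rowP => i; rewrite !mxE (nbhs_singleton (H i)).
have [P0 P1] := Phi_out p.
have near_t c d : c < t -> t < d -> \forall q \near p, c < (q : X) ord0 ord0 < d.
  by move=> h1 h2; apply: near_head; rewrite h1.
have i0 : \1_I0 t = ((-1 < t) && (t < 0))%:R :> R by rewrite indicE /I0 mem_setE in_itv.
have i1 : \1_I1 t = ((1 < t) && (t < 2))%:R :> R by rewrite indicE /I1 mem_setE in_itv.
rewrite i0 i1.
have [t1|t1|t1] := ltgtP t (-1); last by case/negP: n1; apply/eqP.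
  rewrite (@pd_g_0 p 0 0); last first.
    have := @near_t (t - 1) (-1); rewrite ltrBlDr ltrDl ltr01 => /(_ isT t1).
    by apply: filterS => q /andP[_ h]; rewrite chi_zero ?mul0r ?addr0//; left; rewrite ltW.
  rewrite mul0r mul0r mulr0 (_ : 1 < t = false); last by apply/negbTE; rewrite -leNgt; lra.
  by rewrite !mul0r subrr.
have [t2|t2|t2] := ltgtP t 0; last by case/negP: n2; apply/eqP.
  rewrite (@pd_g_0 p 1 1); last first.
    by have := near_t _ _ t1 t2; apply: filterS => q /andP[h1 h2]; rewrite chi_up ?ltW// mul1r addrC.
  rewrite (cofE _ (P0 t2)) (FE' _ (P0 t2)) (_ : 1 < t = false); last by apply/negbTE; rewrite -leNgt; lra.
  by rewrite !mul1r mul0r subr0 /g0; ring.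
have [t3|t3|t3] := ltgtP t 1; last by case/negP: n3; apply/eqP.
  rewrite (@pd_g_0 p 1 0); last first.
    by have := near_t _ _ t2 t3; apply: filterS => q /andP[h1 h2]; rewrite chi_one ?ltW// mul0r addr0.
  by rewrite /= !mul0r mulr0 subrr.
have [t4|t4|t4] := ltgtP t 2; last by case/negP: n4; apply/eqP.
  rewrite (@pd_g_0 p 2 (-1)); last first.
    by have := near_t _ _ t3 t4; apply: filterS => q /andP[h1 h2]; rewrite chi_down ?ltW// mulN1r.
  rewrite (cofE _ (P1 t3)) (FE' _ (P1 t3)) /= mul0r mul1r sub0r /g1; ring.
rewrite (@pd_g_0 p 0 0); last first.
  have := @near_t 2 (t + 1); rewrite ltrDl ltr01 => /(_ t4 isT).
  by apply: filterS => q /andP[h _]; rewrite chi_zero ?mul0r ?addr0//; right; rewrite ltW.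
by rewrite /= !mul0r mulr0 subrr.
Qed.

Let lift_term p : (forall k, derivable (w \o @tl R n) p (e_ (lift ord0 k))) ->
  `|F p * \sum_k (pd (lift ord0 k) g p * cofactor (Q p) ord0 (lift ord0 k))| <=
  (n.+1`!%:R * b * eta * \prod_i L i) * (\1_(`[0, 1]%classic : set R) (p ord0 ord0) * \sum_k `|pd k w (tl p)|).
Proof.
move=> dw; rewrite mulr_sumr !mulr_sumr (le_trans (ler_norm_sum _ _ _))//; apply: ler_sum => k _.
have LL : 0 <= \prod_i L i by exact: prodr_ge0.
rewrite (normrM (F p)) (normrM (pd _ g p)) indicE mem_setE in_itv /=.
have := cof_lift p k; rewrite /w0; case: ifPn => t01 hc; last first.
  have -> : cofactor (Q p) ord0 (lift ord0 k) = 0.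
    by apply/eqP; rewrite -normr_le0 (le_trans hc)// !mulr0.
  by rewrite normr0 !mulr0 mul0r mulr0.
rewrite mul1r.
have [z|nz] := eqVneq (pd k w (tl p)) 0.
  have /(le_trans (pd_g_lift (dw k))) : `|pd k w (tl p)| <= 0 by rewrite z normr0.
  by rewrite normr_le0 => /eqP ->; rewrite z normr0 !(mul0r, mulr0).
have Fb : `|F p| <= b.
  by rewrite /F; have := fb nz (clamp01_le (p ord0 ord0)); congr (`|f _| <= _).
have -> : n.+1`!%:R * b * eta * (\prod_i L i) * `|pd k w (tl p)| =
   b * (`|pd k w (tl p)| * (n.+1`!%:R * ((\prod_i L i) * eta))) by ring.
by apply: ler_pM => //; apply: ler_pM => //; exact: pd_g_lift.
Qed.

(** The lateral term of Stokes' theorem contains the gradient of the weight, so [f] has to be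
    bounded by [b] only along homotopy tracks starting where this gradient is nonzero. Taking
    [b = 0] turns the estimate into invariance under homotopy. *)
Lemma homotopy_estimate :
  `|tint w f phi0 - tint w f phi1| <=
  n.+1`!%:R * b * eta * (\prod_i L i) * \sum_k \int[mu]_x `|pd k w x|.
Proof.
have [iF F0] := int_F.
have [C C0 fC] := lip_csup_bounded fL fr.
have wi := itg_lip_csup wL wr.
have gi (ph : 'I_n.+1 -> V -> R) : (forall i, lip (L i) (ph i)) ->
    itg mu (fun x : T => w x * f (\row_i ph i x) * \det (Dmx ph x)).
  move=> phL.
  have [M [M0 phM]] : exists M, 0 <= M /\ forall i, lip M (ph i).
    exists (\sum_i L i); split; first exact: sumr_ge0.
    by move=> i; apply: lipW (phL i); rewrite (bigD1 i)//= lerDl sumr_ge0.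
  have fM : lip (Lf * (n.+1%:R * M)) (f \o (fun x : V => \row_i ph i x)).
    apply: lip_comp => //; first by rewrite (le_trans _ (pd_bound fL ord0 0)).
    by apply: lipm_coor => i; under [X in lip _ X]eq_fun do rewrite mxE; exact: phM.
  apply: (itgMb (C := n.+1`!%:R * \prod_i L i)).
  - by apply: (itgMb wi (lip_mble fM)) => x; exact: fC.
  - by apply: mble_detD => i; exists (L i).
  - by apply: detD_bound.
have m0 : lebesgue_measure I0 = 1%:E.
  by rewrite /I0 lebesgue_measure_itv/= lte_fin ltrN10; congr EFin; ring.
have m1 : lebesgue_measure I1 = 1%:E.
  by rewrite /I1 lebesgue_measure_itv/= lte_fin ltr1n; congr EFin; ring.
have m2 : lebesgue_measure (`[0, 1]%classic : set R) = 1%:E.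
  by rewrite lebesgue_measure_itv/= lte_fin ltr01 oppr0 adde0.
have [j0 J0] := int_indic_fin (measurable_itv _) m0.
have [j1 J1] := int_indic_fin (measurable_itv _) m1.
have [j2 J2] := int_indic_fin (measurable_itv _) m2.
have [a0 A0] := int_peel j0 (gi _ phi0L); have [a1 A1] := int_peel j1 (gi _ phi1L).
have ipd k : itg mu (fun x : T => `|pd k w x|).
  exact/itg_norm/(itg_csup (pd_mble wL k) (pd_bound wL k) (csup_pd k wr)).
have iS : itg mu (fun x : T => \sum_k `|pd k w x|) by apply: itg_sum => k _; exact: ipd.
have [a2 A2] := int_peel j2 iS.
pose A (p : TX) := \1_I0 (p ord0 ord0) * g0 (tl p) - \1_I1 (p ord0 ord0) * g1 (tl p).
have iA : itg (lebesgue_rV R n.+2) A := itgB a0 a1.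
have EA : \int[lebesgue_rV R n.+2]_p A p = tint w f phi0 - tint w f phi1.
  have E0 : (\int[@lebesgue_measure R]_t (\1_I0 t : R)) * tint w f phi0 = tint w f phi0 := etrans (congr1 (fun x => x * _) J0) (mul1r _).
  have E1 : (\int[@lebesgue_measure R]_t (\1_I1 t : R)) * tint w f phi1 = tint w f phi1 := etrans (congr1 (fun x => x * _) J1) (mul1r _).
  exact: etrans (intB a0 a1) (congr2 (fun x y => x - y) (etrans A0 E0) (etrans A1 E1)).
set K := n.+1`!%:R * b * eta * _.
have EK : \int[lebesgue_rV R n.+2]_p (K * (\1_(`[0, 1]%classic : set R) (p ord0 ord0) * \sum_k `|pd k w (tl p)|)) =
    K * \sum_k \int[mu]_x `|pd k w x|.
  have E2 : (\int[@lebesgue_measure R]_t (\1_(`[0, 1]%classic : set R) t : R)) * \int[mu]_x \sum_k `|pd k w x| =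
      \sum_k \int[mu]_x `|pd k w x|.
    by apply: (etrans (etrans (congr1 (fun x => x * _) J2) (mul1r _))); rewrite int_sum// => k _; exact: ipd.
  exact: etrans (intZ K a2) (congr1 (fun x => K * x) (etrans A2 E2)).
have E3 : - (\int[lebesgue_rV R n.+2]_p A p) = \int[lebesgue_rV R n.+2]_p (F p * \det (Dmx (fcons g Phi) p) - A p).
  by rewrite (intB iF iA) F0 sub0r.
rewrite -EK -EA -normrN E3.
apply: int_norm_le_ae; [exact: itgB|exact: (itgZ K a2)|].
have wX : lip Lw (w \o @tl R n).
  by apply: lip_tl => //; rewrite (le_trans _ (pd_bound wL ord0 0)).
have h1 := @head_null R n (-1); have h2 := @head_null R n 0.
have h3 := @head_null R n 1; have h4 := @head_null R n 2; have h5 := lip_ae_derivable_all wX.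
have h12 : {ae lebesgue_rV R n.+2, forall p : TX, p ord0 ord0 != -1 /\ p ord0 ord0 != 0}.
  by apply: filterS2 h1 h2 => p.
have h34 : {ae lebesgue_rV R n.+2, forall p : TX, p ord0 ord0 != 1 /\ p ord0 ord0 != 2}.
  by apply: filterS2 h3 h4 => p.
apply: filterS3 h5 h12 h34 => p dw [n1 n2] [n3 n4].
have -> : \det (Dmx (fcons g Phi) p) = pd ord0 g p * cofactor (Q p) ord0 ord0 +
    \sum_k (pd (lift ord0 k) g p * cofactor (Q p) ord0 (lift ord0 k)).
  by rewrite -(upd_fcons (fun=> 0) g) det_upd big_ord_recl.
rewrite mulrDr first_term// addrAC subrr add0r.
by apply: lift_term => k; exact: dw.
Qed.

End estimate.

End homotopy.

(** * Smoothing functions of bounded fractional variation *)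

Section translation_bounds.
Context (R : realType) (n : nat).
Local Notation V := 'rV[R]_n.+1.
Local Notation T := 'rV[measurableTypeR R]_n.+1.
Local Notation mu := (lebesgue_rV R n.+1).
Local Notation e_ j := (delta_mx ord0 j : V).
Implicit Types (f g h u w : V -> R).

Lemma le_add_div (r A D : R) : (forall m : nat, r <= A + D / m.+1%:R) -> r <= A.
Proof.
move=> H; apply/ler_addgt0Pr => e e0; have D1 : 0 < `|D| + 1 by rewrite ltr_wpDl.
have [k _ /(_ k (leqnn k)) Hk] := near_infty_natSinv_lt (PosNum (divr_gt0 e0 D1)).
apply: (le_trans (H k)); rewrite lerD2l; move: Hk => /= Hk.
apply: (@le_trans _ _ ((`|D| + 1) * k.+1%:R^-1)).
  by rewrite ler_wpM2r// (le_trans (ler_norm D))// lerDl.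
by rewrite mulrC -ler_pdivlMr// ltW.
Qed.

Lemma taylor_step C h G B (v : V) : taylor C h G -> (forall j x, `|G j x| <= B) ->
  forall x, `|h (x + v) - h x| <= n.+1%:R * B * enorm v + C * enorm v ^+ 2.
Proof.
move=> ht GB x; rewrite -[h (x + v) - h x](subrK (\sum_j v ord0 j * G j x)) addrC.
rewrite (le_trans (ler_normD _ _))//; apply: lerD; last exact: (ht x v).
rewrite (le_trans (ler_norm_sum _ _ _))// -mulrA mulr_natl -[X in _ *+ X](card_ord n.+1) -sumr_const.
apply: ler_sum => j _; rewrite normrM mulrC; apply: ler_pM => //; exact: coor_le.
Qed.

(** The segment is cut into [m.+1] equal pieces. The quadratic remainders add up to [O(1/m)] and
    disappear in the limit. *)
Lemma taylor_lip C h G B : taylor C h G -> (forall j x, `|G j x| <= B) -> lip (n.+1%:R * B) h.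
Proof.
move=> ht GB y x; apply: (@le_add_div _ _ (C * enorm (y - x) ^+ 2)) => m.
pose v := m.+1%:R^-1 *: (y - x).
have m0 : m.+1%:R != 0 :> R by rewrite pnatr_eq0.
have step k : `|h (x + k%:R *: v) - h x| <= k%:R * (n.+1%:R * B * enorm v + C * enorm v ^+ 2).
  elim: k => [|k IH]; first by rewrite scale0r addr0 subrr normr0 mul0r.
  rewrite -natr1 scalerDl scale1r addrA mulrDl mul1r.
  rewrite -[X in `|X|](_ : (h (x + k%:R *: v + v) - h (x + k%:R *: v)) + (h (x + k%:R *: v) - h x) = _); last by ring.
  by rewrite (le_trans (ler_normD _ _))// addrC lerD//; exact: taylor_step ht GB _.
have := step m.+1; rewrite /v scalerA divff// scale1r (_ : x + (y - x) = y) ?enormZ ?normfV ?(ger0_norm (ler0n _ _)); last by rewrite addrC subrK.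
by move: (m.+1%:R) m0 (enorm _) (n.+1%:R) => q q0 d N; congr (_ <= _); field.
Qed.

Lemma L1_shift_step C h G r (v : V) : taylor C h G -> csup r h -> (forall j, csup r (G j)) ->
  (forall j, itg mu (G j : T -> R)) -> itg mu (h : T -> R) -> 0 <= C -> 0 <= r -> enorm v <= 1 ->
  \int[mu]_x `|h ((x : V) + v) - h x| <= enorm v * (\sum_j \int[mu]_x `|G j x|) + C * (2 * (r + 1)) ^+ n.+1 * enorm v ^+ 2.
Proof.
move=> ht hr Gr Gi hi C0 r0 v1.
have [hi' _] := int_rVshift v hi.
have iB : itg mu (fun x : T => `|h ((x : V) + v) - h x|) by apply: itg_norm; exact: itgB.
have iS : itg mu (fun x : T => enorm v * \sum_j `|G j x|).
  by apply: itgZ; apply: itg_sum => j _; exact: itg_norm.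
have ic := itgZ (C * enorm v ^+ 2) (@itg_cube R n (r + 1)).
apply: (@le_trans _ _ (\int[mu]_x (enorm v * (\sum_j `|G j x|) + C * enorm v ^+ 2 * \1_(cube (r + 1) : set T) x))).
  apply: int_le => // [|x]; first exact: itgD.
  have [xr|xr] := leP (enorm (x : V)) (r + 1); last first.
    have xr' : r < enorm (x : V) by apply: lt_trans xr; rewrite ltrDl.
    have xvr : r < enorm ((x : V) + v) by have := enormD ((x : V) + v) (- v); rewrite enormN addrK; lra.
    rewrite (hr _ xr') (hr _ xvr) subrr normr0; apply: addr_ge0.
      by rewrite mulr_ge0 ?enorm_ge0 ?sumr_ge0.
    by apply: mulr_ge0; [rewrite mulr_ge0 ?sqr_ge0|rewrite indicE ler0n].
  rewrite indicE mem_set ?mulr1; last exact: cube_ball.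
  rewrite -[h (_ + v) - h x](subrK (\sum_j v ord0 j * G j x)) addrC.
  rewrite (le_trans (ler_normD _ _))//; apply: lerD; last exact: (ht (x : V) v).
  rewrite (le_trans (ler_norm_sum _ _ _))// mulr_sumr; apply: ler_sum => j _.
  by rewrite normrM ler_wpM2r//; exact: coor_le.
rewrite (intD iS ic) (intZ _ (@itg_cube R n (r + 1))) int_cube; last by rewrite addr_ge0.
rewrite intZ; last by apply: itg_sum => j _; exact: itg_norm.
rewrite int_sum; last by move=> j _; exact: itg_norm.
by rewrite [X in _ <= _ + X]mulrAC.
Qed.

(** The same subdivision as in [taylor_lip], now in [L^1]: each short translation costs its length
    times the norm of the gradient plus a quadratic error, and translation invariance makes all
    pieces alike. *)
Lemma L1_shift C h G r : taylor C h G -> csup r h -> (forall j, csup r (G j)) ->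
  (forall j, itg mu (G j : T -> R)) -> itg mu (h : T -> R) -> 0 <= C -> 0 <= r -> forall v,
  \int[mu]_x `|h ((x : V) + v) - h x| <= enorm v * \sum_j \int[mu]_x `|G j x|.
Proof.
move=> ht hr Gr Gi hi C0 r0 v.
set A := \sum_j _; pose D := C * (2 * (r + 1)) ^+ n.+1.
have [k0 v0] : exists k0 : nat, enorm v <= k0.+1%:R.
  have [k _ /(_ k (leqnn k)) Hk] := nbhs_infty_ger (enorm v).
  by exists k; apply: (le_trans Hk); rewrite ler_nat.
apply: (@le_add_div _ _ (D * enorm v ^+ 2)) => m.
(* At least [enorm v] pieces, so that each one has length at most 1, as [L1_shift_step] requires. *)
pose q : R := (m + k0).+1%:R.
have q0 : q != 0 by rewrite pnatr_eq0.
have qp : 0 < q by rewrite ltr0n.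
pose s := q^-1 *: v.
have s1 : enorm s <= 1.
  rewrite enormZ normfV (ger0_norm (ltW qp)) ler_pdivrMl// mulr1 (le_trans v0)// ler_nat.
  by rewrite ltnS leq_addl.
have step k : \int[mu]_x `|h ((x : V) + k%:R *: s) - h x| <= k%:R * (enorm s * A + D * enorm s ^+ 2).
  elim: k => [|k IH].
    by rewrite mul0r; under eq_Rintegral do rewrite scale0r addr0 subrr normr0; rewrite int0.
  have [i1 _] := int_rVshift (k%:R *: s) hi.
  have [i2 _] := int_rVshift (k.+1%:R *: s) hi.
  have i3 : itg mu (fun x : T => `|h ((x : V) + s) - h x|).
    by apply: itg_norm; apply: itgB => //; have [] := int_rVshift s hi.
  have [i4 E] := int_rVshift (k%:R *: s) i3.
  have i5 : itg mu (fun x : T => `|h ((x : V) + k%:R *: s) - h x|) by apply: itg_norm; exact: itgB.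
  apply: (@le_trans _ _ (\int[mu]_x (`|h (rVshift (k%:R *: s) x + s) - h (rVshift (k%:R *: s) x)| + `|h ((x : V) + k%:R *: s) - h x|))).
    apply: int_le => [||x]; [apply: itg_norm; exact: itgB|exact: itgD|].
    rewrite -natr1 scalerDl scale1r addrA /rVshift.
    rewrite -[X in `|X|](_ : (h ((x : V) + k%:R *: s + s) - h ((x : V) + k%:R *: s)) + (h ((x : V) + k%:R *: s) - h x) = _); last by ring.
    exact: ler_normD.
  rewrite (intD i4 i5) -natr1 mulrDl mul1r addrC lerD//.
  by apply: (le_trans _ (L1_shift_step ht hr Gr Gi hi C0 r0 s1)); rewrite le_eqVlt; apply/orP; left; apply/eqP; exact: E.
have := step (m + k0).+1; rewrite -/q /s scalerA divff// scale1r enormZ normfV (ger0_norm (ltW qp)).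
move=> H; apply: (le_trans H).
have -> : q * (q^-1 * enorm v * A + D * (q^-1 * enorm v) ^+ 2) = enorm v * A + D * enorm v ^+ 2 / q by field.
rewrite lerD2l; apply: ler_wpM2l.
  by rewrite mulr_ge0 ?sqr_ge0// /D mulr_ge0// exprn_ge0// mulr_ge0// addr_ge0.
by rewrite lef_pV2 ?posrE ?ltr0n// ler_nat ltnS leq_addr.
Qed.

(** The mollification is an average of translates by vectors of length at most [e]. Duality and
    Fubini bring the average outside the [L^1] norm. *)
Lemma cv_L1_close e r g S D : 0 < e -> itg mu (g : T -> R) -> csup r g -> (forall x, `|g x| <= D) -> 0 <= S ->
  (forall v, enorm v <= e -> \int[mu]_x `|g ((x : V) + v) - g x| <= S) ->
  \int[mu]_x `|cv e g x - g x| <= S.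
Proof.
move=> e0 gi gr gD S0 H; have ci := itg_cv e0 gi gr.
apply: L1_dual; first exact: itgB.
move=> L r' f fL fr f1; have fi := itg_lip_csup fL fr.
pose h (p : T * T) := mol e p.1 * ((g ((p.2 : V) + p.1) - g p.2) * f p.2).
have ms : measurable_fun setT (fun p : T * T => ((p.2 : V) + p.1 : T)).
  apply: measurable_fun_rV => i.
  rewrite (_ : (fun x => _) = (fun p : T * T => p.2 ord0 i + p.1 ord0 i)); last first.
    by apply/funext => p; rewrite !mxE.
  by apply: measurable_funD; apply: (measurableT_comp (measurable_coor _)); [exact: measurable_snd|exact: measurable_fst].
have mh : mble h.
  apply: measurable_funM; first exact: (measurableT_comp (itg_mble (@mol_itg R n e e0)) measurable_fst).
  apply: measurable_funM; last exact: (measurableT_comp (itg_mble fi) measurable_snd).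
  apply: measurable_funB; first exact: (measurableT_comp (itg_mble gi) ms).
  exact: (measurableT_comp (itg_mble gi) measurable_snd).
have hd (z x : T) : `|h (z, x)| <= (D + D) * mol e z * `|f x|.
  rewrite /h/= (normrM (mol e z)) (ger0_norm (mol_ge0 e0 _)) normrM mulrA.
  rewrite ler_wpM2r// mulrC ler_wpM2r ?mol_ge0// (le_trans (ler_normB _ _))//.
  by rewrite lerD.
have mi := @mol_itg R n e e0.
have i1 := itgZ (D + D) mi; have i2 := itg_norm fi.
have -> : \int[mu]_x ((cv e g x - g x) * f x) = \int[mu]_x \int[mu]_z h (z, x).
  apply: eq_Rintegral => x _; have [i3 ->] := cv_shift e0 (x : V) gi.
  have -> : g x = \int[mu]_z (mol e z * g x).
    under eq_Rintegral do rewrite mulrC.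
    by rewrite intZ ?int_mol ?mulr1.
  have i4 : itg mu (fun z : T => mol e z * g x).
    by under [X in itg _ X]eq_fun do rewrite mulrC; exact: itgZ.
  rewrite -(intB i3 i4) mulrC -intZ; last exact: itgB.
  by apply: eq_Rintegral => z _; rewrite /h/= -mulrBr; ring.
rewrite -(dom_fubini mh hd i1 i2).
have -> : S = \int[mu]_z (S * mol e z) by rewrite intZ// int_mol// mulr1.
apply: int_norm_le; [exact: dom_itg_fubini1 mh hd i1 i2|exact: itgZ|].
move=> z; have [ze|ze] := leP (enorm (z : V)) e; last first.
  rewrite mol_csup// mulr0 (_ : \int[mu]_y h (z, y) = 0) ?normr0// -(@int0 _ _ _ mu).
  by apply: eq_Rintegral => x _; rewrite /h /= mol_csup// mul0r.
have [i3 _] := int_rVshift (z : V) gi.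
have i5 : itg mu (fun x : T => (g ((x : V) + z) - g x) * f x).
  by apply: (itgMb (itgB i3 gi) (itg_mble fi)) => x; exact: f1.
rewrite /h /= (intZ _ i5) normrM (ger0_norm (mol_ge0 e0 _)) mulrC ler_wpM2r ?mol_ge0//.
apply: (le_trans _ (H z ze)); apply: int_norm_le => // [|x]; first exact/itg_norm/itgB.
by rewrite normrM -[leRHS]mulr1 ler_wpM2l.
Qed.

End translation_bounds.

Section frac_var.
Context (R : realType) (n : nat).
Local Notation V := 'rV[R]_n.+1.
Local Notation T := 'rV[measurableTypeR R]_n.+1.
Local Notation mu := (lebesgue_rV R n.+1).
Local Notation e_ j := (delta_mx ord0 j : V).
Implicit Types (f g h u w : V -> R).

Lemma coor_taylor (i : 'I_n.+1) : taylor 0 (fun x : V => x ord0 i) (fun k _ => (k == i)%:R).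
Proof.
move=> x v; rewrite (bigD1 i)//= eqxx mulr1 big1 ?addr0 => [|k /negbTE ->]; last by rewrite mulr0.
by rewrite mxE (_ : _ - _ = 0) ?normr0 ?mul0r//; ring.
Qed.

Lemma pd_coor (i k : 'I_n.+1) (x : V) : pd k (fun x : V => x ord0 i) x = (k == i)%:R.
Proof. by rewrite (taylor_pd k (coor_taylor i)). Qed.

Lemma closed_eball (r : R) : closed [set x : V | enorm x <= r].
Proof.
rewrite (_ : [set x : V | enorm x <= r] = @enorm R n.+1 @^-1` [set t | t <= r])//.
by apply: closed_comp; [move=> x _; exact: enorm_continuous|exact: closed_le].
Qed.

Lemma compact_eball (r : R) : compact [set x : V | enorm x <= r].
Proof.
apply: bounded_closed_compact; last exact: closed_eball.
exists r; split; first exact: num_real.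
by move=> M rM x /= xr; rewrite (le_trans (mxnorm_enorm x))// (le_trans xr)// ltW.
Qed.

Lemma csup_compact r f : csup r f -> compact (closure [set x | f x != 0]).
Proof.
move=> fr; apply: (subclosed_compact (@closed_closure _ _) (@compact_eball r)).
have /closure_id E := @closed_eball r; rewrite E.
apply: closure_subset => x /=; apply: contraNP => /negP; rewrite -ltNge => /fr ->; exact: eqxx.
Qed.

(* Completing [f] by the coordinates other than the [j]-th one turns the
   determinant into the [j]-th partial derivative, up to sign. *)
Lemma det_partial f j : exists2 s : R, `|s| = 1 &
  forall x, \det (Dmx (fcons f (fun i x => x ord0 (lift j i))) x) = pd j f x * s.
Proof.
exists ((-1) ^+ (0 + j)%N); first by rewrite normrX normrN1 expr1n.
move=> x; rewrite (expand_det_row _ ord0) (bigD1 j)//= big1 ?addr0.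
  rewrite DmxE /fcons unlift_none; congr (_ * _); rewrite /cofactor -[RHS]mulr1; congr (_ * _).
  rewrite -(@det1 _ n); congr (\det _); apply/matrixP => i k.
  by rewrite !mxE liftK; have := pd_coor (lift j i) (lift j k) x; rewrite /pd => ->; rewrite (inj_eq lift_inj) eq_sym.
move=> k kj; rewrite /cofactor; case: (unliftP j k) => [l kl|kj']; last by rewrite kj' eqxx in kj.
rewrite (det_row0 (i := l)) ?mulr0// => m; rewrite mxE mxE DmxE /fcons liftK.
by rewrite pd_coor -kl eq_sym (negbTE (neq_lift _ _)).
Qed.

(** Scaled to Hoelder constant 1 and completed by coordinate functions, [f] competes in the supremum
    defining [frac_var]. *)
Lemma frac_var_pd a u W j f L r M : itg mu (u : T -> R) -> (frac_var a u <= W%:E)%E -> lip L f -> csup r f -> 0 < M -> hol a M f ->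
  `|\int[mu]_x (u x * pd j f x)| <= W * M.
Proof.
move=> ui uW fL fr M0 fM.
pose f' x := M^-1 * f x.
have f'L := lipZ M^-1 fL; have L0 : 0 <= L by rewrite (le_trans _ (pd_bound fL ord0 0)).
have [s s1 Es] := det_partial f' j.
have Mi : 0 <= M^-1 by rewrite invr_ge0 ltW.
have : ((`| \int[mu]_x (u x * \det (Dmx (fcons f' (fun i x => x ord0 (lift j i))) x)) |)%:E <= W%:E)%E.
  apply: le_trans uW; apply: ereal_sup_ubound; exists f', (fun i x => x ord0 (lift j i)); split => //.
  - by apply: (csup_compact (r := r)); exact: csupMr.
  - by apply/LipP; exists (`|M^-1| * L) => //; rewrite mulr_ge0.
  - apply/Lipc_le => // x y; rewrite -mulrBr normrM (ger0_norm Mi) ler_pdivrMl//.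
    by rewrite mul1r.
  - move=> i; apply/Lipc_le => // x y; rewrite mul1r powRr1 ?enorm_ge0//.
    by have := lip_coor (lift j i) x y; rewrite mul1r.
rewrite lee_fin; have -> : \int[mu]_x (u x * \det (Dmx (fcons f' (fun i x => x ord0 (lift j i))) x)) =
   \int[mu]_x (u x * pd j f x * (M^-1 * s)).
  apply: eq_Rintegral => x _; rewrite Es.
  have -> : pd j f' x = M^-1 * pd j f x.
    have [d|nd] := pselect (derivable f x (e_ j)); last first.
      rewrite (pd_ndvg nd) mulr0; apply: pd_ndvg => /derivable_dq d; apply: nd; apply/derivable_dq.
      have -> : dq f j x = fun t : R => M * dq f' j x t.
        by apply/funext => t; rewrite /dq /f' -mulrBr [RHS]mulrCA mulVKf// gt_eqF.
      by apply: is_cvgM => //; exact: is_cvg_cst.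
    have dc : derivable (fun _ : V => M^-1) x (e_ j) by exact: derivable_cst.
    rewrite /f' (pdM dc d).
    by rewrite pd_cst mulr0 addr0.
  by ring.
have cs : `|M^-1 * s| = M^-1 by rewrite normrM s1 mulr1 ger0_norm// invr_ge0 ltW.
have -> : \int[mu]_x (u x * pd j f x * (M^-1 * s)) = \int[mu]_x (u x * pd j f x) * (M^-1 * s).
  rewrite RintegralZr//; apply: (itgMb ui (pd_mble fL j)) => x; exact: pd_bound fL j x.
by rewrite normrM cs ler_pdivrMr.
Qed.

End frac_var.

Section smoothing.
Context (R : realType) (n : nat).
Local Notation V := 'rV[R]_n.+1.
Local Notation T := 'rV[measurableTypeR R]_n.+1.
Local Notation mu := (lebesgue_rV R n.+1).
Implicit Types (f g h w : V -> R).
Variables (a W ru : R) (u : V -> R).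
Hypotheses (a0 : 0 <= a) (a1 : a < 1) (W0 : 0 <= W) (ui : itg mu (u : T -> R)) (ur : csup ru u)
  (u1 : forall x, `|u x| <= 1) (uW : (frac_var a u <= W%:E)%E).

Let B : R := n.+1%:R * molK R n.

Let B0 : 0 < B.
Proof. by rewrite mulr_gt0 ?ltr0n// /molK mulr_gt0// exprn_gt0// mulr_gt0// ltr0n. Qed.

(** Interpolation: a function of oscillation at most 2 with a Lipschitz bound is Hoelder of every
    intermediate exponent. *)
Lemma min_powR (t : R) : 0 <= t -> Num.min 2 t <= 2 * t `^ a.
Proof.
move=> t0; have [t1|t1] := leP 1 t.
  have : 1 <= t `^ a by rewrite -(powRr0 t) ler_powR.
  by rewrite ge_min => h; apply/orP; left; lra.
have [->|tn0] := eqVneq t 0; first by rewrite (min_idPr _)// mulr_ge0// powR_ge0.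
have : t <= t `^ a.
  rewrite -[X in X <= _]powRr1//; apply: ger_powR; last exact: ltW.
  by rewrite lt0r tn0 t0/= ltW.
by rewrite ge_min => h; apply/orP; right; have := powR_ge0 t a; lra.
Qed.

Let hol_cv e L r f : 0 < e -> lip L f -> csup r f -> (forall x, `|f x| <= 1) -> hol a (2 * (B / e) `^ a) (cv e f).
Proof.
move=> e0 fL fr f1 x y; have fi := itg_lip_csup fL fr.
have h2 : `|cv e f x - cv e f y| <= 2.
  have -> : 2 = 1 + 1 :> R by ring.
  by rewrite (le_trans (ler_normB _ _))//; apply: lerD; exact: (cv_sup e0 fi f1).
have [C _ ht] := cv_taylor e0 fi.
have := taylor_lip ht (fun j => dcv_sup e0 j fi f1) x y; rewrite mul1r mulrA -/B => h1.
have Be : 0 <= B / e by rewrite divr_ge0// ltW.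
rewrite -mulrA -powRM ?enorm_ge0//.
by apply: (le_trans _ (min_powR (mulr_ge0 Be (enorm_ge0 _)))); rewrite le_min h2 h1.
Qed.

Let cu (e : R) (e0 : 0 < e) : itg mu (cv e u : T -> R) := itg_cv e0 ui ur.

Let TV e := \sum_j \int[mu]_x `|pd j (cv e u) x|.

(** By duality the derivative and the mollifier pass to the test function. A mollified test of sup
    norm 1 has slope at most [B / e], hence the Hoelder constant [2 (B / e)^a] given by
    interpolation, to which [frac_var_pd] applies. *)
Let TVj e j : 0 < e -> \int[mu]_x `|pd j (cv e u) x| <= W * (2 * (B / e) `^ a).
Proof.
move=> e0; have [L L0 cL] := cv_lip e0 ui.
have cr := cv_csup e0 ur.
apply: L1_dual; first exact: (itg_csup (pd_mble cL j) (pd_bound cL j) (csup_pd j cr)).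
move=> Lf r f fL fr f1; have fi := itg_lip_csup fL fr.
have [Lc Lc0 cfL] := cv_lip e0 fi; have cfr := cv_csup e0 fr.
have pdi : itg mu (pd j f : T -> R) := itg_csup (pd_mble fL j) (pd_bound fL j) (csup_pd j fr).
have -> : \int[mu]_x (pd j (cv e u) x * f x) = - \int[mu]_x (u x * pd j (cv e f) x).
  have [_ E] := cv_selfadj e0 pdi ui; rewrite -(cv_pd_lip e0 j fL fr) in E.
  by rewrite (ibp1 j cL fL fr) E.
rewrite normrN; apply: (frac_var_pd j ui uW cfL cfr); last exact: hol_cv e0 fL fr f1.
by rewrite mulr_gt0// powR_gt0// divr_gt0.
Qed.

Let C1 : R := n.+1%:R * (W * (2 * B `^ a)).

Let C10 : 0 <= C1. Proof. by rewrite !mulr_ge0// powR_ge0. Qed.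

Let inv_powR (e : R) : 0 < e -> (e^-1) `^ a = e `^ (- a).
Proof. by move=> e0; rewrite -powR_inv1 ?ltW// -powRrM mulN1r. Qed.

Let TV_le e : 0 < e -> TV e <= C1 * e `^ (- a).
Proof.
move=> e0; apply: (@le_trans _ _ (\sum_(j < n.+1) W * (2 * (B / e) `^ a))).
  by apply: ler_sum => j _; exact: TVj.
rewrite sumr_const card_ord -[leLHS]mulr_natl powRM ?invr_ge0 ?(ltW B0) ?(ltW e0)//.
by rewrite inv_powR// /C1 !mulrA.
Qed.

Let TV_ge0 e : 0 <= TV e. Proof. by apply: sumr_ge0 => j _; exact: int_ge0. Qed.

Let cv_cv e e' : 0 < e -> 0 < e' -> \int[mu]_x `|cv e' (cv e u) x - cv e u x| <= e' * TV e.
Proof.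
move=> e0 e'0; have [C C0 ct] := cv_taylor e0 ui; have cr := cv_csup e0 ur.
have cr' : csup (`|ru| + e) (cv e u) by apply: csupW cr; rewrite lerD2r ler_norm.
have [L L0 cL] := cv_lip e0 ui.
apply: (cv_L1_close e'0 (cu e0) cr (cv_sup e0 ui u1)); first by rewrite mulr_ge0// ltW.
move=> v ve; apply: (@le_trans _ _ (enorm v * TV e)); last by rewrite ler_wpM2r.
have pE j : dcv e u j = pd j (cv e u) by rewrite cv_pd.
have := @L1_shift _ _ C (cv e u) (dcv e u) (`|ru| + e) ct cr' _ _ (cu e0) C0 _ v.
rewrite /TV; under eq_bigr do under eq_Rintegral do rewrite pE.
apply.
- by move=> j; rewrite pE; exact: csup_pd.
- by move=> j; rewrite pE; exact: (itg_csup (pd_mble cL j) (pd_bound cL j) (csup_pd j cr)).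
- by rewrite addr_ge0// ltW.
Qed.

(** Both functions are compared with the double mollification, in which the order of the two scales
    does not matter. *)
Let cv_diff_L1 e e' : 0 < e -> 0 < e' -> \int[mu]_x `|cv e u x - cv e' u x| <= e' * TV e + e * TV e'.
Proof.
move=> e0 e'0; have c1 := cv_cv e0 e'0; have c2 := cv_cv e'0 e0.
have k1 : itg mu (cv e' (cv e u) : T -> R) := itg_cv e'0 (cu e0) (cv_csup e0 ur).
have E := cv_comm e0 e'0 ui ur u1.
have i1 := itg_norm (itgB k1 (cu e0)); have i2 : itg mu (fun x => `|cv e (cv e' u) x - cv e' u x|).
  by rewrite E; exact: itg_norm (itgB k1 (cu e'0)).
apply: (@le_trans _ _ (\int[mu]_x (`|cv e' (cv e u) x - cv e u x| + `|cv e (cv e' u) x - cv e' u x|))).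
  apply: int_le => [||x]; [exact: itg_norm (itgB (cu e0) (cu e'0))|exact: itgD|].
  rewrite E distrC; have -> : cv e' u x - cv e u x = (cv e' (cv e u) x - cv e u x) - (cv e' (cv e u) x - cv e' u x) by ring.
  exact: ler_normB.
by rewrite (intD i1 i2) lerD.
Qed.

Let q : R := 2^-1 `^ (1 - a).

Let q1 : q < 1.
Proof.
have E1 : 1 = 1 `^ (1 - a) :> R by rewrite powR1.
rewrite /q [ltRHS]E1 gt0_ltr_powR ?nnegrE ?invr_ge0 ?subr_gt0//.
by rewrite invf_lt1// ltr1n.
Qed.

Let half_powR e : 0 < e -> (e / 2) `^ (1 - a) = e `^ (1 - a) * q.
Proof. by move=> e0; rewrite powRM// ?invr_ge0// ltW. Qed.

Let e_powR (e : R) : 0 < e -> e * e `^ (- a) = e `^ (1 - a).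
Proof. by move=> e0; rewrite powRD ?(gt_eqF e0) ?implybT// powRr1 ?ltW. Qed.

(** The two terms give [1/2 + 2], rounded up to 3; the 2 bounds the factor [2^a] lost in passing
    from [e] to [e / 2]. *)
Let half_arith (e C p t s : R) : 0 < e -> 0 <= C -> 0 <= p -> t <= C * p -> s <= C * (2 * p) ->
  e / 2 * t + e * s <= 3 * C * (e * p).
Proof.
move=> e0 C0 p0 tp sp.
have h1 : e / 2 * t <= e / 2 * (C * p) by rewrite ler_wpM2l// divr_ge0// ltW.
have h2 : e * s <= e * (C * (2 * p)) by rewrite (ler_wpM2l (ltW e0)).
have h3 : 0 <= e * (C * p) by rewrite mulr_ge0 ?mulr_ge0// ltW.
apply: (le_trans (lerD h1 h2)); move: h3; rewrite (_ : 3 * C * (e * p) = e / 2 * (C * p) + e * (C * (2 * p)) + 2^-1 * (e * (C * p))); last by field.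
by rewrite lerDl => h3; rewrite mulr_ge0.
Qed.

Let cv_half e : 0 < e -> \int[mu]_x `|cv e u x - cv (e / 2) u x| <= 3 * C1 * e `^ (1 - a).
Proof.
move=> e0; have e2 : 0 < e / 2 by rewrite divr_gt0.
apply: (le_trans (cv_diff_L1 e0 e2)); rewrite -e_powR//.
have t1 := TV_le e0; have t2 := TV_le e2.
have h : (e / 2) `^ (- a) <= 2 * e `^ (- a).
  rewrite powRM ?invr_ge0 ?(ltW e0)// mulrC ler_wpM2r ?powR_ge0//.
  have -> : 2^-1 `^ (- a) = 2 `^ a :> R by rewrite -inv_powR ?invr_gt0// invrK.
  by rewrite -[leRHS]powRr1//; apply: ler_powR; rewrite ?ler1n// ltW.
have p0 := powR_ge0 e (- a).
by apply: half_arith => //; rewrite (le_trans t2)// ler_wpM2l.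
Qed.

(** The sum of the dyadic steps, a geometric series of ratio [q = 2^(a - 1)]; it is here that
    [a < 1] enters. *)
Let D : R := 3 * C1 / (1 - q).

Let D0 : 0 <= D. Proof. by apply: divr_ge0; [apply: mulr_ge0; [exact: ler0n|exact: C10]|rewrite subr_ge0 ltW]. Qed.

Let cv_dyadic m e : 0 < e -> \int[mu]_x `|cv e u x - cv (e / 2 ^+ m) u x| <= D * e `^ (1 - a).
Proof.
elim: m e => [|m IH] e e0.
  rewrite expr0 divr1; under eq_Rintegral do rewrite subrr normr0.
  by rewrite int0; apply: mulr_ge0; [exact: D0|exact: powR_ge0].
have e2 : 0 < e / 2 by rewrite divr_gt0.
have em : 0 < e / 2 ^+ m.+1 by rewrite divr_gt0// exprn_gt0.
have emE : e / 2 ^+ m.+1 = e / 2 / 2 ^+ m by rewrite exprS invfM mulrA.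
have i1 := itg_norm (itgB (cu e0) (cu e2)); have i2 := itg_norm (itgB (cu e2) (cu em)).
apply: (@le_trans _ _ (\int[mu]_x (`|cv e u x - cv (e / 2) u x| + `|cv (e / 2) u x - cv (e / 2 ^+ m.+1) u x|))).
  apply: int_le => [||x]; [exact: itg_norm (itgB (cu e0) (cu em))|exact: itgD|exact: ler_distD].
rewrite (intD i1 i2); apply: (@le_trans _ _ (3 * C1 * e `^ (1 - a) + D * (e / 2) `^ (1 - a))).
  by apply: lerD; [exact: cv_half|rewrite emE; exact: IH].
rewrite half_powR// /D le_eqVlt; apply/orP; left; apply/eqP.
by field; rewrite subr_eq0 gt_eqF.
Qed.

Lemma smoothing_close e : 0 < e -> \int[mu]_x `|u x - cv e u x| <= D * e `^ (1 - a).
Proof.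
move=> e0; apply/ler_addgt0Pl => eta eta0.
have [d d0 Hd] := cv_L1_cvg ui ur eta0.
have [m md] : exists m, e / 2 ^+ m < d.
  have [k _ /(_ k (leqnn k)) Hk] := near_infty_natSinv_expn_lt (PosNum (divr_gt0 d0 e0)).
  by exists k; move: Hk; rewrite /= mul1r ltr_pdivlMr// mulrC.
have em : 0 < e / 2 ^+ m by rewrite divr_gt0// exprn_gt0.
have i1 := itg_norm (itgB (cu em) ui); have i2 := itg_norm (itgB (cu e0) (cu em)).
apply: (@le_trans _ _ (\int[mu]_x (`|cv (e / 2 ^+ m) u x - u x| + `|cv e u x - cv (e / 2 ^+ m) u x|))).
  apply: int_le => [||x]; [exact: itg_norm (itgB ui (cu e0))|exact: itgD|].
  by rewrite (distrC (cv (e / 2 ^+ m) u x)) (distrC (cv e u x)); exact: ler_distD.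
by rewrite (intD i1 i2); apply: lerD; [by apply: ltW; exact: Hd|exact: cv_dyadic].
Qed.

Lemma smoothing : exists2 C, 0 <= C & forall e, 0 < e ->
  \sum_j \int[mu]_x `|pd j (cv e u) x| <= C * e `^ (- a) /\ \int[mu]_x `|u x - cv e u x| <= C * e `^ (1 - a).
Proof.
exists (C1 + D); first by apply: addr_ge0; [exact: C10|exact: D0].
move=> e e0; split.
  by rewrite (le_trans (TV_le e0))// ler_wpM2r ?powR_ge0// lerDl.
by rewrite (le_trans (smoothing_close e0))// ler_wpM2r ?powR_ge0// lerDr.
Qed.

End smoothing.

(** * Push forward by Hoelder maps *)

Section powR_facts.
Context (R : realType).
Implicit Types (e t a : R).

Lemma mul_powR e a : 0 < e -> e * e `^ (a - 1) = e `^ a.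
Proof. by move=> e0; rewrite powRB ?(gt_eqF e0) ?implybT// powRr1 ?ltW// mulrCA mulfV ?mulr1// gt_eqF. Qed.

(** At scale [e] a Hoelder modulus is at most a Lipschitz one plus a constant: the constant suffices
    below [e], the linear term above. This is what bounds inf-convolutions from below. *)
Lemma powR_le_affine e t a : 0 < e -> 0 <= t -> 0 <= a <= 1 -> t `^ a <= e `^ a + e `^ (a - 1) * t.
Proof.
move=> e0 t0 /andP[a0 a1]; have p0 := powR_ge0 e (a - 1).
have [te|te] := leP t e.
  have : t `^ a <= e `^ a by apply: ge0_ler_powR => //; rewrite nnegrE ltW.
  by move/le_trans; apply; rewrite lerDl mulr_ge0.
have s1 : 1 <= t / e by rewrite ler_pdivlMr// mul1r ltW.
have -> : t `^ a = e `^ a * (t / e) `^ a.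
  rewrite -powRM ?ltW//; last by rewrite (lt_le_trans ltr01).
  by rewrite mulrCA divff ?mulr1// gt_eqF.
apply: (@le_trans _ _ (e `^ a * (t / e))); first by rewrite ler_wpM2l ?powR_ge0//; exact: ler1_powR.
by rewrite -mul_powR// [e * _]mulrC -mulrA (mulrCA e) divff ?gt_eqF// mulr1 lerDr mulr_ge0// ltW.
Qed.

Lemma prod_powR I (s : seq I) (F : I -> R) e : 0 < e -> \prod_(i <- s) e `^ F i = e `^ (\sum_(i <- s) F i).
Proof.
move=> e0; elim: s => [|a s IH]; first by rewrite !big_nil powRr0.
by rewrite !big_cons IH powRD ?(gt_eqF e0) ?implybT.
Qed.

Lemma le_powRN e t a : 0 < t -> t <= e -> a <= 1 -> e `^ (a - 1) <= t `^ (a - 1).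
Proof.
move=> t0 te a1; rewrite -opprB !powRN lef_pV2 ?posrE ?powR_gt0 ?(lt_le_trans t0)//.
by apply: ge0_ler_powR => //; rewrite ?subr_ge0// nnegrE; lra.
Qed.

Lemma le_dist3 (x y p q A : R) : `|x - p| <= A -> `|y - q| <= A -> `|q - p| <= A -> `|x - y| <= A + A + A.
Proof. by move=> /ler_normlP[? ?] /ler_normlP[? ?] /ler_normlP[? ?]; rewrite ler_norml; apply/andP; split; lra. Qed.

Lemma le_dist_half (y z p A B C : R) : y <= p -> z <= p -> p - A <= y -> p - B <= z -> A <= C -> B <= A -> `|y - z| <= C.
Proof. by move=> *; rewrite ler_norml; apply/andP; split; lra. Qed.

End powR_facts.

(** * Inf-convolutions of Hoelder functions *)

Section infconv.
Context (R : realType) (n : nat).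
Local Notation V := 'rV[R]_n.+1.
Implicit Types (g : V -> R).

(** The largest [L]-Lipschitz minorant of [g]. For [g] of Hoelder constant [M] and exponent [al],
    the slope [M e^(al - 1)] keeps it within [M e^al] of [g]. *)
Definition infconv (L : R) g (x : V) : R := inf [set g y + L * enorm (x - y) | y in setT].

Section bounds.
Variables (M al e : R) (g : V -> R).
Hypotheses (M0 : 0 <= M) (al01 : 0 <= al <= 1) (e0 : 0 < e) (gM : hol al M g).
Let L := M * e `^ (al - 1).

Let L0 : 0 <= L. Proof. by rewrite mulr_ge0// powR_ge0. Qed.

Lemma infconv_lb x y : g x - M * e `^ al <= g y + L * enorm (x - y).
Proof.
rewrite lerBlDr addrAC -addrA -lerBlDl (le_trans (ler_norm _))// (le_trans (gM x y))//.
rewrite /L -mulrA -mulrDr ler_wpM2l//.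
by apply: powR_le_affine => //; exact: enorm_ge0.
Qed.

Let S x := [set g y + L * enorm (x - y) | y in setT].

Let hlb x : has_lbound (S x).
Proof. by exists (g x - M * e `^ al) => _ [y _ <-]; exact: infconv_lb. Qed.

Let ne x : S x !=set0.
Proof. by exists (g x + L * enorm (x - x)); exists x. Qed.

Lemma infconv_le_pt x y : infconv L g x <= g y + L * enorm (x - y).
Proof. by apply: (ge_inf (hlb x)); exists y. Qed.

Lemma infconv_le x : infconv L g x <= g x.
Proof. by have := infconv_le_pt x x; rewrite subrr enorm0 mulr0 addr0. Qed.

Lemma infconv_ge x : g x - M * e `^ al <= infconv L g x.
Proof. by apply: (lb_le_inf (ne _)) => _ [y _ <-]; exact: infconv_lb. Qed.

Lemma infconv_lip : lip L (infconv L g).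
Proof.
suff H x x' : infconv L g x - infconv L g x' <= L * enorm (x - x').
  by move=> x x'; apply/ler_normlP; split; [rewrite opprB enormB|]; exact: H.
rewrite lerBlDl -lerBlDr; apply: (lb_le_inf (ne _)) => _ [y _ <-]; rewrite lerBlDr.
apply: (le_trans (infconv_le_pt x y)); rewrite -addrA lerD2l -mulrDr ler_wpM2l// addrC addrC [leRHS]addrC.
exact: enorm_dist_triangle.
Qed.

(** Inf-convolution commutes with translations and is monotone, so it preserves the modulus of
    continuity: competitors are moved along with the point. *)
Lemma infconv_hol : hol al M (infconv L g).
Proof.
suff H x x' : infconv L g x - infconv L g x' <= M * enorm (x - x') `^ al.
  by move=> x x'; apply/ler_normlP; split; [rewrite opprB enormB|]; exact: H.
rewrite lerBlDl -lerBlDr; apply: (lb_le_inf (ne _)) => _ [y _ <-]; rewrite lerBlDr.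
apply: (le_trans (infconv_le_pt x (y + (x - x')))).
have -> : x - (y + (x - x')) = x' - y by rewrite opprD opprB addrA addrAC (addrCA x) subrr addr0 addrC.
have := gM (y + (x - x')) y; rewrite (_ : y + (x - x') - y = x - x'); last by rewrite addrC addKr.
move/ler_normlP => [_]; rewrite lerBlDl => h; rewrite addrAC lerD2r; exact: h.
Qed.

(** This ends the dyadic chains after finitely many steps: at small scales the inf-convolution of a
    Lipschitz map is the map itself. *)
Lemma infconv_id K : lip K g -> K <= L -> infconv L g = g.
Proof.
move=> gK KL; apply/funext => x; apply/eqP; rewrite eq_le infconv_le/=.
apply: (lb_le_inf (ne _)) => _ [y _ <-]; rewrite -lerBlDl (le_trans (ler_norm _))//.
by rewrite (le_trans (gK x y))// ler_wpM2r// enorm_ge0.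
Qed.

End bounds.

Lemma infconv_dist M al e g g' s : 0 <= M -> 0 <= al <= 1 -> 0 < e -> hol al M g -> hol al M g' ->
  (forall x, `|g x - g' x| <= s) -> forall x,
  `|infconv (M * e `^ (al - 1)) g x - infconv (M * e `^ (al - 1)) g' x| <= s.
Proof.
move=> M0 al01 e0 gM g'M gg' x.
suff H h h' : hol al M h -> hol al M h' -> (forall x, `|h x - h' x| <= s) ->
    infconv (M * e `^ (al - 1)) h x - infconv (M * e `^ (al - 1)) h' x <= s.
  apply/ler_normlP; split; last exact: H.
  by rewrite opprB; apply: H => // y; rewrite distrC.
move=> hM h'M hh'; rewrite lerBlDl -lerBlDr; apply: lb_le_inf.
  by exists (h' x + M * e `^ (al - 1) * enorm (x - x)); exists x.
move=> _ [y _ <-]; rewrite lerBlDr; apply: (le_trans (infconv_le_pt M0 al01 e0 hM x y)).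
by rewrite addrAC lerD2r -lerBlDl (le_trans (ler_norm _)).
Qed.

End infconv.

Section main_estimate.
Context (R : realType) (n : nat).
Local Notation V := 'rV[R]_n.+1.
Local Notation T := 'rV[measurableTypeR R]_n.+1.
Local Notation mu := (lebesgue_rV R n.+1).
Implicit Types (f g h w : V -> R) (phi psi p q : 'I_n.+1 -> V -> R).

Lemma lip_row phi (L : 'I_n.+1 -> R) : (forall i, lip (L i) (phi i)) ->
  exists2 M, 0 <= M & (forall i, lip M (phi i)) /\ lipm (n.+1%:R * M) (fun x : V => \row_i phi i x : V).
Proof.
move=> H; exists (\sum_i `|L i|); first exact: sumr_ge0.
have H' i : lip (\sum_i `|L i|) (phi i).
  by apply: lipW (H i); rewrite (bigD1 i)//= (le_trans (ler_norm _))// lerDl sumr_ge0.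
split=> //; apply: lipm_coor => i; rewrite (_ : (fun _ => _) = phi i)//.
by apply/funext => x; rewrite mxE.
Qed.

Lemma itg_tint w f phi (L : 'I_n.+1 -> R) Lf rf : itg mu (w : T -> R) -> lip Lf f -> csup rf f ->
  (forall i, lip (L i) (phi i)) -> itg mu (fun x : T => w x * f (\row_i phi i x) * \det (Dmx phi x)).
Proof.
move=> wi fL fr phL; have [M M0 [phM rM]] := lip_row phL.
have [C C0 fC] := lip_csup_bounded fL fr.
have fM : lip (Lf * (n.+1%:R * M)) (f \o (fun x : V => \row_i phi i x : V)).
  by apply: lip_comp => //; rewrite (le_trans _ (pd_bound fL ord0 0)).
apply: (itgMb (C := n.+1`!%:R * \prod_i L i)).
- by apply: (itgMb wi (lip_mble fM)) => x; exact: fC.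
- by apply: mble_detD => i; exists (L i).
- by apply: detD_bound.
Qed.

Lemma tint_diff_weight w w' f phi (L : 'I_n.+1 -> R) Lf rf b : itg mu (w : T -> R) -> itg mu (w' : T -> R) ->
  lip Lf f -> csup rf f -> (forall x, `|f x| <= b) -> (forall i, lip (L i) (phi i)) ->
  `|tint w f phi - tint w' f phi| <= n.+1`!%:R * b * (\prod_i L i) * \int[mu]_x `|w x - w' x|.
Proof.
move=> wi w'i fL fr fb phL; have i1 := itg_tint wi fL fr phL; have i2 := itg_tint w'i fL fr phL.
rewrite /tint -(intB i1 i2) -intZ; last exact/itg_norm/itgB.
apply: int_norm_le => [||x]; [exact: itgB|exact/itgZ/itg_norm/itgB|].
rewrite -mulrBl -mulrBl !normrM -[leRHS]mulrC -mulrA ler_wpM2l//.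
rewrite [_ * b]mulrC -mulrA; apply: ler_pM => //; exact: detD_bound.
Qed.

Section estimate.
Variables (a ru C : R) (u : V -> R) (alpha : 'I_n.+1 -> R) (M : R).
Hypotheses (a0 : 0 <= a) (a1 : a < 1) (ui : itg mu (u : T -> R)) (ur : csup ru u) (C0 : 0 <= C).
Hypothesis uC : forall e, 0 < e ->
  \sum_j \int[mu]_x `|pd j (cv e u) x| <= C * e `^ (- a) /\ \int[mu]_x `|u x - cv e u x| <= C * e `^ (1 - a).
Hypotheses (alpha01 : forall i, 0 < alpha i <= 1) (M0 : 0 < M).
Let tau : R := \sum_i alpha i.
Let gam : R := tau - (n%:R + a).
Hypothesis gam0 : 0 < gam.

(** The weight [u] is exchanged for its mollification on both sides, and the homotopy is run with
    the mollified weight. At scale [e] these three errors have the same size, whence the factor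
    3. *)
Lemma step_estimate f p q (L : 'I_n.+1 -> R) e b Lf rf : 0 < e -> 0 <= b ->
  (forall i, lip (L i) (p i)) -> (forall i, lip (L i) (q i)) -> (forall i x, `|p i x - q i x| <= e * L i) ->
  lip Lf f -> csup rf f -> (forall x, `|f x| <= b) ->
  `|tint u f p - tint u f q| <= 3 * n.+1`!%:R * C * b * (\prod_i L i) * e `^ (1 - a).
Proof.
move=> e0 b0 pL qL pq fL fr fb; have [tv l1] := uC e0.
have ci := itg_cv e0 ui ur; have [Lc _ cL] := cv_lip e0 ui; have cr := cv_csup e0 ur.
have L0 i : 0 <= L i by rewrite (le_trans _ (pd_bound (pL i) ord0 0)).
have P0 : 0 <= \prod_i L i by exact: prodr_ge0.
pose A := n.+1`!%:R * b * \prod_i L i.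
have A0 : 0 <= A by rewrite !mulr_ge0.
have h1 : `|tint u f p - tint (cv e u) f p| <= A * (C * e `^ (1 - a)).
  by rewrite (le_trans (tint_diff_weight ui ci fL fr fb pL))// ler_wpM2l.
have h2 : `|tint u f q - tint (cv e u) f q| <= A * (C * e `^ (1 - a)).
  by rewrite (le_trans (tint_diff_weight ui ci fL fr fb qL))// ler_wpM2l.
have h3 : `|tint (cv e u) f q - tint (cv e u) f p| <= A * (C * e `^ (1 - a)).
  have fb' (x : V) (k : 'I_n.+1) : pd k (cv e u) x != 0 -> forall s, 0 <= s <= 1 ->
     `|f (\row_i (q i x + s * (p i x - q i x)))| <= b by [].
  have HH := homotopy_estimate qL pL (ltW e0) pq cL cr fL fr fb'.
  apply: (le_trans HH).
  have -> : n.+1`!%:R * b * e * (\prod_i L i) = A * e by rewrite /A; ring.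
  rewrite -mulrA ler_wpM2l//.
  have -> : C * e `^ (1 - a) = e * (C * e `^ (- a)).
    by rewrite mulrCA; congr (_ * _); rewrite powRD ?(gt_eqF e0) ?implybT// powRr1 ?ltW.
  by rewrite (ler_wpM2l (ltW e0)).
have -> : 3 * n.+1`!%:R * C * b * (\prod_i L i) * e `^ (1 - a) = A * (C * e `^ (1 - a)) + A * (C * e `^ (1 - a)) + A * (C * e `^ (1 - a)).
  by rewrite /A; ring.
exact: le_dist3 h1 h2 h3.
Qed.

Let Li e i := M * e `^ (alpha i - 1).

(** The exponents add up as [(tau - (n + 1)) + (1 - a) = gam], positive by assumption; every
    convergence statement for Hoelder maps comes from this. *)
Let prod_Li e : 0 < e -> (\prod_i Li e i) * e `^ (1 - a) = M ^+ n.+1 * e `^ gam.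
Proof.
move=> e0; rewrite big_split/= prodr_const card_ord -mulrA; congr (_ * _).
rewrite prod_powR// -powRD ?(gt_eqF e0) ?implybT//; congr (_ `^ _).
rewrite sumrB -/tau sumr_const card_ord /gam -natr1; ring.
Qed.

Let K := 3 * n.+1`!%:R * C * M ^+ n.+1.
Let K0 : 0 <= K. Proof. by rewrite !mulr_ge0// exprn_ge0// ltW. Qed.

Let ic e phi i := infconv (Li e i) (phi i).

Let alpha01' i : 0 <= alpha i <= 1.
Proof. by have /andP[h1 h2] := alpha01 i; rewrite h2 ltW. Qed.

Let ic_lip e phi : 0 < e -> (forall i, hol (alpha i) M (phi i)) -> forall i, lip (Li e i) (ic e phi i).
Proof. by move=> e0 H i; exact: infconv_lip (ltW M0) (alpha01' i) e0 (H i). Qed.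

Let half_step e phi f b Lf rf : 0 < e -> 0 <= b -> (forall i, hol (alpha i) M (phi i)) ->
  lip Lf f -> csup rf f -> (forall x, `|f x| <= b) ->
  `|tint u f (ic e phi) - tint u f (ic (e / 2) phi)| <= 2 * K * b * e `^ gam.
Proof.
move=> e0 b0 phM fL fr fb; have e2 : 0 < e / 2 by rewrite divr_gt0.
have Lle i : Li e i <= Li (e / 2) i.
  by apply: ler_wpM2l; [exact: ltW|apply: le_powRN => //; [lra|by have /andP[] := alpha01 i]].
have h i x : `|ic e phi i x - ic (e / 2) phi i x| <= e * Li (e / 2) i.
  have l1 := infconv_le (ltW M0) (alpha01' i) e0 (phM i) x.
  have l2 := infconv_le (ltW M0) (alpha01' i) e2 (phM i) x.
  have g1 := infconv_ge (ltW M0) (alpha01' i) e0 (phM i) x.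
  have g2 := infconv_ge (ltW M0) (alpha01' i) e2 (phM i) x.
  have m1 : M * e `^ alpha i <= e * Li (e / 2) i.
    by rewrite -(mul_powR (alpha i) e0) mulrCA; apply: (ler_wpM2l (ltW e0)); exact: Lle.
  have m2 : M * (e / 2) `^ alpha i <= M * e `^ alpha i.
    apply: ler_wpM2l; [exact: ltW|]; have /andP[al0 _] := alpha01' i.
    by apply: ge0_ler_powR; rewrite ?nnegrE//; lra.
  exact: (le_dist_half l1 l2 g1 g2 m1 m2).
have := step_estimate e0 b0 (fun i => lipW (Lle i) (ic_lip e0 phM i)) (ic_lip e2 phM) h fL fr fb.
move/le_trans; apply.
(* The Lipschitz constants are those of the finer scale; this brings the remaining power to the same
   scale so that [prod_Li] applies. *)
have E1 : e `^ (1 - a) <= 2 * (e / 2) `^ (1 - a).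
  have {1}-> : e = 2 * (e / 2) by field.
  rewrite (powRM _ (ler0n _ 2) (ltW e2)); apply: ler_wpM2r; first exact: powR_ge0.
  by rewrite -[leRHS]powRr1//; apply: ler_powR; [rewrite ler1n|rewrite lerBlDr lerDl].
have P0 : 0 <= \prod_i Li (e / 2) i by apply: prodr_ge0 => i _; rewrite mulr_ge0 ?powR_ge0// ltW.
apply: (@le_trans _ _ (3 * n.+1`!%:R * C * b * (\prod_i Li (e / 2) i) * (2 * (e / 2) `^ (1 - a)))).
  by rewrite ler_wpM2l// !mulr_ge0.
have -> : 3 * n.+1`!%:R * C * b * (\prod_i Li (e / 2) i) * (2 * (e / 2) `^ (1 - a)) =
   2 * (3 * n.+1`!%:R * C) * b * ((\prod_i Li (e / 2) i) * (e / 2) `^ (1 - a)) by ring.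
rewrite prod_Li// mulrA.
have -> : 2 * (3 * n.+1`!%:R * C) * b * M ^+ n.+1 = 2 * K * b by rewrite /K; ring.
apply: ler_wpM2l; first by apply: mulr_ge0 => //; exact: mulr_ge0.
by apply: ge0_ler_powR; rewrite ?nnegrE ?(ltW gam0) ?(ltW e0) ?(ltW e2)//; lra.
Qed.

Let r : R := 2^-1 `^ gam.
Let D := 2 * K / (1 - r).

Let r01 : 0 < r < 1.
Proof.
have <- : 1 `^ gam = 1 :> R by rewrite powR1.
rewrite /r powR_gt0 ?invr_gt0//=; apply: gt0_ltr_powR => //; rewrite ?nnegrE ?invr_ge0//.
by rewrite invf_lt1// ltr1n.
Qed.

Let D0 : 0 <= D. Proof. have /andP[_ h] := r01; by apply: divr_ge0; [exact: mulr_ge0|rewrite subr_ge0 ltW]. Qed.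

(** [D] is the sum of the geometric series [2 K r^m]; this fixed-point equation closes the induction
    of [chain]. *)
Let DE : 2 * K + D * r = D.
Proof. by rewrite /D; field; case/andP: r01 => _ ?; rewrite gt_eqF// subr_gt0. Qed.

Let chain m e phi f b Lf rf : 0 < e -> 0 <= b -> (forall i, hol (alpha i) M (phi i)) ->
  lip Lf f -> csup rf f -> (forall x, `|f x| <= b) ->
  `|tint u f (ic e phi) - tint u f (ic (e / 2 ^+ m) phi)| <= D * b * e `^ gam.
Proof.
move=> + b0 phM fL fr fb; elim: m e => [e e0|m IH e e0].
  by rewrite expr0 divr1 subrr normr0; apply: mulr_ge0; [exact: mulr_ge0|exact: powR_ge0].
have e2 : 0 < e / 2 by rewrite divr_gt0.
have h1 := half_step e0 b0 phM fL fr fb; have h2 := IH _ e2.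
have -> : e / 2 ^+ m.+1 = e / 2 / 2 ^+ m by rewrite exprS invfM mulrA.
have E : (e / 2) `^ gam = e `^ gam * r by rewrite powRM ?(ltW e0)// invr_ge0.
apply: (le_trans (ler_distD (tint u f (ic (e / 2) phi)) _ _)).
apply: (le_trans (lerD h1 h2)); rewrite E -[X in _ <= X * b * _]DE le_eqVlt; apply/orP; left; apply/eqP; ring.
Qed.

Let ic_id phi (L : 'I_n.+1 -> R) e : 0 < e -> (forall i, hol (alpha i) M (phi i)) -> (forall i, lip (L i) (phi i)) ->
  exists m, ic (e / 2 ^+ m) phi = phi.
Proof.
move=> e0 phM phL.
have [x_ x_P] : exists x_ : 'I_n.+1 -> R, forall i, 0 < x_ i /\
    forall t, 0 < t -> t <= x_ i -> infconv (Li t i) (phi i) = phi i.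
  suff /choice[F FP] : forall i, exists x0 : R, 0 < x0 /\ forall t, 0 < t -> t <= x0 -> infconv (Li t i) (phi i) = phi i by exists F.
  move=> i; have /andP[al0 al1] := alpha01 i.
  have [alE|aln] := eqVneq (alpha i) 1.
    (* For exponent 1 the slope stays equal to [M] at all scales, but then the Hoelder bound itself
       says that the component is [M]-Lipschitz. *)
    exists 1; split=> // t t0 _; apply: (@infconv_id _ _ _ _ _ _ (ltW M0) (alpha01' i) t0 (phM i) M).
      by move=> x y; have := phM i x y; rewrite alE powRr1// enorm_ge0.
    by rewrite alE subrr powRr0 mulr1.
  (* The scale at which the slope [M t^(alpha i - 1)] equals [|L i| + 1]; for smaller [t] it is
     larger still. *)
  pose x0 := ((`|L i| + 1) / M) `^ (alpha i - 1)^-1.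
  have k0 : 0 < (`|L i| + 1) / M by rewrite divr_gt0// ltr_wpDl.
  exists x0; split=> [|t t0 tx]; first exact: powR_gt0.
  apply: (@infconv_id _ _ _ _ _ _ (ltW M0) (alpha01' i) t0 (phM i) (L i)) => //.
  apply: (@le_trans _ _ (M * x0 `^ (alpha i - 1))); last first.
    by apply: (ler_wpM2l (ltW M0)); exact: le_powRN.
  rewrite -powRrM mulVf ?subr_eq0// powRr1 ?(ltW k0)// mulrCA divff ?gt_eqF// mulr1.
  by rewrite (le_trans (ler_norm _))// lerDl.
pose x0 := \big[Order.min/1]_i x_ i.
have x00 : 0 < x0 by apply/bigmin_gtP; split=> // i _; have [] := x_P i.
(* Enough halvings because [m < 2^m]. *)
exists (Num.truncn (e / x0)).+1; apply/funext => i; have [xi H] := x_P i; apply: H.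
  by rewrite divr_gt0// exprn_gt0.
apply: (@le_trans _ _ x0); last exact: bigmin_le.
rewrite ler_pdivrMr ?exprn_gt0// mulrC -ler_pdivrMr//.
apply/ltW/(lt_le_trans (truncnS_gt _)); rewrite -natrX ler_nat; exact/ltnW/ltn_expl.
Qed.

(** Two chains lead from the inf-convolutions at scale [e] down to [phi] and [psi], and one step
    joins the inf-convolutions. The Lipschitz constants [L] only determine the number of dyadic
    steps and do not enter the bound. *)
Lemma push_estimate : exists2 Cm : R, 0 <= Cm & forall e b f Lf rf phi psi (L : 'I_n.+1 -> R),
  0 < e -> 0 <= b -> (forall i, hol (alpha i) M (phi i)) -> (forall i, hol (alpha i) M (psi i)) ->
  (forall i, lip (L i) (phi i)) -> (forall i, lip (L i) (psi i)) ->
  (forall i x, `|phi i x - psi i x| <= M * e `^ alpha i) ->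
  lip Lf f -> csup rf f -> (forall x, `|f x| <= b) ->
  `|tint u f phi - tint u f psi| <= Cm * b * e `^ gam.
Proof.
exists (2 * D + K); first by rewrite addr_ge0// mulr_ge0.
move=> e b f Lf rf phi psi L e0 b0 phM psM phL psL pp fL fr fb.
have [m mE] := ic_id e0 phM phL; have [k kE] := ic_id e0 psM psL.
have h1 := chain m e0 b0 phM fL fr fb; have h2 := chain k e0 b0 psM fL fr fb.
rewrite mE in h1; rewrite kE in h2.
have pq i x : `|ic e phi i x - ic e psi i x| <= e * Li e i.
  rewrite /Li mulrCA mul_powR//; apply: (infconv_dist (ltW M0) (alpha01' i)) => //.
have := step_estimate e0 b0 (ic_lip e0 phM) (ic_lip e0 psM) pq fL fr fb.
have -> : 3 * n.+1`!%:R * C * b * (\prod_i Li e i) * e `^ (1 - a) = K * b * e `^ gam.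
  by rewrite -mulrA prod_Li// /K; ring.
move: h1 h2; move: (tint u f phi) (tint u f psi) (tint u f _) (tint u f _) => x y z t.
have -> : (2 * D + K) * b * e `^ gam = D * b * e `^ gam + K * b * e `^ gam + D * b * e `^ gam by ring.
move: (D * b * _) (K * b * _) => d k' /ler_normlP[h1 h2] /ler_normlP[h3 h4] /ler_normlP[h5 h6].
by rewrite ler_norml; apply/andP; split; lra.
Qed.

End estimate.

End main_estimate.

(** * Completeness of [L^1] in tested form *)

Section L1_complete.
Context d (T : measurableType d) (R : realType) (m : {measure set T -> \bar R}).

(** The Riesz-Fischer argument: the series of the differences converges absolutely almost
    everywhere, and its sum of absolute values is an integrable majorant. *)
Lemma L1_complete (w_ : nat -> T -> R) : (forall k, itg m (w_ k)) ->
  (forall k, \int[m]_x `|w_ k.+1 x - w_ k x| <= 1 / (2 ^ k.+1)%:R) ->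
  exists2 w, itg m w & forall f C, mble f -> (forall x, `|f x| <= C) ->
    \int[m]_x (w_ k x * f x) @[k --> \oo] --> \int[m]_x (w x * f x).
Proof.
move=> wi wd.
have di k : itg m (fun x => `|w_ k.+1 x - w_ k x|) by exact/itg_norm/itgB.
pose D k x := (`|w_ k.+1 x - w_ k x|)%:E.
have D0 k x : (0 <= D k x)%E by rewrite lee_fin.
have mD k : measurable_fun setT (D k) by exact/measurable_EFinP/(itg_mble (di k)).
pose G x := (\sum_(k <oo) D k x)%E.
have G0 x : (0 <= G x)%E by apply: nneseries_ge0 => k _ _; exact: D0.
have mG : measurable_fun setT G.
  have := @ge0_emeasurable_sum _ _ R setT D xpredT (fun k x _ _ => D0 k x) (fun k _ => mD k).
  by apply: eq_measurable_fun => x _; apply: eq_eseriesl => i.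
have IG : (\int[m]_x G x <= 1)%E.
  rewrite integral_nneseries//.
  apply: le_trans (epsilon_trick0 xpredT (ler01 : 0 <= 1 :> R)).
  apply: lee_nneseries => k _; first by move=> _; exact: integral_ge0.
  by rewrite (int_EFin (di k)) lee_fin.
have Gi : m.-integrable setT G.
  apply/integrableP; split=> //; under eq_integral do rewrite gee0_abs//.
  by rewrite (le_lt_trans IG)// ltry.
(* The conull set where the series converges absolutely. The functions are set to zero off it, so
   that they converge at every point. *)
pose A := [set x | G x \is a fin_num].
have mA : measurable A by rewrite -[A]setTI; exact: emeasurable_fin_num.
have Aae : {ae m, forall x, A x} by apply: filterS (integrable_ae measurableT Gi) => x; apply.
pose h n x := w_ n x * (\1_A x : R).
have mI : mble (\1_A : T -> R) by exact: measurable_indic.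
have mh n : mble (h n) by apply: measurable_funM => //; exact: itg_mble (wi n).
pose g x := `|w_ 0 x| + fine (G x).
have fG0 x : 0 <= fine (G x) by exact: fine_ge0.
have gi : itg m g.
  apply: itgD; first exact: itg_norm.
  apply: (@le_integrable _ _ _ _ _ measurableT _ _ _ _ Gi).
    by apply/measurable_EFinP; apply: measurableT_comp => //; exact: fine_measurable.
  move=> x _ /=; rewrite gee0_abs ?lee_fin//.
  have := G0 x; case: (G x) => [r| |] //= r0; last by rewrite leey.
  by rewrite ger0_norm.
have sumle n x : A x -> \sum_(0 <= k < n) `|w_ k.+1 x - w_ k x| <= fine (G x).
  move=> Ax; rewrite -lee_fin fineK// -sumEFin.
  exact: (@nneseries_lim_ge R (D ^~ x) xpredT 0 n (fun k _ _ => D0 k x)).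
have wE n x : w_ n x = w_ 0 x + series (fun k => w_ k.+1 x - w_ k x) n.
  by rewrite /series/= telescope_sumr// addrC subrK.
have hg n x : `|h n x| <= g x.
  rewrite /h indicE; case: (boolP (x \in A)) => [|_]; last first.
    by rewrite mulr0 normr0 addr_ge0.
  rewrite inE => Ax; rewrite mulr1 wE (le_trans (ler_normD _ _))// lerD2l.
  by rewrite (le_trans (ler_norm_sum _ _ _))// sumle.
pose w x := limn (h ^~ x).
have hw x : h ^~ x @ \oo --> w x.
  suff : cvgn (h ^~ x) by [].
  rewrite /h indicE; case: (boolP (x \in A)) => [|_]; last first.
    by under eq_fun do rewrite mulr0; exact: is_cvg_cst.
  rewrite inE => Ax; under eq_fun do rewrite mulr1 wE.
  apply: is_cvgD; first exact: is_cvg_cst.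
  apply: normed_cvg; apply: nondecreasing_is_cvgn.
    by apply: (@nondecreasing_series R (fun k => `|w_ k.+1 x - w_ k x|) xpredT 0) => k _ _; exact: normr_ge0.
  by exists (fine (G x)) => _ [n _ <-]; exact: sumle.
have mw : mble w by apply: (@measurable_fun_cvg _ _ _ setT h) => // x _; exact: hw.
have [iw _] := dct mh mw gi (aeW _ hw) hg.
exists w => // f C mf fC.
have [|||||] := @dct _ _ _ m (fun k x => h k x * f x) (fun x => w x * f x) (fun x => g x * C).
- by move=> k; exact: (measurable_funM (mh k) mf).
- exact: (measurable_funM mw mf).
- by under eq_fun do rewrite mulrC; exact: itgZ.
- by apply: aeW => x; apply: cvgM; [exact: hw|exact: cvg_cst].
- by move=> k x; rewrite normrM ler_pM.
move=> _; apply: cvg_seq_eq => k; apply: int_aeE.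
- exact: (measurable_funM (mh k) mf).
- exact: (measurable_funM (itg_mble (wi k)) mf).
- by apply: filterS Aae => x Ax; rewrite /h indicE mem_set// mulr1.
Qed.

End L1_complete.

Lemma mble_fst (R : realType) d1 d2 (T1 : measurableType d1) (T2 : measurableType d2) (f : T1 -> R) :
  mble f -> mble (fun p : T1 * T2 => f p.1).
Proof. by move=> mf; exact: (measurableT_comp mf measurable_fst). Qed.

Lemma mble_snd (R : realType) d1 d2 (T1 : measurableType d1) (T2 : measurableType d2) (f : T2 -> R) :
  mble f -> mble (fun p : T1 * T2 => f p.2).
Proof. by move=> mf; exact: (measurableT_comp mf measurable_snd). Qed.

(** * Densities of push forwards by Lipschitz maps *)

Section push_lip.
Context (R : realType) (n : nat).
Local Notation V := 'rV[R]_n.+1.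
Local Notation T := 'rV[measurableTypeR R]_n.+1.
Local Notation mu := (lebesgue_rV R n.+1).
Implicit Types (f g h w : V -> R) (phi psi p q : 'I_n.+1 -> V -> R).

Lemma bound_ge0 (b : R) f : (forall x, `|f x| <= b) -> 0 <= b.
Proof. by move/(_ 0); exact: le_trans. Qed.

Lemma itg_mul_lip w f L r : itg mu (w : T -> R) -> lip L f -> csup r f -> itg mu (fun x : T => w x * f x).
Proof.
move=> wi fL fr; have [C C0 fC] := lip_csup_bounded fL fr.
exact: (itgMb wi (lip_mble fL) fC).
Qed.

(** The error is measured against the sup norm of the test, so by duality the approximate densities
    form a Cauchy sequence in [L^1], and the functional [S] inherits a density. *)
Lemma density_limit (S : (V -> R) -> R) : (forall e, 0 < e -> exists2 w : V -> R, itg mu (w : T -> R) &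
    forall f L r b, lip L f -> csup r f -> (forall x, `|f x| <= b) -> `|S f - \int[mu]_x (w x * f x)| <= e * b) ->
  exists2 w : V -> R, itg mu (w : T -> R) & forall f L r, lip L f -> csup r f -> S f = \int[mu]_x (w x * f x).
Proof.
(* Two consecutive errors add up to at most [1 / 2^(k+1)], the rate expected by [L1_complete]. *)
move=> H; pose e k : R := 1 / (2 ^ k.+2)%:R.
have e0 k : 0 < e k by rewrite divr_gt0// ltr0n expn_gt0.
have eS k : e k + e k = 1 / (2 ^ k.+1)%:R.
  by rewrite /e [in LHS]expnS natrM; field; rewrite pnatr_eq0 expn_eq0.
have eS' k : e k.+1 <= e k.
  by rewrite /e ler_pdivrMr ?ltr0n ?expn_gt0// mulrAC ler_pdivlMr ?ltr0n ?expn_gt0// !mul1r ler_nat leq_exp2l.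
have [w_ wP] : exists w_ : nat -> V -> R, forall k, itg mu (w_ k : T -> R) /\
    forall f L r b, lip L f -> csup r f -> (forall x, `|f x| <= b) -> `|S f - \int[mu]_x (w_ k x * f x)| <= e k * b.
  suff /choice[F FP] : forall k, exists w : V -> R, itg mu (w : T -> R) /\
     forall f L r b, lip L f -> csup r f -> (forall x, `|f x| <= b) -> `|S f - \int[mu]_x (w x * f x)| <= e k * b by exists F.
  by move=> k; have [w wi wP] := H _ (e0 k); exists w.
have wi k : itg mu (w_ k : T -> R) by have [] := wP k.
have wd k : \int[mu]_x `|w_ k.+1 x - w_ k x| <= 1 / (2 ^ k.+1)%:R.
  apply: L1_dual; first exact: itgB.
  move=> L r f fL fr f1.
  have h1 := (wP k).2 f L r 1 fL fr f1; have h2 := (wP k.+1).2 f L r 1 fL fr f1.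
  have -> : \int[mu]_x ((w_ k.+1 x - w_ k x) * f x) = \int[mu]_x (w_ k.+1 x * f x) - \int[mu]_x (w_ k x * f x).
    rewrite -(intB (itg_mul_lip (wi k.+1) fL fr) (itg_mul_lip (wi k) fL fr)).
    by apply: eq_Rintegral => x _; rewrite mulrBl.
  rewrite -eS; move: h1 h2 (eS' k); rewrite !mulr1.
  move: (S f) (\int[mu]_x _) (\int[mu]_x _) => s x y /ler_normlP[? ?] /ler_normlP[? ?] ?.
  by rewrite ler_norml; apply/andP; split; lra.
have [w iw ww] := L1_complete wi wd.
exists w => // f L r fL fr; have [C C0 fC] := lip_csup_bounded fL fr.
apply: (cvg_seq_unique (u := fun k => \int[mu]_x (w_ k x * f x))); last exact: (ww _ _ (lip_mble fL) fC).
apply/cvgrPdist_le => a a0.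
have c1 : 0 < C + 1 by rewrite ltr_wpDl.
have d0 : 0 < a / (C + 1) by rewrite divr_gt0.
apply: filterS (near_infty_natSinv_lt (PosNum d0)) => k /= kd.
apply: (le_trans ((wP k).2 f L r C fL fr fC)).
have ek : e k <= k.+1%:R^-1.
  rewrite /e mul1r lef_pV2 ?posrE ?ltr0n ?expn_gt0// ler_nat.
  by apply: (leq_trans (ltnW (ltn_expl _ (isT : (1 < 2)%N)))); rewrite leq_exp2l.
apply: (@le_trans _ _ (a / (C + 1) * C)); first by apply: ler_wpM2r => //; exact/ltW/(le_lt_trans ek).
by rewrite mulrAC ler_pdivrMr// ler_pM2l// lerDl.
Qed.

Lemma pd_addc j f (c : R) : pd j (fun x => f x + c) = pd j f.
Proof.
have E : dq (fun x => f x + c) j = dq f j.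
  by apply/funext => x; apply/funext => h; rewrite /dq; congr (_ * _); rewrite opprD addrACA subrr addr0.
by apply/funext => x; rewrite !pd_dq E.
Qed.

Lemma Dmx_addc phi (z : V) x : Dmx (fun i x => phi i x + z ord0 i) x = Dmx phi x.
Proof. by apply/matrixP => i j; rewrite !DmxE pd_addc. Qed.

Section pushed.
Variables (u : V -> R) (ru : R) (phi : 'I_n.+1 -> V -> R) (L : 'I_n.+1 -> R).
Hypotheses (ui : itg mu (u : T -> R)) (ur : csup ru u) (phL : forall i, lip (L i) (phi i)).
Local Notation row phi := (fun x : V => \row_i phi i x : V).

Let mrow : measurable_fun setT (row phi : T -> T).
Proof.
apply: measurable_fun_rV => i; rewrite (_ : (fun _ => _) = phi i); first exact: lip_mble (phL i).
by apply/funext => x; rewrite mxE.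
Qed.

Let det_itg : itg mu (fun x : T => u x * \det (Dmx phi x)).
Proof. by apply: (itgMb ui _ (detD_bound phL)); apply: mble_detD => i; exists (L i). Qed.

Lemma row_bounded : exists2 r, 0 <= r & forall x, enorm x <= ru -> enorm (row phi x) <= r.
Proof.
have [M M0 [_ rM]] := lip_row phL.
exists (enorm (row phi 0) + n.+1%:R * M * `|ru|); first by rewrite addr_ge0 ?enorm_ge0// !mulr_ge0.
move=> x xr; have -> : row phi x = row phi 0 + (row phi x - row phi 0) by rewrite addrC subrK.
rewrite (le_trans (enormD _ _))// lerD2l (le_trans (rM _ _))// subr0 ler_wpM2l ?mulr_ge0//.
by rewrite (le_trans xr)// ler_norm.
Qed.

Let K s (y x : V) : R := mol s (y - row phi x).

Let mK s : 0 < s -> mble (fun p : T * T => K s p.1 p.2).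
Proof.
move=> s0; apply: (measurableT_comp (mol_mble s0)).
apply: measurable_fun_rV => i /=.
rewrite (_ : (fun _ => _) = fun p : T * T => (p.1 : V) ord0 i - phi i p.2); last first.
  by apply/funext => p; rewrite !mxE.
apply: measurable_funB.
  by apply: (@mble_fst R _ _ T T (fun y : T => (y : V) ord0 i)); exact: measurable_coor.
by apply: (@mble_snd R _ _ T T (phi i)); exact: lip_mble (phL i).
Qed.

(** With a mollified test, Fubini makes the density explicit: the integral over [x] of
    [mol s (y - phi x) * u x * det D phi x]. *)
Lemma pushed_density s : 0 < s -> exists2 w : V -> R, itg mu (w : T -> R) &
  forall f Lf rf, lip Lf f -> csup rf f -> tint u (cv s f) phi = \int[mu]_y (w y * f y).
Proof.
move=> s0; have [r r0 rb] := row_bounded.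
have [C C0 [KC _]] := mol_bounded n s0.
pose h (p : T * T) : R := K s p.1 p.2 * (u p.2 * \det (Dmx phi p.2)).
pose G (y : T) : R := C * \1_(cube (r + s) : set T) y.
pose H (x : T) : R := `|u x * \det (Dmx phi x)|.
have Gi : itg mu G by apply: itgZ; exact: itg_cube.
have Hi : itg mu H by exact: itg_norm.
have G0 y : 0 <= G y by rewrite mulr_ge0// indicE ler0n.
have mh : mble h.
  apply: measurable_funM; first exact: mK.
  by apply: (@mble_snd R _ _ T T (fun x => u x * \det (Dmx phi x))); exact: itg_mble det_itg.
have hGH y x : `|h (y, x)| <= G y * H x.
  rewrite /h /= normrM -/(H x); have [u0|un] := eqVneq (u x) 0.
    by rewrite /H u0 mul0r normr0 !mulr0.
  have xr : enorm x <= ru by rewrite leNgt; apply/negP => /ur /eqP; rewrite (negbTE un).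
  apply: ler_wpM2r; first exact: normr_ge0.
  have [ys|sy] := leP (enorm ((y : V) - row phi x)) s; last first.
    by rewrite /K (mol_csup s0 sy) normr0.
  have yc : (cube (r + s) : set T) y.
    apply: cube_ball; rewrite -[y : V](subrK (row phi x)) (le_trans (enormD _ _))// addrC lerD//.
    exact: rb.
  by rewrite /G indicE mem_set// mulr1; exact: KC.
exists (fun y => \int[mu]_x h (y, x)); first exact: (dom_itg_fubini1 mh hGH Gi Hi).
move=> f Lf rf fL fr; have [b b0 fb] := lip_csup_bounded fL fr.
have hGH' y x : `|h (y, x) * f y| <= (G y * b) * H x.
  by rewrite normrM mulrAC; apply: ler_pM.
have Gi' : itg mu (fun y => G y * b) by under eq_fun do rewrite mulrC; exact: itgZ.
have mh' : mble (fun p : T * T => h p * f p.1).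
  by apply: measurable_funM => //; apply: (@mble_fst R _ _ T T f); exact: lip_mble fL.
have E := dom_fubini mh' hGH' Gi' Hi.
transitivity (\int[mu]_x \int[mu]_y (h (y, x) * f y)).
  apply: eq_Rintegral => x _; rewrite /cv /convk.
  have -> : \int[mu]_y (h (y, x) * f y) = \int[mu]_y ((u x * \det (Dmx phi x)) * (mol s ((y : V) - row phi x) * f y)).
    by apply: eq_Rintegral => y _; rewrite /h /K /=; ring.
  rewrite intZ; last exact: (convk_itg _ (mol_mble s0) KC (itg_lip_csup fL fr)).
  by ring.
rewrite -E; apply: eq_Rintegral => y _.
have iy := dom_itg1 mh hGH Hi y.
by rewrite mulrC -(intZ (f y) iy); apply: eq_Rintegral => x _; rewrite mulrC.
Qed.

(** Mollifying the test amounts to averaging over the translates [phi + z] with [|z| <= s]. Each is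
    joined to [phi] by an affine homotopy, which costs the gradient of [u] and only the sup norm of
    [f]; the modulus of continuity of [f] would not do. *)
Lemma pushed_close Lu s f Lf rf b : lip Lu u -> 0 < s -> lip Lf f -> csup rf f -> (forall x, `|f x| <= b) ->
  `|tint u f phi - tint u (cv s f) phi| <=
    n.+1`!%:R * b * s * (\prod_i (`|L i| + 1)) * \sum_k \int[mu]_x `|pd k u x|.
Proof.
move=> uL s0 fL fr fb; have b0 := bound_ge0 fb.
set B := n.+1`!%:R * b * s * _ * _.
pose F (z : V) := tint u f (fun i x => phi i x + z ord0 i).
have phL' i : lip (`|L i| + 1) (phi i) by apply: lipW (phL i); rewrite (le_trans (ler_norm _))// lerDl.
have FB (z : V) : enorm z <= s -> `|F z - F 0| <= B.
  move=> zs; rewrite distrC /F.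
  have L0 i : lip (`|L i| + 1) (fun x => phi i x + (0 : V) ord0 i).
    by move=> x y; rewrite opprD addrACA subrr addr0; exact: phL'.
  have L1 i : lip (`|L i| + 1) (fun x => phi i x + z ord0 i).
    by move=> x y; rewrite opprD addrACA subrr addr0; exact: phL'.
  have d i x : `|(phi i x + z ord0 i) - (phi i x + (0 : V) ord0 i)| <= s * (`|L i| + 1).
    rewrite mxE addr0 addrAC subrr add0r (le_trans (coor_le _ _))// (le_trans zs)//.
    by rewrite ler_peMr// ?(ltW s0)// lerDr.
  have fb' (x : V) (k : 'I_n.+1) : pd k u x != 0 -> forall t, 0 <= t <= 1 ->
     `|f (\row_i ((phi i x + (0 : V) ord0 i) + t * ((phi i x + z ord0 i) - (phi i x + (0 : V) ord0 i))))| <= b by [].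
  exact: (homotopy_estimate L0 L1 (ltW s0) d uL ur fL fr fb').
have rowD (z x : V) : \row_i (phi i x + z ord0 i) = row phi x + z by apply/rowP => i; rewrite !mxE.
have FE (z : V) : F z = \int[mu]_x (u x * f (row phi x + z) * \det (Dmx phi x)).
  by apply: eq_Rintegral => x _; rewrite Dmx_addc rowD.
pose h (p : T * T) : R := mol s p.1 * (u p.2 * f (row phi p.2 + (p.1 : V)) * \det (Dmx phi p.2)).
pose H (x : T) : R := b * `|u x * \det (Dmx phi x)|.
have Hi : itg mu H by exact/itgZ/itg_norm.
have mh : mble h.
  apply: measurable_funM; first by apply: (@mble_fst R _ _ T T (mol s)); exact: mol_mble.
  apply: measurable_funM; last first.
    by apply: (@mble_snd R _ _ T T (fun x => \det (Dmx phi x))); apply: mble_detD => i; exists (L i).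
  apply: measurable_funM; first by apply: (@mble_snd R _ _ T T u); exact: itg_mble ui.
  apply: (measurableT_comp (lip_mble fL)); apply: measurable_fun_rV => i /=.
  rewrite (_ : (fun _ => _) = fun p : T * T => phi i p.2 + (p.1 : V) ord0 i); last first.
    by apply/funext => p; rewrite !mxE.
  apply: measurable_funD.
    by apply: (@mble_snd R _ _ T T (phi i)); exact: lip_mble (phL i).
  by apply: (@mble_fst R _ _ T T (fun y : T => (y : V) ord0 i)); exact: measurable_coor.
have hGH z x : `|h (z, x)| <= mol s z * H x.
  rewrite /h /= normrM (ger0_norm (mol_ge0 s0 z)); apply: ler_wpM2l; first exact: mol_ge0.
  by rewrite -mulrA mulrCA normrM; apply: ler_wpM2r.
have E := dom_fubini mh hGH (mol_itg n s0) Hi.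
have i1 := dom_itg_fubini1 mh hGH (mol_itg n s0) Hi.
have hz z : \int[mu]_x h (z, x) = mol s z * F z.
  suff iF : itg mu (fun x : T => u x * f (row phi x + z) * \det (Dmx phi x)) by rewrite FE -(intZ _ iF).
  have [C C0 fC] := lip_csup_bounded fL fr.
  have -> : (fun x : T => u x * f (row phi x + z) * \det (Dmx phi x)) = (fun x => (u x * \det (Dmx phi x)) * f (row phi x + z)).
    by apply/funext => x; ring.
  apply: (itgMb det_itg _ (fun x => fC _)).
  apply: (measurableT_comp (lip_mble fL)); apply: measurable_fun_rV => i /=.
  rewrite (_ : (fun _ => _) = fun x : T => phi i x + z ord0 i); last by apply/funext => p; rewrite !mxE.
  exact: (lip_mble (lipD (phL i) (lip_cst (z ord0 i)))).
have cE : tint u (cv s f) phi = \int[mu]_z (mol s z * F z).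
  under [RHS]eq_Rintegral do rewrite -hz.
  rewrite E; apply: eq_Rintegral => x _.
  have [ix ->] := cv_shift s0 (row phi x) (itg_lip_csup fL fr).
  rewrite mulrAC -(intZ _ ix); apply: eq_Rintegral => z _; rewrite /h /=; ring.
have T0 : tint u f phi = \int[mu]_z (mol s z * F 0).
  under eq_Rintegral do rewrite mulrC.
  rewrite (intZ _ (mol_itg n s0)) (int_mol n s0) mulr1 /F.
  have -> // : (fun i x => phi i x + (0 : V) ord0 i) = phi.
  by apply/funext => i; apply/funext => x; rewrite mxE addr0.
rewrite distrC cE T0.
have := @mol_avg R n s s0 F (fun=> F 0) B; apply.
- by under eq_fun do rewrite -hz; exact: i1.
- by under eq_fun do rewrite mulrC; exact/itgZ/mol_itg.
- exact: FB.
Qed.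

End pushed.

(** [u] is replaced by a Lipschitz function close in [L^1], so that [pushed_close] applies, and then
    the test is mollified at a scale depending on the gradient of that function. Half of the error
    goes to each replacement. *)
Lemma push_dens u ru phi L : itg mu (u : T -> R) -> csup ru u -> (forall i, lip (L i) (phi i)) -> exists2 w : V -> R, itg mu (w : T -> R) &
  forall f Lf rf, lip Lf f -> csup rf f -> tint u f phi = \int[mu]_x (w x * f x).
Proof.
move=> ui ur phL; apply: density_limit => e e0.
pose P := n.+1`!%:R * \prod_i (`|L i| + 1).
have P0 : 0 <= P by apply: mulr_ge0; [|apply: prodr_ge0 => i _; rewrite addr_ge0].
have P1 : 0 < P + 1 by rewrite ltr_wpDl.
have d0 : 0 < e / 2 / (P + 1) by rewrite !divr_gt0.
have [Lo [ro [q [oL oR od]]]] := lip_dense ui d0.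
have phL' i : lip (`|L i| + 1) (phi i) by apply: lipW (phL i); rewrite (le_trans (ler_norm _))// lerDl.
pose D := \sum_k \int[mu]_x `|pd k q x|.
have D0 : 0 <= D by apply: sumr_ge0 => k _; apply: int_ge0.
have D1 : 0 < P * D + 1 by rewrite ltr_wpDl// mulr_ge0.
have s0 : 0 < e / 2 / (P * D + 1) by rewrite !divr_gt0.
have oi := itg_lip_csup oL oR.
have [w wi wE] := pushed_density oi oR phL s0.
exists w => // f Lf rf b fL fr fb; have b0 := bound_ge0 fb.
rewrite -(wE f Lf rf fL fr).
apply: (le_trans (ler_distD (tint q f phi) _ _)).
have -> : e * b = e / 2 * b + e / 2 * b by field.
apply: lerD.
  apply: (le_trans (tint_diff_weight ui oi fL fr fb phL')).
  have -> : n.+1`!%:R * b * (\prod_i (`|L i| + 1)) * \int[mu]_x `|u x - q x| = b * (P * \int[mu]_x `|u x - q x|).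
    by rewrite /P; ring.
  rewrite mulrC; apply: ler_wpM2r => //.
  apply: (@le_trans _ _ (P * (e / 2 / (P + 1)))); first by apply: (ler_wpM2l P0); exact: ltW.
  by rewrite mulrA ler_pdivrMr// mulrC ler_wpM2l ?lerDl// ltW// divr_gt0.
apply: (le_trans (pushed_close oi oR phL oL s0 fL fr fb)).
have -> : n.+1`!%:R * b * (e / 2 / (P * D + 1)) * (\prod_i (`|L i| + 1)) * D = P * D * (e / 2) / (P * D + 1) * b.
  by rewrite /P; ring.
by apply: ler_wpM2r => //; rewrite ler_pdivrMr// mulrC ler_wpM2l ?lerDl// ltW// divr_gt0.
Qed.

End push_lip.

Section lip_push.
Context (R : realType) (n : nat).
Local Notation V := 'rV[R]_n.+1.
Local Notation T := 'rV[measurableTypeR R]_n.+1.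
Local Notation mu := (lebesgue_rV R n.+1).
Implicit Types (f g h w u : V -> R) (phi p q : 'I_n.+1 -> V -> R) (psi : V -> V).

Lemma comp_funE psi x : \row_i comp_fun psi i x = psi x.
Proof. by apply/rowP => i; rewrite mxE. Qed.

Lemma Lip_choice phi : (forall i, Lip (phi i)) -> exists2 M, 0 <= M & forall i, lip M (phi i).
Proof.
move=> H; have /choice[L LP] : forall i, exists L, lip L (phi i) by move=> i; have /LipP[L _ ?] := H i; exists L.
by have [M M0 [h _]] := lip_row LP; exists M.
Qed.

Lemma Dmx_near p q x : (forall i, \forall y \near x, p i y = q i y) -> Dmx p x = Dmx q x.
Proof. by move=> H; apply/matrixP => i j; rewrite !DmxE; exact: pd_near. Qed.

Lemma near_ball_lt (x : V) (r : R) : enorm x < r -> \forall y \near x, enorm (y : V) < r.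
Proof.
move=> xr; apply/nbhs_eballP; exists (r - enorm x); rewrite ?subr_gt0// => y; rewrite enormB => h.
have -> : y = x + (y - x) by rewrite addrC subrK.
by rewrite (le_lt_trans (enormD _ _))// addrC -ltrBrDr.
Qed.

Lemma lipb_det (A : V -> 'M[R]_n.+1) : (forall i j, lipb (fun x => A x i j)) -> lipb (fun x => \det (A x)).
Proof.
move=> H; have lipb_sum I (s : seq I) (F : I -> V -> R) : (forall i, lipb (F i)) -> lipb (fun x => \sum_(i <- s) F i x).
  move=> HF; elim: s => [|a s [L [C [l c]]]].
    by exists 0, 0; split=> [x y|x]; rewrite !big_nil ?subrr normr0 ?mul0r.
  have [L' [C' [l' c']]] := HF a; exists (L' + L), (C' + C); split=> [x y|x]; rewrite !big_cons.
    by have := lipD l' l x y.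
  by rewrite (le_trans (ler_normD _ _))// lerD.
apply: lipb_sum => s; have [L [C [l c]]] := @lipb_prod R n 'I_n.+1 (index_enum _) xpredT (fun i x => A x i (s i)) (fun i _ => H i (s i)).
exists (`|(-1) ^+ s| * L), C; split; first exact: lipZ.
by move=> x; rewrite normrM normrX normrN1 expr1n mul1r.
Qed.

Lemma nice_lipb_pd g e D j : 0 < e -> itg mu (g : T -> R) -> (forall x, `|g x| <= D) -> lipb (pd j (cv e g)).
Proof.
move=> e0 gi gD; have [C [L [_ l _]]] := cv_nice e0 gi; exists L, (D * (molK R n / e)); split=> // x.
by rewrite cv_pd//; exact: dcv_sup.
Qed.

(** [push_dens] tests against coordinates only. General Lipschitz [g] are mollified, so that the
    chain rule and multiplicativity of determinants reduce them to that case; [weak_det] takes the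
    limit on both sides. *)
Lemma lip_push_density u ru psi : itg mu (u : T -> R) -> csup ru u -> (forall i, Lip (comp_fun psi i)) ->
  exists w, is_lip_push_density u psi w.
Proof.
move=> ui ur psL; have [M M0 pM] := Lip_choice psL.
have psM : lipm (n.+1%:R * M) psi by apply: lipm_coor; exact: pM.
have [w0 wi wE] := push_dens ui ur pM.
have [r r0 rb] := row_bounded (ru + 1) pM.
have {}rb x : enorm x < ru + 1 -> enorm (psi x) <= r.
  by move=> xr; rewrite -comp_funE; apply: rb; exact: ltW.
have crL := @cutoff_lip R n r; have crr := @cutoff_csup R n r.
exists (fun x => w0 x * cutoff r x); split.
  split; first by exact: (itgMb wi (lip_mble crL) (@cutoff_norm R n r)).
  exists [set x : V | enorm x <= r + 1]; first exact: compact_eball.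
  by apply: aeW => x /= /negP; rewrite -ltNge => /crr ->; rewrite mulr0.
move=> f g fLip gLip; have [Lf Lf0 fL] := (LipP f).1 fLip; have [Mg Mg0 gM] := Lip_choice gLip.
have [Lc _ fcL] := lip_mul_csup fL crL crr.
(* Integrable, hence fit for mollification, and equal to [g] on the open ball of radius [r + 2],
   which contains all points at which either integral looks at [g]. *)
pose g' i x := g i x * cutoff (r + 2) x.
have [Mg' Mg'0 g'M] : exists2 L, 0 <= L & forall i, lip L (g' i).
  suff /Lip_choice : forall i, Lip (g' i) by [].
  move=> i; apply/LipP; have [L L0 h] := lip_mul_csup (gM i) (@cutoff_lip R n (r + 2)) (@cutoff_csup R n (r + 2)).
  by exists L.
have g'r i : csup (r + 2 + 1) (g' i) by apply: csupMr; exact: cutoff_csup.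
have g'i i := itg_lip_csup (g'M i) (g'r i).
have g'E i y : enorm y < r + 2 -> g' i y = g i y by move=> h; rewrite /g' cutoff1 ?mulr1// ltW.
pose G k i := cv (hseq R k) (g' i).
have h0 k : 0 < hseq R k by rewrite invr_gt0 ltr0n.
have GM k i : lip Mg' (G k i) by apply: cv_lipL.
have Gc i y : G k i y @[k --> \oo] --> g' i y.
  apply/cvgrPdist_le => e e0; have M1 : 0 < Mg' + 1 by rewrite ltr_wpDl.
  have d0 : 0 < e / (Mg' + 1) by rewrite divr_gt0.
  apply: filterS (near_infty_natSinv_lt (PosNum d0)) => k /= kd; rewrite distrC.
  apply: (cv_close (h0 k) (g'i i)) => z zk; rewrite (le_trans (g'M i _ _))// addrC addKr.
  apply: (@le_trans _ _ (Mg' * (e / (Mg' + 1)))).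
    by apply: ler_wpM2l => //; apply: (le_trans zk); exact: ltW.
  by rewrite mulrA ler_pdivrMr// mulrC ler_wpM2l ?lerDl// ltW.
have compM h : lip Mg' h -> lip (Mg' * (n.+1%:R * M)) (h \o psi) by move=> hM; exact: lip_comp.
have psx x : u x != 0 -> enorm x < ru + 1.
  move=> un; rewrite (@le_lt_trans _ _ ru) ?ltrDl// leNgt; apply/negP => /ur /eqP.
  by rewrite (negbTE un).
have fcr : csup (r + 1) (fun x => f x * cutoff r x) by exact: csupMr.
have fcb := lip_csup_bounded fcL fcr.
have mps : measurable_fun setT (psi : T -> T) by apply: measurable_fun_rV => i; exact: lip_mble (pM i).
have Pi : itg mu (fun x : T => u x * (f (psi x) * cutoff r (psi x))).
  have [C C0 fC] := fcb; apply: (itgMb ui _ (fun x => fC _)).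
  exact: (measurableT_comp (lip_mble fcL) mps).
have Wi : itg mu (fun x : T => w0 x * (f x * cutoff r x)).
  by have [C C0 fC] := fcb; exact: (itgMb wi (lip_mble fcL) fC).
have left_lim : \int[mu]_x (u x * (f (psi x) * cutoff r (psi x)) * \det (Dmx (fun i => G k i \o psi) x))
    @[k --> \oo] --> current_push psi (current u) f g.
  rewrite (_ : current_push psi (current u) f g = \int[mu]_x (u x * (f (psi x) * cutoff r (psi x)) * \det (Dmx (fun i => g' i \o psi) x))).
    apply: (weak_det (M := Mg' * (n.+1%:R * M))) => //.
    - by move=> k i; exact: compM.
    - by move=> i; exact: compM.
    - by move=> i x; exact: Gc.
  apply: eq_Rintegral => x _ /=; have [->|un] := eqVneq (u x) 0; first by rewrite !mul0r.
  rewrite cutoff1 ?mulr1; last exact/rb/psx.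
  congr (_ * \det _); apply: Dmx_near => i; apply: filterS (near_ball_lt (psx _ un)) => y yr /=.
  by rewrite g'E// (le_lt_trans (rb _ yr))// ltrDl.
have right_lim : \int[mu]_x (w0 x * (f x * cutoff r x) * \det (Dmx (G k) x)) @[k --> \oo] -->
    current (fun x => w0 x * cutoff r x) f g.
  rewrite (_ : current _ f g = \int[mu]_x (w0 x * (f x * cutoff r x) * \det (Dmx g' x))).
    exact: (weak_det (M := Mg')).
  apply: eq_Rintegral => x _ /=; have [->|cn] := eqVneq (cutoff r x) 0; first by rewrite !(mulr0, mul0r).
  have xr : enorm x < r + 2.
    rewrite (@le_lt_trans _ _ (r + 1)) ?ltrD2l ?ltr1n// leNgt; apply/negP => /crr /eqP.
    by rewrite (negbTE cn).
  rewrite (_ : Dmx g x = Dmx g' x); first by ring.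
  by apply: Dmx_near => i; apply: filterS (near_ball_lt xr) => y yr; rewrite g'E.
apply: (cvg_seq_unique left_lim); apply: cvg_seq_eq right_lim => k.
(* The gradients of the mollified [G k] are bounded and Lipschitz, so [f * cutoff r * det D(G k)] is
   itself an admissible test for [w0]. *)
have dl : lipb (fun x => \det (Dmx (G k) x)).
  apply: lipb_det => i j; under eq_fun do rewrite DmxE.
  have [C C0 gC] := lip_csup_bounded (g'M i) (g'r i).
  exact: (nice_lipb_pd _ (h0 k) (g'i i) gC).
have [Ld [Cd [dL dC]]] := dl; have [Cf Cf0 fC] := fcb.
have FL := lipM fcL dL fC dC.
have Fr : csup (r + 1) (fun x => f x * cutoff r x * \det (Dmx (G k) x)) by exact: csupMl.
transitivity (\int[mu]_x (w0 x * (f x * cutoff r x * \det (Dmx (G k) x)))).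
  by apply: eq_Rintegral => x _; exact/esym/mulrA.
rewrite -(wE _ _ _ FL Fr) /tint; apply: int_aeE.
- apply: (measurable_funM _ (mble_detD _)); last by move=> i; exists M.
  apply: (measurable_funM (itg_mble ui)).
  under eq_fun do rewrite comp_funE.
  exact: (measurableT_comp (lip_mble FL) mps).
- apply: (measurable_funM (itg_mble Pi) (mble_detD _)) => i; exists (Mg' * (n.+1%:R * M)); exact: compM.
have dP : {ae mu, forall x : T, forall i j, derivable (comp_fun psi i) x (delta_mx ord0 j : V)}.
  by apply: filter_forall => i; exact: lip_ae_derivable_all (pM i).
apply: filterS dP => x dx /=; rewrite comp_funE.
rewrite (_ : Dmx (fun i => G k i \o psi) x = Dmx (G k) (psi x) *m Dmx (comp_fun psi) x).
  by rewrite det_mulmx; ring.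
apply/matrixP => i j; rewrite DmxE !mxE.
have [C C0 tC] := cv_taylor (h0 k) (g'i i).
have [_ ->] := chain_rule tC C0 psM (fun l => dx l j).
by apply: eq_bigr => l _; rewrite !mxE -/(pd l _ _) cv_pd.
Qed.

Lemma Dmx_coor (x : V) : Dmx (fun i (y : V) => y ord0 i) x = 1%:M.
Proof. by apply/matrixP => i j; rewrite DmxE pd_coor mxE eq_sym. Qed.

Lemma lip_push_test u psi w f L r : is_lip_push_density u psi w -> lip L f -> csup r f ->
  \int[mu]_x (w x * f x) = tint u f (comp_fun psi).
Proof.
move=> [_ H] fL fr.
have cL : forall i : 'I_n.+1, Lip (fun x : V => x ord0 i) by move=> i; apply/LipP; exists 1 => //; exact: lip_coor.
have fLip : Lip f by apply/LipP; exists L => //; exact: le_trans (pd_bound fL ord0 0).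
have := H f _ fLip cL; rewrite /current /current_push /= => E.
transitivity (\int[mu]_x (w x * f x * \det (Dmx (fun i (x : V) => x ord0 i) x))).
  by apply: eq_Rintegral => x _; rewrite Dmx_coor det1 mulr1.
by rewrite -E; apply: eq_Rintegral => x _; rewrite comp_funE.
Qed.

End lip_push.

(** * The limit density for Hoelder maps *)

Section push_holder.
Context (R : realType) (n : nat).
Local Notation V := 'rV[R]_n.+1.
Local Notation T := 'rV[measurableTypeR R]_n.+1.
Local Notation mu := (lebesgue_rV R n.+1).
Implicit Types (f g h w : V -> R) (phi p q : 'I_n.+1 -> V -> R).

Lemma holW al (M M' : R) f : M <= M' -> hol al M f -> hol al M' f.
Proof. by move=> MM fM x y; rewrite (le_trans (fM x y))// ler_wpM2r// powR_ge0. Qed.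

Lemma frac_half_lt (e b : R) : 0 < e -> 0 <= b -> e / (b + 1) / 2 * b < e.
Proof.
move=> e0 b0; have b1 : 0 < b + 1 by rewrite ltr_wpDl.
have -> : e / (b + 1) / 2 * b = e * b / ((b + 1) * 2) by field; rewrite gt_eqF.
by rewrite ltr_pdivrMr ?mulr_gt0// ltr_pM2l//; lra.
Qed.

Lemma lim_dist_le (s : nat -> R) (l c B : R) : s k @[k --> \oo] --> l ->
  (\forall k \near \oo, `|s k - c| <= B) -> `|l - c| <= B.
Proof.
move=> sl H; rewrite leNgt; apply/negP => lB; pose e := `|l - c| - B.
have e0 : 0 < e by rewrite subr_gt0.
move/cvgrPdist_lt : sl => /(_ _ e0) sl.
have [k [h1 h2]] : exists k, `|l - s k| < e /\ `|s k - c| <= B.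
  have [N1 _ h1] := sl; have [N2 _ h2] := H; exists (maxn N1 N2).
  by split; [apply: h1; exact: leq_maxl|apply: h2; exact: leq_maxr].
have := ler_distD (s k) l c; rewrite leNgt; case/negP.
by rewrite (lt_le_trans (ltr_leD h1 h2))// /e subrK.
Qed.

Lemma small_pow (al d : R) : 0 < al -> 0 < d -> exists2 x0 : R, 0 < x0 & forall t : R, 0 <= t -> t <= x0 -> t `^ al <= d.
Proof.
move=> al0 d0; exists (d `^ al^-1) => [|t t0 tx]; first exact: powR_gt0.
have dE : (d `^ al^-1) `^ al = d by rewrite -powRrM mulVf ?gt_eqF// powRr1// ltW.
rewrite -[leRHS]dE.
by apply: ge0_ler_powR; rewrite ?nnegrE ?powR_ge0// ltW.
Qed.

Variables (a ru C : R) (u : V -> R) (alpha : 'I_n.+1 -> R) (psi : V -> V).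
Hypotheses (a0 : 0 <= a) (a1 : a < 1) (ui : itg mu (u : T -> R)) (ur : csup ru u) (C0 : 0 <= C).
Hypothesis uC : forall e, 0 < e ->
  \sum_j \int[mu]_x `|pd j (cv e u) x| <= C * e `^ (- a) /\ \int[mu]_x `|u x - cv e u x| <= C * e `^ (1 - a).
Hypotheses (alpha01 : forall i, 0 < alpha i <= 1) (gam0 : 0 < \sum_i alpha i - (n%:R + a)).

(** [push_estimate] as uniform continuity: positivity of the exponent [gam] converts a small uniform
    distance into a small relative error, whatever the Lipschitz constants. *)
Lemma tint_close M e : 0 < M -> 0 < e -> exists2 d, 0 < d & forall p q L L' f Lf rf b,
  (forall i, lip (L i) (p i)) -> (forall i, lip (L' i) (q i)) ->
  (forall i, hol (alpha i) M (p i)) -> (forall i, hol (alpha i) M (q i)) ->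
  (forall i x, `|p i x - q i x| <= d) -> lip Lf f -> csup rf f -> (forall x, `|f x| <= b) ->
  `|tint u f p - tint u f q| <= e * b.
Proof.
move=> M0 e0; have [Cm Cm0 H] := push_estimate a0 ui ur C0 uC alpha01 M0 gam0.
have C1 : 0 < Cm + 1 by rewrite ltr_wpDl.
have d0 : 0 < e / (Cm + 1) by rewrite divr_gt0.
have [x0 x00 xP] := small_pow gam0 d0.
pose t := Num.min 1 x0; have t0 : 0 < t by rewrite lt_min ltr01.
(* For [t <= 1] one has [M t <= M t^(alpha i)] for all [i], so one uniform distance serves every
   component. *)
exists (M * t) => [|p q L L' f Lf rf b pL qL pM qM pq fL fr fb]; first exact: mulr_gt0.
have b0 := bound_ge0 fb.
have l1 i : lip (Num.max (L i) (L' i)) (p i) by apply: lipW (pL i); rewrite le_max lexx.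
have l2 i : lip (Num.max (L i) (L' i)) (q i) by apply: lipW (qL i); rewrite le_max lexx orbT.
have pq' i x : `|p i x - q i x| <= M * t `^ alpha i.
  rewrite (le_trans (pq i x))// ler_pM2l//; have /andP[al0 al1] := alpha01 i.
  have t1 : t <= 1 by rewrite ge_min lexx.
  have := le_powRN t0 t1 al1; rewrite powR1 => h.
  by rewrite -(mul_powR _ t0) ler_peMr// ltW.
apply: (le_trans (H _ _ _ _ _ _ _ _ t0 b0 pM qM l1 l2 pq' fL fr fb)).
rewrite mulrAC; apply: ler_wpM2r => //.
apply: (@le_trans _ _ (Cm * (e / (Cm + 1)))).
  by apply: (ler_wpM2l Cm0); apply: xP; [exact: ltW|rewrite ge_min lexx orbT].
by rewrite mulrA ler_pdivrMr// mulrC ler_wpM2l ?lerDl// ltW.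
Qed.

Hypothesis psiL : forall i, Lipa (alpha i) setT (comp_fun psi i).

Lemma Lipa_choice : exists2 M, 0 < M & forall i, hol (alpha i) M (comp_fun psi i).
Proof.
have /choice[M_ MP] : forall i, exists M, hol (alpha i) M (comp_fun psi i).
  by move=> i; have [M _ h] := LipaP (psiL i); exists M => x y; exact: h.
exists (1 + \sum_i `|M_ i|) => [|i]; first by rewrite ltr_pwDl// sumr_ge0.
apply: holW (MP i); rewrite (le_trans (ler_norm _))// (bigD1 i)//= addrCA lerDl.
by rewrite addr_ge0// sumr_ge0.
Qed.

Lemma lip_approx M : 0 < M -> (forall i, hol (alpha i) M (comp_fun psi i)) ->
  exists p : nat -> 'I_n.+1 -> V -> R,
    [/\ forall k i, exists L, lip L (p k i), forall k i, hol (alpha i) M (p k i) &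
     forall d, 0 < d -> \forall k \near \oo, forall i x, `|p k i x - psi x ord0 i| <= d].
Proof.
move=> M0 pM; have al i : 0 <= alpha i <= 1 by have /andP[/ltW -> ->] := alpha01 i.
have h0 k : 0 < hseq R k by rewrite invr_gt0 ltr0n.
exists (fun k i => infconv (M * (hseq R k) `^ (alpha i - 1)) (comp_fun psi i)); split.
- by move=> k i; exists (M * hseq R k `^ (alpha i - 1)); exact: infconv_lip (ltW M0) (al i) (h0 k) (pM i).
- by move=> k i; exact: infconv_hol (ltW M0) (al i) (h0 k) (pM i).
move=> d d0; apply: filter_forall => i; have /andP[ai _] := alpha01 i.
have dM : 0 < d / M by rewrite divr_gt0.
have [x0 x00 xP] := small_pow ai dM.
apply: filterS (near_infty_natSinv_lt (PosNum x00)) => k /= /ltW kx x.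
have hk := xP _ (ltW (h0 k)) kx; rewrite ler_pdivlMr// mulrC in hk.
have := infconv_le (ltW M0) (al i) (h0 k) (pM i) x.
have := infconv_ge (ltW M0) (al i) (h0 k) (pM i) x.
rewrite /comp_fun; move: (infconv _ _ x) hk => s; move: (M * _) (psi x _ _) => v z *.
by rewrite ler_norml; apply/andP; split; lra.
Qed.

(** The working form of [is_push_density]: single Lipschitz maps near [psi] with a Hoelder bound
    replace sequences, and [tint] replaces the densities of their push forwards. *)
Definition tested_by (v : V -> R) := forall M e, 0 < M -> 0 < e -> exists2 d, 0 < d &
  forall p L f Lf rf b, (forall i, lip (L i) (p i)) -> (forall i, hol (alpha i) M (p i)) ->
  (forall i x, `|p i x - psi x ord0 i| <= d) -> lip Lf f -> csup rf f -> (forall x, `|f x| <= b) ->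
  `|\int[mu]_x (v x * f x) - tint u f p| <= e * b.

Lemma hol_bounded M r : 0 < M -> (forall i, hol (alpha i) M (comp_fun psi i)) -> exists2 r', 0 <= r' &
  forall x, enorm x <= r -> enorm (psi x) <= r'.
Proof.
move=> M0 pM; exists (\sum_i (`|psi 0 ord0 i| + M * (`|r| + 1))) => [|x xr].
  by apply: sumr_ge0 => i _; rewrite addr_ge0// mulr_ge0 ?addr_ge0// ltW.
rewrite (le_trans (enorm_sumE _))//; apply: ler_sum => i _.
rewrite -[psi x ord0 i](subrK (psi 0 ord0 i)) (le_trans (ler_normD _ _))// addrC lerD2l.
rewrite (le_trans (pM i x 0))// ler_pM2l// subr0.
have /andP[al0 al1] := alpha01 i.
apply: (@le_trans _ _ ((`|r| + 1) `^ alpha i)).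
  apply: ge0_ler_powR; rewrite ?nnegrE ?enorm_ge0 ?addr_ge0// ?(ltW al0)//.
  by rewrite (le_trans xr)// (le_trans (ler_norm _))// lerDl.
by rewrite -[leRHS]powRr1 ?addr_ge0//; apply: ler_powR => //; rewrite lerDr.
Qed.

(** The values of [tint] along inf-convolutions of [psi] are Cauchy; their limit is a functional
    approximated by Lipschitz push forwards, so [density_limit] provides its density. A cutoff
    around the image of the support of [u] makes the support compact. *)
Lemma tested_exists : exists2 v, L1c v & tested_by v.
Proof.
have [M0 M00 pM0] := Lipa_choice.
have [p [pL pM pd]] := lip_approx M00 pM0.
have /choice[L_ LP] : forall k, exists L : 'I_n.+1 -> R, forall i, lip (L i) (p k i).
  by move=> k; have /choice[F FP] := pL k; exists F.
pose S f := limn (fun k => tint u f (p k)).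
have Scvg f Lf rf : lip Lf f -> csup rf f -> tint u f (p k) @[k --> \oo] --> S f.
  move=> fL fr; suff : cvgn (fun k => tint u f (p k)) by [].
  apply: cauchy_cvg; apply: cauchy_exP => e e0.
  have [b b0 fb] := lip_csup_bounded fL fr.
  have b1 : 0 < b + 1 by rewrite ltr_wpDl.
  have d0 : 0 < e / (b + 1) / 2 by rewrite !divr_gt0.
  have [d dp dH] := tint_close M00 d0.
  have d2 : 0 < d / 2 by rewrite divr_gt0.
  have [N _ NP] := pd _ d2; exists (tint u f (p N)); exists N => // k /= Nk.
  rewrite /ball_ /=; apply: (@le_lt_trans _ _ (e / (b + 1) / 2 * b)).
    apply: (dH _ _ _ _ f Lf rf b (LP N) (LP k)) => // i x.
    have h1 := NP N (leqnn N) i x; have h2 := NP k Nk i x.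
    rewrite (le_trans (ler_distD (psi x ord0 i) _ _))// [leRHS]splitr; apply: lerD => //.
    by rewrite distrC.
  exact: frac_half_lt.
have close M e : M0 <= M -> 0 < e -> exists2 d, 0 < d & forall q L f Lf rf b, (forall i, lip (L i) (q i)) ->
    (forall i, hol (alpha i) M (q i)) -> (forall i x, `|q i x - psi x ord0 i| <= d) ->
    lip Lf f -> csup rf f -> (forall x, `|f x| <= b) -> `|S f - tint u f q| <= e * b.
  move=> MM e0; have M1 : 0 < M by exact: lt_le_trans MM.
  have [d d0 dH] := tint_close M1 e0; have d2 : 0 < d / 2 by rewrite divr_gt0.
  exists (d / 2) => // q L f Lf rf b qL qM qd fL fr fb.
  apply: (lim_dist_le (Scvg _ _ _ fL fr)); apply: filterS (pd _ d2) => k kd.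
  apply: (dH _ _ _ _ f Lf rf b (LP k) qL) => //; first by move=> i; exact: holW (pM k i).
  move=> i x; rewrite (le_trans (ler_distD (psi x ord0 i) _ _))// [leRHS]splitr; apply: lerD => //.
  by rewrite distrC.
have [v0 v0i v0E] : exists2 w : V -> R, itg mu (w : T -> R) & forall f L r, lip L f -> csup r f ->
    S f = \int[mu]_x (w x * f x).
  apply: density_limit => e e0; have [d d0 dH] := close M0 e (lexx _) e0.
  have [N _ NP] := pd _ d0; have [w wi wE] := push_dens ui ur (LP N).
  exists w => // f L r b fL fr fb; rewrite -(wE _ _ _ fL fr).
  by apply: (dH _ _ f L r b (LP N)) => //; exact: NP (leqnn N).
have [r' r'0 r'P] := hol_bounded ru M00 pM0.
pose c := @cutoff R n (r' + 1).
exists (fun x => v0 x * c x).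
  split; first exact: (itgMb v0i (lip_mble (@cutoff_lip R n _)) (@cutoff_norm R n _)).
  exists [set x : V | enorm x <= r' + 1 + 1]; first exact: compact_eball.
  by apply: aeW => x /= /negP; rewrite -ltNge => /cutoff_csup h; rewrite /c h mulr0.
move=> M e Mp e0; pose M1 := Num.max M M0.
have M01 : M0 <= M1 by rewrite le_max lexx orbT.
have [d d0 dH] := close M1 e M01 e0.
(* Components within [1 / (n + 1)] keep the map within distance 1 of [psi], hence inside the ball
   where the cutoff equals 1. *)
have n0 : 0 < n.+1%:R^-1 :> R by rewrite invr_gt0.
exists (Num.min d n.+1%:R^-1); first by rewrite lt_min d0.
move=> q L f Lf rf b qL qM qd fL fr fb.
have cr : csup (r' + 1 + 1) c by exact: cutoff_csup.
have [Lc _ fcL] := lip_mul_csup fL (@cutoff_lip R n (r' + 1)) cr.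
have fcr : csup (r' + 1 + 1) (fun x => f x * c x) by exact: csupMr.
have -> : \int[mu]_x (v0 x * c x * f x) = S (fun x => f x * c x).
  rewrite (v0E _ _ _ fcL fcr).
  by apply: eq_Rintegral => x _; rewrite -mulrA [c x * _]mulrC.
have -> : tint u f q = tint u (fun x => f x * c x) q.
  apply: eq_Rintegral => x _; have [->|un] := eqVneq (u x) 0; first by rewrite !mul0r.
  rewrite (_ : c _ = 1) ?mulr1//; apply: cutoff1.
  have xr : enorm x <= ru by rewrite leNgt; apply/negP => /ur /eqP; rewrite (negbTE un).
  rewrite -[\row_i _](subrK (psi x)) (le_trans (enormD _ _))// addrC lerD ?r'P//.
  rewrite (le_trans (enorm_sumE _))//.
  apply: (@le_trans _ _ (\sum_(i < n.+1) n.+1%:R^-1)); last by rewrite sumr_const card_ord -[leLHS]mulr_natr mulVf// pnatr_eq0.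
  by apply: ler_sum => i _; rewrite !mxE (le_trans (qd i x))// ge_min lexx orbT.
apply: (dH q L (fun x => f x * c x) Lc (r' + 1 + 1)) => //.
- by move=> i; apply: holW (qM i); rewrite le_max lexx.
- by move=> i x; rewrite (le_trans (qd i x))// ge_min lexx.
- move=> x; rewrite normrM (le_trans _ (fb x))// ler_piMr//; exact: cutoff_norm.
Qed.

(** [push_density] is some function chosen by [xget]. The function of [tested_exists] shows that a
    choice is possible, and one approximating sequence shows that any two admissible functions agree
    almost everywhere. *)
Lemma push_density_tested : L1c (push_density alpha u psi) /\ tested_by (push_density alpha u psi).
Proof.
have [v0 v0c v0t] := tested_exists; have [v0i _] := v0c.
have pushE v (psi_ : nat -> V -> V) (w_ : nat -> V -> R) : is_push_density alpha u psi v ->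
  (forall k i, Lip (comp_fun (psi_ k) i)) ->
  (forall e : R, 0 < e -> \forall k \near \oo, forall x, enorm (psi_ k x - psi x) < e) ->
  (exists M : R, forall k i, (Lipc (alpha i) setT (comp_fun (psi_ k) i) <= M%:E)%E) ->
  (forall k, is_lip_push_density u (psi_ k) (w_ k)) ->
  forall e, 0 < e -> \forall k \near \oo, \int[mu]_x `|w_ k x - v x| < e.
  move=> [[vi _] H] h1 h2 h3 h4 e e0; have := H _ _ h1 h2 h3 h4.
  move/fine_cvgP => [_ /cvgrPdist_lt /(_ _ e0)]; apply: filterS => k; rewrite sub0r normrN /=.
  by rewrite ger0_norm// fine_ge0//; exact: integral_ge0.
have p0 : is_push_density alpha u psi v0.
  split=> // psi_ w_ h1 h2 [M hM] h4; pose M1 := Num.max M 1.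
  have M10 : 0 < M1 by rewrite lt_max ltr01 orbT.
  have pM k i : hol (alpha i) M1 (comp_fun (psi_ k) i).
    by apply/Lipc_le; [exact: ltW|rewrite (le_trans (hM k i))// lee_fin le_max lexx].
  have di k : itg mu (fun x : T => w_ k x - v0 x) by apply: itgB => //; have [[]] := h4 k.
  apply/fine_cvgP; split.
    by apply: nearW => k; rewrite (int_EFin (itg_norm (di k))).
  apply/cvgrPdist_le => e e0; have [d d0 dH] := v0t M1 e M10 e0.
  apply: filterS (h2 _ d0) => k kd; rewrite sub0r normrN /= (int_EFin (itg_norm (di k))) /=.
  rewrite ger0_norm; last exact: int_ge0.
  apply: (L1_dual (di k)) => L r f fL fr f1.
  have [Mk _ kL] := Lip_choice (h1 k).
  have wi : itg mu (w_ k : T -> R) by have [[]] := h4 k.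
  have -> : \int[mu]_x ((w_ k x - v0 x) * f x) = \int[mu]_x (w_ k x * f x) - \int[mu]_x (v0 x * f x).
    rewrite -(intB (itg_mul_lip wi fL fr) (itg_mul_lip v0i fL fr)).
    by apply: eq_Rintegral => x _; rewrite mulrBl.
  rewrite (lip_push_test (h4 k) fL fr) distrC -[leRHS]mulr1.
  apply: (dH _ (fun=> Mk) _ L r) => // i x.
  rewrite /comp_fun (_ : _ - _ = (psi_ k x - psi x) ord0 i); last by rewrite !mxE.
  by rewrite (le_trans (coor_le _ _))// ltW.
have p1 : is_push_density alpha u psi (push_density alpha u psi) by apply: xgetPex; exists v0.
set v := push_density _ _ _ in p1 *; have [vc _] := p1; split=> //; have [vi _] := vc.
have [M M0 pM] := Lipa_choice; have [p [pL pH pd]] := lip_approx M0 pM.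
pose psi_ k x : V := \row_i p k i x.
have pE k i : comp_fun (psi_ k) i = p k i by apply/funext => x; rewrite /comp_fun mxE.
have h1 k i : Lip (comp_fun (psi_ k) i).
  by rewrite pE; have [L h] := pL k i; apply/LipP; exists L => //; exact: le_trans (pd_bound h ord0 0).
have h2 (e : R) : 0 < e -> \forall k \near \oo, forall x, enorm (psi_ k x - psi x) < e.
  (* There are [n.+1] coordinates; dividing by [n.+2] makes the final inequality strict. *)
  move=> e0; have d0 : 0 < e / n.+2%:R by rewrite divr_gt0.
  apply: filterS (pd _ d0) => k kd x; rewrite (le_lt_trans (enorm_sumE _))//.
  apply: (@le_lt_trans _ _ (\sum_(i < n.+1) e / n.+2%:R)).
    by apply: ler_sum => i _; rewrite !mxE.
  by rewrite sumr_const card_ord -[ltLHS]mulr_natr mulrAC ltr_pdivrMr// ltr_pM2l// ltr_nat.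
have h3 : exists M : R, forall k i, (Lipc (alpha i) setT (comp_fun (psi_ k) i) <= M%:E)%E.
  by exists M => k i; rewrite pE; apply/Lipc_le; [exact: ltW|].
have /choice[w_ h4] : forall k, exists w, is_lip_push_density u (psi_ k) w.
  by move=> k; exact: (lip_push_density ui ur (h1 k)).
have dvi : itg mu (fun x : T => v x - v0 x) by exact: itgB.
have N0 : \int[mu]_x `|v x - v0 x| = 0.
  apply/eqP; rewrite eq_le int_ge0// andbT; apply/ler_addgt0Pr => e e0; rewrite add0r.
  have e2 : 0 < e / 2 by rewrite divr_gt0.
  have [N1 _ H1] := pushE _ _ _ p1 h1 h2 h3 h4 _ e2; have [N2 _ H2] := pushE _ _ _ p0 h1 h2 h3 h4 _ e2.
  pose k := maxn N1 N2; have {}H1 := H1 k (leq_maxl _ _); have {}H2 := H2 k (leq_maxr _ _).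
  have wi : itg mu (w_ k : T -> R) by have [[]] := h4 k.
  have i1 := itg_norm (itgB wi vi); have i2 := itg_norm (itgB wi v0i).
  apply: (@le_trans _ _ (\int[mu]_x (`|w_ k x - v x| + `|w_ k x - v0 x|))).
    apply: int_le; [exact: itg_norm|exact: itgD|] => x.
    by rewrite (le_trans (ler_distD (w_ k x) _ _))// lerD2r distrC.
  by rewrite (intD i1 i2) [leRHS]splitr; apply: lerD; exact: ltW.
have ae0 := int_norm0_ae dvi N0.
move=> M' e M'0 e0; have [d d0 dH] := v0t M' e M'0 e0; exists d => // q L f Lf rf b qL qM qd fL fr fb.
rewrite (_ : \int[mu]_x (v x * f x) = \int[mu]_x (v0 x * f x)); first exact: (dH _ L _ Lf rf).
apply: int_aeE; [exact: itg_mble (itg_mul_lip vi fL fr)|exact: itg_mble (itg_mul_lip v0i fL fr)|].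
by apply: filterS ae0 => x /eqP; rewrite subr_eq0 => /eqP ->.
Qed.

End push_holder.

(** * The push forward near a regular value *)

Section compactness.
Context (R : realType) (n : nat).
Local Notation V := 'rV[R]_n.+1.

(** Compactness in the only form used below: a property that holds near each point of [K] at all
    small scales holds on [K] at one common scale. *)
Lemma compact_uniform (K : set V) (P : R -> V -> Prop) : compact K ->
  (forall x, K x -> exists2 d, 0 < d & forall y e, enorm (x - y) < d -> 0 < e -> e < d -> P e y) ->
  exists2 e, 0 < e & forall x, K x -> P e x.
Proof.
move=> /compact_near_coveringP cK H.
have F : \forall e \near (0 : R)^'+, K `<=` P e.
  apply: (cK R (0 : R)^'+ P _) => x Kx; have [d d0 dH] := H x Kx.
  exists ([set y : V | enorm (x - y) < d], [set e : R | 0 < e < d]); last first.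
    by move=> [y e] /= [h /andP[h1 h2]]; exact: dH.
  split; first by apply/nbhs_eballP; exists d.
  by apply: filterS2 (nbhs_right_gt 0) (nbhs_right_lt d0) => e /= -> ->.
by have [e [e0 eP]] := filter_ex (filterI (nbhs_right_gt 0) F); exists e.
Qed.

Lemma continuous_enormP (g : V -> V) x e : {for x, continuous g} -> 0 < e ->
  exists2 d, 0 < d & forall y, enorm (x - y) < d -> enorm (g y - g x) < e.
Proof.
move=> gc e0; have /gc : nbhs (g x) [set z : V | enorm (g x - z) < e] by apply/nbhs_eballP; exists e.
by move=> /nbhs_eballP[d d0 dH]; exists d => // y /dH; rewrite /= enormB.
Qed.

Lemma compact_lb (K : set V) (m : V -> R) : compact K -> continuous m -> (forall x, K x -> 0 < m x) ->
  exists2 e, 0 < e & forall x, K x -> e <= m x.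
Proof.
move=> cK mc m0; apply: compact_uniform => // x Kx.
have /cvgrPdist_lt/(_ (m x / 2)) := mc x; rewrite divr_gt0 ?m0// => /(_ isT) /nbhs_eballP[d d0 dH].
exists (Num.min d (m x / 2)) => [|y e]; first by rewrite lt_min d0 divr_gt0 ?m0.
rewrite !lt_min => /andP[/dH /ltr_normlP[h1 h2] _] _ /andP[_ ex]; move: (m x) (m y) h1 h2 ex => s t; lra.
Qed.

Lemma compact_unif (K : set V) (g : V -> V) w : compact K -> continuous g -> 0 < w ->
  exists2 e, 0 < e & forall x, K x -> forall z, enorm z <= e -> enorm (g (x + z) - g x) < w.
Proof.
move=> cK gc w0; apply: (@compact_uniform K (fun e x => forall z, enorm z <= e -> enorm (g (x + z) - g x) < w)) => // x Kx.
have w2 : 0 < w / 2 by rewrite divr_gt0.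
have [d d0 dH] := continuous_enormP (gc x) w2.
exists (d / 2) => [|y e yd e0 ed z ze]; first by rewrite divr_gt0.
rewrite (le_lt_trans (enorm_dist_triangle _ (g x) _))// [ltRHS]splitr ltrD//.
  apply: dH; have -> : x - (y + z) = (x - y) - z by rewrite opprD addrA.
  rewrite (le_lt_trans (enormD _ _))// enormN [ltRHS]splitr ltr_leD// (le_trans ze)// ltW//.
by rewrite enormB; apply: dH; rewrite (lt_le_trans yd)// ler_pdivrMr// ler_peMr ?ler1n// ltW.
Qed.

End compactness.

(** * Homotopy invariance and the degree of linear maps *)

Section homotopy_invariance.
Context (R : realType) (n : nat).
Local Notation V := 'rV[R]_n.+1.
Local Notation T := 'rV[measurableTypeR R]_n.+1.
Local Notation mu := (lebesgue_rV R n.+1).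
Implicit Types (f g h w u : V -> R) (phi p q : 'I_n.+1 -> V -> R).

Lemma csup_neq0 r f x : csup r f -> f x != 0 -> enorm x <= r.
Proof. by move=> fr; rewrite leNgt; apply: contraNN => /fr ->. Qed.

(** [homotopy_estimate] with [b = 0]. That estimate asks for a bounded displacement, so [q - p] is
    first cut off outside the support of [w], which affects neither side. *)
Lemma tint_homotopy p q Lw rw w Lf rf f : (forall i, Lip (p i)) -> (forall i, Lip (q i)) ->
  lip Lw w -> csup rw w -> lip Lf f -> csup rf f ->
  (forall x k, pd k w x != 0 -> forall s, 0 <= s <= 1 -> f (\row_i (p i x + s * (q i x - p i x))) = 0) ->
  tint w f p = tint w f q.
Proof.
move=> pL qL wL wr fL fr H; have [Mp Mp0 pM] := Lip_choice pL; have [Mq Mq0 qM] := Lip_choice qL.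
pose c := @cutoff R n (rw + 1).
have cL : lip 1 c by exact: cutoff_lip.
have cr : csup (rw + 1 + 1) c by exact: cutoff_csup.
have /choice[M_ M_P] : forall i, exists MC : R * R, [/\ 0 <= MC.1, 0 <= MC.2, lip MC.1 (fun x => (q i x - p i x) * c x) &
    forall x, `|(q i x - p i x) * c x| <= MC.2].
  move=> i; have [M M0 h] := lip_mul_csup (lipB (qM i) (pM i)) cL cr.
  have hr : csup (rw + 1 + 1) (fun x => (q i x - p i x) * c x) by exact: csupMr.
  by have [C C0 hC] := lip_csup_bounded h hr; exists (M, C).
pose M := Mp + 1 + \sum_i (M_ i).1; pose C := \sum_i (M_ i).2.
have S0 : 0 <= \sum_i (M_ i).1 by apply: sumr_ge0 => i _; have [] := M_P i.
have C0 : 0 <= C by apply: sumr_ge0 => i _; have [] := M_P i.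
have M1 : 1 <= M by rewrite /M addrAC lerDr addr_ge0.
pose q' i x := p i x + (q i x - p i x) * c x.
have pM' i : lip M (p i) by apply: lipW (pM i); rewrite /M -addrA lerDl addr_ge0.
have qM' i : lip M (q' i).
  have [_ _ h _] := M_P i; apply: lipW (lipD (pM i) h); rewrite /M -addrA lerD2l.
  by rewrite (le_trans _ (_ : \sum_i (M_ i).1 <= _)) ?lerDr// (bigD1 i)//= lerDl sumr_ge0// => j _; have [] := M_P j.
have dM i x : `|q' i x - p i x| <= C * M.
  rewrite /q' addrAC subrr add0r; have [_ C20 _ h] := M_P i; rewrite (le_trans (h x))//.
  rewrite (@le_trans _ _ C)// ?ler_peMr// /C (bigD1 i)//= lerDl sumr_ge0// => j _; by have [] := M_P j.
have fb (x : V) (k : 'I_n.+1) : pd k w x != 0 -> forall s, 0 <= s <= 1 ->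
    `|f (\row_i (p i x + s * (q' i x - p i x)))| <= 0.
  move=> wx s s01; rewrite normr_le0; apply/eqP; rewrite -[RHS](H x k wx s s01); congr f.
  apply/rowP => i; rewrite !mxE /q' addrAC subrr add0r /c cutoff1 ?mulr1//.
  have wr' : csup rw (pd k w) by exact: csup_pd.
  by rewrite (le_trans (csup_neq0 wr' wx))// lerDl.
have := homotopy_estimate pM' qM' C0 dM wL wr fL fr fb; rewrite mulr0 !mul0r normr_le0 subr_eq0 => /eqP ->.
apply: eq_Rintegral => x _; have [->|wx] := eqVneq (w x) 0; first by rewrite !mul0r.
have xr : enorm x < rw + 1 by rewrite (le_lt_trans (csup_neq0 wr wx))// ltrDl.
have E i y : enorm y < rw + 1 -> q' i y = q i y.
  by move=> yr; rewrite /q' /c cutoff1 ?mulr1 ?ltW// addrC subrK.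
rewrite (_ : \row_i q' i x = \row_i q i x); last by apply/rowP => i; rewrite !mxE E.
rewrite (_ : Dmx q' x = Dmx q x)//; apply: Dmx_near => i.
by apply: filterS (near_ball_lt xr) => y /E.
Qed.

Definition lin (A : 'M[R]_n.+1) (i : 'I_n.+1) (x : V) : R := (x *m A) ord0 i.

Definition mxsum (A : 'M[R]_n.+1) : R := \sum_i \sum_j `|A j i|.

Lemma lin_row A x : \row_i lin A i x = x *m A.
Proof. by apply/rowP => i; rewrite mxE. Qed.

Lemma enorm_mulmx A (x : V) : enorm (x *m A) <= mxsum A * enorm x.
Proof.
rewrite (le_trans (enorm_sumE _))// mulr_suml; apply: ler_sum => i _; rewrite mxE mulr_suml.
by rewrite (le_trans (ler_norm_sum _ _ _))//; apply: ler_sum => j _; rewrite normrM mulrC ler_wpM2l// coor_le.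
Qed.

Lemma lin_lip A i : Lip (lin A i).
Proof.
apply/LipP; exists (mxsum A) => [|x y]; first by apply: sumr_ge0 => j _; exact: sumr_ge0.
rewrite /lin (_ : _ - _ = ((x - y) *m A) ord0 i); last by rewrite mulmxBl !mxE.
by rewrite (le_trans (coor_le _ _))// enorm_mulmx.
Qed.

Lemma Dmx_lin A x : Dmx (lin A) x = A^T.
Proof.
apply/matrixP => i j; rewrite DmxE mxE.
have tl : taylor 0 (lin A i) (fun j _ => A j i).
  move=> y v; rewrite /lin (_ : ((y + v) *m A) ord0 i = (y *m A) ord0 i + (v *m A) ord0 i).
    by rewrite [X in X - _]addrAC subrr add0r mxE subrr normr0 mul0r.
  by rewrite mulmxDl mxE.
by rewrite (taylor_pd j tl).
Qed.

(** Cramer's rule: [x *m A *m \adj A] is [\det A] times [x], and the adjugate is bounded through its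
    cofactors. The constant is uniform over the matrices considered. *)
Lemma mulmx_lb A (c K : R) (x : V) : 0 < c -> c <= `|\det A| -> (forall i j, `|A i j| <= K) ->
  c * enorm x <= (n.+1%:R * (n.+1%:R * (n`!%:R * K ^+ n))) * enorm (x *m A).
Proof.
move=> c0 cA AK; have K0 : 0 <= K by rewrite (le_trans _ (AK ord0 ord0)).
apply: (@le_trans _ _ (enorm (x *m A *m \adj A))).
  rewrite -mulmxA mul_mx_adj mul_mx_scalar enormZ.
  by apply: ler_wpM2r => //; exact: enorm_ge0.
rewrite (le_trans (enorm_mulmx _ _))// ler_wpM2r ?enorm_ge0//.
have sc (c' : R) : n.+1%:R * c' = \sum_(i < n.+1) c' by rewrite sumr_const card_ord mulr_natl.
rewrite sc; apply: ler_sum => i _; rewrite sc; apply: ler_sum => j _.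
by rewrite mxE; exact: cofactor_bound.
Qed.

(** The degree of the linear map [x *m A] at the origin, computed by integration against a
    mollifier. *)
Definition linmass e (A : 'M[R]_n.+1) : R := \int[mu]_x (mol e (x *m A) * \det A).

Lemma linmass_tint e A w : (forall x : V, mol e (x *m A) != 0 -> w x = 1) -> linmass e A = tint w (mol e) (lin A).
Proof.
move=> H; apply: eq_Rintegral => x _; rewrite lin_row Dmx_lin det_tr.
have [->|/H ->] := eqVneq (mol e (x *m A)) 0; first by rewrite mulr0 !mul0r.
by rewrite mul1r.
Qed.

Lemma linmass_seg e A B c : 0 < e -> 0 < c ->
  (forall s, 0 <= s <= 1 -> c <= `|\det (A + s *: (B - A))|) -> linmass e A = linmass e B.
Proof.
move=> e0 c0 H; pose K := \sum_i \sum_j (`|A i j| + `|B i j|).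
have AK s : 0 <= s <= 1 -> forall i j, `|(A + s *: (B - A)) i j| <= K.
  move=> /andP[s0 s1] i j; rewrite !mxE.
  have -> : A i j + s * (B i j - A i j) = (1 - s) * A i j + s * B i j by ring.
  rewrite (@le_trans _ _ (`|A i j| + `|B i j|))//.
    rewrite (le_trans (ler_normD _ _))// !normrM lerD// ler_piMl//; rewrite ger0_norm ?subr_ge0//.
    by rewrite lerBlDr lerDl.
  rewrite /K (bigD1 i)//= (bigD1 j)//= -addrA lerDl addr_ge0//; first by apply: sumr_ge0 => k _; rewrite addr_ge0.
  by apply: sumr_ge0 => l _; apply: sumr_ge0 => k _; rewrite addr_ge0.
have K0 : 0 <= K by rewrite (le_trans _ (AK 0 _ ord0 ord0))// lexx ler01.
(* By [mulmx_lb], every [x] at which some matrix of the segment maps into the support of the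
   mollifier has norm below [r]; the cutoff at [r] is therefore locally constant there. *)
pose Q := n.+1%:R * (n.+1%:R * (n`!%:R * K ^+ n)); pose r := (Q + 1) * e / c.
have Q0 : 0 <= Q by rewrite !mulr_ge0// exprn_ge0.
have Q1 : 0 < Q + 1 by rewrite ltr_wpDl.
have small s (x : V) : 0 <= s <= 1 -> mol e (x *m (A + s *: (B - A))) != 0 -> enorm x < r.
  move=> s01 /(csup_neq0 (mol_csup e0)) xe; have := mulmx_lb x c0 (H s s01) (AK s s01); rewrite -/Q => h.
  rewrite ltr_pdivlMr// mulrC (le_lt_trans h)//.
  by rewrite (@le_lt_trans _ _ (Q * e)) ?ler_wpM2l// ltr_pM2r// ltrDl.
have A0 : A + 0 *: (B - A) = A by rewrite scale0r addr0.
have B1 : A + 1 *: (B - A) = B by rewrite scale1r addrC subrK.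
rewrite (@linmass_tint e A (cutoff r)); last first.
  by move=> x; rewrite -{1}A0 => h; apply: cutoff1; apply/ltW/(small 0) => //; rewrite lexx ler01.
rewrite (@linmass_tint e B (cutoff r)); last first.
  by move=> x; rewrite -{1}B1 => h; apply: cutoff1; apply/ltW/(small 1) => //; rewrite lexx ler01.
have [Lm _ mL] := mol_lip n e0.
apply: (tint_homotopy (lin_lip A) (lin_lip B) (@cutoff_lip R n r) (@cutoff_csup R n r) mL (mol_csup e0)).
move=> x k cx s s01; apply/eqP; apply: contraNT cx.
have -> : \row_i (lin A i x + s * (lin B i x - lin A i x)) = x *m (A + s *: (B - A)).
  apply/rowP => i; rewrite mulmxDr -scalemxAr mulmxBr mxE.
  by rewrite [RHS]mxE [X in _ = _ + X]mxE [X in _ = _ + _ * X]mxE [X in _ = _ + _ * (_ + X)]mxE.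
move=> /(small s x s01) xr; apply/eqP.
have -> : pd k (cutoff r) x = pd k (fun=> 1) x by apply: pd_near; apply: filterS (near_ball_lt xr) => y /ltW /cutoff1.
exact: pd_cst.
Qed.

Lemma seg_min (m m' s : R) : 0 < m * m' -> 0 <= s <= 1 -> Num.min `|m| `|m'| <= `|m + s * (m' - m)|.
Proof.
move=> mm /andP[s0 s1]; have E : m + s * (m' - m) = (1 - s) * m + s * m' by ring.
have s1' : 0 <= 1 - s by rewrite subr_ge0.
have /orP[/andP[m0 m'0]|/andP[m0 m'0]] : (0 <= m) && (0 <= m') || (m <= 0) && (m' <= 0).
- have [m0|m0] := ltP 0 m; first by rewrite pmulr_rgt0// in mm; rewrite (ltW m0) (ltW mm).
  have m1 : m < 0 by rewrite lt_neqAle m0 andbT; apply: contraTneq mm => ->; rewrite mul0r ltxx.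
  by rewrite nmulr_rgt0// in mm; rewrite !(ltW mm) orbT.
- rewrite !ger0_norm ?E ?addr_ge0 ?mulr_ge0//.
  set t := Num.min m m'; have h1 : t <= m by rewrite ge_min lexx.
  have h2 : t <= m' by rewrite ge_min lexx orbT.
  have -> : t = (1 - s) * t + s * t by ring.
  by rewrite lerD// ler_wpM2l.
- rewrite !ler0_norm ?E//; last by rewrite -oppr_ge0 opprD -!mulrN addr_ge0// mulr_ge0// oppr_ge0.
  set t := Num.min (- m) (- m'); have h1 : t <= - m by rewrite ge_min lexx.
  have h2 : t <= - m' by rewrite ge_min lexx orbT.
  have -> : t = (1 - s) * t + s * t by ring.
  by rewrite opprD -!mulrN lerD// ler_wpM2l.
Qed.

(** Along the segment the matrices stay triangular and no diagonal entry crosses zero, which bounds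
    the determinant from below. *)
Lemma linmass_trig e A B : 0 < e -> is_trig_mx A -> is_trig_mx B -> (forall i, 0 < A i i * B i i) ->
  linmass e A = linmass e B.
Proof.
move=> e0 tA tB AB; apply: (@linmass_seg e A B (\prod_i Num.min `|A i i| `|B i i|)) => //.
  apply: prodr_gt0 => i _; rewrite lt_min !normr_gt0.
  by apply/andP; split; apply/eqP => h; have := AB i; rewrite h ?mul0r ?mulr0 ltxx.
move=> s s01; rewrite det_trig; last first.
  move/is_trig_mxP : tA => tA; move/is_trig_mxP : tB => tB.
  by apply/is_trig_mxP => i j ij; rewrite !mxE tA// tB// subrr mulr0 addr0.
rewrite normr_prod; apply: ler_prod => i _; rewrite !mxE seg_min// andbT le_min !normr_ge0//.
Qed.

Lemma mol_enorm e (x y : V) : enorm x = enorm y -> mol e x = mol e y.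
Proof. by move=> xy; rewrite -[mol e x]/(_ * pos (e ^+ 2 - enorm x ^+ 2) ^+ 2) xy. Qed.

Lemma enorm_perm (s : 'S_n.+1) (x : V) : enorm (x *m perm_mx s) = enorm x.
Proof.
rewrite /enorm; congr Num.sqrt; rewrite (reindex_inj (@perm_inj _ s))/=; apply: eq_bigr => i _.
have -> : x *m perm_mx s = col_perm s^-1%g x by rewrite col_permE invgK.
by rewrite mxE permK.
Qed.

Lemma linmass_itg e A : 0 < e -> \det A != 0 -> itg mu (fun x : T => mol e ((x : V) *m A)).
Proof.
move=> e0 A0; have c0 : 0 < `|\det A| by rewrite normr_gt0.
pose Q := n.+1%:R * (n.+1%:R * (n`!%:R * mxsum A ^+ n)).
have S0 : 0 <= mxsum A by apply: sumr_ge0 => i _; exact: sumr_ge0.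
have Q0 : 0 <= Q by rewrite !mulr_ge0// exprn_ge0.
have AK i j : `|A i j| <= mxsum A.
  rewrite /mxsum (bigD1 j)//= (bigD1 i)//= -addrA lerDl addr_ge0//; first exact: sumr_ge0.
  by apply: sumr_ge0 => k _; exact: sumr_ge0.
have [Lm Lm0 mL] := mol_lip n e0; have [C C0 [mC _]] := mol_bounded n e0.
have AL : lipm (mxsum A) (fun x : V => x *m A) by move=> x y; rewrite -mulmxBl; exact: enorm_mulmx.
apply: (@itg_csup _ _ (Q * e / `|\det A|) C) => [|x|x].
- exact: (lip_mble (lip_comp Lm0 mL AL)).
- exact: mC.
- move=> h; apply: (mol_csup e0); move: h; rewrite ltr_pdivrMr// [ltRHS]mulrC => h.
  have Qe := lt_le_trans h (mulmx_lb x c0 (lexx _) AK); rewrite -/Q in Qe.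
  rewrite ltNge; apply/negP => xe; move: Qe; rewrite ltNge; case/negP.
  by rewrite ler_wpM2l.
Qed.

(* The LUP decomposition reduces this to triangular matrices, which are joined
   to diagonal sign matrices by segments of invertible matrices. *)
Lemma linmass_sg e A : 0 < e -> \det A != 0 -> linmass e A = Num.sg (\det A).
Proof.
move=> e0 A0.
have := cormen_lup_perm A^T; have := cormen_lup_correct A^T; have := cormen_lup_detL A^T.
have := @cormen_lup_lower _ _ A^T; have := @cormen_lup_upper _ _ A^T.
case: cormen_lup => [[P L] U] /= Uu Ll dL PLU /is_perm_mxP [s sP].
have AE : A = (U^T *m L^T) *m (perm_mx s).
  rewrite -trmx_mul -[L *m U]/(L * U) -PLU -[P * _]/(P *m _) sP trmx_mul trmxK -mulmxA tr_perm_mx -perm_mxM.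
  by rewrite mulVg perm_mx1 mulmx1.
have dU : \det A = \prod_i U i i * (-1) ^+ s.
  rewrite AE !det_mulmx !det_tr dL mulr1 det_perm -det_tr det_trig; last first.
    by apply/is_trig_mxP => i j ij; rewrite mxE Uu.
  by congr (_ * _); apply: eq_bigr => i _; rewrite mxE.
have U0 i : U i i != 0.
  apply: contraNN A0 => /eqP h; rewrite dU (bigD1 i)//= h !mul0r//.
have dU' : \det U^T != 0.
  by rewrite det_tr -det_tr det_trig; [apply/prodf_neq0 => i _; rewrite mxE|apply/is_trig_mxP => i j ij; rewrite mxE Uu].
have dUL : \det (U^T *m L^T) != 0 by rewrite det_mulmx [X in _ * X]det_tr dL mulr1.
have -> : linmass e A = (-1) ^+ s * linmass e (U^T *m L^T).
  rewrite /linmass -intZ; last by under eq_fun do rewrite mulrC; exact/itgZ/linmass_itg.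
  apply: eq_Rintegral => x _; have -> : \det A = \det (U^T *m L^T) * (-1) ^+ s by rewrite {1}AE det_mulmx det_perm.
  have -> : mol e (x *m A) = mol e (x *m (U^T *m L^T)).
    by apply: mol_enorm; rewrite [in LHS]AE mulmxA enorm_perm.
  by move: (mol e _) (\det _) ((-1) ^+ s) => a b c; ring.
have -> : linmass e (U^T *m L^T) = linmass e U^T.
  symmetry; apply: (@linmass_seg e _ _ `|\det U^T|) => //; first by rewrite normr_gt0.
  move=> t _; rewrite (_ : _ + _ = U^T *m (1%:M + t *: (L - 1%:M))^T).
    suff d1 : \det (1%:M + t *: (L - 1%:M))^T = 1 by rewrite det_mulmx d1 mulr1.
    rewrite det_tr det_trig; first by rewrite big1// => i _; rewrite !mxE eqxx Ll// eqxx subrr mulr0 addr0.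
    apply/is_trig_mxP => i j ij; rewrite !mxE (Ll i j (ltnW ij)).
    have -> : (i == j) = false by rewrite -val_eqE/= ltn_eqF.
    by rewrite subrr mulr0 addr0.
  have -> : (1%:M + t *: (L - 1%:M))^T = 1%:M + t *: (L^T - 1%:M).
    by apply/matrixP => i j; rewrite !mxE (eq_sym j).
  rewrite mulmxDr mulmx1 -scalemxAr mulmxBr mulmx1//.
pose D : 'M[R]_n.+1 := \matrix_(i, j) (Num.sg (U i i) * (i == j)%:R).
have tD : is_trig_mx D by apply/is_trig_mxP => i j ij; rewrite mxE -val_eqE/= ltn_eqF// mulr0.
have -> : linmass e U^T = linmass e D.
  apply: linmass_trig => //; first by apply/is_trig_mxP => i j ij; rewrite mxE Uu.
  by move=> i; rewrite !mxE eqxx mulr1 mulrC -normrEsg normr_gt0.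
have dD : \det D = \prod_i Num.sg (U i i).
  by rewrite det_trig//; apply: eq_bigr => i _; rewrite mxE eqxx mulr1.
have xD (x : V) : enorm (x *m D) = enorm x.
  rewrite /enorm; congr Num.sqrt; apply: eq_bigr => i _; rewrite mxE (bigD1 i)//= big1 ?addr0.
    by rewrite mxE eqxx mulr1 exprMn sqr_sg U0 mulr1.
  by move=> j ji; rewrite mxE (negbTE ji) !mulr0.
have -> : linmass e D = \det D.
  rewrite /linmass; under eq_Rintegral do rewrite (mol_enorm e (xD _)) mulrC.
  by rewrite (intZ _ (mol_itg n e0)) (int_mol n e0) mulr1.
rewrite dD dU sgrM mulrC; congr (_ * _).
  by elim/big_rec2: _ => [|i x y _ ->]; rewrite ?sgr1 ?sgrM.
by rewrite sgrX sgrN sgr1.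
Qed.

End homotopy_invariance.

Section set_distance.
Context (R : realType) (n : nat).
Local Notation V := 'rV[R]_n.+1.
Variables (A : set V) (a : V).
Hypothesis Aa : A a.

Lemma dist_set_le x z : A z -> dist_set x A <= enorm (x - z).
Proof. by move=> Az; apply: ge_inf; [exists 0 => _ [t _ <-]; exact: enorm_ge0|exists z]. Qed.

Lemma dist_set_glb x c : (forall z, A z -> c <= enorm (x - z)) -> c <= dist_set x A.
Proof. by move=> H; apply: lb_le_inf; [exists (enorm (x - a)), a|move=> _ [z Az <-]; exact: H]. Qed.

Lemma dist_set_ge0 x : 0 <= dist_set x A.
Proof. by apply: dist_set_glb => z _; exact: enorm_ge0. Qed.

Lemma dist_set_lip : lip 1 (fun x : V => dist_set x A).
Proof.
suff H x y : dist_set x A - dist_set y A <= enorm (x - y).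
  move=> x y; rewrite mul1r; apply/ler_normlP; split; last exact: H.
  by rewrite opprB enormB; exact: H.
rewrite lerBlDr addrC -lerBlDr; apply: dist_set_glb => z Az.
by rewrite lerBlDr addrC (le_trans (dist_set_le _ Az))// enorm_dist_triangle.
Qed.

Lemma dist_set0 x : A x -> dist_set x A = 0.
Proof. by move=> Ax; apply/eqP; rewrite eq_le dist_set_ge0 andbT -(enorm0 R n.+1) -(subrr x) dist_set_le. Qed.

Lemma dist_set_gt0 x : closed A -> ~ A x -> 0 < dist_set x A.
Proof.
move=> cA nAx; have : open (~` A) by rewrite openC.
rewrite openE => /(_ x nAx) /nbhs_eballP[d d0 dH].
apply: (lt_le_trans d0); apply: dist_set_glb => z Az; rewrite leNgt; apply/negP => /dH; exact.
Qed.

End set_distance.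

Section differential.
Context (R : realType) (n : nat).
Local Notation V := 'rV[R]_n.+1.

Lemma coor_cvg I (F : set_system I) (f : I -> V) (l : V) i : f @ F --> l -> f t ord0 i @[t --> F] --> l ord0 i.
Proof. by move=> fl P /(lip_continuous (lip_coor i)) h; exact: fl h. Qed.

Lemma diff_Dmx (g : V -> V) (a h : V) : differentiable g a ->
  'd g a h = h *m (Dmx (comp_fun g) a)^T.
Proof.
move=> dg; rewrite -deriveE// deriveEjacobian//; congr (h *m _); apply/matrixP => j i.
rewrite [RHS]mxE DmxE.
have -> : jacobian g a j i = ('D_(delta_mx ord0 j) g a) ord0 i.
  by rewrite deriveEjacobian// -rowE [RHS]mxE.
have dv : derivable g a (delta_mx ord0 j) by exact: diff_derivable.
symmetry; apply: cvg_lim => //.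
have := @coor_cvg _ _ _ _ i dv.
apply: cvg_trans; apply: near_eq_cvg; apply: nearW => t /=.
by rewrite !mxE.
Qed.

Lemma frechet (g : V -> V) (a : V) e : differentiable g a -> 0 < e -> exists2 d, 0 < d &
  forall z, enorm z < d -> enorm (g (a + z) - g a - z *m (Dmx (comp_fun g) a)^T) <= e * enorm z.
Proof.
move=> dg e0; have [_ /eqaddoP H] := (diff_locallyP _ _).1 dg.
have e' : 0 < e / n.+1%:R by rewrite divr_gt0.
have /nbhs_eballP[d d0 dH] := H _ e'.
exists d => // z zd; have := dH z; rewrite sub0r enormN => /(_ zd) /= h.
rewrite (le_trans (enorm_mxnorm _))//.
have E : g (a + z) - g a - z *m (Dmx (comp_fun g) a)^T = (g \o shift a - (cst (g a) + 'd g a)) z.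
  by rewrite -diff_Dmx//= opprD addrA [a + z]addrC.
rewrite E; apply: (@le_trans _ _ (n.+1%:R * (e / n.+1%:R * `|z|))); first by rewrite ler_wpM2l.
have -> : n.+1%:R * (e / n.+1%:R * `|z|) = e * `|z| by rewrite mulrA [_ * (e / _)]mulrC divfK// pnatr_eq0.
by rewrite (ler_wpM2l (ltW e0))// mxnorm_enorm.
Qed.

Lemma mulmx_lb1 (A : 'M[R]_n.+1) : \det A != 0 -> exists2 c, 0 < c & forall z : V, c * enorm z <= enorm (z *m A).
Proof.
move=> A0; have c0 : 0 < `|\det A| by rewrite normr_gt0.
pose Q := n.+1%:R * (n.+1%:R * (n`!%:R * mxsum A ^+ n)).
have AK i j : `|A i j| <= mxsum A.
  rewrite /mxsum (bigD1 j)//= (bigD1 i)//= -addrA lerDl addr_ge0//; first exact: sumr_ge0.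
  by apply: sumr_ge0 => k _; exact: sumr_ge0.
have S0 : 0 <= mxsum A by apply: sumr_ge0 => i _; exact: sumr_ge0.
have Q1 : 0 < Q + 1 by rewrite ltr_wpDl// !mulr_ge0// exprn_ge0.
exists (`|\det A| / (Q + 1)) => [|z]; first by rewrite divr_gt0.
rewrite mulrAC ler_pdivrMr// (le_trans (mulmx_lb z c0 (lexx _) AK))// -/Q mulrC ler_wpM2l ?enorm_ge0//.
by rewrite lerDl.
Qed.

Lemma small_all (I : eqType) (s : seq I) (P : I -> R -> Prop) :
  (forall x, x \in s -> exists2 d, 0 < d & forall r, 0 < r -> r < d -> P x r) ->
  exists2 d, 0 < d & forall x, x \in s -> forall r, 0 < r -> r < d -> P x r.
Proof.
elim: s => [|a s IH] H; first by exists 1.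
have [d d0 dH] := H a (mem_head _ _).
have [|d' d'0 d'H] := IH; first by move=> x xs; apply: H; rewrite in_cons xs orbT.
exists (Num.min d d') => [|x]; first by rewrite lt_min d0.
rewrite in_cons => /orP[/eqP ->|xs] r r0; rewrite lt_min => /andP[rd rd']; [exact: dH|exact: d'H].
Qed.

Lemma open_eball (a : V) r : open [set y : V | enorm (a - y) < r].
Proof.
rewrite openE => y /= ay; apply/nbhs_eballP; exists (r - enorm (a - y)); rewrite ?subr_gt0// => z yz.
by rewrite /= (le_lt_trans (enorm_dist_triangle _ y _))// addrC -ltrBrDr.
Qed.

Lemma finite_fiber (K : set V) (g : V -> V) (y : V) : compact K -> continuous g ->
  (forall x, K x -> g x = y -> exists2 d, 0 < d & forall z, enorm z < d -> g (x + z) = y -> z = 0) ->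
  finite_set (K `&` g @^-1` [set y]).
Proof.
move=> cK gc H; set Z := _ `&` _.
have cZ : compact Z.
  apply: (subclosed_compact _ cK); last by move=> x [].
  apply: closedI; first exact: compact_closed.
  apply: closed_comp; first by move=> x _; exact: gc.
  exact: compact_closed (@compact_set1 _ y).
have /choice[d dP] : forall x : V, exists d : R, 0 < d /\ (Z x -> forall z, enorm z < d -> g (x + z) = y -> z = 0).
  move=> x; have [[Kx gx]|nZ] := pselect (Z x); last by exists 1.
  by have [d d0 dH] := H x Kx gx; exists d.
rewrite compact_cover in cZ.
have [||X XZ cX] := cZ V Z (fun x => [set z : V | enorm (x - z) < d x]).
- by move=> x _; exact: open_eball.
- by move=> x Zx; exists x => //=; rewrite subrr enorm0; have [] := dP x.
apply: (sub_finite_set _ (finite_fset X)) => z Zz; have [x /= xX xz] := cX z Zz.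
have Zx : Z x by have := XZ x xX; rewrite inE.
have [_ /(_ Zx (z - x))] := dP x; rewrite enormB => /(_ xz).
rewrite addrC subrK; have [_ /= ->] := Zz => /(_ erefl) /eqP; rewrite subr_eq0 => /eqP ->.
exact: xX.
Qed.

(** [g] is cut off beyond [K] to become integrable and then mollified. The approximant is [C^{1,1}],
    as the covering of critical values and the passage to [C1] maps both need. *)
Lemma lip_approx_compact (K : set V) (g : V -> V) w : compact K -> continuous g -> 0 < w ->
  exists q : 'I_n.+1 -> V -> R, [/\ forall i, Lip (q i), forall i, nice (q i) &
    forall x, K x -> enorm (\row_i q i x - g x) <= w].
Proof.
move=> cK gc w0.
have [r r0 rK] : exists2 r, 0 <= r & forall x, K x -> enorm x <= r.
  have [|e e0 eH] := @compact_uniform R n K (fun e x => enorm x * e <= 1) cK.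
    move=> x Kx; exists (Num.min 1 (enorm x + 1)^-1); first by rewrite lt_min ltr01 invr_gt0 ltr_wpDl ?enorm_ge0.
    have x1 : 0 < enorm x + 1 by rewrite ltr_wpDl ?enorm_ge0.
    move=> y e; rewrite !lt_min => /andP[xy _] e0 /andP[_ ex].
    have : enorm y <= enorm x + 1.
      rewrite -[y](subrK x) (le_trans (enormD _ _))// addrC lerD2l enormB; exact: ltW.
    move=> h; apply: (@le_trans _ _ ((enorm x + 1) * (enorm x + 1)^-1)); last by rewrite mulfV ?gt_eqF.
    by apply: ler_pM; rewrite ?enorm_ge0 ?(ltW e0) ?(ltW ex).
  by exists e^-1 => [|x /eH]; rewrite ?invr_ge0 ?(ltW e0)// -ler_pdivlMr// div1r.
have w' : 0 < w / n.+1%:R by rewrite divr_gt0.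
have [e e0 eH] := compact_unif cK gc w'.
pose c := @cutoff R n (r + e).
pose G i x := g x ord0 i * c x.
have Gr i : csup (r + e + 1) (G i) by apply: csupMr; exact: cutoff_csup.
have Gc i : continuous (G i).
  move=> x; have h1 : (fun y => g y ord0 i) y @[y --> x] --> g x ord0 i by exact: (@coor_cvg _ _ _ _ i (gc x)).
  exact: (@cvgM R V _ (nbhs_filter x) _ _ _ _ h1 (lip_continuous (@cutoff_lip R n (r + e)) (x := x))).
have Gb i : exists C, forall x, `|G i x| <= C.
  have [|d d0 dH] := @compact_uniform R n _ (fun d x => `|G i x| * d <= 1) (@compact_eball R n (r + e + 1)).
    move=> x _; have x1 : 0 < `|G i x| + 1 by rewrite ltr_wpDl.
    have /cvgrPdist_lt/(_ 1 ltr01)/nbhs_eballP[d d0 dH] := Gc i x.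
    exists (Num.min d (`|G i x| + 1)^-1); first by rewrite lt_min d0 invr_gt0.
    move=> y t; rewrite !lt_min => /andP[xy _] t0 /andP[_ tx].
    have h : `|G i y| <= `|G i x| + 1.
      have := dH y xy; rewrite distrC => /ltW h; rewrite -[G i y](subrK (G i x)).
      by rewrite (le_trans (ler_normD _ _))// addrC lerD2l.
    apply: (@le_trans _ _ ((`|G i x| + 1) * (`|G i x| + 1)^-1)); last by rewrite mulfV ?gt_eqF.
    by apply: ler_pM; rewrite ?(ltW t0) ?(ltW tx).
  exists d^-1 => x; have [xr|xr] := leP (enorm x) (r + e + 1); last by rewrite (Gr i _ xr) normr0 invr_ge0 ltW.
  by have := dH x xr; rewrite -ler_pdivlMr// div1r.
have Gi i : itg (lebesgue_rV R n.+1) (G i : 'rV[measurableTypeR R]_n.+1 -> R).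
  by have [C GC] := Gb i; exact: (itg_csup (continuous_mble (Gc i)) GC (Gr i)).
exists (fun i => cv e (G i)); split=> [i|i|x Kx]; [|exact: cv_nice|].
  by apply/LipP; have [L L0 h] := cv_lip e0 (Gi i); exists L.
rewrite (le_trans (enorm_sumE _))//.
apply: (@le_trans _ _ (\sum_(i < n.+1) w / n.+1%:R)); last first.
  by rewrite sumr_const card_ord -[leLHS]mulr_natr divfK// pnatr_eq0.
apply: ler_sum => i _; rewrite !mxE.
have c1 z : enorm z <= e -> c (x + z) = 1.
  by move=> ze; apply: cutoff1; rewrite (le_trans (enormD _ _))// lerD// rK.
have c0 : c x = 1 by apply: cutoff1; rewrite (le_trans (rK x Kx))// lerDl ltW.
have -> : g x ord0 i = G i x by rewrite /G c0 mulr1.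
apply: (cv_close e0 (Gi i)) => z ze; rewrite /G c1// c0 !mulr1.
rewrite (_ : _ - _ = (g (x + z) - g x) ord0 i); last by rewrite !mxE.
by rewrite (le_trans (coor_le _ _))// ltW// eH.
Qed.

End differential.

Section degree_value.
Context (R : realType) (n : nat).
Local Notation V := 'rV[R]_n.+1.
Local Notation T := 'rV[measurableTypeR R]_n.+1.
Local Notation mu := (lebesgue_rV R n.+1).
Implicit Types (f g h w : V -> R) (p q : 'I_n.+1 -> V -> R).

Lemma boundary_open (U : set V) x : open U -> closure U x -> ~ U x -> boundary U x.
Proof. by move=> oU cx nUx; split=> // /interior_subset. Qed.

Lemma boundaryP (U : set V) x : open U -> boundary U x <-> closure U x /\ ~ U x.
Proof.
move=> oU; split=> [[cx nx]|[]]; last exact: boundary_open.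
by split=> // Ux; apply: nx; rewrite -/(interior U) (iffLR (@interior_id _ U) oU).
Qed.

Lemma bounded_enorm (U : set V) : bounded_set U -> exists2 r, 0 <= r & forall x, U x -> enorm x <= r.
Proof.
move=> [M [_ HM]]; exists (n.+1%:R * (`|M| + 1)) => [|x Ux]; first by rewrite mulr_ge0 ?addr_ge0.
rewrite (le_trans (enorm_mxnorm _))// ler_wpM2l//; apply: (HM (`|M| + 1)) => //.
by rewrite (le_lt_trans (ler_norm _))// ltrDl.
Qed.

Lemma compact_closure_bounded (U : set V) : bounded_set U -> compact (closure U).
Proof.
move=> /bounded_enorm[r r0 rU]; apply: (subclosed_compact (@closed_closure _ _) (@compact_eball R n r)).
by have /closure_id E := @closed_eball R n r; rewrite E; apply: closure_subset.
Qed.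

Lemma boundary_compact (U : set V) : open U -> bounded_set U -> compact (boundary U).
Proof.
move=> Uo Ub; have -> : boundary U = closure U `&` ~` U by apply/seteqP; split=> x /boundaryP-/(_ Uo).
by apply: compact_closedI; [exact: compact_closure_bounded|exact: open_closedC].
Qed.

Variables (U : set V) (psi : V -> V) (v : V -> R).
Hypotheses (Uo : open U) (Ub : bounded_set U) (psic : continuous psi).
Hypothesis vtest : forall r e, 0 < r -> 0 < e -> exists p, [/\ forall i, Lip (p i),
  forall x, enorm (\row_i p i x - psi x) <= r &
  forall f Lf rf b, lip Lf f -> csup rf f -> (forall x, `|f x| <= b) ->
    `|\int[mu]_x (v x * f x) - tint (\1_U) f p| <= e * b].

Variables (g : V -> V) (y0 : V).
Hypotheses (gC1 : C1 g) (gpsi : forall x, boundary U x -> enorm (g x - psi x) < enorm (psi x - y0)).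
Hypothesis greg : regular_value g U y0.

Let K := closure U.
Let cK : compact K. Proof. exact: compact_closure_bounded. Qed.
Let gc : continuous g. Proof. by move=> x; exact/differentiable_continuous/gC1.1. Qed.
Let KU x : U x -> K x. Proof. exact: subset_closure. Qed.

Let A (a : V) : 'M[R]_n.+1 := (Dmx (comp_fun g) a)^T.

Let outside : exists a, ~ U a.
Proof.
have [r r0 rU] := bounded_enorm Ub; apply: contrapT => /forallNP H.
have /rU : U ((r + 1) *: delta_mx ord0 ord0) by apply: contrapT; exact: H.
by rewrite enormZ enorm_delta mulr1 ger0_norm ?addr_ge0// gerDl leNgt ltr01.
Qed.

Let dU (x : V) := dist_set x (~` U).

Let dU_lip : lip 1 dU. Proof. by have [a na] := outside; exact: (@dist_set_lip _ _ _ a). Qed.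

Let h (x : V) : R := enorm (psi x - y0) - enorm (g x - psi x).

Let enorm_cont (F : V -> V) : continuous F -> continuous (fun x => enorm (F x)).
Proof.
move=> Fc x; apply/(@cvgrPdist_lt _ _ _ _ (nbhs_filter x)) => e e0.
have [d d0 dH] := continuous_enormP (Fc x) e0; apply/nbhs_eballP; exists d => // y /dH.
by apply: le_lt_trans; rewrite distrC; exact: enorm_lip.
Qed.

Let subc (F G : V -> V) : continuous F -> continuous G -> continuous (fun x => F x - G x).
Proof. by move=> Fc Gc x; apply: (@cvgB _ _ _ _ (nbhs_filter x)); [exact: Fc|exact: Gc]. Qed.

(* On [closure U] either the distance to the complement of [U] is at least
   [eta], or the whole segment from [psi x] to [g x] is [eta]-far from [y0]. *)
Let eta_spec : exists2 eta, 0 < eta & forall x, K x -> eta <= h x \/ eta <= dU x.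
Proof.
have hc : continuous h.
  have cc : continuous ((fun _ : V => y0) : V -> V) by apply: (@lipm_continuous R n n 0) => x x'; rewrite subrr enorm0 mul0r.
  have h1 := enorm_cont (subc psic cc); have h2 := enorm_cont (subc gc psic).
  by move=> x; exact: (@cvgB _ _ _ _ (nbhs_filter x) _ _ _ _ (h1 x) (h2 x)).
have [|x Kx|eta eta0 H] := @compact_lb R n K (fun x => Num.max (h x) (dU x)) cK.
- move=> x; have dc : {for x, continuous dU} by exact: (lip_continuous dU_lip).
  exact: (continuous_max (hc x) dc).
- have [Ux|nUx] := pselect (U x); rewrite lt_max.
    have [a na] := outside; rewrite (dist_set_gt0 (a := a)) ?orbT//.
      exact: open_closedC.
  by rewrite subr_gt0 gpsi//; exact: boundary_open.
by exists eta => // x /H; rewrite le_max => /orP.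
Qed.

Let Z := U `&` g @^-1` [set y0].

Let A_det a : Z a -> \det (A a) != 0.
Proof. by move=> [Ua ga]; rewrite det_tr; exact: greg. Qed.

Let KZ x : K x -> g x = y0 -> U x.
Proof.
move=> Kx gx; apply: contrapT => nUx; have := gpsi (boundary_open Uo Kx nUx).
by rewrite gx enormB ltxx.
Qed.

Let local a : Z a -> exists2 c, 0 < c & (forall z, c * enorm z <= enorm (z *m A a)) /\
  exists2 d, 0 < d & forall z, enorm z < d -> enorm (g (a + z) - y0 - z *m A a) <= c / 2 * enorm z.
Proof.
move=> Za; have [c c0 cA] := mulmx_lb1 (A_det Za); exists c => //; split=> //.
have c2 : 0 < c / 2 by rewrite divr_gt0.
have [d d0 dH] := frechet (gC1.1 a) c2; exists d => // z /dH; have [_ ->] := Za; exact.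
Qed.

Let Zfin : finite_set Z.
Proof.
have -> : Z = K `&` g @^-1` [set y0].
  by apply/seteqP; split=> x [] h1 h2; split=> //; [exact: KU|exact: KZ].
apply: finite_fiber => // x Kx gx; have [c c0 [cA [d d0 dH]]] := local (conj (KZ Kx gx) gx).
exists d => // z zd gz; have := dH z zd; rewrite gz subrr sub0r enormN => hz.
have := le_trans (cA z) hz; rewrite -subr_ge0 -mulrBl => h1.
apply: enorm_eq0; apply/eqP; rewrite eq_le enorm_ge0 andbT leNgt; apply/negP => z0.
move: h1; rewrite pmulr_lge0// leNgt; case/negP; lra.
Qed.

Let Zseq : exists s : seq V, uniq s /\ forall a, a \in s <-> Z a.
Proof.
have /finite_seqP[s sZ] := Zfin; exists (undup s); split; first exact: undup_uniq.
by move=> a; rewrite mem_undup sZ.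
Qed.

(** The linearisation error is written as [|z A| - c/2 |z|] because this is how it is used: on the
    segment from [g] to its linearisation the distance to [y0] stays at least [c/2 |z|]. Balls of
    radius [rho] around distinct preimages are disjoint. *)
Let spec (s : seq V) : (forall a, a \in s <-> Z a) -> exists c rho : R, [/\ 0 < c, 0 < rho,
  forall a, a \in s -> forall z, c * enorm z <= enorm (z *m A a),
  forall a, a \in s -> forall z, enorm z <= rho -> U (a + z) /\
    enorm (g (a + z) - y0 - z *m A a) <= enorm (z *m A a) - c / 2 * enorm z &
  forall a a', a \in s -> a' \in s -> a' != a -> 2 * rho < enorm (a - a')].
Proof.
move=> sP.
have [a /sP Za|c0 c00 c0H] := @small_all R V s (fun a c => (forall z, c * enorm z <= enorm (z *m A a)) /\
  exists2 d, 0 < d & forall z, enorm z < d -> enorm (g (a + z) - y0 - z *m A a) <= enorm (z *m A a) - c / 2 * enorm z).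
  have [c c0 [cA [d d0 dH]]] := local Za; exists c => // c' c'0 c'c.
  have cz (z : V) : c' * enorm z <= c * enorm z by rewrite ler_wpM2r ?enorm_ge0// ltW.
  split=> [z|]; first exact: le_trans (cz z) (cA z).
  exists d => // z /dH; have := cz z; have := cA z.
  move: (enorm (_ - _)) (enorm (z *m _)) (enorm z) => x y t; lra.
(* [small_all] provides all constants strictly below [c0]; one of them is fixed. *)
pose c := c0 / 2; have cp : 0 < c by rewrite divr_gt0.
have cc0 : c < c0 by rewrite ltr_pdivrMr// ltr_pMr// ltr1n.
have [a as_|d1 d10 H1] := @small_all R V s (fun a rho => forall z, enorm z <= rho -> U (a + z) /\
    enorm (g (a + z) - y0 - z *m A a) <= enorm (z *m A a) - c / 2 * enorm z).
  have [_ [d d0 dH]] := c0H a as_ c cp cc0; have [Ua _] := (sP a).1 as_.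
  have := Uo; rewrite openE => /(_ a Ua) /nbhs_eballP[d' d'0 d'H].
  exists (Num.min d d') => [|rho rho0]; first by rewrite lt_min d0.
  rewrite lt_min => /andP[rd rd'] z zr; split; last by apply: dH; exact: le_lt_trans rd.
  by apply: d'H; rewrite opprD addNKr enormN; exact: le_lt_trans rd'.
have [a as_|d2 d20 H2] := @small_all R V s (fun a rho => forall a', a' \in s -> a' != a -> 2 * rho < enorm (a - a')).
  have [a' a's|d d0 dH] := @small_all R V s (fun a' rho => a' != a -> 2 * rho < enorm (a - a')).
    have [->|an] := eqVneq a' a; first by exists 1.
    have p0 : 0 < enorm (a - a') by apply: enorm_gt0; rewrite subr_eq0 eq_sym.
    exists (enorm (a - a') / 2) => [|rho r0 rr _]; first by rewrite divr_gt0.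
    by rewrite mulrC -ltr_pdivlMr.
  by exists d => // rho r0 rd a' a's; exact: dH.
pose rho := Num.min d1 d2 / 2.
have m0 : 0 < Num.min d1 d2 by rewrite lt_min d10.
have r0 : 0 < rho by rewrite divr_gt0.
have : rho < Num.min d1 d2 by rewrite ltr_pdivrMr// ltr_pMr// ltr1n.
rewrite lt_min => /andP[r1 r2]; exists c, rho; split=> //.
- by move=> a as_; have [] := c0H a as_ c cp cc0.
- by move=> a as_; exact: H1.
- by move=> a a' as_ a's; exact: H2.
Qed.

(** The density [v] is known only through Lipschitz maps near [psi]. The chain of equalities runs
    from such a map [p] to a Lipschitz approximation [q] of [g], splits at the preimages of [y0],
    and ends at affine maps. *)
Theorem degree_value : exists2 r, 0 < r & forall (y : V) e, enorm (y - y0) < r -> 0 < e -> e < r ->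
  cv e v y = (degree_C1 g U y0)%:~R.
Proof.
have [eta eta0 etaP] := eta_spec; have [s [us sP]] := Zseq.
have [c [rho [c0 rho0 cA loc sep]]] := spec sP.
(* Outside the half-size balls around the preimages, [g] stays at distance at least [eta2] from
   [y0]. *)
have [|eta2 eta20 eta2P] := @compact_uniform R n K (fun e x => (exists2 a, a \in s & enorm (x - a) < rho / 2) \/
    e <= enorm (g x - y0)) cK.
  move=> x Kx; have [[a as_ xa]|nz] := pselect (exists2 a, a \in s & enorm (x - a) < rho / 2).
    exists (rho / 2 - enorm (x - a)); rewrite ?subr_gt0// => y e xy _ _; left; exists a => //.
    by rewrite (le_lt_trans (enorm_dist_triangle _ x _))// [enorm (y - x)]enormB -ltrBrDr.
  have gx : 0 < enorm (g x - y0).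
    apply: enorm_gt0; rewrite subr_eq0; apply/negP => /eqP gx; apply: nz; exists x.
      by apply/sP; split=> //; exact: KZ.
    by rewrite subrr enorm0 divr_gt0.
  have g2 : 0 < enorm (g x - y0) / 2 by rewrite divr_gt0.
  have gcx : {for x, continuous g} by exact: gc.
  have [d d0 dH] := continuous_enormP gcx g2.
  exists (Num.min d (enorm (g x - y0) / 2)) => [|y e]; first by rewrite lt_min d0.
  rewrite !lt_min => /andP[/dH xy _] _ /andP[_ ex]; right.
  have := enorm_dist_triangle (g x) (g y) y0; rewrite [enorm (g x - g y)]enormB.
  move: (enorm (g x - y0)) (enorm (g y - _)) (enorm (g y - _)) xy ex => p q t; lra.
(* The test [f] is supported within [2 r] of [y0] and the approximations cost at most another [r];
   the factor 4 leaves a strict margin in each of the three uses. *)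
pose r := Num.min (Num.min eta eta2) (c * rho / 4) / 4.
have crho0 : 0 < c * rho / 4 by rewrite divr_gt0// mulr_gt0.
have m0 : 0 < Num.min (Num.min eta eta2) (c * rho / 4) by rewrite !lt_min eta0 eta20.
have r0 : 0 < r by rewrite divr_gt0.
have r1 : 4 * r <= eta by rewrite /r mulrC divfK// !ge_min lexx.
have r2 : 4 * r <= eta2 by rewrite /r mulrC divfK// !ge_min lexx !orbT.
have r3 : 4 * r <= c * rho / 4 by rewrite /r mulrC divfK// !ge_min lexx !orbT.
exists r => // y e yy0 e0 er.
pose f (z : V) : R := mol e (z - y).
have f0 z : f z != 0 -> enorm (z - y0) < 2 * r.
  move=> /(csup_neq0 (mol_csup e0)) ze; rewrite (le_lt_trans (enorm_dist_triangle _ y _))//.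
  move: yy0 ze; move: (enorm _) (enorm _) => t t'; lra.
have [q [qL _ qg]] := lip_approx_compact cK gc r0.
have [ru ru0 rU] := bounded_enorm Ub.
have [Lf _ fL] : exists2 Lf, 0 <= Lf & lip Lf f.
  by have [Lm Lm0 mL] := mol_lip n e0; exists Lm => //; exact: (lip_shift mL (- y)).
have fr : csup (enorm y + e) f.
  move=> z zr; apply: (mol_csup e0); have := enorm_dist_triangle z y 0; rewrite !subr0.
  by move: zr; move: (enorm _) (enorm y) (enorm _) => t t' t''; lra.
have [C C0 [mC _]] := mol_bounded n e0.
(* A Lipschitz substitute for the indicator of [U], since homotopies need a Lipschitz weight. It
   differs from it, and has a gradient, only where [dU] is below [eta]; on the closure of [U] the
   homotopy there avoids the support of [f]. *)
pose w x := Num.min 1 (2 / eta * dU x).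
have wL : lip (`|2 / eta| * 1) w by apply: lip_min; exact: lipZ.
have dU0 x : ~ U x -> dU x = 0 by move=> nUx; exact: (dist_set0 nUx).
have w0 x : ~ U x -> w x = 0 by move=> /dU0 h0; rewrite /w h0 mulr0 min_r.
have w1 x : eta / 2 <= dU x -> w x = 1.
  by move=> h1; rewrite /w min_l// mulrAC ler_pdivlMr// mul1r mulrC -ler_pdivrMr.
have wr : csup ru w by move=> x xr; apply: w0 => /rU; rewrite leNgt xr.
have uw (p : 'I_n.+1 -> V -> R) : (forall x, K x -> eta <= h x -> f (\row_i p i x) = 0) -> tint (\1_U) f p = tint w f p.
  move=> pfar; apply: eq_Rintegral => x _; congr (_ * _).
  have [Ux|nUx] := pselect (U x); last by rewrite w0// indicE memNset.
  rewrite indicE mem_set//; have [hx|dx] := etaP x (KU Ux); first by rewrite pfar ?mulr0//; exact: KU.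
  by rewrite w1// (le_trans _ dx)// ler_pdivrMr// ler_peMr ?ler1n// ltW.
have pdw x k : pd k w x != 0 -> K x /\ eta <= h x.
  move=> wx; have Kx : K x.
    apply: contrapT => nKx; move: wx; rewrite pd0_near ?eqxx//.
    have : open (~` K) by rewrite openC; exact: closed_closure.
    by rewrite openE => /(_ x nKx); apply: filterS => z nKz; apply: w0 => /KU.
  split=> //; have [//|dx] := etaP x Kx.
  move: wx; have -> : pd k w x = pd k (fun=> 1) x.
    apply: pd_near; apply/nbhs_eballP; exists (eta / 2) => [|z xz]; first by rewrite divr_gt0.
    apply: w1; have := dU_lip x z; rewrite mul1r => /ler_normlP[_].
    by move: dx xz; move: (dU x) (dU z) (enorm _) => t t' t''; lra.
  by rewrite pd_cst eqxx.
have f_far (z : V) : 2 * r <= enorm (z - y0) -> f z = 0.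
  by move=> h1; apply/eqP; apply: contraTT h1 => /f0; rewrite ltNge.
have tint_pq p : (forall i, Lip (p i)) -> (forall x, enorm (\row_i p i x - psi x) <= r) -> tint (\1_U) f p = tint (\1_U) f q.
  move=> pL pr.
  have seg x t : K x -> eta <= h x -> 0 <= t <= 1 ->
      2 * r <= enorm (\row_i p i x + t *: (\row_i q i x - \row_i p i x) - y0).
    move=> Kx hx /andP[t0 t1]; set P := \row_i p i x; set Q := \row_i q i x.
    have E : psi x - y0 = (P + t *: (Q - P) - y0) - (t *: (g x - psi x) + ((1 - t) *: (P - psi x) + t *: (Q - g x))).
      by apply/rowP => i; rewrite !mxE; ring.
    have n1 : enorm (psi x - y0) <= enorm (P + t *: (Q - P) - y0) + (enorm (g x - psi x) + r).
      rewrite [in leLHS]E (le_trans (enormD _ _))// enormN lerD2l (le_trans (enormD _ _))//.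
      rewrite enormZ ger0_norm// lerD ?ler_piMl ?enorm_ge0// (le_trans (enormD _ _))// !enormZ.
      have -> : r = (1 - t) * r + t * r by ring.
      by rewrite !ger0_norm ?subr_ge0// lerD// ler_wpM2l ?subr_ge0//; [exact: pr|exact: qg].
    move: hx n1; rewrite /h; move: (enorm (psi x - y0)) (enorm (g x - _)) (enorm _) => a b d; lra.
  have pfar x : K x -> eta <= h x -> f (\row_i p i x) = 0.
    move=> Kx hx; apply: f_far; have := seg x 0 Kx hx; rewrite scale0r addr0; apply.
    by rewrite lexx ler01.
  have qfar x : K x -> eta <= h x -> f (\row_i q i x) = 0.
    move=> Kx hx; apply: f_far; have := seg x 1 Kx hx; rewrite scale1r (addrC (\row_i p i x)) subrK; apply.
    by rewrite lexx ler01.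
  rewrite (uw _ pfar) (uw _ qfar); apply: (tint_homotopy pL qL wL wr fL fr) => x k wx t t01.
  have [Kx hx] := pdw x k wx; apply: f_far; rewrite (_ : \row_i _ = \row_i p i x + t *: (\row_i q i x - \row_i p i x)).
    exact: seg.
  by apply/rowP => i; rewrite !mxE.
(* Equal to 1 up to radius [rho / 2] and to 0 from radius [rho] on, so its gradient lives in an
   annulus where [spec] controls the linearisation. *)
pose om (a x : V) := clamp01 (2 - 2 / rho * enorm (x - a)).
have om_lip a : lip (0 + `|2 / rho| * 1) (om a).
  apply: clamp01_lip; apply: lipB; first exact: lip_cst.
  exact/lipZ/lip_enorm.
have om1 a x : enorm (x - a) <= rho / 2 -> om a x = 1.
  move=> h1; apply: clamp01_1; have : 2 / rho * enorm (x - a) <= 1; last lra.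
  by rewrite mulrAC ler_pdivrMr// mul1r mulrC -ler_pdivlMr.
have om0 a x : rho <= enorm (x - a) -> om a x = 0.
  move=> h1; apply: clamp01_0; have : 2 <= 2 / rho * enorm (x - a); last lra.
  by rewrite mulrAC ler_pdivlMr// ler_wpM2l.
have om_csup a : csup (enorm a + rho) (om a).
  move=> x xr; apply: om0; have := enorm_dist_triangle x a 0; rewrite !subr0.
  by move: xr; move: (enorm _) (enorm a) (enorm _) => t t' t''; lra.
have om_pd a x k : pd k (om a) x != 0 -> rho / 2 <= enorm (x - a) <= rho.
  move=> ox; apply/andP; split; rewrite leNgt; apply: contraNN ox => h1.
    have -> : pd k (om a) x = pd k (fun=> 1) x; last by rewrite pd_cst eqxx.
    apply: pd_near; apply/nbhs_eballP; exists (rho / 2 - enorm (x - a)); rewrite ?subr_gt0// => z xz.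
    apply: om1; have := enorm_dist_triangle z x a; rewrite [enorm (z - x)]enormB.
    by move: xz; move: (enorm _) (enorm _) (enorm _) => t t' t''; lra.
  rewrite pd0_near ?eqxx//; apply/nbhs_eballP; exists (enorm (x - a) - rho); rewrite ?subr_gt0// => z xz.
  apply: om0; have := enorm_dist_triangle x z a.
  by move: xz; move: (enorm _) (enorm _) (enorm _) => t t' t''; lra.
have inU a x : a \in s -> enorm (x - a) <= rho -> U x.
  by move=> as_ h1; have [h2 _] := loc a as_ _ h1; rewrite addrC subrK in h2.
(* Where [f] does not vanish at the image of a point of [K], that point is within [rho / 2] of a
   preimage and further than [rho] from all others, so the weights add up to 1. *)
have split_q : tint (\1_U) f q = \sum_(a <- s) tint (om a) f q.
  have qM := Lip_choice qL; have [Mq _ qM'] := qM.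
  have oi a : itg mu (om a : T -> R) by exact: itg_lip_csup (om_lip a) (om_csup a).
  rewrite /tint -int_sum; last by move=> a _; exact: (itg_tint (oi a) fL fr qM').
  apply: eq_Rintegral => x _; rewrite -mulr_suml -mulr_suml; congr (_ * _).
  have [->|fx] := eqVneq (f (\row_i q i x)) 0; first by rewrite !mulr0.
  congr (_ * _); have qx := f0 _ fx.
  have om_out a : a \in s -> ~ K x -> om a x = 0.
    move=> as_ nKx; apply: om0; rewrite leNgt; apply/negP => /ltW h1; apply: nKx; apply: KU; exact: inU h1.
  have [Kx|nKx] := pselect (K x); last first.
    rewrite big1_seq => [|a /andP[_ as_]]; last exact: om_out.
    by rewrite indicE memNset// => /KU.
  have [[a as_ xa]|far] := eta2P x Kx; last first.
    exfalso; have := enorm_dist_triangle (g x) (\row_i q i x) y0; rewrite [enorm (g x - \row_i _)]enormB.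
    move: far qx (qg x Kx); move: (enorm (g x - y0)) (enorm (_ - y0)) (enorm _) => t t' t'' *; lra.
  rewrite (big_rem a)//= om1 ?(ltW xa)// big1_seq ?addr0.
    by rewrite indicE mem_set//; apply: (inU a) => //; rewrite (le_trans (ltW xa))// ler_pdivrMr// ler_peMr ?ler1n// ltW.
  move=> a' /andP[_]; rewrite mem_rem_uniq// inE => /andP[an a's]; apply: om0.
  have := sep a a' as_ a's an; have := enorm_dist_triangle a x a'; rewrite [enorm (a - x)]enormB.
  by move: xa rho0; move: (enorm _) (enorm _) (enorm _) => t t' t''; lra.
have tint_a a : a \in s -> tint (om a) f q = Num.sg (\det (A a)).
  move=> as_; have dA := A_det ((sP a).1 as_).
  pose b := y0 - a *m A a; pose af i x := lin (A a) i x + b ord0 i.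
  have afL i : Lip (af i).
    by have /LipP[L L0 h0] := lin_lip (A a) i; apply/LipP; exists (L + 0); [rewrite addr0|exact: lipD h0 (lip_cst _)].
  have afE x : \row_i af i x = y0 + (x - a) *m A a.
    have -> : \row_i af i x = x *m A a + b by apply/rowP => i; rewrite [LHS]mxE [RHS]mxE.
    by rewrite /b mulmxBl addrCA.
  rewrite (tint_homotopy qL afL (om_lip a) (om_csup a) fL fr); last first.
    move=> x k /om_pd /andP[x1 x2] t /andP[t0 t1]; apply: f_far.
    have -> : \row_i (q i x + t * (af i x - q i x)) = \row_i q i x + t *: (\row_i af i x - \row_i q i x).
      by apply/rowP => i; rewrite !mxE.
    have Kx : K x by apply: KU; exact: inU x2.
    have [_ err] := loc a as_ _ x2; rewrite [a + _]addrC subrK in err.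
    rewrite afE; set Q := \row_i q i x; set z := x - a in x1 x2 err *.
    have E : z *m A a = (Q + t *: (y0 + z *m A a - Q) - y0) - (1 - t) *: ((g x - y0 - z *m A a) + (Q - g x)).
      by move: (z *m A a) => zA; apply/rowP => i; rewrite !mxE; ring.
    have n1 : enorm (z *m A a) <= enorm (Q + t *: (y0 + z *m A a - Q) - y0) + (enorm (g x - y0 - z *m A a) + r).
      rewrite [in leLHS]E (le_trans (enormD _ _))// enormN lerD2l enormZ ger0_norm ?subr_ge0//.
      rewrite (@le_trans _ _ (enorm ((g x - y0 - z *m A a) + (Q - g x))))//.
        by rewrite ler_piMl ?enorm_ge0// lerBlDr lerDl.
      by rewrite (le_trans (enormD _ _))// lerD2l; exact: qg.
    have c2 : c * (rho / 2) <= c * enorm z by rewrite ler_wpM2l// ltW.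
    move: n1 err c2 r3; move: (enorm (z *m A a)) (enorm (g x - y0 - z *m A a)) (enorm (_ - y0)) (enorm z) => t1' t2 t3 t4 *; lra.
  rewrite -(linmass_sg e0 dA) /linmass.
  have uA : A a \in unitmx by rewrite unitmxE unitfE.
  (* The point that the affine map sends to [y], the centre of the mollifier; translating it to the
     origin produces [linmass]. *)
  pose b' := a - (y0 - y) *m invmx (A a).
  have iA : itg mu (fun x : T => mol e ((x : V) *m A a) * \det (A a)).
    by under eq_fun do rewrite mulrC; apply: itgZ; exact: linmass_itg.
  have [_ <-] := int_rVshift (- b') iA.
  apply: eq_Rintegral => x _; rewrite afE (Dmx_addc (lin (A a)) b x) Dmx_lin det_tr.
  have fE : f (y0 + (x - a) *m A a) = mol e (((x : V) - b') *m A a).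
    rewrite /f (addrAC y0); congr (mol e _).
    have -> : (x : V) - b' = (x - a) + (y0 - y) *m invmx (A a) by rewrite /b' opprB addrA addrAC.
    by rewrite [RHS]mulmxDl mulmxKV// addrC.
  rewrite -[mol e (rVshift _ _ *m _)]fE; congr (_ * _).
  have [->|fx] := eqVneq (f (y0 + (x - a) *m A a)) 0; first by rewrite mulr0.
  rewrite om1 ?mul1r//; have := f0 _ fx; rewrite addrC addKr => h1.
  have := cA a as_ (x - a); move: h1 c0 r3 r0; move: (enorm (x - a)) (enorm _) => t1 t2 h1 cp h3 h4 h5.
  have : c * t1 < c * (rho / 2) by lra.
  by rewrite ltr_pM2l// => /ltW.
have tk : tint (\1_U) f q = (degree_C1 g U y0)%:~R.
  rewrite split_q /degree_C1 (_ : U `&` g @^-1` [set y0] = [set` s]); last by apply/seteqP; split=> x /sP.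
  rewrite -fsbig_seq// rmorph_sum /=; apply: eq_big_seq => a as_.
  by rewrite tint_a// sgrEz det_tr.
transitivity (\int[mu]_x (v x * f x)); first by apply: eq_Rintegral => x _; rewrite mulrC.
apply/eqP; rewrite -subr_eq0 -normr_le0; apply/ler_addgt0Pr => t t0; rewrite add0r.
have C1 : 0 < C + 1 by rewrite ltr_wpDl.
have t' : 0 < t / (C + 1) by rewrite divr_gt0.
have [p [pL pr pt]] := vtest r0 t'.
have := pt f Lf _ C fL fr (fun z => mC _); rewrite (tint_pq p pL pr) tk => /le_trans; apply.
by rewrite mulrAC ler_pdivrMr// ler_pM2l// lerDl.
Qed.

End degree_value.

(** * Existence of the degree *)

Section critical_values.
Context (R : realType) (n : nat).
Local Notation V := 'rV[R]_n.+1.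
Local Notation T := 'rV[measurableTypeR R]_n.+1.
Local Notation mu := (lebesgue_rV R n.+1).
Implicit Types (q : 'I_n.+1 -> V -> R).

Lemma mol1_ge : exists2 c : R, 0 < c & forall x : V, enorm x <= 1 / 2 -> c <= mol 1 x.
Proof.
exists ((@bumpc R n 1)^-1 / 2) => [|x x2]; first by rewrite divr_gt0// invr_gt0 bumpc_gt0.
rewrite -[mol 1 x]/(_ * pos (1 ^+ 2 - enorm x ^+ 2) ^+ 2) ler_pM2l ?invr_gt0 ?bumpc_gt0//.
have x4 : enorm x ^+ 2 <= 1 / 4.
  have -> : 1 / 4 = (1 / 2) ^+ 2 :> R by field.
  by rewrite lerXn2r// nnegrE ?enorm_ge0// divr_ge0.
rewrite /pos max_r; last by rewrite expr1n; lra.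
have h : 3 / 4 <= 1 ^+ 2 - enorm x ^+ 2 by rewrite expr1n; lra.
apply: (@le_trans _ _ ((3 / 4) ^+ 2)); first by rewrite expr2; lra.
by rewrite lerXn2r// nnegrE; lra.
Qed.

(** A kernel vector divided by its entry of largest modulus. The normalisation keeps the slab below
    free of constants depending on the point. *)
Lemma kernel_vector (J : 'M[R]_n.+1) : \det J = 0 -> exists (w : 'I_n.+1 -> R) i0,
  [/\ w i0 = 1, forall j, `|w j| <= 1 & forall k, \sum_j J k j * w j = 0].
Proof.
move=> J0; have : \det J^T == 0 by rewrite det_tr J0.
move=> /det0P[v v0 vJ].
have [i1 vi1] : exists i, v ord0 i != 0.
  by apply/existsP; apply: contraNT v0 => /existsPn H; apply/eqP/rowP => i; rewrite mxE; apply/eqP; have := H i; rewrite negbK.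
have [i0 _ vmax] := @Order.TotalTheory.arg_maxP _ _ _ i1 xpredT (fun i => `|v ord0 i|) isT.
have v0' : v ord0 i0 != 0.
  by rewrite -normr_gt0 (lt_le_trans _ (vmax i1 isT))// normr_gt0.
exists (fun j => v ord0 j / v ord0 i0), i0; split=> [|j|k]; first by rewrite divff.
- by rewrite normrM normfV ler_pdivrMr ?normr_gt0// mul1r; exact: vmax.
- have : (v *m J^T) ord0 k = 0 by rewrite vJ mxE.
  rewrite mxE => h.
  have -> : \sum_j J k j * (v ord0 j / v ord0 i0) = (\sum_j v ord0 j * J^T j k) / v ord0 i0.
    by rewrite mulr_suml; apply: eq_bigr => j _; rewrite [J^T _ _]mxE mulrA [J k j * _]mulrC.
  by rewrite h mul0r.
Qed.

(** Replacing the coordinate [i0] by the pairing with [w] is a unimodular change of variables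
    because [w i0 = 1]. Rescaling each new coordinate maps the slab into a fixed ball, with
    determinant the inverse of its volume up to a constant. *)
Lemma slab_matrix (w : 'I_n.+1 -> R) i0 (a b : R) : w i0 = 1 -> 0 < a -> 0 < b ->
  exists2 A : 'M[R]_n.+1, `|\det A| = (a ^+ n * b)^-1 & forall z : V, (forall j, `|z ord0 j| <= a) ->
    `|\sum_j z ord0 j * w j| <= b -> enorm (z *m A) <= n.+1%:R.
Proof.
move=> wi a0 b0; pose W : 'M[R]_n.+1 := \matrix_(k, j) (if j == i0 then w k else (k == j)%:R).
pose d : 'rV[R]_n.+1 := \row_j (if j == i0 then b^-1 else a^-1).
have dW : \det W = 1.
  rewrite (expand_det_col W i0) (bigD1 i0)//= big1 ?addr0 => [|k ki].
    rewrite mxE eqxx wi mul1r; have : cofactor W i0 i0 = cofactor 1%:M i0 i0.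
      rewrite /cofactor; congr (_ * \det _); apply/matrixP => i j; rewrite !mxE.
      by rewrite eq_sym (negbTE (neq_lift i0 j)).
    move=> ->; have := mul_mx_adj (1%:M : 'M[R]_n.+1); rewrite mul1mx det1 => /matrixP/(_ i0 i0).
    by rewrite !mxE eqxx.
  have -> : cofactor W k i0 = cofactor 1%:M k i0.
    rewrite /cofactor; congr (_ * \det _); apply/matrixP => i j; rewrite !mxE.
    by rewrite eq_sym (negbTE (neq_lift i0 j)).
  have := mul_mx_adj (1%:M : 'M[R]_n.+1); rewrite mul1mx det1 => /matrixP/(_ i0 k).
  by rewrite !mxE (eq_sym i0) (negbTE ki) => ->; rewrite mulr0.
exists (W *m diag_mx d) => [|z za zb].
  rewrite det_mulmx dW mul1r det_diag (bigD1 i0)//= mxE eqxx.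
  rewrite (eq_bigr (fun=> a^-1)) => [|j ji]; last by rewrite mxE (negbTE ji).
  rewrite prodr_const cardC1 card_ord ger0_norm ?exprVn ?invfM 1?mulrC//.
  by rewrite divr_ge0 ?invr_ge0 ?exprn_ge0 ?(ltW a0) ?(ltW b0).
rewrite (le_trans (enorm_sumE _))//.
apply: (@le_trans _ _ (\sum_(i < n.+1) 1)); last by rewrite sumr_const card_ord.
apply: ler_sum => j _; rewrite mulmxA mul_mx_diag mxE normrM.
have [->|ji] := eqVneq j i0.
  rewrite [d _ _]mxE eqxx normfV (gtr0_norm b0) ler_pdivrMr// mul1r mxE.
  by under eq_bigr do rewrite mxE eqxx.
rewrite [X in _ * `|X|]mxE (negbTE ji) normfV (gtr0_norm a0) ler_pdivrMr// mul1r mxE.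
rewrite (bigD1 j)//= big1 ?addr0 => [|k kj]; last by rewrite mxE (negbTE ji) (negbTE kj) mulr0.
by rewrite mxE (negbTE ji) eqxx mulr1.
Qed.

(** The change of variables for affine maps is read off from [linmass_sg], on dividing the sign of
    the determinant by the determinant. *)
Lemma int_mol_affine (A : 'M[R]_n.+1) (p : V) : \det A != 0 ->
  itg mu (fun z : T => mol 1 (((z : V) - p) *m A)) /\ \int[mu]_z mol 1 (((z : V) - p) *m A) = `|\det A|^-1.
Proof.
move=> A0; have iA := linmass_itg (@ltr01 R) A0.
have [h1 h2] := int_rVshift (- p) iA; split; first exact: h1.
transitivity (\int[mu]_x mol 1 ((x : V) *m A)); first exact: h2.
have := linmass_sg (@ltr01 R) A0; rewrite /linmass; under eq_Rintegral do rewrite mulrC.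
rewrite (intZ _ iA) => /(canRL (mulKf A0)) ->.
by rewrite {1}[\det A]numEsg invfM mulrAC mulVf ?mul1r// sgr_eq0.
Qed.

Variable q : 'I_n.+1 -> V -> R.
Hypothesis qn : forall i, nice (q i).

(* The critical values coming from [X] lie in a slab of thickness [O(rho^2)]. *)
Lemma critical_cell : exists2 B, 0 <= B & forall (X : set V) (rho : R), 0 < rho ->
  (forall x x', X x -> X x' -> enorm (x - x') <= rho) ->
  exists F : V -> R, [/\ itg mu (F : T -> R), forall z, 0 <= F z, \int[mu]_z F z <= B * rho ^+ n.+2 &
    forall x, X x -> \det (Dmx q x) = 0 -> 1 <= F (\row_i q i x)].
Proof.
have /choice[CL CLP] : forall i, exists CL : R * R, taylor CL.1 (q i) (fun j => pd j (q i)) /\ lip CL.2 (q i).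
  by move=> i; have [C [L [h1 _ h2]]] := qn i; exists (C, L).
pose M := 1 + \sum_i (`|(CL i).1| + `|(CL i).2|).
have MS : 0 <= \sum_i (`|(CL i).1| + `|(CL i).2|) by apply: sumr_ge0 => i _; rewrite addr_ge0.
have M1 : 1 <= M by rewrite lerDl.
have M0 : 0 < M by exact: lt_le_trans M1.
have MC i : `|(CL i).1| <= M /\ `|(CL i).2| <= M.
  have h : `|(CL i).1| + `|(CL i).2| <= M.
    rewrite /M (bigD1 i)//= addrCA lerDl addr_ge0// sumr_ge0// => j _; by rewrite addr_ge0.
  by split; apply: le_trans h; rewrite ?lerDl ?lerDr.
have [c0 c00 c0P] := mol1_ge.
(* [slab_matrix] reaches a ball of radius [n + 1], whereas [mol1_ge] needs radius [1/2]; this is the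
   ratio. *)
pose k : R := 2 * n.+1%:R; have k0 : 0 < k by rewrite mulr_gt0.
pose B := c0^-1 * ((k * M) ^+ n * (k * (n.+1%:R * M))).
have B0 : 0 <= B by rewrite !mulr_ge0 ?invr_ge0 ?exprn_ge0 ?mulr_ge0// ltW.
exists B => // X rho rho0 Xd.
have [[a [Xa a0]]|nocrit] := pselect (exists a, X a /\ \det (Dmx q a) = 0); last first.
  exists (fun=> 0); split=> //; first exact: itg0.
    by rewrite int0 mulr_ge0// exprn_ge0// ltW.
  by move=> x Xx x0; exfalso; apply: nocrit; exists x.
have J0 : \det (Dmx q a)^T = 0 by rewrite det_tr.
have [w [i0 [wi w1 wJ]]] := kernel_vector J0.
have la0 : 0 < k * (M * rho) by rewrite !mulr_gt0.
have lb0 : 0 < k * (n.+1%:R * M * rho ^+ 2) by rewrite !mulr_gt0// exprn_gt0.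
have [A dA AP] := slab_matrix wi la0 lb0.
have A0 : \det A != 0 by rewrite -normr_gt0 dA invr_gt0 mulr_gt0// exprn_gt0.
pose p : V := \row_i q i a; have [iF intF] := int_mol_affine p A0.
exists (fun z => c0^-1 * mol 1 ((z - p) *m A)); split.
- exact: itgZ.
- by move=> z; rewrite mulr_ge0 ?invr_ge0 ?(ltW c00)// mol_ge0.
- rewrite (intZ _ iF) intF dA invrK /B -!mulrA ler_pM2l ?invr_gt0//.
  rewrite le_eqVlt; apply/orP; left; apply/eqP.
  by rewrite !exprMn !exprS; ring.
move=> x Xx _; rewrite mulrC ler_pdivlMr// mul1r; apply: c0P.
have k0' : k != 0 by rewrite gt_eqF.
pose z : V := \row_i q i x - p.
have zi i : z ord0 i = q i x - q i a by rewrite !mxE.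
have xa : enorm (x - a) <= rho by exact: Xd.
have zb j : `|(k *: z) ord0 j| <= k * (M * rho).
  rewrite mxE zi normrM (gtr0_norm k0) ler_pM2l//; have [_ l] := CLP j.
  rewrite (le_trans (l x a))// ler_pM ?enorm_ge0//; first exact: le_trans (pd_bound l ord0 0).
  by rewrite (le_trans (ler_norm _))//; have [] := MC j.
(* Paired with the kernel vector, the linear Taylor term at the critical point [a] vanishes and only
   the quadratic remainder is left. *)
have zw : `|\sum_j (k *: z) ord0 j * w j| <= k * (n.+1%:R * M * rho ^+ 2).
  have -> : \sum_j (k *: z) ord0 j * w j = k * \sum_j (q j x - q j a - \sum_l (x - a) ord0 l * pd l (q j) a) * w j.
    rewrite mulr_sumr.
    have : \sum_j (\sum_l (x - a) ord0 l * pd l (q j) a) * w j = 0.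
      under eq_bigr do rewrite mulr_suml.
      rewrite exchange_big/= big1// => l _; under eq_bigr do rewrite -mulrA.
      by rewrite -mulr_sumr (_ : \sum_i _ = 0) ?mulr0// -[RHS](wJ l); apply: eq_bigr => j _; rewrite !mxE.
    move=> h; rewrite -[LHS]subr0 -[X in _ - X](mulr0 k) -[X in _ - k * X]h mulr_sumr -sumrB.
    by apply: eq_bigr => j _; rewrite mxE zi; ring.
  rewrite normrM (gtr0_norm k0) ler_pM2l// (le_trans (ler_norm_sum _ _ _))//.
  apply: (@le_trans _ _ (\sum_(j < n.+1) M * rho ^+ 2)); last by rewrite sumr_const card_ord -mulrA mulr_natl.
  apply: ler_sum => j _; have [t _] := CLP j; have := t a (x - a); rewrite (addrC a) subrK => h.
  rewrite normrM (@le_trans _ _ (M * rho ^+ 2 * 1))//; last by rewrite mulr1.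
  apply: ler_pM => //; apply: (le_trans h).
  apply: (@le_trans _ _ (M * enorm (x - a) ^+ 2)).
    by rewrite ler_wpM2r ?exprn_ge0 ?enorm_ge0// (le_trans (ler_norm _))//; have [] := MC j.
  by rewrite (ler_wpM2l (ltW M0))// lerXn2r// nnegrE ?enorm_ge0 ?(ltW rho0).
have := AP _ zb zw; rewrite -scalemxAl enormZ (gtr0_norm k0) -/z -ler_pdivlMl// => /le_trans; apply.
by rewrite /k invfM -mulrA mulVf ?pnatr_eq0// mulr1 div1r.
Qed.

(** Indices range over [N.+1] values because the far face of the cube has index [N]. *)
Lemma grid_cover (r : R) (N : nat) (x : V) : 0 < r -> (0 < N)%N -> cube r x ->
  exists k : {ffun 'I_n.+1 -> 'I_N.+1}, forall i, `|x ord0 i - (2 * r * (k i)%:R / N%:R - r)| <= 2 * r / N%:R.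
Proof.
move=> r0 N0 /cubeE xr.
pose t i := (x ord0 i + r) * N%:R / (2 * r).
have N0' : 0 < N%:R :> R by rewrite ltr0n.
have r2 : 0 < 2 * r by rewrite mulr_gt0.
have t0 i : 0 <= t i.
  have /andP[h _] : - r <= x ord0 i <= r by rewrite -ler_norml.
  by rewrite /t divr_ge0 ?(ltW r2)// mulr_ge0// -lerBlDr sub0r.
have tN i : t i <= N%:R.
  have /andP[_ h] : - r <= x ord0 i <= r by rewrite -ler_norml.
  by rewrite /t ler_pdivrMr// mulrC ler_pM2l// mulrDl mul1r lerD2r.
have kN i : (Num.truncn (t i) < N.+1)%N.
  by have /andP[h _] := truncn_itv (t0 i); rewrite ltnS -(ler_nat R) (le_trans h).
exists [ffun i => Ordinal (kN i)] => i; rewrite ffunE /=.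
have /andP[h1 h2] := truncn_itv (t0 i).
have xE : x ord0 i = 2 * r * t i / N%:R - r by rewrite /t; field; rewrite !gt_eqF.
rewrite xE opprB addrA subrK -mulrBl -mulrBr normrM normfV (gtr0_norm N0').
rewrite ler_pM2r ?invr_gt0// normrM (gtr0_norm r2) -[leRHS]mulr1 ler_pM2l//.
move: h2; rewrite -natr1; move: (t i) (_%:R) h1 => u v h1 h2.
by rewrite ler_norml; apply/andP; split; lra.
Qed.

(* Otherwise [y - c] is a critical value for every small [c], whereas the
   critical values of the [O(N^(n+1))] cells of side [O(1 / N)] have total
   volume [O(1 / N)]. *)
Lemma sard (r : R) (y : V) (d : R) : 0 < r -> 0 < d -> exists2 c : V, enorm c < d &
  forall x, cube r x -> \row_i q i x + c = y -> \det (Dmx q x) != 0.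
Proof.
move=> r0 d0; apply: contrapT => /forall2NP H.
have crit (c : V) : enorm c < d -> exists x, [/\ cube r x, \row_i q i x + c = y & \det (Dmx q x) = 0].
  move=> cd; have [//|/existsNP[x h]] := H c.
  exists x; have /not_implyP[xr /not_implyP[xc /negP]] := h.
  by rewrite negbK => /eqP.
have [B B0 BP] := critical_cell.
pose d' := d / n.+2%:R; have d'0 : 0 < d' by rewrite divr_gt0.
(* There are at most [(2 N)^(n+1)] cells, of diameter at most [(n + 1) 4 r / N]; the bounds of
   [critical_cell] add up to [Q / N], which the choice of [N] makes smaller than the volume of the
   cube of half-side [d']. *)
pose Q := 2 ^+ n.+1 * B * (n.+1%:R * (4 * r)) ^+ n.+2.
have dd0 : 0 < (2 * d') ^+ n.+1 by rewrite exprn_gt0// mulr_gt0.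
pose N := (Num.truncn (Q / (2 * d') ^+ n.+1)).+1.
have N0 : 0 < N%:R :> R by rewrite ltr0n.
have rho0 : 0 < n.+1%:R * (4 * r) / N%:R by rewrite divr_gt0// mulr_gt0// mulr_gt0.
pose cell (k : {ffun 'I_n.+1 -> 'I_N.+1}) : set V :=
  [set x | forall i, `|x ord0 i - (2 * r * (k i)%:R / N%:R - r)| <= 2 * r / N%:R].
have diam k x x' : cell k x -> cell k x' -> enorm (x - x') <= n.+1%:R * (4 * r) / N%:R.
  move=> hx hx'; rewrite (le_trans (enorm_sumE _))//.
  apply: (@le_trans _ _ (\sum_(i < n.+1) (4 * r / N%:R))); last first.
    by rewrite sumr_const card_ord -[leLHS]mulr_natl [leLHS]mulrA.
  apply: ler_sum => i _; rewrite !mxE; have := hx i; have := hx' i.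
  have -> : 4 * r / N%:R = 2 * r / N%:R + 2 * r / N%:R by rewrite -mulrDl; congr (_ / _); ring.
  move: (_ / _) (_ - r) (x _ _) (x' _ _) => u s a b /ler_normlP[? ?] /ler_normlP[? ?].
  by rewrite ler_norml; apply/andP; split; lra.
have /choice[F FP] : forall k, exists F : V -> R, [/\ itg mu (F : T -> R), forall z, 0 <= F z,
    \int[mu]_z F z <= B * (n.+1%:R * (4 * r) / N%:R) ^+ n.+2 &
    forall x, cell k x -> \det (Dmx q x) = 0 -> 1 <= F (\row_i q i x)].
  by move=> k; apply: BP => //; exact: diam.
have iF k : itg mu (F k : T -> R) by have [] := FP k.
have i1 := @itg_cube R n d'.
have [i1' I1] := int_rVshift (- y) i1.
have : \int[mu]_x ((\1_(cube d' : set T) : T -> R) (rVshift (- y) x)) <= \int[mu]_x \sum_k F k x.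
  apply: int_le => //; first by apply: itg_sum.
  move=> z; rewrite indicE; case: (boolP (_ \in _)) => [|_]; last first.
    by apply: sumr_ge0 => k _; have [] := FP k.
  rewrite inE => /cubeE zc.
  have zd : enorm (y - z) < d.
    rewrite enormB (le_lt_trans (enorm_sumE _))//.
    apply: (@le_lt_trans _ _ (\sum_(i < n.+1) d')); first by apply: ler_sum => i _; exact: zc.
    by rewrite sumr_const card_ord -[ltLHS]mulr_natr /d' mulrAC ltr_pdivrMr// ltr_pM2l// ltr_nat.
  have [x [xr xy x0]] := crit _ zd.
  have zx : z = \row_i q i x by move: xy; rewrite addrCA -[RHS]addr0 => /addrI /eqP; rewrite subr_eq0 => /eqP.
  have [k kx] := grid_cover r0 (isT : (0 < N)%N) xr.
  rewrite (bigD1 k)//= zx (@le_trans _ _ (F k (\row_i q i x)))//; first by have [_ _ _] := FP k; apply.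
  by rewrite lerDl sumr_ge0// => k' _; have [] := FP k'.
rewrite I1 (int_cube n (ltW d'0)) int_sum// => h.
have : (2 * d') ^+ n.+1 <= Q / N%:R.
  apply: (le_trans h); apply: (@le_trans _ _ (\sum_(k : {ffun 'I_n.+1 -> 'I_N.+1}) B * (n.+1%:R * (4 * r) / N%:R) ^+ n.+2)).
    by apply: ler_sum => k _; have [] := FP k.
  rewrite sumr_const card_ffun !card_ord -[leLHS]mulr_natl natrX.
  apply: (@le_trans _ _ ((2 * N%:R) ^+ n.+1 * (B * (n.+1%:R * (4 * r) / N%:R) ^+ n.+2))).
    rewrite ler_wpM2r//; first by rewrite mulr_ge0// exprn_ge0// ltW.
    by rewrite lerXn2r ?nnegrE ?mulr_ge0// -natrM ler_nat mul2n -addnn -addn1 leq_add2l.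
  rewrite /Q exprMn exprMn exprVn [N%:R ^+ n.+2]exprS invfM le_eqVlt; apply/orP; left; apply/eqP.
  by field; rewrite gt_eqF// expf_neq0// gt_eqF.
rewrite ler_pdivlMr// mulrC -ler_pdivlMr// leNgt => /negP; apply.
exact: truncnS_gt.
Qed.

End critical_values.

Section degree_existence.
Context (R : realType) (n : nat).
Local Notation V := 'rV[R]_n.+1.
Implicit Types (q : 'I_n.+1 -> V -> R).

(** Otherwise [closure U] is contained in [U], and by compactness balls of one radius around all its
    points stay in [U]. Walking in a fixed direction then never leaves [U], against boundedness. *)
Lemma boundary_neq0 (U : set V) x0 : open U -> bounded_set U -> U x0 -> exists b, boundary U b.
Proof.
move=> Uo Ub Ux0; apply: contrapT => /forallNP nb; have [r r0 rU] := bounded_enorm Ub.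
have KU x : closure U x -> U x by move=> cx; apply: contrapT => nUx; apply: (nb x); exact: boundary_open.
have [x Kx|d d0 dP] := @compact_uniform R n (closure U) (fun e x => forall y, enorm (x - y) < e -> U y) (compact_closure_bounded Ub).
  have := Uo; rewrite openE => /(_ x (KU x Kx)) /nbhs_eballP[d d0 dH].
  exists (d / 2) => [|x' e xx' e0 ed y x'y]; first by rewrite divr_gt0.
  apply: dH; rewrite (le_lt_trans (enorm_dist_triangle _ x' _))// [ltRHS]splitr ltrD//.
  exact: lt_trans x'y ed.
have step k : U (x0 + (k%:R * (d / 2)) *: delta_mx ord0 ord0).
  elim: k => [|k IH]; first by rewrite mul0r scale0r addr0.
  apply: (dP _ (subset_closure IH)); rewrite opprD addrACA subrr add0r -scalerBl.
  rewrite enormZ enorm_delta mulr1 -mulrBl -natr1 opprD addNKr normrM normrN1 mul1r gtr0_norm ?divr_gt0//.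
  by rewrite ltr_pdivrMr// ltr_pMr// ltr1n.
pose k := (Num.truncn ((r + enorm x0) / (d / 2))).+1.
have := rU _ (step k); rewrite leNgt => /negP; apply.
have d2 : 0 < d / 2 by rewrite divr_gt0.
have kr : r + enorm x0 < k%:R * (d / 2) by rewrite -ltr_pdivrMr// truncnS_gt.
set z := _ *: _; have zE : z = (x0 + z) + (- x0) by rewrite addrC addKr.
have nz : enorm z = k%:R * (d / 2) by rewrite enormZ enorm_delta mulr1 ger0_norm// mulr_ge0// ltW.
have := enormD (x0 + z) (- x0); rewrite -zE nz enormN.
by move: kr; move: (enorm _) (enorm _) (_ * _) => a b t; lra.
Qed.

Lemma nice_C1 q c : (forall i, nice (q i)) -> C1 (fun x : V => \row_i q i x + c) /\
  forall x, Dmx (comp_fun (fun x : V => \row_i q i x + c)) x = Dmx q x.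
Proof.
move=> qn; have cE i : comp_fun (fun x : V => \row_i q i x + c) i = fun x => q i x + c ord0 i.
  by apply/funext => x; rewrite /comp_fun !mxE.
have DE x : Dmx (comp_fun (fun x : V => \row_i q i x + c)) x = Dmx q x.
  by rewrite -(Dmx_addc q c); congr (Dmx _ x); apply/funext => i; rewrite cE.
split=> //; split=> [x|i j]; last first.
  under eq_fun do rewrite DE DmxE; have [_ [L [_ h _]]] := qn i.
  exact: (lip_continuous (h j)).
set F := fun x : V => _; pose J := (Dmx q x)^T.
have /choice[C_ CP] : forall i, exists C, taylor C (q i) (fun j => pd j (q i)).
  by move=> i; have [C [L [h _ _]]] := qn i; exists C.
pose S := \sum_i `|C_ i|; have S0 : 0 <= S by exact: sumr_ge0.
have key v : enorm (F (v + x) - F x - v *m J) <= S * enorm v ^+ 2.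
  rewrite (le_trans (enorm_sumE _))// mulr_suml; apply: ler_sum => i _.
  have := CP i x v; rewrite (addrC x v) => h; apply: le_trans (le_trans h _); last first.
    by rewrite ler_wpM2r ?exprn_ge0 ?enorm_ge0// ler_norm.
  rewrite le_eqVlt; apply/orP; left; apply/eqP; congr `|_|.
  have -> : \sum_j v ord0 j * pd j (q i) x = (v *m J) ord0 i.
    by rewrite [RHS]mxE; apply: eq_bigr => j _; rewrite !mxE.
  by move: (v *m J) => w; rewrite /F !mxE; ring.
have Jc : continuous (mulmxr J : V -> V).
  by apply: (@lipm_continuous R n n (mxsum J)) => y z; rewrite /= -mulmxBl; exact: enorm_mulmx.
have dxf : F \o shift x = cst (F x) + (mulmxr J : V -> V) +o_ 0 id.
  apply/eqaddoP => e e0.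
  have K0 : 0 < n.+1%:R ^+ 2 * S + 1 by rewrite ltr_wpDl// mulr_ge0// exprn_ge0.
  apply/nbhs_eballP; exists (e / (n.+1%:R ^+ 2 * S + 1)) => [|v]; first by rewrite divr_gt0.
  rewrite sub0r enormN ltr_pdivlMr// => ve.
  rewrite (_ : (F \o shift x - _) v = F (v + x) - F x - v *m J); last by rewrite /= opprD addrA.
  rewrite (le_trans (mxnorm_enorm _))// (le_trans (key v))// /=.
  have vn := enorm_mxnorm v; have v0 := enorm_ge0 v.
  have E : enorm v ^+ 2 <= n.+1%:R * `|v| * enorm v by rewrite expr2 ler_wpM2r.
  apply: (@le_trans _ _ (S * (n.+1%:R * `|v| * enorm v))); first by rewrite ler_wpM2l.
  have -> : S * (n.+1%:R * `|v| * enorm v) = (enorm v * (n.+1%:R * S)) * `|v| by ring.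
  rewrite ler_wpM2r// (le_trans _ (ltW ve))// ler_wpM2l//.
  rewrite ler_wpDr// ler_wpM2r// expr2 ler_peMr// ?ler0n// ler1n//.
have E := diff_unique Jc dxf.
by apply/diff_locallyP; rewrite E.
Qed.

(** Mollification costs a third of the distance from [y] to the image of the boundary, and the small
    translation that makes [y] a regular value less than another third. *)
Lemma degree_exists (U : set V) (phi psi : V -> V) (y : V) : open U -> bounded_set U -> continuous psi ->
  (forall x, boundary U x -> psi x = phi x) -> ~ (phi @` boundary U) y -> exists k, is_degree phi U y k.
Proof.
move=> Uo Ub psic psiE ny; have cK := compact_closure_bounded Ub; have [r r0 rU] := bounded_enorm Ub.
have [eta eta0 etaP] : exists2 eta, 0 < eta & forall x, closure U x -> eta <= dist_set y (psi @` boundary U).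
  have [[x0 Ux0]|nU] := pselect (exists x, U x); last first.
    (* For empty [U] the distance is an infimum over the empty set and says nothing, but the claim
       is then vacuous. *)
    exists 1 => // x; suff -> : U = set0 by rewrite closure0.
    by apply/seteqP; split=> // z Uz; apply: nU; exists z.
  have [b bU] := boundary_neq0 Uo Ub Ux0.
  have [x Kx|d d0 dP] := @compact_uniform R n (closure U) (fun e x => boundary U x -> e <= enorm (y - psi x)) cK.
    have [yx|yx] := eqVneq (psi x) y.
      have nb : ~ boundary U x by move=> bx; apply: ny; exists x; rewrite -?psiE.
      have Ux : U x by apply: contrapT => nUx; apply: nb; exact: boundary_open.
      have := Uo; rewrite openE => /(_ x Ux) /nbhs_eballP[d d0 dH].
      exists d => // x' e /dH Ux' _ _ /(boundaryP _ Uo)[_]; by move=> /(_ Ux').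
    have p0 : 0 < enorm (y - psi x) / 2 by rewrite divr_gt0// enorm_gt0// subr_eq0 eq_sym.
    have cx : {for x, continuous psi} by exact: psic.
    have [d d0 dH] := continuous_enormP cx p0.
    exists (Num.min d (enorm (y - psi x) / 2)) => [|x' e]; first by rewrite lt_min d0.
    rewrite !lt_min => /andP[/dH h _] _ /andP[_ ex] _.
    have := enorm_dist_triangle y (psi x') (psi x).
    by move: h ex; move: (enorm _) (enorm _) (enorm _) => s t u; lra.
  exists d => // _ _; apply: (@dist_set_glb _ _ _ (psi b)); first by exists b.
  by move=> _ [x bx <-]; apply: dP => //; case: bx.
have e3 : 0 < eta / 3 by rewrite divr_gt0.
have [q [qL qn qE]] := lip_approx_compact cK psic e3.
have r1 : 0 < r + 1 by rewrite ltr_wpDl.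
have [c cd cP] := sard qn y r1 e3.
have [gC1 gD] := nice_C1 c qn; set g := fun x : V => _ in gC1 gD.
exists (degree_C1 g U y), psi; split=> //; first exact: continuous_subspaceT.
exists g; split=> // [x Kx|x Ux gx].
  apply: (lt_le_trans _ (etaP x Kx)).
  rewrite /g (_ : _ - _ = (\row_i q i x - psi x) + c); last by rewrite addrAC.
  rewrite (le_lt_trans (enormD _ _))// (@lt_le_trans _ _ (eta / 3 + eta / 3))//; first by rewrite ler_ltD// qE.
  by lra.
by rewrite gD; apply: cP => //; apply: cube_ball; rewrite (le_trans (rU x Ux))// lerDl.
Qed.

End degree_existence.

(** * The density of the push forward is the degree *)

Section degree_density.
Context (R : realType) (n : nat).
Local Notation V := 'rV[R]_n.+1.
Local Notation T := 'rV[measurableTypeR R]_n.+1.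
Local Notation mu := (lebesgue_rV R n.+1).

Lemma hol_near (alpha : 'I_n.+1 -> R) M (psi : V -> V) e : 0 < M -> 0 < e -> (forall i, 0 < alpha i <= 1) ->
  exists2 d, 0 < d & forall x y, enorm (x - y) < d ->
    (forall i, `|comp_fun psi i x - comp_fun psi i y| <= M * enorm (x - y) `^ alpha i) ->
    enorm (psi x - psi y) < e.
Proof.
move=> M0 e0 a01.
have e' : 0 < e / (n.+2%:R * M) by rewrite divr_gt0// mulr_gt0.
have [i _|d d0 dP] := @small_all R 'I_n.+1 (enum 'I_n.+1) (fun i t => t `^ alpha i <= e / (n.+2%:R * M)).
  have /andP[ai _] := a01 i; have [x0 x00 xP] := small_pow ai e'.
  by exists x0 => // t t0 tx; apply: xP; exact: ltW.
exists d => // x y xy H.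
have [->|yx] := eqVneq y x; first by rewrite subrr enorm0.
rewrite (le_lt_trans (enorm_sumE _))//.
apply: (@le_lt_trans _ _ (\sum_(i < n.+1) e / n.+2%:R)).
  apply: ler_sum => i _; rewrite !mxE (le_trans (H i))//.
  have := dP i (mem_enum _ _) (enorm (x - y)); rewrite enorm_gt0 ?subr_eq0 1?eq_sym// => /(_ isT xy).
  rewrite -(ler_pM2l M0) => /le_trans; apply.
  have N0 : n.+2%:R != 0 :> R by rewrite pnatr_eq0.
  by move: (n.+2%:R) N0 => N N0; rewrite le_eqVlt; apply/orP; left; apply/eqP; field; rewrite N0 gt_eqF.
by rewrite sumr_const card_ord -[ltLHS]mulr_natl mulrA ltr_pdivrMr// mulrC ltr_pM2l// ltr_nat.
Qed.

Lemma hol_continuous (alpha : 'I_n.+1 -> R) M (psi : V -> V) : 0 < M -> (forall i, 0 < alpha i <= 1) ->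
  (forall i, hol (alpha i) M (comp_fun psi i)) -> continuous psi.
Proof.
move=> M0 a01 pM x A /nbhs_eballP[e e0 eA]; have [d d0 dH] := hol_near psi M0 e0 a01.
by apply/nbhs_eballP; exists d => // y xy; apply: eA; apply: dH => // i; exact: pM.
Qed.

Lemma min1_norm_lip (a b c : R) :
  `|Num.min 1 `|a - c| - Num.min 1 `|b - c| | <= `|a - b|.
Proof.
have : `| `|a - c| - `|b - c| | <= `|a - b|.
  by rewrite (le_trans (ler_dist_dist _ _))// (_ : a - c - (b - c) = a - b)//; ring.
rewrite ler_norml => /andP[h1 h2]; rewrite ler_norml.
have [] := leP 1 `|a - c|; have [] := leP 1 `|b - c|; lra.
Qed.

Variables (U : set V) (phi psi : V -> V) (v : V -> R).
Hypotheses (Uo : open U) (Ub : bounded_set U) (psic : continuous psi) (vc : L1c v).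
Hypothesis psiE : forall x, boundary U x -> psi x = phi x.
Hypothesis vtest : forall r e, 0 < r -> 0 < e -> exists p, [/\ forall i, Lip (p i),
  forall x, enorm (\row_i p i x - psi x) <= r &
  forall f Lf rf b, lip Lf f -> csup rf f -> (forall x, `|f x| <= b) ->
    `|\int[mu]_x (v x * f x) - tint (\1_U) f p| <= e * b].

Let O : set V := ~` (phi @` boundary U).

Lemma image_boundary_closed : closed (phi @` boundary U).
Proof.
have -> : phi @` boundary U = psi @` boundary U.
  by apply/seteqP; split=> _ [x bx <-]; exists x; rewrite ?psiE.
suff cI : compact (psi @` boundary U) by exact: compact_closed.
by apply: continuous_compact; [exact: continuous_subspaceT|exact: boundary_compact].
Qed.

Let Oo : open O. Proof. by rewrite openC; exact: image_boundary_closed. Qed.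

(** The integer chosen by [xget] comes with some extension and some [C^1] map. [degree_value] covers
    every such map, and the other side of the equation does not know the choice. *)
Lemma degree_local y : O y -> exists2 r, 0 < r & forall (y' : V) e, enorm (y' - y) < r -> 0 < e -> e < r ->
  cv e v y' = (degree phi U y)%:~R.
Proof.
move=> Oy; have : is_degree phi U y (degree phi U y).
  have [k kP] := degree_exists Uo Ub psic psiE Oy.
  by rewrite /degree; apply: xgetPex; exists k.
move=> [Phi [Phic PhiE [g [gC1 gPhi greg ->]]]].
apply: (degree_value Uo Ub psic vtest gC1 _ greg) => x bx.
have Px : Phi x = psi x by rewrite PhiE// psiE.
have [cx _] := bx; rewrite -Px (lt_le_trans (gPhi x cx))// [leRHS]enormB.
by apply: dist_set_le; exists x.
Qed.

(** Both degrees equal the same mollified density at [y'], taken at a scale that is admissible for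
    [y] and for [y']. *)
Lemma degree_locally_constant y : O y -> exists2 r, 0 < r & forall y', O y' -> enorm (y' - y) < r -> degree phi U y' = degree phi U y.
Proof.
move=> Oy; have [r r0 H] := degree_local Oy; exists r => // y' Oy' yy'.
have [r' r'0 H'] := degree_local Oy'; pose e := Num.min r r' / 2.
have m0 : 0 < Num.min r r' by rewrite lt_min r0.
have : e < Num.min r r' by rewrite ltr_pdivrMr// ltr_pMr// ltr1n.
have e0 : 0 < e by rewrite divr_gt0.
rewrite lt_min => /andP[er er']; apply: (@intr_inj R); rewrite -(H _ e yy')// -(H' y' e)//.
by rewrite subrr enorm0.
Qed.

Lemma degree_fun_mble : mble (degree_fun phi U : T -> R).
Proof.
move=> _ B mB; rewrite setTI.
have -> : degree_fun phi U @^-1` B = (O `&` [set y | B (degree phi U y)%:~R]) `|` (~` O `&` [set _ | B 0]).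
  apply/seteqP; split=> y; rewrite /= /degree_fun patchE.
    by case: ifPn => [/set_mem Oy By|/negP nOy By]; [left|right; split=> // Oy; apply: nOy; exact: mem_set].
  move=> [[Oy By]|[nOy B0]]; first by rewrite mem_set.
  by rewrite memNset.
apply: measurableU; last first.
  apply: measurableI; first by apply: measurableC; exact: (open_measurable_rV Oo).
  have [B0|nB0] := pselect (B 0).
    by rewrite (_ : [set _ | _] = setT)//; apply/seteqP; split.
  by rewrite (_ : [set _ | _] = set0)//; apply/seteqP; split.
apply: open_measurable_rV; rewrite openE => y [Oy By].
have [r r0 H] := degree_locally_constant Oy.
have := Oo; rewrite openE => /(_ y Oy) /nbhs_eballP[d d0 dH].
apply/nbhs_eballP; exists (Num.min r d) => [|z]; first by rewrite lt_min r0.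
rewrite lt_min => /andP[zr /dH Oz]; split=> //=; rewrite H// enormB//.
Qed.

(** As the scale shrinks, the mollifications of [v] tend to [v] in [L^1] and to the degree at every
    point of [O]; the two limits must agree almost everywhere. *)
Lemma density_degree : {ae mu, forall y : T, O y -> v y = degree_fun phi U y}.
Proof.
have [vi [K0 cK0 vK0]] := vc.
have [R0 R00 K0R] : exists2 r, 0 <= r & forall x, K0 x -> enorm x <= r.
  by apply: bounded_enorm; exact: compact_bounded.
pose v' y := v y * cutoff R0 y.
have vv' : {ae mu, forall y : T, v y = v' y}.
  have vK0' : {ae mu, forall x : T, ~ K0 x -> v x = 0} by exact: vK0.
  apply: filterS vK0' => y h; rewrite /v'; have [Ky|nKy] := pselect (K0 y).
    by rewrite cutoff1 ?mulr1// K0R.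
  by rewrite h// mul0r.
have v'i : itg mu (v' : T -> R) by exact: (itgMb vi (lip_mble (@cutoff_lip R n R0)) (@cutoff_norm R n R0)).
have v'r : csup (R0 + 1) v' by apply: csupMr; exact: cutoff_csup.
have cvE e y : 0 < e -> cv e v y = cv e v' y.
  move=> e0; have [C C0 [mC _]] := mol_bounded n e0.
  apply: int_aeE; [exact: itg_mble (convk_itg y (mol_mble e0) mC vi)|exact: itg_mble (convk_itg y (mol_mble e0) mC v'i)|].
  by apply: filterS vv' => z ->.
have h0 k : 0 < hseq R k by rewrite invr_gt0 ltr0n.
have lim y : O y -> cv (hseq R k) v' y @[k --> \oo] --> degree_fun phi U y.
  move=> Oy; have [r r0 H] := degree_local Oy.
  rewrite /degree_fun patchE mem_set//; apply: (@cvg_trans _ ((fun=> (degree phi U y)%:~R : R) @ \oo)); last exact: cvg_cst.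
  apply: near_eq_cvg; apply: filterS (near_infty_natSinv_lt (PosNum r0)) => k /= kr.
  by rewrite -cvE// (H y)// subrr enorm0.
have mO : measurable (O : set T) by exact: open_measurable_rV.
have mI : mble (\1_O : T -> R) by exact: measurable_indic.
have md := degree_fun_mble; have mv' := itg_mble v'i.
have mcv k : mble (cv (hseq R k) v' : T -> R) by exact: itg_mble (itg_cv (h0 k) v'i v'r).
(* Integrability of the degree is not known at this point. Truncation at 1 and restriction to a cube
   provide the majorant; outside the cube [v'] and its mollifications at scales at most 1 vanish. *)
pose D (a : T -> R) (y : T) := Num.min 1 `|a y - v' y| * (\1_O y : R) * (\1_(cube (R0 + 3) : set T) y : R).
have mD a : mble a -> mble (D a).
  move=> ma; apply: measurable_funM; last by apply: measurable_indic; exact: measurable_cube.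
  apply: measurable_funM => //; apply: measurable_minr => //.
  by apply: measurableT_comp => //; exact: measurable_funB.
have iC := @itg_cube R n (R0 + 3).
have Ds a y : `|D a y| <= (\1_(cube (R0 + 3) : set T) y : R).
  have [m0 m1] : 0 <= Num.min 1 `|a y - v' y| /\ Num.min 1 `|a y - v' y| <= 1.
    by split; [rewrite le_min ler01 normr_ge0|rewrite ge_min lexx].
  rewrite /D !indicE; case: (y \in O); case: (y \in _); rewrite ?mulr0 ?mul0r ?mulr1 ?normr0 ?ler01//.
  by rewrite ger0_norm.
have Dlim : {ae mu, forall y : T, D (cv (hseq R k) v') y @[k --> \oo] --> D (degree_fun phi U) y}.
  apply: aeW => y; rewrite /D indicE; case: (boolP (y \in O)) => [|_]; last first.
    by rewrite mulr0 mul0r; under eq_fun do rewrite mulr0 mul0r; exact: cvg_cst.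
  rewrite inE => /lim ly; apply: cvgM; last exact: cvg_cst.
  apply: cvgM; last exact: cvg_cst.
  apply/cvgrPdist_lt => e e0; move/cvgrPdist_lt: ly => /(_ e e0); apply: filterS => k; apply: le_lt_trans.
  exact: min1_norm_lip.
have [||iD Dcv] := @dct _ _ _ mu (fun k => D (cv (hseq R k) v')) (D (degree_fun phi U)) _ _ _ iC Dlim (fun k => Ds _).
- by move=> k; exact: mD.
- exact: mD.
have D0 : \int[mu]_y D (degree_fun phi U) y = 0.
  apply: (cvg_seq_unique Dcv); apply/cvg_seq0P => e e0.
  have [d d0 dH] := cv_L1_cvg v'i v'r e0.
  apply: filterS (near_infty_natSinv_lt (PosNum d0)) => k /= kd.
  have ik := itg_cv (h0 k) v'i v'r.
  apply: le_lt_trans (dH _ (h0 k) kd); apply: int_norm_le.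
  - by apply: (itg_le (mD _ (mcv k)) _ iC) => y; rewrite (le_trans (Ds _ y))// ler_norm.
  - by exact/itg_norm/itgB.
  - move=> y; rewrite /D !normrM -[leRHS]mulr1 -[leRHS]mulr1 ler_pM// ?mulr_ge0//; last first.
      by rewrite ger0_norm indicE ?ler0n ?lern1 ?leq_b1.
    rewrite ler_pM//; last by rewrite ger0_norm indicE ?ler0n ?lern1 ?leq_b1.
    by rewrite ger0_norm ?le_min ?ler01 ?normr_ge0// ge_min lexx orbT.
have Dp y : 0 <= D (degree_fun phi U) y.
  by rewrite /D !mulr_ge0 ?indicE ?ler0n// le_min ler01 normr_ge0.
have ae0 : {ae mu, forall y : T, D (degree_fun phi U) y = 0}.
  apply: int_norm0_ae => //; rewrite -[RHS]D0; apply: eq_Rintegral => y _.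
  by rewrite ger0_norm.
apply: filterS2 ae0 vv' => y Dy -> Oy; have [yr|yr] := leP (enorm y) (R0 + 3).
  move: Dy; rewrite /D !indicE mem_set// mem_set; last exact: cube_ball.
  rewrite !mulr1 => /eqP; rewrite minEle; case: ifP => [_|_ /eqP]; first by rewrite oner_eq0.
  by move/normr0_eq0/eqP; rewrite subr_eq0 => /eqP.
have vy0 : v' y = 0 by apply: v'r; move: (enorm y) yr => N; lra.
rewrite vy0; apply: (cvg_seq_unique (u := fun k => cv (hseq R k) v' y)); last exact: lim.
apply: (cvg_seq_eq (u := fun=> 0)); last exact: cvg_cst.
move=> k; apply/esym; have hr : csup (R0 + 1 + hseq R k) (cv (hseq R k) v') by exact: cv_csup.
apply: hr.
have : hseq R k <= 1 by rewrite invf_le1 ?ltr0n// ler1n.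
by move: (enorm y) yr (hseq R k) => N Nr h h1; lra.
Qed.

End degree_density.

Section degree_push.
Context (R : realType) (n : nat).
Local Notation V := 'rV[R]_n.+1.
Local Notation T := 'rV[measurableTypeR R]_n.+1.
Local Notation mu := (lebesgue_rV R n.+1).
Variables (U : set V) (phi psi : V -> V) (alpha : 'I_n.+1 -> R) (d : R).
Hypotheses (Uo : open U) (Ub : bounded_set U) (alpha01 : forall i, 0 < alpha i <= 1).
Hypotheses (dn : n%:R <= d < n.+1%:R) (UBV : BV (d - n%:R) (\1_U : V -> R)) (dal : d < \sum_i alpha i).
Hypotheses (psiL : forall i, Lipa (alpha i) setT (comp_fun psi i)) (psiE : forall x, boundary U x -> psi x = phi x).

Let v : V -> R := push_density alpha \1_U psi.
Let O : set V := ~` (phi @` boundary U).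

(** Smoothing and the tested push forward in the form that the degree argument consumes, with scales
    and Hoelder constants hidden. *)
Let v_spec : L1c v /\ forall r e, 0 < r -> 0 < e -> exists p, [/\ forall i, Lip (p i),
  forall x, enorm (\row_i p i x - psi x) <= r &
  forall f Lf rf b, lip Lf f -> csup rf f -> (forall x, `|f x| <= b) ->
    `|\int[mu]_x (v x * f x) - tint (\1_U) f p| <= e * b].
Proof.
have [ui uW] := UBV; have [nd dn1] := andP dn.
have [ru ru0 Ur] := bounded_enorm Ub.
have a0 : 0 <= d - n%:R by rewrite subr_ge0.
have a1 : d - n%:R < 1 by rewrite ltrBlDr -natr1 addrC in dn1 *.
have ur : csup ru (\1_U : V -> R).
  by move=> x xr; rewrite indicE memNset// => /Ur; rewrite leNgt xr.
have u1 x : `|(\1_U : V -> R) x| <= 1 by rewrite indicE ger0_norm ?ler0n// lern1 leq_b1.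
have [W W0 uWW] : exists2 W, 0 <= W & (frac_var (d - n%:R) (\1_U : V -> R) <= W%:E)%E.
  move: uW; case: (frac_var _ _) => [W _|//|_]; [|by exists 0; rewrite ?leNye].
  by exists `|W| => //; rewrite lee_fin ler_norm.
have [C C0 uC] := smoothing a0 a1 W0 ui ur u1 uWW.
have gam0 : 0 < \sum_i alpha i - (n%:R + (d - n%:R)) by rewrite subr_gt0 addrC subrK.
have [vc vt] := push_density_tested a0 ui ur C0 uC alpha01 gam0 psiL.
split=> // r e r0 e0.
have [M M0 pM] := Lipa_choice psiL.
have [dd dd0 H] := vt M e M0 e0.
have [p [pL pH pd]] := lip_approx alpha01 M0 pM.
have t0 : 0 < Num.min dd (r / n.+1%:R) by rewrite lt_min dd0 divr_gt0.
have [k _ /(_ k (leqnn k)) kP] := pd _ t0.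
have /choice[L LP] : forall i, exists L, lip L (p k i) by exact: pL.
exists (p k); split=> [i|x|f Lf rf b fL fr fb].
- by apply/LipP; exists `|L i| => //; apply: lipW (LP i); exact: ler_norm.
- rewrite (le_trans (enorm_sumE _))//.
  rewrite [leRHS](_ : r = \sum_(i < n.+1) r / n.+1%:R); last first.
    by rewrite sumr_const card_ord -[RHS]mulr_natr divfK// pnatr_eq0.
  by apply: ler_sum => i _; rewrite !mxE (le_trans (kP i x))// ge_min lexx orbT.
- apply: (H (p k) L f Lf rf b) => // i x.
  by rewrite (le_trans (kP i x))// ge_min lexx.
Qed.

Let ae_degree : {ae mu, forall y : T, O y -> v y = degree_fun phi U y}.
Proof.
have [vc vt] := v_spec; have [M M0 pM] := Lipa_choice psiL.
exact: (density_degree Uo Ub (hol_continuous M0 alpha01 pM) vc psiE vt).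
Qed.

Let mdeg : mble (degree_fun phi U : T -> R).
Proof.
have [vc vt] := v_spec; have [M M0 pM] := Lipa_choice psiL.
exact: (degree_fun_mble Uo Ub (hol_continuous M0 alpha01 pM) psiE vt).
Qed.

Let Oo : open O.
Proof.
have [M M0 pM] := Lipa_choice psiL.
by rewrite openC; exact: (image_boundary_closed Uo Ub (hol_continuous M0 alpha01 pM) psiE).
Qed.

Let current_ae (w w' : V -> R) : mble (w : T -> R) -> mble (w' : T -> R) -> {ae mu, forall x : T, w x = w' x} ->
  current_eq (current w) (current w').
Proof.
move=> mw mw' ww f g /LipP[Lf _ fL] gL.
have mf := lip_mble fL.
have mg : mble (fun x : T => \det (Dmx g x)).
  by apply: mble_detD => i; have /LipP[L _ h] := gL i; exists L.
apply: int_aeE.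
- exact: (measurable_funM (measurable_funM mw mf) mg).
- exact: (measurable_funM (measurable_funM mw' mf) mg).
- by apply: filterS ww => x ->.
Qed.

Let ae_restrict : {ae mu, forall y : T, (v \_ O) y = degree_fun phi U y}.
Proof.
apply: filterS ae_degree => y h; rewrite patchE; case: ifPn => [|nO]; first by rewrite inE => /h.
by rewrite /degree_fun patchE (negbTE nO).
Qed.

Let restrict_itg : itg mu (v \_ O : T -> R).
Proof.
have [[vi _] _] := v_spec; have mO : measurable (O : set T) by exact: open_measurable_rV.
rewrite patch_indic; apply: (itgMb vi (measurable_indic mO) (C := 1)) => x.
by rewrite indicE ger0_norm ?ler0n// lern1 leq_b1.
Qed.

Lemma degree_L1 : L1 (degree_fun phi U).
Proof. exact: itg_aeE restrict_itg mdeg ae_restrict. Qed.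

Lemma current_restrict : current_eq (current (v \_ O)) (current (degree_fun phi U)).
Proof. apply: current_ae; [exact: itg_mble restrict_itg|exact: mdeg|exact: ae_restrict]. Qed.

Let ae_null : mu (phi @` boundary U) = 0%E -> {ae mu, forall y : T, v y = degree_fun phi U y}.
Proof.
move=> m0; have aeO : {ae mu, forall y : T, O y}.
  exists (phi @` boundary U); split => //.
    by rewrite -[X in measurable X]setCK; apply: measurableC; exact: open_measurable_rV.
  by move=> y; rewrite /O /= => /contrapT.
by apply: filterS2 ae_degree aeO => y h /h.
Qed.

Lemma degree_L1c : mu (phi @` boundary U) = 0%E -> L1c (degree_fun phi U).
Proof.
move=> m0; split; first exact: degree_L1.
have [[_ [K cK vK]] _] := v_spec; exists K => //.
have vK' : {ae mu, forall x : T, ~ K x -> v x = 0} by exact: vK.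
have h : {ae mu, forall x : T, ~ K x -> degree_fun phi U x = 0}.
  by apply: filterS2 (ae_null m0) vK' => y <-.
exact: h.
Qed.

Lemma current_degree : mu (phi @` boundary U) = 0%E -> current_eq (current v) (current (degree_fun phi U)).
Proof.
have [[vi _] _] := v_spec; move=> m0; apply: current_ae; [exact: itg_mble vi|exact: mdeg|exact: ae_null].
Qed.

End degree_push.

(** * Box dimension *)

Section box_cover.
Context (R : realType) (n : nat).
Local Notation V := 'rV[R]_n.+1.
Local Notation T := 'rV[measurableTypeR R]_n.+1.
Local Notation mu := (lebesgue_rV R n.+1).

Definition rbox (c : V) (r : 'I_n.+1 -> R) : set T := [set y | forall i, `|y ord0 i - c ord0 i| <= r i].

Let rboxE c r : rbox c r = rV_box (fun i => `[c ord0 i - r i, c ord0 i + r i]%classic).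
Proof. by apply/seteqP; split=> y H i; have := H i; rewrite /= in_itv/= ler_distl. Qed.

Lemma measurable_rbox c r : measurable (rbox c r).
Proof. by rewrite rboxE; apply: measurable_rV_box => i; exact: measurable_itv. Qed.

Lemma mu_rbox c r : (forall i, 0 < r i) -> mu (rbox c r) = (\prod_i (2 * r i))%:E.
Proof.
move=> r0; rewrite rboxE mu_rV_box => [|i]; last exact: measurable_itv.
rewrite -prodEFin; apply: eq_bigr => i _; have ri := r0 i.
rewrite lebesgue_measure_itv/= lte_fin ifT; last by lra.
by rewrite -EFinD; congr EFin; ring.
Qed.

Lemma ball_rbox (c x : V) e : enorm (x - c) <= e -> rbox c (fun=> e) x.
Proof. by move=> xc i; have := coor_le (x - c) i; rewrite !mxE => /le_trans; apply. Qed.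

Lemma mu_cover k (A : set T) (B : 'I_k -> set T) b : measurable A -> (forall i, measurable (B i)) ->
  (forall x, A x -> exists i, B i x) -> (forall i, (mu (B i) <= b%:E)%E) -> (mu A <= (k%:R * b)%:E)%E.
Proof.
move=> mA mB AB Bb; pose B' m := if insub m is Some i then B i else set0.
have B'E (i : 'I_k) : B' i = B i by rewrite /B' valK.
have mB' m : measurable (B' m) by rewrite /B'; case: insubP => [i _ _|_].
have AB' : A `<=` \big[setU/set0]_(i < k) B' i.
  by move=> x /AB[i Bx]; rewrite -bigcup_mkord; exists i => //=; rewrite B'E.
rewrite (le_trans (content_subadditive mu (fun i _ => mB' i) mA AB'))//.
apply: (@le_trans _ _ (\sum_(i < k) b%:E)%E); first by apply: lee_sum => i _; rewrite B'E; exact: Bb.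
by rewrite sumEFin sumr_const card_ord mulr_natl.
Qed.

Variable S : set V.

Lemma covered_exists e : bounded_set S -> 0 < e -> exists k, Defs.covered_by S e k.
Proof.
move=> Sb e0; have [r r0 rS] := bounded_enorm Sb.
have r1 : 0 < r + 1 by rewrite ltr_wpDl.
pose N := (Num.truncn (n.+1%:R * (2 * (r + 1)) / e)).+1.
have N0 : 0 < N%:R :> R by rewrite ltr0n.
exists #|{ffun 'I_n.+1 -> 'I_N.+1}|.
pose c (i : 'I_#|{ffun 'I_n.+1 -> 'I_N.+1}|) : V :=
  \row_j (2 * (r + 1) * (enum_val i j)%:R / N%:R - (r + 1)).
exists c => x Sx; have xr : cube (r + 1) x.
  by apply: cube_ball; rewrite (le_trans (rS x Sx))// lerDl.
have [k kP] := grid_cover r1 (isT : (0 < N)%N) xr.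
exists (enum_rank k) => /=; rewrite (le_trans (enorm_le_cube (k := 2 * (r + 1) / N%:R) _))// => [i|].
  by rewrite !mxE enum_rankK.
by rewrite mulrA ler_pdivrMr// mulrC [leRHS]mulrC -ler_pdivrMr// ltW// mulrC truncnS_gt.
Qed.

Lemma box_dim_cover D s : bounded_set S -> has_box_dim S D -> D < s ->
  exists2 e0, 0 < e0 & forall e, 0 < e -> e < e0 -> exists2 k, Defs.covered_by S e k & k%:R <= e `^ (- s).
Proof.
move=> Sb SD Ds; have sD : 0 < s - D by rewrite subr_gt0.
move/cvgrPdist_lt : SD => /(_ _ sD) [d /= d0 dH].
exists (Num.min d 1) => [|e e0]; first by rewrite lt_min d0 ltr01.
rewrite lt_min => /andP[ed e1].
have {}dH : ln (covering_number S e) / ln e^-1 < s.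
  have := dH e; rewrite /= sub0r normrN gtr0_norm// => /(_ ed e0).
  by rewrite ltr_norml => /andP[h _]; move: h; move: (_ / _) => q h; lra.
have le0 : 0 < ln e^-1 by rewrite ln_gt0// invf_gt1.
have [k0 k0P] := covered_exists Sb e0.
have E0 : [set (k%:R : R) | k in Defs.covered_by S e] !=set0 by exists k0%:R, k0.
have : covering_number S e < e `^ (- s).
  (* The covering number of the empty set is 0, where the logarithm has only a default value. *)
  have [c0|c0] := leP (covering_number S e) 0; first by rewrite (le_lt_trans c0)// powR_gt0.
  rewrite -(lnK (x := covering_number S e)) ?posrE// /powR gt_eqF//.
  by rewrite ltr_expR mulNr -mulrN -lnV ?posrE// -ltr_pdivrMr.
by move=> /(inf_lt E0)[_ [k kS <-]] ks; exists k => //; exact: ltW.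
Qed.

Lemma dist_near x e : S !=set0 -> 0 < e -> dist_set x S <= e -> exists2 z, S z & enorm (x - z) < 2 * e.
Proof.
move=> [a Sa] e0 xe; apply: contrapT => /forall2NP H.
have : 2 * e <= dist_set x S.
  by apply: (dist_set_glb Sa) => z Sz; have [//|/negP] := H z; rewrite -leNgt.
by move=> /le_trans/(_ xe); rewrite leNgt mulr2n ?ltrDl//; move: e0; lra.
Qed.

(** A point at distance at most [e] has a point of [S] within [2 e], since the infimum may not be
    attained, and so a centre of the covering within [3 e]: hence cubes of side [6 e]. *)
Lemma mu_dist D s : S !=set0 -> bounded_set S -> has_box_dim S D -> D < s ->
  exists2 e0, 0 < e0 & forall e, 0 < e -> e < e0 ->
    (mu [set x : T | (dist_set (x : V) S <= e)%R] <= (6 ^+ n.+1 * e `^ (n.+1%:R - s))%R%:E)%E.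
Proof.
move=> S0 Sb SD Ds; have [e0 e00 H] := box_dim_cover Sb SD Ds; have [a Sa] := S0.
exists e0 => // e e_gt0 ee; have [k [c Sc] ks] := H e e_gt0 ee.
have e3 : 0 < 3 * e by rewrite mulr_gt0.
apply: (@le_trans _ _ (k%:R * (6 * e) ^+ n.+1)%:E).
  apply: (@mu_cover k _ (fun i => rbox (c i) (fun=> 3 * e))).
  - apply: closed_measurable_rV; rewrite (_ : [set _ | _] = (fun x => dist_set x S) @^-1` [set t | t <= e])//.
    by apply: closed_comp; [move=> x _; exact: lip_continuous (dist_set_lip Sa) x|exact: closed_le].
  - by move=> i; exact: measurable_rbox.
  - move=> x /= xe; have [z Sz xz] := dist_near S0 e_gt0 xe; have [i zi] := Sc z Sz.
    exists i; apply: ball_rbox; rewrite (le_trans (enorm_dist_triangle _ z _))//.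
    by move: zi xz; rewrite /=; move: (enorm _) (enorm _) => u v; lra.
  - move=> i; rewrite mu_rbox// prodr_const card_ord lee_fin le_eqVlt; apply/orP; left.
    by apply/eqP; congr (_ ^+ _); ring.
rewrite lee_fin exprMn mulrCA ler_wpM2l// -powR_mulrn ?(ltW e_gt0)//.
rewrite [_ - s]addrC powRD; last by apply/implyP => _; rewrite gt_eqF.
by rewrite ler_wpM2r// powR_ge0.
Qed.

End box_cover.

(** * The image of a set of small box dimension *)

Section image_null.
Context (R : realType) (n : nat).
Local Notation V := 'rV[R]_n.+1.
Local Notation T := 'rV[measurableTypeR R]_n.+1.
Local Notation mu := (lebesgue_rV R n.+1).
Variables (S : set V) (phi : V -> V) (alpha : 'I_n.+1 -> R) (D : R).
Hypotheses (cS : compact S) (SD : has_box_dim S D) (Dal : D < \sum_i alpha i).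
Hypotheses (alpha01 : forall i, 0 < alpha i <= 1) (phiL : forall i, Lipa (alpha i) S (comp_fun phi i)).

Let hol_on : exists2 M, 0 < M & forall x y, S x -> S y -> forall i,
  `|comp_fun phi i x - comp_fun phi i y| <= M * enorm (x - y) `^ alpha i.
Proof.
have /choice[M_ MP] : forall i, exists M, forall x y, S x -> S y ->
    `|comp_fun phi i x - comp_fun phi i y| <= M * enorm (x - y) `^ alpha i.
  by move=> i; have [M _ h] := LipaP (phiL i); exists M.
exists (1 + \sum_i `|M_ i|) => [|x y Sx Sy i]; first by rewrite ltr_pwDl// sumr_ge0.
rewrite (le_trans (MP i x y Sx Sy))// ler_wpM2r ?powR_ge0// (le_trans (ler_norm _))//.
by rewrite (bigD1 i)//= addrCA lerDl addr_ge0// sumr_ge0.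
Qed.

Lemma image_closed : closed (phi @` S).
Proof.
have [M M0 phM] := hol_on.
apply: compact_closed => //; apply: continuous_compact => //.
apply/subspace_continuousP => x Sx A /nbhs_eballP[e e0 eA].
have [d d0 dH] := hol_near phi M0 e0 alpha01.
apply/nbhs_eballP; exists d => // y xy Sy; apply: eA; apply: dH => //.
exact: phM.
Qed.

Lemma image_null : mu (phi @` S) = 0%E.
Proof.
have [M M0 phM] := hol_on; pose tau := \sum_i alpha i; have Dt : D < tau by [].
pose s := (D + tau) / 2; have Ds : D < s by rewrite /s; lra.
have st : 0 < tau - s by rewrite /s; lra.
have [e0 e00 H] := box_dim_cover (compact_bounded cS) SD Ds.
have K0 : 0 < (2 * M) ^+ n.+1 * 2 `^ tau by rewrite mulr_gt0 ?powR_gt0// exprn_gt0// mulr_gt0.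
apply/eqP; rewrite eq_le measure_ge0 andbT; apply/lee_addgt0Pr => eps eps0; rewrite add0e.
have [x0 x00 xP] := small_pow st (divr_gt0 eps0 K0).
pose e := Num.min (e0 / 2) x0.
have e_gt0 : 0 < e by rewrite lt_min x00 andbT divr_gt0.
have ee : e < e0 by rewrite gt_min ltr_pdivrMr// ltr_pMr// ltr1n.
have ex : e <= x0 by rewrite ge_min lexx orbT.
have e2 : 0 < 2 * e by rewrite mulr_gt0.
have [k [c Sc] ks] := H e e_gt0 ee.
(* The centres of the covering need not lie in [S], where alone [phi] is controlled. Each ball is
   represented by a point [z i] of [S] in it, which doubles the radius; balls that miss [S] get a
   default point and merely add to the count. *)
pose B i : set V := [set x | S x /\ enorm (x - c i) <= e].
pose z i := xget 0 (B i).
apply: (@le_trans _ _ (k%:R * ((2 * M) ^+ n.+1 * (2 * e) `^ tau))%:E).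
  apply: (@mu_cover R n k _ (fun i => rbox (phi (z i)) (fun j => M * (2 * e) `^ alpha j))).
  - by apply: closed_measurable_rV; exact: image_closed.
  - by move=> i; exact: measurable_rbox.
  - move=> _ [x Sx <-]; have [i xi] := Sc x Sx; exists i => j.
    have [Sz zi] : B i (z i) by apply: xgetPex; exists x.
    apply: (le_trans (phM _ _ Sx Sz j)); rewrite ler_wpM2l ?(ltW M0)//.
    have /andP[aj _] := alpha01 j.
    apply: ge0_ler_powR; rewrite ?nnegrE ?enorm_ge0 ?(ltW e2) ?(ltW aj)//.
    rewrite (le_trans (enorm_dist_triangle _ (c i) _))// (enormB (c i)).
    by move: zi xi; rewrite /=; move: (enorm _) (enorm _) => u v; lra.
  - move=> i; rewrite mu_rbox => [|j]; last by rewrite mulr_gt0// powR_gt0.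
    rewrite lee_fin le_eqVlt; apply/orP; left; apply/eqP.
    under eq_bigr do rewrite mulrA.
    by rewrite big_split/= prodr_const card_ord prod_powR.
have -> : (2 * e) `^ tau = 2 `^ tau * e `^ tau by rewrite powRM// ltW.
rewrite lee_fin; have := xP e (ltW e_gt0) ex; rewrite ler_pdivlMr// => h.
apply: le_trans h; rewrite addrC powRD; last by apply/implyP => _; rewrite gt_eqF.
rewrite (_ : k%:R * _ = k%:R * (e `^ tau * ((2 * M) ^+ n.+1 * 2 `^ tau))); last by ring.
by rewrite mulrA ler_wpM2r ?(ltW K0)// ler_wpM2r// powR_ge0.
Qed.

End image_null.

(** * Fractional variation of the indicator *)

Section frac_var_indicator.
Context (R : realType) (n : nat).
Local Notation V := 'rV[R]_n.+1.
Local Notation T := 'rV[measurableTypeR R]_n.+1.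
Local Notation mu := (lebesgue_rV R n.+1).

(** The supremum of the parameters at which the segment from [x] to [z] lies in [U] gives a boundary
    point. It shows that inside [U] the distance to the complement is at least that to the
    boundary. *)
Lemma segment_boundary (U : set V) x z : open U -> U x -> ~ U z ->
  exists2 b, boundary U b & enorm (x - b) <= enorm (x - z).
Proof.
move=> Uo Ux nUz; pose g (t : R) := x + t *: (z - x).
have gB t t' : enorm (g t - g t') = `|t - t'| * enorm (x - z).
  by rewrite /g opprD addrACA subrr add0r -scalerBl enormZ (enormB z).
pose E := [set t : R | 0 <= t <= 1 /\ U (g t)].
have E0 : E 0 by split; rewrite ?lexx ?ler01// /g scale0r addr0.
have Eub : has_ubound E by exists 1 => t [/andP[]].
have hE : has_sup E by split; [exists 0|].
have s0 : 0 <= sup E by exact: ub_le_sup.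
have s1 : sup E <= 1 by apply: ge_sup; [exists 0|move=> t [/andP[]]].
have xz0 : 0 <= enorm (x - z) := enorm_ge0 _.
have near e : 0 < e -> exists2 d, 0 < d & forall t, `|sup E - t| < d -> enorm (g (sup E) - g t) < e.
  move=> e0; exists (e / (enorm (x - z) + 1)) => [|t]; first by rewrite divr_gt0// ltr_wpDl.
  rewrite gB ltr_pdivlMr ?ltr_wpDl//; apply: le_lt_trans; rewrite ler_wpM2l//; lra.
exists (g (sup E)).
  apply: boundary_open => // [|Us].
    move=> A /nbhs_eballP[e e0 eA]; have [d d0 dH] := near e e0.
    have [t [t01 Ut] ts] := sup_adherent d0 hE.
    exists (g t); split=> //; apply/eA/dH; rewrite ger0_norm ?subr_ge0; first by lra.
    exact: ub_le_sup.
  have := Uo; rewrite openE => /(_ _ Us) /nbhs_eballP[e e0 eU]; have [d d0 dH] := near e e0.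
  have s_lt1 : sup E < 1.
    rewrite lt_neqAle s1 andbT; apply/eqP => sE; apply: nUz; move: Us.
    by rewrite sE /g scale1r addrC subrK.
  pose t := Num.min 1 (sup E + d / 2).
  have ts : sup E < t by rewrite lt_min s_lt1 ltrDl divr_gt0.
  have td : t <= sup E + d / 2 by rewrite ge_min lexx orbT.
  have : t <= sup E; last by rewrite leNgt ts.
  apply: ub_le_sup => //; split; first by rewrite (le_trans s0 (ltW ts))/= ge_min lexx.
  by apply/eU/dH; rewrite ltr_norml; apply/andP; split; lra.
have := gB 0 (sup E); rewrite {1}/g scale0r addr0 sub0r normrN ger0_norm// => ->.
by rewrite -[leRHS]mul1r ler_wpM2r.
Qed.

Lemma int_le_measure (F : T -> R) (A : set T) c m : 0 <= c -> 0 <= m -> measurable A -> (mu A <= m%:E)%E ->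
  mble F -> (forall x, `|F x| <= c * \1_A x) -> itg mu F /\ `|\int[mu]_x F x| <= c * m.
Proof.
move=> c0 m0 mA Am mF FA.
have i1 : itg mu (\1_A : T -> R).
  apply/integrableP; split; first exact/measurable_EFinP/measurable_indic.
  rewrite (eq_integral (fun x => (\1_A x)%:E)); last by move=> x _ /=; rewrite ger0_norm// indicE ler0n.
  by rewrite integral_indic// setIT (le_lt_trans Am)// ltry.
have ic : itg mu (fun x : T => c * \1_A x) by exact: itgZ.
have iF : itg mu F.
  by apply: (itg_le mF _ ic) => x; rewrite (le_trans (FA x))// ler_norm.
split=> //; apply: (le_trans (int_norm_le iF ic FA)); rewrite intZ//.
rewrite ler_wpM2l// -lee_fin -int_EFin// integral_indic// setIT//.
Qed.

Lemma det_fcons_bound K (f : V -> R) (g : 'I_n -> V -> R) x : lip K f -> (forall i, lip 1 (g i)) ->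
  `|\det (Dmx (fcons f g) x)| <= n.+1`!%:R * K.
Proof.
move=> fK gL; apply: le_trans (det_bound (L := fcons K (fun=> 1)) _) _ => [i j|].
  by rewrite DmxE /fcons; case: unliftP => [k _|_]; exact: pd_bound.
by rewrite big_ord_recl {1}/fcons unlift_none big1 ?mulr1// => i _; rewrite /fcons liftK.
Qed.

(** With [f'] the inf-convolution, the slope [e^(a - 1)] bounds the Jacobian of [f']. In the
    remainder, parts move the derivative of [f - f'] onto [zeta], leaving a factor [e^a]. Both
    integrands live on [A], as [zeta] and its derivatives vanish outside. *)
Lemma det_frac_bound a Lf Lz rz e m (f zeta : V -> R) (g : 'I_n -> V -> R) (A : set T) :
  0 <= a <= 1 -> 0 < e -> 0 <= Lz -> 0 <= m -> lip Lf f -> hol a 1 f -> (forall i, lip 1 (g i)) ->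
  lip Lz zeta -> csup rz zeta -> (forall x, `|zeta x| <= 1) ->
  measurable A -> (mu A <= m%:E)%E -> (forall x : V, ~ A x -> \forall y \near x, zeta y = 0) ->
  `|\int[mu]_x (zeta x * \det (Dmx (fcons f g) x))| <= n.+1`!%:R * (e `^ (a - 1) + e `^ a * Lz) * m.
Proof.
move=> a01 e0 Lz0 m0 fL fh gL zL zr z1 mA Am zA.
have one0 : (0 : R) <= 1 := ler01.
pose L := 1 * e `^ (a - 1); pose f' := infconv L f.
have L0 : 0 <= L by rewrite /L mul1r powR_ge0.
have f'L : lip L f' by exact: (infconv_lip one0 a01 e0 fh).
have ff' x : `|f x - f' x| <= e `^ a.
  have h1 := infconv_le one0 a01 e0 fh x; have h2 := infconv_ge one0 a01 e0 fh x.
  by rewrite ger0_norm ?subr_ge0//; move: h2; rewrite mul1r /f' /L; move: (infconv _ _ _) => q; lra.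
pose M := 1 + `|Lf| + L + Lz.
have [M1 [MLf [ML MLz]]] : 1 <= M /\ Lf <= M /\ L <= M /\ Lz <= M.
  have h := ler_norm Lf; have h0 := normr_ge0 Lf; rewrite /M; move: (`|Lf|) h h0 => q h h0.
  by do !split; lra.
pose h0 := fcons (fun=> 0 : R) g.
have hM i : lip M (h0 i).
  by rewrite /h0 /fcons; case: unliftP => [j _|_]; [exact: lipW M1 (gL j)|exact: lipW (le_trans ler01 M1) (lip_cst _)].
have p1 := int_det_parts ord0 hM (lipW MLf fL) (lipW MLz zL) zr.
have p2 := int_det_parts ord0 hM (lipW ML f'L) (lipW MLz zL) zr.
rewrite !upd_fcons in p1 p2.
have consM q : lip M q -> forall i, lip M (fcons q g i).
  by move=> qM i; rewrite -(upd_fcons (fun=> 0)); apply: upd_lipM.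
have consE q : lip M q -> forall i, exists L, lip L (fcons q g i) by move=> qM i; exists M; exact: consM.
have dz x : rz < enorm x -> \det (Dmx (fcons zeta g) x) = 0.
  move=> xr; apply: (det_row0 (i := ord0)) => j; rewrite DmxE /fcons unlift_none.
  by rewrite (csup_pd j zr).
have zA0 x : ~ A x -> zeta x = 0 by move=> /zA /nbhs_singleton.
have mz := lip_mble zL; have mf' := lip_mble f'L; have mf := lip_mble fL.
have b1 (x : T) : `|zeta x * \det (Dmx (fcons f' g) x)| <= n.+1`!%:R * e `^ (a - 1) * \1_A x.
  rewrite indicE; case: (boolP (x \in A)) => [_|/negP nA].
    rewrite mulr1 normrM -[leRHS]mul1r ler_pM//; have := det_fcons_bound x f'L gL.
    by rewrite /L mul1r.
  by rewrite zA0 ?mul0r ?normr0 ?mulr0// => Ax; apply: nA; exact: mem_set.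
have b2 (x : T) : `|(f x - f' x) * \det (Dmx (fcons zeta g) x)| <= n.+1`!%:R * (e `^ a * Lz) * \1_A x.
  rewrite indicE; case: (boolP (x \in A)) => [_|/negP nA].
    rewrite mulr1 normrM mulrCA ler_pM//; exact: det_fcons_bound.
  rewrite (det_row0 (i := ord0)) ?mulr0 ?normr0// => j; rewrite DmxE /fcons unlift_none.
  by apply: pd0_near; apply: zA => Ax; apply: nA; exact: mem_set.
have c1 : 0 <= n.+1`!%:R * e `^ (a - 1) by rewrite mulr_ge0// powR_ge0.
have c2 : 0 <= n.+1`!%:R * (e `^ a * Lz) by rewrite !mulr_ge0// powR_ge0.
have md1 := mble_detD (consE _ (lipW ML f'L)).
have md2 := mble_detD (consE _ (lipW MLz zL)).
have [i1 B1] := int_le_measure c1 m0 mA Am (measurable_funM mz md1) b1.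
have mff : mble (fun x : T => f x - f' x) by exact: (measurable_funB mf mf').
have [i2 B2] := int_le_measure c2 m0 mA Am (measurable_funM mff md2) b2.
have i3 : itg mu (fun x : T => f' x * \det (Dmx (fcons zeta g) x)).
  apply: (@itg_csup R n rz ((`|f' 0| + `|L| * `|rz|) * (n.+1`!%:R * Lz))).
  - exact: (measurable_funM mf' md2).
  - move=> x; have [xr|xr] := leP (enorm x) rz.
      by rewrite normrM ler_pM//; [exact: (lip_bounded_ball f'L)|exact: det_fcons_bound].
    by rewrite dz// mulr0 normr0 !mulr_ge0// addr_ge0// mulr_ge0.
  - by move=> x xr; rewrite dz// mulr0.
have E : \int[mu]_x (zeta x * \det (Dmx (fcons f g) x)) =
    \int[mu]_x (zeta x * \det (Dmx (fcons f' g) x)) - \int[mu]_x ((f x - f' x) * \det (Dmx (fcons zeta g) x)).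
  rewrite p1 p2 -opprD -(intD i3 i2); congr (- _); apply: eq_Rintegral => x _.
  by rewrite -mulrDl addrC subrK.
rewrite E (le_trans (ler_normB _ _))// mulrDr mulrDl; apply: lerD; [exact: B1|exact: B2].
Qed.

Section bound.
Variables (U : set V) (D s a : R).
Hypotheses (Uo : open U) (Ub : bounded_set U) (Un0 : U !=set0).
Hypotheses (UD : has_box_dim (boundary U) D) (Ds : D < s) (a01 : 0 <= a <= 1) (sa : s < n%:R + a).

Let N := n.+1.
Let S := boundary U.
Let dU (x : V) := dist_set x (~` U).
Let eta e x := Num.min 1 (dU x / e).

Let outside : exists b, ~ U b.
Proof. by have [u Uu] := Un0; have [b /boundaryP-/(_ Uo)[_ nUb]] := boundary_neq0 Uo Ub Uu; exists b. Qed.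

Let dU_lip : lip 1 dU. Proof. by have [b nUb] := outside; exact: (@dist_set_lip _ _ _ b). Qed.
Let dU_ge0 x : 0 <= dU x. Proof. by have [b nUb] := outside; exact: (@dist_set_ge0 _ _ _ b). Qed.
Let dU0 x : ~ U x -> dU x = 0. Proof. by move=> nUx; exact: (dist_set0 nUx). Qed.

Let eta_lip e : 0 < e -> lip e^-1 (eta e).
Proof.
move=> e0; apply: lip_min => x y; rewrite -mulrBl normrM normfV (gtr0_norm e0) mulrC.
by rewrite ler_wpM2l ?invr_ge0 ?(ltW e0)// -[leRHS]mul1r; exact: dU_lip.
Qed.

Let eta01 e x : 0 < e -> 0 <= eta e x <= 1.
Proof. by move=> e0; rewrite le_min ler01 divr_ge0 ?(ltW e0)//= ge_min lexx. Qed.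

Let eta0 e x : ~ U x -> eta e x = 0.
Proof. by move=> /dU0 h; rewrite /eta h mul0r; apply/min_idPr; exact: ler01. Qed.

Let eta1 e x : 0 < e -> e <= dU x -> eta e x = 1.
Proof. by move=> e0 h; apply/min_idPl; rewrite ler_pdivlMr// mul1r. Qed.

Let dist_le_dU x : U x -> dist_set x S <= dU x.
Proof.
move=> Ux; have [b nUb] := outside; apply: (dist_set_glb nUb) => z nUz.
have [c Sc xc] := segment_boundary Uo Ux nUz.
by apply: le_trans xc; exact: dist_set_le Sc.
Qed.

Let near_boundary e x : 0 < e -> e < dist_set x S -> \forall y \near x, eta (e / 2) y - eta e y = 0.
Proof.
move=> e0 ex; have [u Uu] := Un0; have [b Sb] := boundary_neq0 Uo Ub Uu.
apply/nbhs_eballP; exists (dist_set x S - e) => [|y xy]; first by rewrite subr_gt0.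
have [Uy|nUy] := pselect (U y); last by rewrite !eta0 ?subrr.
have ye : e < dU y.
  have h := dist_le_dU Uy; have := dist_set_lip Sb x y; rewrite mul1r ler_norml => /andP[_ h'].
  by move: xy h h'; move: (enorm _) (dist_set x S) (dist_set y S) (dU y) => p q r t; lra.
by rewrite !eta1 ?subrr ?divr_gt0// ?(ltW ye)//; move: ye; move: (dU y) => t; lra.
Qed.

Lemma indic_frac_bound : exists W, forall Lf (f : V -> R) (g : 'I_n -> V -> R),
  lip Lf f -> hol a 1 f -> (forall i, lip 1 (g i)) ->
  `|\int[mu]_x ((\1_U : V -> R) x * \det (Dmx (fcons f g) x))| <= W.
Proof.
have [ru ru0 Ur] := bounded_enorm Ub; have [u Uu] := Un0.
have S0 : S !=set0 by have [b Sb] := boundary_neq0 Uo Ub Uu; exists b.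
have Sb : bounded_set S.
  exact/compact_bounded/boundary_compact.
have [e0 e00 Hmu] := mu_dist S0 Sb UD Ds.
pose e1 := e0 / 2; have e10 : 0 < e1 by rewrite divr_gt0.
have e1e0 : e1 < e0 by rewrite ltr_pdivrMr// ltr_pMr// ltr1n.
pose p := n%:R + a - s; have p0 : 0 < p by rewrite subr_gt0.
pose q : R := 2^-1 `^ p.
have q1 : q < 1.
  have p1 : (1 : R) `^ p = 1 by rewrite powR1.
  rewrite -[ltRHS]p1; apply: gt0_ltr_powR; rewrite ?nnegrE ?invr_ge0//.
  by rewrite invf_lt1 ?ltr1n.
(* The 4 collects [e^(a - 1) + e^a (2/e + 1/e)], with the slopes of [eta (e / 2)] and [eta e]; the
   power of 6 comes from [mu_dist]. *)
pose K := N`!%:R * 4 * 6 ^+ N : R.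
have K0 : 0 <= K by rewrite !mulr_ge0 ?exprn_ge0.
pose B := N`!%:R * (e1 `^ (a - 1) + e1 `^ a * e1^-1) * (2 * (ru + 1)) ^+ N.
exists (B + K / (1 - q) * e1 `^ p) => Lf f g fL fh gL.
pose T_ e := \int[mu]_x (eta e x * \det (Dmx (fcons f g) x)).
have ecs e : 0 < e -> csup ru (eta e).
  by move=> e_gt0 x xr; apply: eta0 => /Ur; rewrite leNgt xr.
have TB : `|T_ e1| <= B.
  apply: (@det_frac_bound a Lf e1^-1 ru e1 _ f (eta e1) g (cube (ru + 1))) => //.
  - by rewrite invr_ge0 ltW.
  - by rewrite exprn_ge0// mulr_ge0// addr_ge0.
  - exact: eta_lip.
  - exact: ecs.
  - by move=> x; have /andP[h1 h2] := eta01 x e10; rewrite ger0_norm.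
  - exact: measurable_cube.
  - by rewrite mu_cube// addr_ge0.
  - move=> x nx; apply/nbhs_eballP; exists 1 => // y xy; apply: (ecs _ e10).
    have : ru + 1 < enorm x by rewrite ltNge; apply/negP => /cube_ball.
    have := enormD (x - y) y; rewrite subrK; move: xy.
    by move: (enorm _) (enorm _) (enorm _) => b c d; lra.
have step e : 0 < e -> e < e0 -> `|T_ (e / 2) - T_ e| <= K * e `^ p.
  move=> e_gt0 ee; have e2 : 0 < e / 2 by rewrite divr_gt0.
  have ei e' : 0 < e' -> itg mu (fun x : T => eta e' x * \det (Dmx (fcons f g) x)).
    move=> e'0; apply: (itgMb (itg_lip_csup (eta_lip e'0) (ecs e' e'0)) _ (fun x => det_fcons_bound x fL gL)).
    apply: mble_detD => i; exists (Num.max Lf 1).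
    rewrite /fcons; case: unliftP => [j _|_]; first by apply: lipW (gL j); rewrite le_max lexx orbT.
    by apply: lipW fL; rewrite le_max lexx.
  rewrite /T_ -(intB (ei _ e2) (ei _ e_gt0)).
  under eq_Rintegral do rewrite -mulrBl.
  have Lz : 0 <= (e / 2)^-1 + e^-1 by rewrite addr_ge0// invr_ge0 ltW.
  have m0 : 0 <= 6 ^+ N * e `^ (N%:R - s) by rewrite mulr_ge0 ?powR_ge0// exprn_ge0.
  apply: le_trans (@det_frac_bound a Lf _ ru e _ f _ g [set x : T | (dist_set (x : V) S <= e)%R] a01 e_gt0 Lz m0 fL fh gL _ _ _ _ (Hmu e e_gt0 ee) _) _.
  - exact: lipB (eta_lip e2) (eta_lip e_gt0).
  - by move=> x xr; rewrite !ecs// subrr.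
  - move=> x; have /andP[h1 h2] := eta01 x e2; have /andP[h3 h4] := eta01 x e_gt0.
    by rewrite ler_norml; apply/andP; split; move: h1 h2 h3 h4; move: (eta _ _) (eta _ _) => b c; lra.
  - have [b Sb'] := S0; apply: closed_measurable_rV.
    rewrite (_ : [set _ | _] = (fun x => dist_set x S) @^-1` [set t | t <= e])//.
    by apply: closed_comp; [move=> x _; exact: lip_continuous (dist_set_lip Sb') x|exact: closed_le].
  - by move=> x /= /negP; rewrite -ltNge; exact: near_boundary.
  - rewrite le_eqVlt; apply/orP; left; apply/eqP.
    have -> : e `^ a = e `^ (a - 1) * e.
      by rewrite -{3}(powRr1 (ltW e_gt0)) -powRD ?subrK//; apply/implyP => _; rewrite gt_eqF.
    have -> : e `^ p = e `^ (a - 1) * e `^ (N%:R - s).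
      rewrite -powRD; last by apply/implyP => _; rewrite gt_eqF.
      by congr (_ `^ _); rewrite /p /N -natr1; ring.
    rewrite /K; move: (e `^ _) (e `^ _) (N`!%:R) (6 ^+ N) => b c d h.
    by field; rewrite gt_eqF.
have em m : 0 < e1 / 2 ^+ m by rewrite divr_gt0// exprn_gt0.
(* Keeping the exact partial sum of the geometric series makes the induction an identity. *)
have Tm m : `|T_ (e1 / 2 ^+ m) - T_ e1| <= K / (1 - q) * (e1 `^ p - (e1 / 2 ^+ m) `^ p).
  elim: m => [|m IH]; first by rewrite expr0 divr1 !subrr normr0 mulr0.
  have emE : e1 / 2 ^+ m.+1 = e1 / 2 ^+ m / 2 by rewrite exprSr invfM mulrA.
  have eme0 : e1 / 2 ^+ m < e0.
    by apply: le_lt_trans e1e0; rewrite ler_pdivrMr ?exprn_gt0// ler_peMr ?(ltW e10)// exprn_ege1// ler1n.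
  have st := step _ (em m) eme0.
  have -> : (e1 / 2 ^+ m.+1) `^ p = q * (e1 / 2 ^+ m) `^ p.
    by rewrite emE powRM ?(ltW (em m))// mulrC.
  rewrite emE; move: st IH; move: ((e1 / 2 ^+ m) `^ p) (e1 `^ p) (T_ _) (T_ _) (T_ _) => b c t1 t2 t3 st IH.
  have -> : t3 - t1 = (t3 - t2) + (t2 - t1) by rewrite addrA subrK.
  rewrite (le_trans (ler_normD _ _))//; apply: (le_trans (lerD st IH)).
  rewrite le_eqVlt; apply/orP; left; apply/eqP; field.
  by rewrite subr_eq0 gt_eqF.
have TW m : `|T_ (e1 / 2 ^+ m) - 0| <= B + K / (1 - q) * e1 `^ p.
  rewrite subr0 -[T_ (e1 / 2 ^+ m)](subrK (T_ e1)) addrC (le_trans (ler_normD _ _))//.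
  apply: lerD => //; apply: (le_trans (Tm m)).
  rewrite ler_wpM2l//; first by rewrite divr_ge0// subr_ge0 ltW.
  by rewrite gerBl powR_ge0.
set I := Rintegral _ _ _; suff cT : T_ (e1 / 2 ^+ m) @[m --> \oo] --> I.
  have h := lim_dist_le cT (nearW _ TW); rewrite subr0 in h; exact: h.
rewrite {}/I.
have md : mble (fun x : T => \det (Dmx (fcons f g) x)).
  apply: mble_detD => i; exists (Num.max Lf 1).
  rewrite /fcons; case: unliftP => [j _|_]; first by apply: lipW (gL j); rewrite le_max lexx orbT.
  by apply: lipW fL; rewrite le_max lexx.
have [|||||_ H] := @dct _ _ _ mu (fun m x => eta (e1 / 2 ^+ m) x * \det (Dmx (fcons f g) x))
  (fun x => \1_U x * \det (Dmx (fcons f g) x)) (fun x => (\1_(cube ru : set T) x : R) * (N`!%:R * Lf)).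
- by move=> m; exact: (measurable_funM (lip_mble (eta_lip (em m))) md).
- by apply: (measurable_funM _ md); apply: measurable_indic; exact: open_measurable_rV.
- apply: (itgMb (itg_cube _ _) (C := `|N`!%:R * Lf|)); first exact: measurable_cst.
  by [].
- apply: aeW => x; apply: cvgM; last exact: cvg_cst.
  rewrite indicE; case: (boolP (x \in U)) => [/set_mem Ux|/negP nU]; last first.
    have nUx : ~ U x by move=> Ux; apply: nU; exact: mem_set.
    by apply: (cvg_seq_eq (u := fun=> 0)); [move=> m; rewrite eta0|exact: cvg_cst].
  have d0 : 0 < dU x by have [b nUb] := outside; apply: (dist_set_gt0 (a := b)) => //; exact: open_closedC.
  apply: (@cvg_trans _ ((fun=> 1 : R) @ \oo)); last exact: cvg_cst.
  apply: near_eq_cvg; apply: filterS (near_infty_natSinv_expn_lt (PosNum (divr_gt0 d0 e10))) => m /=.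
  rewrite mul1r ltr_pdivlMr// mulrC => h; rewrite eta1//; exact: ltW.
- move=> m x; rewrite indicE; case: (boolP (x \in _)) => [_|/negP nx].
    rewrite mul1r normrM -[leRHS]mul1r ler_pM//; last exact: det_fcons_bound.
    by have /andP[h1 h2] := eta01 x (em m); rewrite ger0_norm.
  have xr : ru < enorm x by rewrite ltNge; apply/negP => /cube_ball h; apply: nx; exact: mem_set.
  by rewrite (ecs _ (em m))// !mul0r normr0.
exact: H.
Qed.

End bound.

(** Compared with points ever further away, where it vanishes, [f x] is bounded by arbitrarily small
    powers. This settles [delta < n], where the exponent in [frac_var] is negative. *)
Lemma neg_hol_csup a rf (f : V -> R) : a < 0 -> hol a 1 f -> csup rf f -> f = fun=> 0.
Proof.
move=> a0 fh fr; apply/funext => x; apply/eqP; rewrite -normr_eq0; apply: contraT => fx.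
have c0 : 0 < `|f x| by rewrite lt_def fx normr_ge0.
have na0 : 0 < - a by rewrite oppr_gt0.
have [t0 t00 tP] := small_pow na0 (divr_gt0 c0 (ltr0n R 2)).
have t0i : 0 < t0^-1 by rewrite invr_gt0.
pose y : V := (enorm x + `|rf| + t0^-1) *: delta_mx ord0 ord0.
have yE : enorm y = enorm x + `|rf| + t0^-1.
  by rewrite enormZ enorm_delta mulr1 ger0_norm// !addr_ge0 ?enorm_ge0// ltW.
have fy : f y = 0.
  apply: fr; rewrite yE; have := ler_norm rf; have := enorm_ge0 x.
  by move: (enorm x) (`|rf|) => p q; lra.
have xy : t0^-1 <= enorm (x - y).
  have := enorm_dist_triangle y x 0; rewrite !subr0 yE (enormB y) => h.
  have := normr_ge0 rf; move: h; move: (enorm x) (`|rf|) (enorm (x - y)) => p q r; lra.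
have xy0 : 0 < enorm (x - y) by exact: lt_le_trans xy.
have := fh x y; rewrite fy subr0 mul1r.
have -> : enorm (x - y) `^ a = (enorm (x - y))^-1 `^ (- a).
  by rewrite -powR_inv1 ?(ltW xy0)// -powRrM mulN1r opprK.
have h1 : 0 <= (enorm (x - y))^-1 by rewrite invr_ge0 ltW.
have h2 : (enorm (x - y))^-1 <= t0 by rewrite -[leRHS]invrK lef_pV2 ?posrE.
move=> /le_trans/(_ (tP _ h1 h2)); rewrite ler_pdivlMr// mulr2n mulrDr mulr1 gerDl leNgt c0; exact.
Qed.

Lemma BVc_indic (U : set V) D delta : open U -> bounded_set U -> has_box_dim (boundary U) D ->
  D < delta -> delta < n.+1%:R -> BVc (delta - n%:R) (\1_U : V -> R).
Proof.
move=> Uo Ub UD Dd dn; have [ru ru0 Ur] := bounded_enorm Ub.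
have Ui : L1 (\1_U : V -> R).
  apply: (@itg_csup R n ru 1) => [|x|x xr].
  - by apply: measurable_indic; exact: open_measurable_rV.
  - by rewrite indicE ger0_norm ?ler0n// lern1 leq_b1.
  - by rewrite indicE memNset// => /Ur; rewrite leNgt xr.
have UK : {ae mu, forall x : T, ~ closure U x -> (\1_U : V -> R) x = 0}.
  by apply: aeW => x nx; rewrite indicE memNset// => /subset_closure.
split; last by split=> //; exists (closure U); [exact: compact_closure_bounded|exact: UK].
split=> //.
suff [W HW] : exists W, forall (f : V -> R) (g : 'I_n -> V -> R) Lf rf, lip Lf f -> csup rf f ->
    hol (delta - n%:R) 1 f -> (forall i, lip 1 (g i)) ->
    `|\int[mu]_x ((\1_U : V -> R) x * \det (Dmx (fcons f g) x))| <= W.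
  apply: (@le_lt_trans _ _ W%:E); last exact: ltry.
  apply: ge_ereal_sup => _ [f [g [fc /LipP[Lf _ fL] fh gh ->]]].
  have [rf _ fr] := bounded_enorm (compact_bounded fc).
  rewrite lee_fin; apply: (HW f g Lf rf fL _ ((Lipc_le _ _ ler01).1 fh)) => [x xr|i x y].
    apply/eqP; apply: contraT => fx; have := fr x (@subset_closure _ [set x | f x != 0] x fx).
    by rewrite leNgt xr.
  by have := (Lipc_le _ _ ler01).1 (gh i) x y; rewrite powRr1 ?enorm_ge0.
(* The empty set is treated apart: [indic_frac_bound] uses points of the boundary, which exist only
   for nonempty [U]. *)
have [U0|/set0P U0] := eqVneq U set0.
  exists 0 => f g Lf rf _ _ _ _; rewrite U0.
  under eq_Rintegral do rewrite indic0 mul0r.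
  by rewrite int0 normr0.
have [a0|a0] := ltP (delta - n%:R) 0.
  exists 0 => f g Lf rf _ fr fh _.
  under eq_Rintegral => x _.
    rewrite (det_row0 (i := ord0)) ?mulr0; last first.
      by move=> j; rewrite DmxE /fcons unlift_none (neg_hol_csup a0 fh fr) pd_cst.
    over.
  by rewrite int0 normr0.
have a01 : 0 <= delta - n%:R <= 1 by rewrite a0 lerBlDr addrC natr1 ltW.
(* The midpoint leaves room on both sides: above [D] for the covering, below [delta] for the
   geometric series. *)
have Ds : D < (D + delta) / 2 by lra.
have sa : (D + delta) / 2 < n%:R + (delta - n%:R) by rewrite [ltRHS]addrC subrK; lra.
have [W HW] := indic_frac_bound Uo Ub U0 UD Ds a01 sa.
by exists W => f g Lf rf fL _ fh gL; exact: (HW Lf).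
Qed.

End frac_var_indicator.

Theorem lemma5p6 (R : realType) (n : nat) (U : set 'rV[R]_n.+1)
    (phi : 'rV[R]_n.+1 -> 'rV[R]_n.+1) (alpha : 'I_n.+1 -> R)
    (Uopen : open U) (Ubnd : bounded_set U)
    (alpha01 : forall i, 0 < alpha i <= 1)
    (phiLip : forall i, Lipa (alpha i) (boundary U) (comp_fun phi i)) :
  (forall d : R, n%:R <= d < n.+1%:R ->
     BV (d - n%:R) (\1_U : 'rV[R]_n.+1 -> R) ->
     d < \sum_i alpha i ->
     forall psi : 'rV[R]_n.+1 -> 'rV[R]_n.+1,
       (forall i, Lipa (alpha i) setT (comp_fun psi i)) ->
       (forall x, boundary U x -> psi x = phi x) ->
       (L1 (degree_fun phi U) /\
        current_eq
          (current (push_density alpha \1_U psi \_ (~` (phi @` boundary U))))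
          (current (degree_fun phi U))) /\
       (lebesgue_rV R n.+1 (phi @` boundary U) = 0%E ->
        L1c (degree_fun phi U) /\
        current_eq (current (push_density alpha \1_U psi))
                   (current (degree_fun phi U)))) /\
  (forall D : R, has_box_dim (boundary U) D -> D < \sum_i alpha i ->
     lebesgue_rV R n.+1 (phi @` boundary U) = 0%E /\
     (forall delta : R, D < delta < \sum_i alpha i ->
        BVc (delta - n%:R) (\1_U : 'rV[R]_n.+1 -> R))).
Proof.
split=> [d dn UBV dal psi psiL psiE|D UD Dal].
  split; first by split; [exact: (degree_L1 Uopen Ubnd alpha01 dn UBV dal psiL psiE)|exact: (current_restrict Uopen Ubnd alpha01 dn UBV dal psiL psiE)].
  by move=> m0; split; [exact: (degree_L1c Uopen Ubnd alpha01 dn UBV dal psiL psiE)|exact: (current_degree Uopen Ubnd alpha01 dn UBV dal psiL psiE)].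
split; first exact: (image_null (boundary_compact Uopen Ubnd) UD Dal alpha01 phiLip).
move=> delta /andP[Dd da]; apply: (BVc_indic Uopen Ubnd UD Dd).
(* Each exponent is at most 1, so [delta] lies below the dimension, which keeps the fractional
   exponent below 1. *)
apply: (lt_le_trans da); rewrite -[in leRHS](card_ord n.+1) -sum1_card natr_sum.
by apply: ler_sum => i _; have /andP[] := alpha01 i.
Qed.
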